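(* Assume that $r<p$ if $k=0$, or that $r<kp/(p-k)$ if $0<k<p$. Let $(u_\ell)_{\ell>0}$ be a family of minimizers, $u_\ell$ being a minimizer of ${\cal P}_\ell$, and let $\ell_n\to+\infty$ and $u^*\in W^{1,p}_{\rm loc}(\Omega_\infty)$, with $u^*=0$ on $\partial\Omega_\infty$, be such that for all $\ell_0>0$, $u_{\ell_n|\Omega_{\ell_0}}\rightharpoonup u^*_{|\Omega_{\ell_0}}$ weakly in $W^{1,p}(\Omega_{\ell_0})$. Then the function $u^*$, identified with a function of $x''$ only that belongs to $W^{1,p}_0(\omega'')$, is a minimizer of problem ${\cal P}_\infty$.
   Context: Let $1\le r<n$ be integers, $p>1$, $\frac1p+\frac1{p'}=1$, $0\le k<p$ real. Let $\omega'\subset\mathbb{R}^r$ be a bounded open set, $0\in\omega'$, starshaped with respect to $0$, whose gauge function $g(x')=\inf\{t>0;\ x'/t\in\omega'\}$ is Lipschitz on $\mathbb{R}^r$. Let $\omega''\subset\mathbb{R}^{n-r}$ be a bounded open set. For $\ell>0$ let $\omega'_\ell=\ell\omega'$, $\Omega_\ell=\omega'_\ell\times\omega''$, and $\Omega_\infty=\mathbb{R}^r\times\omega''$. Write $x=(x',x'')$, $\xi=(\xi',\xi'')\in\mathbb{R}^r\times\mathbb{R}^{n-r}$, $\nabla'=(\partial_1,\dots,\partial_r)$, $\nabla''=(\partial_{r+1},\dots,\partial_n)$. $|\cdot|$ is the Euclidean norm. A function of $x''$ only is also regarded as a function of $x$ independent of $x'$. Let $F:\mathbb{R}^n\to\mathbb{R}$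 be convex, $F''(\xi'')=F(0,\xi'')$, $G(\xi)=F(\xi)-F''(\xi'')$. Assume there are constants $0<\lambda\le\Lambda$ such that for all $\xi\in\mathbb{R}^n$, $$\lambda|\xi|^p\le F(\xi)\le\Lambda(|\xi|^p+1),\qquad \lambda(|\xi'|^p+k|\xi''|^{p-k}|\xi'|^k)\le G(\xi)\le\Lambda(|\xi'|^p+k|\xi''|^{p-k}|\xi'|^k)$$ (terms with factor $k$ are absent if $k=0$). If $k>0$, assume moreover that $F''$ is uniformly strictly convex: there is $\beta>0$ such that for all $\xi'',\zeta''\in\mathbb{R}^{n-r}$ and all $\theta,\mu\in[0,1]$ with $\theta+\mu=1$, $$F''(\theta\xi''+\mu\zeta'')\le\theta F''(\xi'')+\mu F''(\zeta'')-k\beta\theta\mu(\theta^{p-1}+\mu^{p-1})|\xi''-\zeta''|^p.$$ If $k=0$ no strict convexity is assumed. Let $f''\in L^{p'}(\omega'')$. Problem ${\cal P}_\ell$: minimize over $W^{1,p}_0(\Omega_\ell)$ the functional $J_\ell(v)=\int_{\Omega_\ell}[F(\nabla v(x))-f''(x'')v(x)]\,dx$. Problem ${\cal P}_\infty$: minimize over $W^{1,p}_0(\omega'')$ the functional $J_\infty(v)=\int_{\omega''}[F''(\nabla''v(x''))-f''(x'')v(x'')]\,dx''$. Both problems have at least one minimizer. Boundary values are understood in the sense of traces. Under the hypotheses of the claim one has $\nabla'u^*=0$, and $u^*$ is identified with a function of $x''$ only, in $W^{1,p}_0(\omega'')$. *)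

(* Defs.v *)
From HB Require Import structures.
From mathcomp Require Export all_boot all_order all_algebra.
From mathcomp Require Export all_classical all_reals all_analysis.

Set Implicit Arguments.
Unset Strict Implicit.
Unset Printing Implicit Defensive.

Import Order.TTheory GRing.Theory Num.Theory.
Export numFieldNormedType.Exports.

Local Open Scope classical_set_scope.
Local Open Scope ring_scope.

(* Borel sigma-algebra of R^n, generated by the coordinate projections
   (same construction as the one of the library on tuples) *)
Definition rV_display : measure_display.
Proof. exact: default_measure_display. Qed.

Definition rV_coord (R : realType) (n : nat) (i : 'I_n) (x : 'rV[R]_n) :
  measurableTypeR R := x ord0 i.

Section rV_measurable.
Context (R : realType) (n : nat).
Local Notation coord := (@rV_coord R n).

Let rV_set0 : g_sigma_preimage coord set0.
Proof. exact: sigma_algebra0. Qed.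

Let rV_setC A : g_sigma_preimage coord A -> g_sigma_preimage coord (~` A).
Proof. exact: sigma_algebraC. Qed.

Let rV_bigcup (F : (set 'rV[R]_n)^nat) :
  (forall i, g_sigma_preimage coord (F i)) ->
  g_sigma_preimage coord (\bigcup_i (F i)).
Proof. exact: sigma_algebra_bigcup. Qed.

HB.instance Definition _ := @isMeasurable.Build rV_display
  'rV[R]_n (g_sigma_preimage coord) rV_set0 rV_setC rV_bigcup.

End rV_measurable.

Lemma measurable_rV_coord (R : realType) (n : nat) (i : 'I_n) :
  measurable_fun setT (@rV_coord R n i).
Proof.
move=> _ Y mY; rewrite setTI; apply: sub_sigma_algebra => /=.
rewrite -bigcup_seq/=; exists i => /=; first by rewrite mem_index_enum.
by exists Y => //; rewrite setTI.
Qed.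

Lemma measurable_fun_rVP (R : realType) (n : nat) d1 (T1 : measurableType d1)
    (f : T1 -> 'rV[R]_n) :
  measurable_fun setT f <-> forall i, measurable_fun setT (rV_coord i \o f).
Proof.
split=> [mf i|mf].
  by apply: (measurableT_comp _ mf); exact: measurable_rV_coord.
have : g_sigma_preimage (fun i => @rV_coord R n i \o f) `<=` measurable.
  apply: smallest_sub; first exact: sigma_algebra_measurable.
  case: n => [|n'] in f mf *; first by rewrite big_ord0.
  rewrite -bigcup_mkord_ord; apply: bigcup_sub => i Ii.
  by move=> A [B mB <-]; exact: mf.
rewrite g_sigma_preimage_comp => prefS _ A mA; rewrite setTI.
by apply: prefS; exists A => //; rewrite setTI.
Qed.

Section lebesgue_step.
Context (R : realType) (n : nat).
Variable mu : {sigma_finite_measure set 'rV[R]_n -> \bar R}.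
Local Open Scope ereal_scope.

Definition rV_cons (z : measurableTypeR R * 'rV[R]_n) : 'rV[R]_n.+1 :=
  row_mx (const_mx z.1 : 'rV[R]_1) z.2.
Definition rV_uncons (x : 'rV[R]_n.+1) : measurableTypeR R * 'rV[R]_n :=
  (x ord0 ord0, rsubmx (x : 'rV[R]_(1 + n))).

Lemma rV_consK : cancel rV_cons rV_uncons.
Proof.
move=> [a x]; rewrite /rV_uncons /rV_cons /=; congr pair; last exact: row_mxKr.
have -> : (ord0 : 'I_n.+1) = lshift n (ord0 : 'I_1) by exact/val_inj.
exact: etrans (row_mxEl (const_mx a : 'rV[R]_1) x ord0 ord0) (mxE _ _ _ _).
Qed.

Lemma rV_unconsK : cancel rV_uncons rV_cons.
Proof.
move=> x; rewrite /rV_cons /= -[RHS](@hsubmxK _ 1 1 n).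
apply: (congr1 (fun a : 'rV[R]_1 => row_mx a (rsubmx (x : 'rV[R]_(1 + n))))).
apply/matrixP => i j; rewrite !mxE !ord1.
by congr (x _ _); exact/val_inj.
Qed.

Lemma measurable_rV_cons : measurable_fun setT rV_cons.
Proof.
apply/measurable_fun_rVP => i.
case: (split_ordP (i : 'I_(1 + n))) => [j ->|j ->].
  rewrite (_ : _ \o _ = fst); first exact: measurable_fst.
  apply/funext => z.
  exact: etrans (row_mxEl (const_mx z.1 : 'rV[R]_1) z.2 ord0 j) (mxE _ _ _ _).
rewrite (_ : _ \o _ = rV_coord j \o snd).
  by apply: measurableT_comp; [exact: measurable_rV_coord|exact: measurable_snd].
apply/funext => z.
exact: (row_mxEr (const_mx z.1 : 'rV[R]_1) z.2 ord0 j).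
Qed.

Lemma measurable_rV_uncons : measurable_fun setT rV_uncons.
Proof.
apply: measurable_fun_pair; first exact: measurable_rV_coord.
apply/measurable_fun_rVP => i.
rewrite (_ : _ \o _ = @rV_coord R n.+1 (rshift 1 i)).
  exact: measurable_rV_coord.
by apply/funext => x /=; rewrite /rV_coord mxE.
Qed.

Definition lebesgue_step : set 'rV[R]_n.+1 -> \bar R :=
  pushforward (@lebesgue_measure R \x mu) rV_cons.

Let step0 : lebesgue_step set0 = 0.
Proof. by rewrite /lebesgue_step /pushforward preimage_set0 measure0. Qed.

Let step_ge0 A : 0 <= lebesgue_step A.
Proof. by rewrite /lebesgue_step /pushforward; apply: measure_ge0. Qed.

Let step_sigma_additive : semi_sigma_additive lebesgue_step.
Proof.
move=> F mF tF mUF; rewrite /lebesgue_step /pushforward preimage_bigcup.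
apply: measure_semi_sigma_additive.
- by move=> j; rewrite -[X in measurable X]setTI; exact: measurable_rV_cons.
- apply/trivIsetP => /= i j _ _ ij; rewrite -preimage_setI.
  by move/trivIsetP : tF => /(_ _ _ _ _ ij) ->//; rewrite preimage_set0.
- by rewrite -preimage_bigcup -[X in measurable X]setTI; exact: measurable_rV_cons.
Qed.

HB.instance Definition _ := isMeasure.Build _ _ _ lebesgue_step
  step0 step_ge0 step_sigma_additive.

Let step_sigma_finite : sigma_finite setT lebesgue_step.
Proof.
have /sigma_finiteP[F [TF ndF Foo]] := sigma_finiteT (@lebesgue_measure R).
have /sigma_finiteP[G [TG ndG Goo]] := sigma_finiteT mu.
exists (fun j => rV_uncons @^-1` (F j `*` G j)).
  rewrite -preimage_bigcup (_ : \bigcup_k _ = setT) ?preimage_setT//.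
  rewrite -setXTT TF TG predeqE => -[x y]; split.
    by move=> [j _ []/= ? ?]; split; exists j.
  move=> [/= [j _ Fjx] [k _ Gky]]; exists (maxn j k) => //; split.
  - by move: x Fjx; exact/subsetPset/ndF/leq_maxl.
  - by move: y Gky; exact/subsetPset/ndG/leq_maxr.
move=> j; have [? ?] := Foo j; have [? ?] := Goo j; split.
  rewrite -[X in measurable X]setTI; apply: measurable_rV_uncons => //.
  exact: measurableX.
rewrite /lebesgue_step /pushforward -comp_preimage.
rewrite (_ : rV_uncons \o rV_cons = id); last exact/funext/rV_consK.
by rewrite preimage_id product_measure1E// lte_mul_pinfty// ge0_fin_numE.
Qed.

HB.instance Definition _ := Measure_isSigmaFinite.Build _ _ _ lebesgue_step
  step_sigma_finite.

End lebesgue_step.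

(* n-dimensional Lebesgue measure: the image of the product of the
   one-dimensional Lebesgue measure and of the (n-1)-dimensional one. *)
Fixpoint leb (R : realType) (n : nat) :
    {sigma_finite_measure set 'rV[R]_n -> \bar R} :=
  match n with
  | 0%N => \d_(0 : 'rV[R]_0)
  | n'.+1 => lebesgue_step (leb R n')
  end.
Arguments leb {R n}.

Section notions.
Context {R : realType} {n : nat}.
Implicit Types (Omega : set 'rV[R]_n) (u v : 'rV[R]_n -> R).

(* The library's norm on row vectors is the maximum norm. *)
Definition enorm (x : 'rV[R]_n) : R := Num.sqrt (\sum_i x ord0 i ^+ 2).

Definition partial (i : 'I_n) u : 'rV[R]_n -> R := 'D_(delta_mx ord0 i) u.

Definition smooth u : Prop := forall s : seq 'I_n,
  let us := foldr partial u s in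
  continuous us /\ forall i x, derivable us x (delta_mx ord0 i).

Definition test_function Omega u : Prop := smooth u /\
  exists K, [/\ compact K, K `<=` Omega & forall x, ~ K x -> u x = 0].

(* Membership in L^p(Omega), Omega measurable, of the restriction of u. *)
Definition Lp (p : R) Omega u : Prop := u \_ Omega \in Lfun leb p%:E.

Definition Lp_norm (p : R) Omega u : \bar R :=
  'N[leb]_p%:E[EFin \o (u \_ Omega)]%E.

Definition L1loc Omega u : Prop := forall K, compact K -> K `<=` Omega ->
  leb.-integrable K (EFin \o u).

Definition weak_gradient Omega u (g : 'rV[R]_n -> 'rV[R]_n) : Prop :=
  [/\ L1loc Omega u, forall i, L1loc Omega (fun x => g x ord0 i) &
    forall phi i, test_function Omega phi ->
      \int[leb]_(x in Omega) (u x * partial i phi x) =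
      - \int[leb]_(x in Omega) (g x ord0 i * phi x)].

(* Weak gradients are unique up to a.e. equality; one of them is chosen. *)
Definition grad Omega u : 'rV[R]_n -> 'rV[R]_n :=
  xget (fun=> 0) [set g | weak_gradient Omega u g].

Definition W1p (p : R) Omega u : Prop :=
  [/\ Lp p Omega u, exists g, weak_gradient Omega u g &
    forall i, Lp p Omega (fun x => grad Omega u x ord0 i)].

Definition W1p_norm (p : R) Omega u : \bar R :=
  (Lp_norm p Omega u + Lp_norm p Omega (fun x => enorm (grad Omega u x)))%E.

(* W^{1,p}_0(Omega): closure of C_c^oo(Omega) in W^{1,p}(Omega). *)
Definition W01p (p : R) Omega u : Prop := W1p p Omega u /\
  exists phi : ('rV[R]_n -> R)^nat, (forall j, test_function Omega (phi j)) /\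
    W1p_norm p Omega (phi j \- u) @[j --> \oo] --> 0%E.

Definition W1p_loc (p : R) Omega u : Prop := forall U : set 'rV[R]_n,
  open U -> compact (closure U) -> closure U `<=` Omega -> W1p p U u.

(* u = 0 on the boundary of a possibly unbounded and irregular open set. *)
Definition zero_trace (p : R) Omega u : Prop := forall rho,
  test_function setT rho -> W01p p Omega (rho \* u).

(* Continuous linear forms on W^{1,p}(Omega); the bound makes them factor
   through a.e. equality on Omega. *)
Definition W1p_dual (p : R) Omega (L : ('rV[R]_n -> R) -> R) : Prop :=
  (forall (a : R) u v, W1p p Omega u -> W1p p Omega v ->
     L (fun x => a * u x + v x) = a * L u + L v) /\
  exists C : R, forall u, W1p p Omega u ->
    (`|L u|%:E <= C%:E * W1p_norm p Omega u)%E.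

(* Only finitely many terms may fail to be in W^{1,p}(Omega). *)
Definition W1p_weak_cvg (p : R) Omega (u_ : ('rV[R]_n -> R)^nat) u : Prop :=
  [/\ W1p p Omega u, \forall j \near \oo, W1p p Omega (u_ j) &
    forall L, W1p_dual p Omega L -> L (u_ j) @[j --> \oo] --> L u].

Definition energy (Phi : 'rV[R]_n -> R) (f : 'rV[R]_n -> R) Omega v : R :=
  \int[leb]_(x in Omega) (Phi (grad Omega v x) - f x * v x).

Definition is_minimizer (p : R) (Phi f : 'rV[R]_n -> R) Omega u : Prop :=
  W01p p Omega u /\
  forall v, W01p p Omega v -> energy Phi f Omega u <= energy Phi f Omega v.

Definition starshaped0 Omega : Prop := forall x (t : R),
  Omega x -> 0 <= t <= 1 -> Omega (t *: x).

Definition gauge Omega (x : 'rV[R]_n) : R :=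
  inf [set t : R | 0 < t /\ Omega (t^-1 *: x)].

Definition uniformly_strictly_convex (p k beta : R) (Phi : 'rV[R]_n -> R) :=
  forall (xi zeta : 'rV[R]_n) (theta mu : R),
    0 <= theta <= 1 -> 0 <= mu <= 1 -> theta + mu = 1 ->
    Phi (theta *: xi + mu *: zeta) <= theta * Phi xi + mu * Phi zeta
      - k * beta * theta * mu * (theta `^ (p - 1) + mu `^ (p - 1))
        * enorm (xi - zeta) `^ p.

End notions.

(* R^n is 'rV_(r + m) with x = (x', x'') = (lsubmx x, rsubmx x), m = n - r. *)
Section cylinders.
Context {R : realType} {r m : nat}.

Definition cylinder (omega' : set 'rV[R]_r) (omega'' : set 'rV[R]_m) (l : R) :
    set 'rV[R]_(r + m) :=
  [set x | [set l *: y | y in omega'] (lsubmx x) /\ omega'' (rsubmx x)].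

Definition infinite_cylinder (omega'' : set 'rV[R]_m) : set 'rV[R]_(r + m) :=
  [set x | omega'' (rsubmx x)].

Definition F2 (F : 'rV[R]_(r + m) -> R) (xi'' : 'rV[R]_m) : R :=
  F (row_mx 0 xi'').

Definition growth (p k : R) (xi : 'rV[R]_(r + m)) : R :=
  enorm (lsubmx xi) `^ p
  + k * enorm (rsubmx xi) `^ (p - k) * enorm (lsubmx xi) `^ k.

End cylinders.

(* Main.v *)
Require Import Defs.
From mathcomp Require Import ring lra measurable_realfun.

(** Write x = (x', x''), let J be the functional of the cross-sectional problem and mu its infimum over test
functions of omega''. The slice phi(x', .) of a test function phi of a cylinder is a test function of omega'', and
its energy for F is J(phi(x', .)) plus the integral of the excess G = F - F'', hence at least mu. The proof
compares the energies of the minimizers with mu, from above on large cubes and from below slice by slice.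

Upper bound. A minimizer of a cylinder is replaced by a test function phi close to it in W^{1,p}, which is a
near minimizer (near_minimizer), so that slices and competitors can be computed classically. The competitor is
v = (1 - rho) phi + rho w, where J(w) <= mu + e and rho(x') is a cutoff that passes from 1 on the cube Q_t of
half-side t to 0 within a distance h. As F'' is convex, passing from phi to v costs only the excess G of the
gradient of v over the annulus. On a slice that cost is at most a constant times the difference of the
energies of phi and w on the slice plus 2 e + h^(-q), with q = p when k = 0 and q = kp / (p - k) otherwise: when k > 0 the
mixed term of G is weighted so that the gradient of w, which is bounded but not small, carries h^(-q), and the
distance from phi(x', .) to w is estimated by strict convexity (slice_bound). With I(t) the integral over
Q_t x omega'' of the difference of the energy densities of phi and w, this gives
  (1 + K) I(t) <= K I(t + 2h) + small terms + K h^(-q) |Q_(t + 2h)|    (comparison).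
Iterating with h proportional to t along radii T s^j, where s is so close to 1 that the contraction factor
K / (1 + K) beats the growth s^r of the volumes, leaves an error of order T^(r - q), which vanishes for large T
because r < q (iterated_comparison). Hence on every fixed cube the energy of the minimizers is asymptotically at
most |Q_t| mu (local_energy), and so is that of the weak limit u*, because a convex integrand is a supremum of
affine functions (limit_energy).

Lower bound. The trace of u* vanishes, so u* is on each bounded piece of the infinite cylinder a limit of test
functions, and so are almost all its slices, whose energies are therefore at least mu (ae_slices,
closure_lower_bound). Both bounds together force the excess G to vanish at the gradient of u*, hence the horizontal
gradient to vanish, and almost every slice to have energy exactly mu (optimal_slices).

Conclusion. A function without horizontal gradient is invariant under horizontal translations, and by Tonelli's
theorem almost every slice of it represents it (invariant_slice). One slice that is good for all these properties
is the required minimizer (minimal_slice).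

The estimates are carried out for the maximum norm; the hypotheses carry over from the Euclidean norm with other
constants (admissible_enorm). *)

Set Implicit Arguments.
Unset Strict Implicit.
Unset Printing Implicit Defensive.

Import Order.TTheory GRing.Theory Num.Theory.

Local Open Scope classical_set_scope.
Local Open Scope ring_scope.

(** * Inequalities between powers *)

Section powers.
Context {R : realType}.
Implicit Types a b c d h m x y p q k : R.

Lemma powR_split a r s : 0 < a -> a `^ (r + s) = a `^ r * a `^ s.
Proof. by move=> a0; rewrite powRD//; apply/implyP => _; rewrite gt_eqF. Qed.

Lemma powR_mono p a b : 0 <= p -> 0 <= a -> a <= b -> a `^ p <= b `^ p.
Proof.
move=> p0 a0 ab; apply: ge0_ler_powR => //; rewrite nnegrE//.
exact: le_trans ab.
Qed.

Lemma powR_add_le p a b : 0 <= p -> 0 <= a -> 0 <= b ->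
  (a + b) `^ p <= 2 `^ p * (a `^ p + b `^ p).
Proof.
move=> p0 a0 b0.
wlog ab : a b a0 b0 / a <= b.
  move=> h; have [ab|/ltW ba] := leP a b; first exact: h.
  by rewrite addrC [X in _ <= _ * X]addrC; exact: h.
apply: (@le_trans _ _ ((2 * b) `^ p)).
  by apply: powR_mono => //; [rewrite addr_ge0|lra].
by rewrite powRM// ler_wpM2l ?powR_ge0// lerDr powR_ge0.
Qed.

Lemma powR_le_add p a b c : 0 <= p -> 0 <= a -> 0 <= b -> 0 <= c -> a <= b + c ->
  a `^ p <= 2 `^ p * (b `^ p + c `^ p).
Proof.
move=> p0 a0 b0 c0 abc; apply: le_trans (powR_add_le p0 b0 c0).
exact: powR_mono.
Qed.

(** Used in place of Hoelder's inequality: with d of the size of the L^p norm of a function, both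
terms have size d after integration over a bounded set. *)
Lemma le_small_powR p a d : 1 <= p -> 0 <= a -> 0 < d ->
  a <= d + d `^ (1 - p) * a `^ p.
Proof.
move=> p1 a0 d0; have [ad|da] := leP a d.
  by rewrite (le_trans ad)// lerDl mulr_ge0 ?powR_ge0.
rewrite (@le_trans _ _ (d `^ (1 - p) * a `^ p))//; last by rewrite lerDr ltW.
have a1 : 0 < a by exact: lt_trans da.
rewrite -(mulr_powRB1 a0); last lra.
rewrite -[1 - p]opprB powRN.
rewrite mulrCA ler_peMr// ler_pdivlMl ?powR_gt0// mulr1.
by apply: powR_mono; [rewrite subr_ge0|exact: ltW|exact: ltW].
Qed.

(** Young's inequality with a free weight, which makes one of the two terms small. *)
Lemma young_weight p q c a b : 1 < p -> 0 < q -> p^-1 + q^-1 = 1 -> 0 < c -> 0 <= a -> 0 <= b ->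
  a * b <= c `^ q * a `^ q + c `^ (- p) * b `^ p.
Proof.
move=> p1 q0 pq c0 a0 b0; have p0 : 0 < p by lra.
have q1 : 1 <= q.
  rewrite -[leLHS]invr1 -[leRHS]invrK lef_pV2 ?posrE ?invr_gt0//.
  by rewrite -pq lerDr invr_ge0 ltW.
have ca : 0 <= c * a by rewrite mulr_ge0// ltW.
have cb : 0 <= c^-1 * b by rewrite mulr_ge0// invr_ge0 ltW.
have := conjugate_powR cb ca p0 q0 pq.
rewrite (_ : c^-1 * b * (c * a) = a * b); last by field; rewrite gt_eqF.
move=> h; apply: (le_trans h); rewrite addrC.
have c0' := ltW c0; rewrite !powRM ?invr_ge0//.
rewrite powRN -(powR_inv1 c0') -powRrM mulN1r powRN.
apply: lerD; rewrite ler_pdivrMr//; first by rewrite ler_peMr// mulr_ge0 ?powR_ge0.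
by rewrite ler_peMr ?mulr_ge0 ?invr_ge0 ?powR_ge0// ltW.
Qed.

(** The graph of y |-> y^p lies above its tangent at a; integrated, with a the mean value of y, this
is Jensen's inequality. *)
Lemma powR_tangent p a y : 1 < p -> 0 <= a -> 0 <= y ->
  p * a `^ (p - 1) * y - (p - 1) * a `^ p <= y `^ p.
Proof.
move=> p1 a0 y0; have p0 : 0 < p by lra.
pose q := p / (p - 1).
have pm : 0 < p - 1 by lra.
have q0 : 0 < q by rewrite divr_gt0.
have pq : p^-1 + q^-1 = 1 by rewrite /q invf_div; field; rewrite gt_eqF.
have := conjugate_powR y0 (powR_ge0 a (p - 1)) p0 q0 pq.
rewrite -powRrM (_ : (p - 1) * q = p); last by rewrite /q; field; rewrite gt_eqF.
move=> h; have {}h : p * (y * a `^ (p - 1)) <= p * (y `^ p / p + a `^ p / q) by rewrite ler_pM2l.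
have E : p * (y `^ p / p + a `^ p / q) = y `^ p + (p - 1) * a `^ p.
  by rewrite /q; field; rewrite !gt_eqF.
rewrite E in h; lra.
Qed.

(** Either b >= m a, and the first term dominates, or b < m a, and the second one does. *)
Lemma powR_mixed p k a b m : 0 <= k -> k <= p -> 0 <= a -> 0 <= b -> 0 < m ->
  a `^ (p - k) * b `^ k <= m `^ (k - p) * b `^ p + m `^ k * a `^ p.
Proof.
move=> k0 kp a0 b0 m0.
have split_pow c : 0 <= c -> c `^ p = c `^ (p - k) * c `^ k \/ (c = 0 /\ p = 0).
  rewrite le_eqVlt => /predU1P[<-|c0].
    have [->|p0] := eqVneq p 0; first by right.
    left; rewrite powR0//; have [->|kn0] := eqVneq k 0.
      by rewrite subr0 powR0// mul0r.
    by rewrite [X in _ * X]powR0 ?mulr0.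
  by left; rewrite -powR_split// subrK.
have [p00|p0] := eqVneq p 0.
  have k00 : k = 0 by lra.
  by rewrite p00 k00 subrr !powRr0 !mulr1 lerDr.
have pk c : 0 <= c -> c `^ p = c `^ (p - k) * c `^ k.
  by move=> /split_pow[//|[_ /eqP]]; rewrite (negbTE p0).
have m0' := ltW m0.
have mi : m `^ (k - p) = (m `^ (p - k))^-1 by rewrite -opprB powRN.
have [h|h] := leP (m * a) b.
  apply: (@le_trans _ _ (m `^ (k - p) * b `^ p)); last first.
    by rewrite lerDl mulr_ge0// powR_ge0.
  rewrite (pk b)// mulrA ler_wpM2r ?powR_ge0// mi ler_pdivlMl ?powR_gt0//.
  rewrite -powRM//; apply: powR_mono => //; first by rewrite subr_ge0.
  by rewrite mulr_ge0.
apply: (@le_trans _ _ (m `^ k * a `^ p)); last first.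
  by rewrite lerDr mulr_ge0// powR_ge0.
rewrite (pk a)// mulrCA ler_wpM2l ?powR_ge0// -powRM//.
by apply: powR_mono => //; exact: ltW.
Qed.

Lemma powR_mixed1 p k a b : 0 <= k -> k <= p -> 0 <= a -> 0 <= b ->
  a `^ (p - k) * b `^ k <= a `^ p + b `^ p.
Proof.
move=> k0 kp a0 b0; have := powR_mixed k0 kp a0 b0 (@ltr01 R).
have e z : (1 : R) `^ z = 1 by rewrite powR1.
by rewrite !e !mul1r [b `^ p + _]addrC.
Qed.

(** The optimal weight: the factor h^-k is split so that b^p keeps a unit
coefficient. *)
Lemma powR_mixed_opt p k a b h : 0 < k -> k < p -> 0 <= a -> 0 <= b -> 0 < h ->
  h `^ (- k) * (a `^ (p - k) * b `^ k) <= b `^ p + h `^ (- (k * p / (p - k))) * a `^ p.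
Proof.
move=> k0 kp a0 b0 h0.
have pk0 : p - k != 0 by rewrite subr_eq0 gt_eqF.
have m0 : 0 < h `^ (- (k / (p - k))) by rewrite powR_gt0.
have := powR_mixed (ltW k0) (ltW kp) a0 b0 m0.
rewrite -(ler_pM2l (powR_gt0 (- k) h0)) => /le_trans; apply.
rewrite mulrDr !mulrA -!powRrM -!powR_split//.
rewrite (_ : - k + _ * (k - p) = 0); last by field.
by rewrite powRr0 mul1r (_ : - k + _ * k = - (k * p / (p - k)))//; field.
Qed.

End powers.

(** * Lebesgue measure on row vectors *)

Section leb_structure.
Context {R : realType}.

Lemma norm_rV_lt n (x : 'rV[R]_n) (e : R) : 0 < e ->
  (`|x| < e) = [forall i, `|x ord0 i| < e].
Proof.
move=> e0; rewrite [`|x|]/Num.norm/= mx_normrE.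
apply/idP/forallP => [h i|h].
  apply: le_lt_trans h.
  exact: (le_bigmax _ (fun i : 'I_1 * 'I_n => `|x i.1 i.2|) (ord0, i)).
by apply/bigmax_ltP; split => // -[i j] _ /=; rewrite ord1.
Qed.

Lemma norm_rV_le n (x : 'rV[R]_n) (e : R) : 0 <= e ->
  (`|x| <= e) = [forall i, `|x ord0 i| <= e].
Proof.
move=> e0; rewrite [`|x|]/Num.norm/= mx_normrE.
apply/idP/forallP => [h i|h].
  apply: le_trans h.
  exact: (le_bigmax _ (fun i : 'I_1 * 'I_n => `|x i.1 i.2|) (ord0, i)).
by apply/bigmax_leP; split => // -[i j] _ /=; rewrite ord1.
Qed.

Lemma coord_norm_le n (x : 'rV[R]_n) i : `|x ord0 i| <= `|x|.
Proof. by have := lexx `|x|; rewrite {1}norm_rV_le// => /forallP. Qed.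

Lemma measurable_box n (D : 'I_n -> set R) : (forall i, measurable (D i)) ->
  measurable [set x : 'rV[R]_n | forall i, D i (x ord0 i)].
Proof.
move=> mD.
rewrite (_ : [set x | _] = \bigcap_(i in [set: 'I_n])
   ((@rV_coord R n i) @^-1` D i)); last first.
  by apply/seteqP; split => x /= h i; [move=> _; exact: h|exact: (h i)].
apply: fin_bigcap_measurable => [|i _]; first exact: finite_finset.
by have := @measurable_rV_coord R n i measurableT _ (mD i); rewrite setTI.
Qed.

Lemma rational_cube n (A : set 'rV[R]_n) x : open A -> A x ->
  exists c : 'rV[rat]_n * rat, [/\ 0 < ratr c.2 :> R,
    forall i, `|x ord0 i - ratr (c.1 ord0 i)| < ratr c.2 &
    forall y : 'rV[R]_n, (forall i, `|y ord0 i - ratr (c.1 ord0 i)| <= ratr c.2) -> A y].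
Proof.
move=> oA Ax.
have /nbhs_ballP[e /= e0 eA] : nbhs x A by exact: open_nbhs_nbhs.
have [q /andP[q0 qe]] : exists q : rat, 0 < (ratr q : R) < e / 2.
  have h : (0 : R) < e / 2 by rewrite divr_gt0.
  by have [q] := rat_in_itvoo h; rewrite in_itv/=; exists q.
have hc (i : 'I_n) : {s : rat | `|x ord0 i - ratr s| < ratr q :> R}.
  apply: cid.
  have h : x ord0 i - ratr q < x ord0 i :> R by rewrite ltrBlDr ltrDl.
  have [s] := rat_in_itvoo h; rewrite in_itv/= => /andP[s1 s2].
  by exists s; rewrite ltr_norml; apply/andP; split; lra.
exists (\row_i sval (hc i), q); split => // [i /=|y By].
  by rewrite mxE; case: (hc i).
apply: eA; rewrite -ball_normE /= norm_rV_lt//.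
apply/forallP => i; rewrite !mxE.
have := By i; rewrite /= !mxE; case: (hc i) => s /= s1 s2.
rewrite (_ : _ - _ = (x ord0 i - ratr s) - (y ord0 i - ratr s)); last by ring.
by rewrite (le_lt_trans (ler_normB _ _))//; lra.
Qed.

Lemma open_rV_measurable n (A : set 'rV[R]_n) : open A -> measurable A.
Proof.
move=> oA.
pose B (c : 'rV[rat]_n * rat) : set 'rV[R]_n :=
  [set x | forall i, `|x ord0 i - ratr (c.1 ord0 i)| < ratr c.2].
have mB c : measurable (B c).
  apply: (measurable_box (D := fun i => [set t : R | `|t - ratr (c.1 ord0 i)| < ratr c.2])) => i.
  rewrite (_ : [set t | _] = ball (ratr (c.1 ord0 i) : R) (ratr c.2)).
    exact: measurable_ball.
  by apply/seteqP; split => t; rewrite -ball_normE /= distrC.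
rewrite (_ : A = \bigcup_(c in [set c | B c `<=` A]) B c).
  rewrite bigcup_mkcond; apply: countable_bigcupT_measurable => [|c].
    exact: countableP.
  by case: ifP.
apply/seteqP; split => [x Ax|x [c cA]]; last exact: cA.
have [c [_ xc cA]] := rational_cube oA Ax.
by exists c => // y By; apply: cA => i; exact/ltW/By.
Qed.

Lemma closed_rV_measurable n (A : set 'rV[R]_n) : closed A -> measurable A.
Proof.
move=> cA; rewrite -[A]setCK; apply: measurableC.
by apply: open_rV_measurable; exact: closed_openC.
Qed.

Lemma compact_rV_measurable n (A : set 'rV[R]_n) : compact A -> measurable A.
Proof.
move=> cA; apply: closed_rV_measurable; apply: compact_closed => //.
Qed.

Lemma continuous_rV_measurable n (f : 'rV[R]_n -> R) : continuous f ->
  measurable_fun setT f.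
Proof.
move=> /continuousP cf.
apply: (measurability _ (RGenOpens.measurableE R)) => _ [_ [a [b ->] <-]].
by rewrite setTI; apply: open_rV_measurable; apply: cf; exact: interval_open.
Qed.

Lemma lebesgue_measure_shift (c : R) (A : set R) : measurable A ->
  lebesgue_measure ((fun x => x + c) @^-1` A) = lebesgue_measure A.
Proof.
move=> mA.
have ms : measurable_fun [set: measurableTypeR R] (fun x : measurableTypeR R => x + c : measurableTypeR R).
  exact: measurable_funD.
symmetry.
apply: (@lebesgue_measure_unique R (pushforward (@lebesgue_measure R) (fun x : measurableTypeR R => x + c : measurableTypeR R))) => //.
move=> X [[a b] /= _ <-]; rewrite /pushforward.
rewrite (_ : _ @^-1` _ = `]a - c, b - c]%classic); last first.
  by apply/seteqP; split => x /=; rewrite !in_itv/= ltrBlDr lerBrDr.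
by rewrite !lebesgue_measure_itv/= !lte_fin ltrD2r -!EFinD opprB addrA subrK.
Qed.

Lemma ge0_integral_shift1 (c : R) (f : measurableTypeR R -> \bar R) :
  measurable_fun setT f -> (forall x, 0 <= f x)%E ->
  (\int[@lebesgue_measure R]_x f ((x : R) + c)%R = \int[@lebesgue_measure R]_x f x)%E.
Proof.
move=> mf f0.
have ms : measurable_fun [set: measurableTypeR R] (fun x : measurableTypeR R => (x : R) + c : measurableTypeR R).
  exact: measurable_funD.
pose sh := (fun x : measurableTypeR R => (x : R) + c : measurableTypeR R).
transitivity (\int[pushforward (@lebesgue_measure R) sh]_x f x)%E.
  by rewrite ge0_integral_pushforward.
apply: eq_measure_integral => A mA _.
exact: (lebesgue_measure_shift c).
Qed.

(** Tonelli's theorem along the recursion that builds the measure. *)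
Lemma ge0_integral_rV_cons n (f : 'rV[R]_n.+1 -> \bar R) :
  measurable_fun setT f -> (forall x, 0 <= f x)%E ->
  (\int[leb]_x f x =
   \int[lebesgue_measure]_a \int[leb]_y f (rV_cons (a, y)))%E.
Proof.
move=> mf f0.
rewrite [LHS](@ge0_integral_pushforward _ _ _ _ _ _ (@measurable_rV_cons R n))//.
rewrite preimage_setT fubini_tonelli1//; last by move=> x; exact: f0.
by apply: measurableT_comp => //; exact: measurable_rV_cons.
Qed.

Lemma measurable_row_mx n m :
  measurable_fun setT (fun z : 'rV[R]_n * 'rV[R]_m => row_mx z.1 z.2).
Proof.
apply/measurable_fun_rVP => i; case: (split_ordP i) => [j ->|j ->].
  rewrite (_ : _ \o _ = (@rV_coord R n j) \o fst); last first.
    by apply/funext => z; rewrite /= /rV_coord row_mxEl.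
  by apply: measurableT_comp => //; exact: measurable_rV_coord.
rewrite (_ : _ \o _ = (@rV_coord R m j) \o snd); last first.
  by apply/funext => z; rewrite /= /rV_coord row_mxEr.
by apply: measurableT_comp => //; exact: measurable_rV_coord.
Qed.

Lemma measurable_lsubmx n m :
  measurable_fun setT (fun x : 'rV[R]_(n + m) => lsubmx x).
Proof.
apply/measurable_fun_rVP => i.
rewrite (_ : _ \o _ = (@rV_coord R _ (lshift m i))).
  exact: measurable_rV_coord.
by apply/funext => x; rewrite /= /rV_coord mxE.
Qed.

Lemma measurable_rsubmx n m :
  measurable_fun setT (fun x : 'rV[R]_(n + m) => rsubmx x).
Proof.
apply/measurable_fun_rVP => i.
rewrite (_ : _ \o _ = (@rV_coord R _ (rshift n i))).
  exact: measurable_rV_coord.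
by apply/funext => x; rewrite /= /rV_coord mxE.
Qed.

Lemma row_mx_rV_cons n m a (x : 'rV[R]_n) (y : 'rV[R]_m) :
  row_mx (rV_cons (a, x)) y = rV_cons (a, row_mx x y) :> 'rV[R]_(n.+1 + m).
Proof.
apply/rowP => i; rewrite /rV_cons /=.
case: (split_ordP (i : 'I_(1 + (n + m)))) => [j ->|j' ->].
  rewrite [RHS]row_mxEl (_ : lshift _ j = lshift m (lshift n j)); last exact/val_inj.
  by rewrite [LHS]row_mxEl [LHS]row_mxEl.
rewrite [RHS]row_mxEr; case: (split_ordP j') => [j ->|j ->].
  rewrite row_mxEl (_ : @rshift 1 (n + m) _ = @lshift n.+1 m (rshift 1 j)); last exact/val_inj.
  by rewrite [LHS]row_mxEl [LHS]row_mxEr.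
rewrite row_mxEr (_ : @rshift 1 (n + m) _ = @rshift n.+1 m j); last exact/val_inj.
by rewrite [LHS]row_mxEr.
Qed.

Lemma ge0_integral_rV_split n m (f : 'rV[R]_(n + m) -> \bar R) :
  measurable_fun setT f -> (forall x, 0 <= f x)%E ->
  (\int[leb]_x f x = \int[leb]_x \int[leb]_y f (row_mx x y))%E.
Proof.
elim: n f => [|n IHn] f mf f0.
  transitivity (\int[leb]_y f (row_mx (0 : 'rV[R]_0) y))%E; last first.
    symmetry; rewrite [LHS]integral_dirac//; last first.
      apply: (@measurable_fun_fubini_tonelli_F _ _ _ _ R leb (fun z => f (row_mx z.1 z.2))) => //.
      by apply: measurableT_comp => //; exact: measurable_row_mx.
    by rewrite diracT mul1e.
  apply: eq_integral => y _; congr f.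
  by apply/rowP => i; rewrite -{2}[i](_ : rshift 0 i = i) ?row_mxEr//; apply/val_inj.
rewrite [LHS]ge0_integral_rV_cons// [RHS]ge0_integral_rV_cons//; last 2 first.
- apply: (@measurable_fun_fubini_tonelli_F _ _ _ _ R leb (fun z => f (row_mx z.1 z.2))) => //.
  by apply: measurableT_comp => //; exact: measurable_row_mx.
- by move=> x; exact: integral_ge0.
apply: eq_integral => a _; rewrite IHn//.
  apply: eq_integral => x _; apply: eq_integral => y _.
  by rewrite row_mx_rV_cons.
apply: (measurableT_comp mf).
by apply: (measurableT_comp (@measurable_rV_cons R _)); exact: measurable_pair1.
Qed.

Lemma leb_row_mx n m (A : set 'rV[R]_(n + m)) : measurable A ->
  leb A = (leb \x leb)%E ((fun z : 'rV[R]_n * 'rV[R]_m => row_mx z.1 z.2) @^-1` A).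
Proof.
move=> mA.
have mB : measurable ((fun z : 'rV[R]_n * 'rV[R]_m => row_mx z.1 z.2) @^-1` A).
  by rewrite -[X in measurable X]setTI; exact: measurable_row_mx.
have -> : leb A = (\int[leb]_x (\1_A x)%:E)%E by rewrite integral_indic// setIT.
rewrite ge0_integral_rV_split//; last first.
  by apply/measurable_EFinP; exact: measurable_indic.
transitivity (\int[leb \x leb]_z (\1_A (row_mx z.1 z.2))%:E)%E; last first.
  by rewrite -[in RHS](setIT (_ @^-1` A)) -(integral_indic _ measurableT).
rewrite fubini_tonelli1//.
by apply/measurable_EFinP; apply: measurableT_comp; [exact: measurable_indic|exact: measurable_row_mx].
Qed.

Lemma rV_consl n (z : measurableTypeR R * 'rV[R]_n) (j : 'I_1) :
  rV_cons z ord0 (lshift n j : 'I_(1 + n)) = z.1.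
Proof. by rewrite [LHS]row_mxEl mxE. Qed.

Lemma rV_consr n (z : measurableTypeR R * 'rV[R]_n) (j : 'I_n) :
  rV_cons z ord0 (rshift 1 j : 'I_(1 + n)) = z.2 ord0 j.
Proof. by rewrite [LHS]row_mxEr. Qed.

(** By induction on the dimension, from the invariance of the one-dimensional measure. *)
Lemma ge0_integral_rV_shift n (h : 'rV[R]_n) (f : 'rV[R]_n -> \bar R) :
  measurable_fun setT f -> (forall x, 0 <= f x)%E ->
  (\int[leb]_x f (x + h)%R = \int[leb]_x f x)%E.
Proof.
elim: n h f => [|n IHn] h f mf f0.
  by apply: eq_integral => x _; congr f; apply/rowP => -[].
have ms : measurable_fun setT (fun x : 'rV[R]_n.+1 => x + h).
  apply/measurable_fun_rVP => i.
  rewrite (_ : _ \o _ = (fun x => rV_coord i x + h ord0 i)); last first.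
    by apply/funext => x; rewrite /= /rV_coord !mxE.
  by apply: measurable_funD => //; exact: measurable_rV_coord.
rewrite [LHS]ge0_integral_rV_cons//; last exact: measurableT_comp.
rewrite [RHS]ge0_integral_rV_cons//.
pose g a := (\int[leb]_y f (rV_cons (a, y)))%E.
have mg : measurable_fun setT g.
  apply: (@measurable_fun_fubini_tonelli_F _ _ _ _ R leb (f \o @rV_cons R n)) => //; last by move=> x; exact: f0.
  by apply: measurableT_comp => //; exact: measurable_rV_cons.
rewrite -[RHS](ge0_integral_shift1 (h ord0 ord0) mg); last first.
  by move=> x; exact: integral_ge0.
apply: eq_integral => a _; rewrite /g -[RHS](IHn (@rV_uncons R n h).2); last 2 first.
- apply: (measurableT_comp mf).
  by apply: (measurableT_comp (@measurable_rV_cons R _)); exact: measurable_pair1.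
- by [].
apply: eq_integral => y _; congr f.
apply/rowP => i; rewrite mxE.
case: (split_ordP (i : 'I_(1 + n))) => [j ->|j ->].
  rewrite !rV_consl/=; congr (_ + h _ _).
  by apply/val_inj; rewrite /= ord1.
by rewrite !rV_consr/= !mxE; congr (_ + h _ _).
Qed.

Lemma ge0_integral_rV_split_sym n m (f : 'rV[R]_(n + m) -> \bar R) :
  measurable_fun setT f -> (forall x, 0 <= f x)%E ->
  (\int[leb]_x \int[leb]_y f (row_mx x y) = \int[leb]_y \int[leb]_x f (row_mx x y))%E.
Proof.
move=> mf f0.
apply: (@fubini_tonelli _ _ _ _ R leb leb (fun z => f (row_mx z.1 z.2))) => //.
by apply: measurableT_comp => //; exact: measurable_row_mx.
Qed.

Lemma integral_rV_split_prod n m (f : 'rV[R]_(n + m) -> \bar R) :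
  leb.-integrable setT f ->
  (leb \x leb)%E.-integrable setT (fun z : 'rV[R]_n * 'rV[R]_m => f (row_mx z.1 z.2)).
Proof.
move=> /integrableP[mf fi]; apply/integrableP; split.
  by apply: measurableT_comp => //; exact: measurable_row_mx.
rewrite fubini_tonelli1//=.
  rewrite ge0_integral_rV_split in fi; [exact: fi| |by []].
  exact: measurableT_comp.
apply: measurableT_comp => //.
by apply: measurableT_comp => //; exact: measurable_row_mx.
Qed.

Lemma integral_rV_split n m (f : 'rV[R]_(n + m) -> \bar R) :
  leb.-integrable setT f ->
  (\int[leb]_x f x = \int[leb]_x \int[leb]_y f (row_mx x y))%E.
Proof.
move=> fi; have fi2 := integral_rV_split_prod fi.
rewrite (@integral12_prod_meas1 _ _ _ _ R leb leb _ fi2).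
have mf : measurable_fun setT f by case/integrableP : fi.
pose rm := fun z : 'rV[R]_n * 'rV[R]_m => row_mx z.1 z.2.
transitivity (\int[pushforward (leb \x leb)%E rm]_x f x)%E; last first.
  by rewrite (integral_pushforward (@measurable_row_mx n m) mf)//.
apply: eq_measure_integral; first exact: measurable_row_mx.
by move=> mrm A mA _; exact: leb_row_mx.
Qed.

Definition cube n (t : R) : set 'rV[R]_n := [set x | `|x| < t].
Arguments cube n t _ : clear implicits.

Lemma cube_measurable n (t : R) : measurable (cube n t).
Proof.
apply: open_rV_measurable.
rewrite (_ : cube n t = ball (0 : 'rV[R]_n) t); first exact: ball_open.
by apply/seteqP; split => x; rewrite -ball_normE /= sub0r normrN.
Qed.

Lemma leb_cube n (t : R) : 0 < t ->
  leb (cube n t) = ((2 * t) ^+ n)%:E.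
Proof.
move=> t0; elim: n => [|n IHn].
  rewrite expr0 /leb /= diracE mem_set//= /cube/= norm_rV_lt//.
  by apply/forallP => -[].
rewrite -[X in leb X]setIT -(integral_indic _ measurableT); last exact: cube_measurable.
rewrite ge0_integral_rV_cons//; last first.
  by apply/measurable_EFinP; apply: measurable_indic; exact: cube_measurable.
transitivity (\int[@lebesgue_measure R]_(a in [set` `]- t, t[%R]) ((2 * t) ^+ n)%:E)%E.
  rewrite [RHS]integral_mkcond; apply: eq_integral => a _.
  rewrite patchE; case: ifPn => at_.
    rewrite -IHn -[X in leb X]setIT -(integral_indic _ measurableT); last exact: cube_measurable.
    apply: eq_integral => y _; rewrite !indicE; congr ((_ : bool)%:R%:E).
    move: at_; rewrite inE/= in_itv/= -ltr_norml => at_.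
    apply/idP/idP; rewrite !inE/= /cube/= !norm_rV_lt// => /forallP h; apply/forallP => i.
      have := h (lift ord0 i).
      rewrite (_ : lift _ _ = rshift 1 i); last exact/val_inj.
      by rewrite rV_consr.
    case: (split_ordP (i : 'I_(1 + n))) => [j ->|j ->].
      by rewrite rV_consl.
    by rewrite rV_consr; exact: (h j).
  rewrite [LHS]integral0_eq// => y _; rewrite indicE memNset//=.
  rewrite /cube/= norm_rV_lt// => /forallP/(_ (lshift n (ord0 : 'I_1))).
  rewrite rV_consl => at2.
  by move: at_; rewrite notin_setE/= in_itv/= -ltr_norml => /negP; rewrite at2.
rewrite integral_cst//= lebesgue_measure_itv/= lte_fin gtrN//.
by rewrite -EFinB -EFinM exprS opprK; congr (_%:E); ring.
Qed.

Lemma bounded_rV_sub_cube n (A : set 'rV[R]_n) : bounded_set A ->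
  exists2 M : R, 1 <= M & A `<=` cube n M.
Proof.
move=> [M [Mr MA]]; exists (Num.max M 0 + 2).
  by rewrite -lerBlDr (_ : 1 - 2 = -1); [rewrite le_max orbC lerN10|ring].
move=> x Ax /=; have := MA (Num.max M 0 + 1).
by rewrite -[X in (X < _) -> _]addr0 ler_ltD ?le_max ?lexx//= => /(_ isT _ Ax)/= /le_lt_trans; apply; rewrite ltrD2l ltr1n.
Qed.

Lemma leb_bounded_fin n (A : set 'rV[R]_n) : measurable A -> bounded_set A ->
  (leb A < +oo)%E.
Proof.
move=> mA /bounded_rV_sub_cube[M M1 AM].
apply: (@le_lt_trans _ _ (leb (cube n M))).
  by apply: le_measure; rewrite ?inE//; exact: cube_measurable.
by rewrite leb_cube ?ltry// (lt_le_trans ltr01).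
Qed.

Lemma leb_compact_fin n (A : set 'rV[R]_n) : compact A -> (leb A < +oo)%E.
Proof.
move=> cA; apply: leb_bounded_fin; first exact: compact_rV_measurable.
exact: compact_bounded.
Qed.

End leb_structure.
Arguments cube {R} n t _.

(** * Smooth functions *)

Section smooth1.
Context {R : realType}.

(** The classical flat functions: they are all infinitely flat at the origin
and their derivatives are again combinations of them. *)
Definition flat n (t : R) : R := if 0 < t then t^-1 ^+ n * expR (- t^-1) else 0.

Lemma flat_le_sqr n (t : R) : `|flat n t| <= (n.+2)`!%:R * t ^+ 2.
Proof.
rewrite /flat; case: ifPn => [t0|_]; last by rewrite normr0 mulr_ge0 ?sqr_ge0.
have y0 : 0 < t^-1 by rewrite invr_gt0.
rewrite ger0_norm; last by rewrite mulr_ge0 ?expR_ge0// exprn_ge0// ltW.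
rewrite expRN ler_pdivrMr ?expR_gt0//.
have := expR_ge1Dxn n.+1 (ltW y0).
set f := _`!%:R; have f0 : 0 < f by rewrite ltr0n fact_gt0.
move=> h; have {}h : t^-1 ^+ n.+2 / f <= expR t^-1 by lra.
rewrite ler_pdivrMr// in h.
apply: (@le_trans _ _ (t^+2 * (expR t^-1 * f))); last by rewrite le_eqVlt; apply/orP; left; apply/eqP; ring.
rewrite -ler_pdivrMl ?exprn_gt0//; apply: le_trans h.
by have -> : t ^- 2 * t^-1 ^+ n = t^-1 ^+ n.+2 by rewrite -exprVn -exprD.
Qed.

Lemma is_derive_cst1 (c t : R) : is_derive t 1 (fun=> c) 0.
Proof. exact: is_derive_cst. Qed.

Lemma is_derive_affine (a c t : R) : is_derive t 1 (fun t : R => a * t + c) a.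
Proof.
have h := @is_deriveD _ _ _ _ _ _ _ _ _ (@is_deriveZ _ _ _ _ a _ _ _ (is_derive_id t 1)) (is_derive_cst1 c t).
by apply: (is_derive_eq h); rewrite /GRing.scale/= mulr1 addr0.
Qed.

Lemma is_derive_comp_affine (b : R -> R) (a c t db : R) :
  is_derive (a * t + c) 1 b db -> is_derive t 1 (fun t : R => b (a * t + c)) (a * db).
Proof.
move=> hb; have := @is_derive1_comp R b (fun t : R => a * t + c) t db a hb (is_derive_affine a c t).
by rewrite mulrC.
Qed.

Lemma is_derive_flat n (t : R) :
  is_derive t 1 (flat n) (- n%:R * flat n.+1 t + flat n.+2 t).
Proof.
have [t0|t0|t0] := ltgtP t 0.
- rewrite [X in _ + X]/flat [X in _ * X]/flat !ltNge (ltW t0)/= mulr0 addr0.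
  apply: (near_eq_is_derive (f := fun=> 0)).
  near=> s; rewrite /flat ltNge ifF//; apply/negbTE; rewrite negbK ltW//.
  by near: s; exact: lt_nbhsl.
- have tn0 : t != 0 by rewrite gt_eqF.
  rewrite [X in _ + X]/flat [X in _ * X]/flat t0.
  apply: (near_eq_is_derive (f := (fun s : R => s^-1) ^+ n * (expR \o (fun s => - s^-1)))).
    near=> s; rewrite /flat ifT; last by near: s; exact: lt_nbhsr.
    by rewrite exprfctE.
  have dV : is_derive t 1 (fun s : R => s^-1) (- (t ^- 2)).
    apply: DeriveDef; first by apply: derivableV => //; exact: derivable_id.
    by rewrite deriveV// derive_id /GRing.scale/= mulr1.
  apply: is_derive_eq.
  rewrite /GRing.scale/= exprfctE.
  case: n => [|n].
    by rewrite mulr0n !mul0r oppr0 mul0r mulr0 addr0 add0r; field.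
  rewrite /= !exprS; field.
  by rewrite tn0.
- rewrite t0 [X in _ + X]/flat [X in _ * X]/flat ltxx mulr0 addr0.
  suff h : ((fun h => h^-1 *: ((flat n \o shift 0) (h *: 1) - flat n 0)) @ 0^') --> (0 : R).
    by apply: DeriveDef; [apply/cvg_ex; exists 0|apply/cvg_lim].
  apply/cvgrPdist_le => e e0.
  set C : R := (n.+2)`!%:R; have C0 : 0 < C by rewrite ltr0n fact_gt0.
  near=> h; rewrite sub0r normrN /= addr0 /GRing.scale/= mulr1.
  rewrite {2}/flat ltxx subr0 normrM normfV.
  have h0 : h != 0 by near: h; exact: nbhs_dnbhs_neq.
  rewrite ler_pdivrMl ?normr_gt0//; apply: le_trans (flat_le_sqr _ _) _.
  rewrite -/C -real_normK ?num_real// expr2 mulrCA ler_pM2l ?normr_gt0//.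
  rewrite mulrC -ler_pdivlMr//.
  near: h; apply: dnbhs0_le; exact: divr_gt0.
Unshelve. all: by end_near. Qed.

(** A family of functions of one variable which contains the plateaus and which
differentiation preserves; smoothness follows by coinduction. *)
Inductive elementary : (R -> R) -> Prop :=
| elem_cst c : elementary (fun=> c)
| elem_flat n a c : elementary (fun t => flat n (a * t + c))
| elem_add f g : elementary f -> elementary g -> elementary (fun t => f t + g t)
| elem_mul f g : elementary f -> elementary g -> elementary (fun t => f t * g t)
| elem_inv f : elementary f -> (forall t, f t != 0) -> elementary (fun t => (f t)^-1).

Lemma elementary_derive f : elementary f ->
  (forall t, derivable f t 1) /\ elementary (derive1 f).
Proof.
have D (g g' : R -> R) : (forall t : R, is_derive t 1 g (g' t)) -> elementary g' ->
    (forall t, derivable g t 1) /\ elementary (derive1 g).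
  move=> h ?; split=> [t|]; first by apply: ex_derive.
  rewrite (_ : (derive1 g) = g')//; apply/funext => t; rewrite derive1E.
  exact: derive_val.
have I (g : R -> R) (t : R) : derivable g t 1 -> is_derive t 1 g ((derive1 g) t).
  by move=> h; rewrite derive1E; apply: derivableP.
elim=> {f} [c|n a c|f g ef [df ef'] eg [dg eg']|f g ef [df ef'] eg [dg eg']|f ef [df ef'] f0].
- exact: (D _ (fun=> 0) (is_derive_cst1 c) (elem_cst 0)).
- have hd (t : R) : is_derive t 1 (fun t => flat n (a * t + c))
      (a * (- n%:R * flat n.+1 (a * t + c) + flat n.+2 (a * t + c))).
    exact: is_derive_comp_affine (is_derive_flat n (a * t + c)).
  apply: (D _ _ hd); apply: elem_mul; first exact: elem_cst.
  apply: elem_add; last exact: elem_flat.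
  by apply: elem_mul; [exact: elem_cst|exact: elem_flat].
- have hd (t : R) : is_derive t 1 (fun t => f t + g t) (derive1 f t + derive1 g t).
    by apply: is_deriveD; exact: I.
  by apply: (D _ _ hd); exact: elem_add.
- have hd (t : R) : is_derive t 1 (fun t => f t * g t) (f t * derive1 g t + g t * derive1 f t).
    by apply: is_deriveM; exact: I.
  by apply: (D _ _ hd); apply: elem_add; exact: elem_mul.
- have hd (t : R) : is_derive t 1 (fun t => (f t)^-1) ((-1 * (f t)^-1 * (f t)^-1) * derive1 f t).
    apply: DeriveDef; first exact: derivableV.
    apply: (etrans (@deriveV R R f t 1 (f0 t) (df t))).
    rewrite (derive1E f t) /GRing.scale/= expr2 invfM; ring.
  apply: (D _ _ hd); apply: elem_mul => //; apply: elem_mul; last exact: elem_inv.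
  by apply: elem_mul; [exact: elem_cst|exact: elem_inv].
Qed.

Lemma elementary_continuous f : elementary f -> continuous f.
Proof.
move=> /elementary_derive[df _] t.
by apply: differentiable_continuous; apply/derivable1_diffP; exact: df.
Qed.

Definition step (t : R) : R := flat 0 t / (flat 0 t + flat 0 (1 - t)).

Lemma flat_ge0 n t : 0 <= flat n t.
Proof.
rewrite /flat; case: ifPn => // t0.
by rewrite mulr_ge0 ?expR_ge0// exprn_ge0// invr_ge0 ltW.
Qed.

Lemma flat_gt0 n t : 0 < t -> 0 < flat n t.
Proof. by move=> t0; rewrite /flat t0 mulr_gt0 ?expR_gt0// exprn_gt0// invr_gt0. Qed.

Lemma flat_le0 n t : t <= 0 -> flat n t = 0.
Proof. by rewrite /flat leNgt => /negbTE ->. Qed.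

Lemma step_den t : 0 < flat 0 t + flat 0 (1 - t).
Proof.
have [t0|t0] := ltP 0 t; first by rewrite ltr_pwDl ?flat_gt0 ?flat_ge0.
by rewrite ltr_wpDl ?flat_ge0// flat_gt0//; lra.
Qed.

Lemma step_ge0 t : 0 <= step t.
Proof. by rewrite divr_ge0 ?flat_ge0// ltW// step_den. Qed.

Lemma step_le1 t : step t <= 1.
Proof. by rewrite ler_pdivrMr ?step_den// mul1r lerDl flat_ge0. Qed.

Lemma step_le0 t : t <= 0 -> step t = 0.
Proof. by move=> t0; rewrite /step flat_le0// mul0r. Qed.

Lemma step_ge1 t : 1 <= t -> step t = 1.
Proof.
move=> t1; have := step_den t; rewrite /step [flat 0 (1 - t)]flat_le0 ?addr0; last lra.
by move=> h; rewrite divff// gt_eqF.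
Qed.

Lemma elementary_step a c : elementary (fun t => step (a * t + c)).
Proof.
have h : elementary (fun t => flat 0 (1 - (a * t + c))).
  rewrite (_ : (fun t => _) = (fun t => flat 0 (- a * t + (1 - c)))).
    exact: elem_flat.
  by apply/funext => t; congr (flat 0 _); ring.
apply: elem_mul; first exact: elem_flat.
apply: (@elem_inv (fun t => flat 0 (a * t + c) + flat 0 (1 - (a * t + c)))).
  by apply: elem_add => //; exact: elem_flat.
by move=> t; rewrite gt_eqF// step_den.
Qed.

Definition plateau t h (s : R) := step (h^-1 * s + (t + h) / h) * step (- h^-1 * s + (t + h) / h).

Lemma elementary_plateau t h : elementary (plateau t h).
Proof. by apply: elem_mul; exact: elementary_step. Qed.

Lemma plateau_ge0 t h s : 0 <= plateau t h s.
Proof. by rewrite mulr_ge0 ?step_ge0. Qed.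

Lemma plateau_le1 t h s : plateau t h s <= 1.
Proof. by rewrite mulr_ile1 ?step_ge0 ?step_le1. Qed.

Lemma plateau1 t h s : 0 < h -> `|s| <= t -> plateau t h s = 1.
Proof.
move=> h0 st; rewrite /plateau; move: st; rewrite ler_norml => /andP[s1 s2].
by rewrite !step_ge1 ?mulr1// mulrC ?mulNr ?mulrN -?mulNr -mulrDl ler_pdivlMr//; lra.
Qed.

Lemma plateau0 t h s : 0 < h -> t + h <= `|s| -> plateau t h s = 0.
Proof.
move=> h0; rewrite ler_normr => /orP[] s1; rewrite /plateau.
  rewrite [X in _ * X]step_le0 ?mulr0// mulNr mulrC -mulNr -mulrDl ler_pdivrMr//; lra.
rewrite [X in X * _]step_le0 ?mul0r// mulrC -mulrDl ler_pdivrMr//; lra.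
Qed.

(** A plateau is a product of two rescalings, by the factors 1 / h and - 1 / h, of one fixed
smooth step, whose derivative is bounded because it vanishes outside a compact interval. *)
Lemma plateau_derive_le : exists2 C : R, 0 < C &
  forall t h s, 0 <= t -> 1 <= h -> `|derive1 (plateau t h) s| <= C / h.
Proof.
have [_ /elementary_continuous cs] := elementary_derive (elementary_step 1 0).
have [C C0 hC] : exists2 C : R, 0 < C & forall s, `|(derive1 (fun s => step (1 * s + 0))) s| <= C.
  have /compact_bounded [M [_ MA]] : compact ((derive1 (fun s => step (1 * s + 0))) @` `[-1, 2]).
    apply: continuous_compact; last exact: segment_compact.
    exact: continuous_subspaceT.
  exists (`|M| + 1); first by rewrite ltr_wpDl.
  move=> s; have [hs|] := boolP (s \in `[-1, 2]).
    by apply: MA; [rewrite ltr_pwDr// ler_norm|exists s].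
  rewrite in_itv/= negb_and -!ltNge => hs.
  have -> : (derive1 (fun s : R => step (1 * s + 0))) s = 0.
    rewrite derive1E.
    case/orP : hs => hs.
      rewrite (@near_eq_derive _ _ _ _ (cst 0 : R -> R)) ?derive_cst//.
      near=> x; rewrite step_le0// mul1r addr0.
      suff : x < -1 by lra.
      by near: x; exact: lt_nbhsl.
    rewrite (@near_eq_derive _ _ _ _ (cst 1 : R -> R)) ?derive_cst//.
    near=> x; rewrite step_ge1// mul1r addr0.
    suff : 2 < x by lra.
    by near: x; exact: lt_nbhsr.
  by rewrite normr0 addr_ge0.
exists (C + C); first exact: addr_gt0.
move=> t h s t0 h1; have h0 : 0 < h by lra.
have Ds (a c u : R) : is_derive u 1 (fun v => step (a * v + c)) (a * (derive1 (fun s => step (1 * s + 0))) (a * u + c)).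
  have hs : is_derive (a * u + c) 1 (fun s => step (1 * s + 0)) ((derive1 (fun s => step (1 * s + 0))) (a * u + c)).
    rewrite derive1E; apply: derivableP.
    by have [+ _] := elementary_derive (elementary_step 1 0); apply.
  have := is_derive_comp_affine hs.
  rewrite (_ : (fun t0 : R => step (1 * (a * t0 + c) + 0)) = (fun v => step (a * v + c)))//.
  by apply/funext => v /=; rewrite mul1r addr0.
rewrite derive1E (@derive_val _ _ _ _ _ _ _ (is_deriveM (Ds h^-1 _ s) (Ds (- h^-1) _ s))).
rewrite /GRing.scale/= [leRHS]mulrDl; apply: le_trans (ler_normD _ _) _.
have aux (x y z : R) : `|x| <= 1 -> `|y| = h^-1 -> `|z| <= C -> `|x * (y * z)| <= C / h.
  move=> x1 y1 z1; rewrite !normrM y1 mulrCA mulrC ler_pM2r ?invr_gt0//.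
  by rewrite -[leRHS]mul1r; apply: ler_pM.
have s1 v : `|step v| <= 1 by rewrite ger0_norm ?step_ge0 ?step_le1.
by apply: lerD; apply: aux => //; rewrite ?normrN ger0_norm// invr_ge0 ltW.
Unshelve. all: by end_near. Qed.

End smooth1.

Section smooth_rV.
Context {R : realType}.

Lemma derivable_congr n m (f : 'rV[R]_n -> R) (g : 'rV[R]_m -> R) x v y w :
  (forall h, f (h *: v + x) = g (h *: w + y)) ->
  derivable g y w -> derivable f x v /\ 'D_v f x = 'D_w g y.
Proof.
move=> fg; rewrite /derivable /derive.
suff -> : (fun h => h^-1 *: ((f \o shift x) (h *: v) - f x)) =
          (fun h => h^-1 *: ((g \o shift y) (h *: w) - g y)) by [].
apply/funext => h /=; rewrite fg; congr (_ *: (_ - _)).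
by have := fg 0; rewrite !scale0r !add0r.
Qed.

Lemma derivable_congr1 n (f : 'rV[R]_n -> R) (g : R -> R) x v (y : R) :
  (forall h, f (h *: v + x) = g (h + y)) ->
  derivable g y 1 -> derivable f x v /\ 'D_v f x = derive1 g y.
Proof.
move=> fg; rewrite derive1E /derivable /derive.
suff -> : (fun h => h^-1 *: ((f \o shift x) (h *: v) - f x)) =
          (fun h => h^-1 *: ((g \o shift y) (h *: 1) - g y)) by [].
apply/funext => h /=; rewrite fg [h%:A]/GRing.scale/= mulr1.
congr (_ *: (_ - _)).
by have := fg 0; rewrite !scale0r !add0r.
Qed.

(** Restricting a function to a line parallel to an axis turns its partial
derivative into an ordinary one. *)
Lemma is_derive_line n (f : 'rV[R]_n -> R) x v (t : R) :
  derivable f (t *: v + x) v ->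
  is_derive t 1 (fun s => f (s *: v + x)) ('D_v f (t *: v + x)).
Proof.
move=> df.
have E : (fun h => h^-1 *: (((fun s : R => f (s *: v + x)) \o shift t) (h *: 1) - f (t *: v + x))) =
   (fun h => h^-1 *: ((f \o shift (t *: v + x)) (h *: v) - f (t *: v + x))).
  apply/funext => h /=; congr (_ *: (f _ - _)).
  by rewrite {2}/GRing.scale/= mulr1 scalerDl addrA.
by apply: DeriveDef; rewrite /derivable /derive E.
Qed.

Lemma nonexpansive_continuous (V W : normedModType R) (f : V -> W) :
  (forall x y, `|f x - f y| <= `|x - y|) -> continuous f.
Proof.
move=> h x; apply/cvgrPdist_lt => e e0; near=> y.
apply: (le_lt_trans (h _ _)); near: y.
by apply: cvgr_dist_lt => //; exact: cvg_id.
Unshelve. all: by end_near. Qed.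

Lemma norm_lsubmx_le n m (x : 'rV[R]_(n + m)) : `|lsubmx x| <= `|x|.
Proof.
rewrite norm_rV_le//; apply/forallP => i; rewrite mxE; exact: coord_norm_le.
Qed.

Lemma norm_rsubmx_le n m (x : 'rV[R]_(n + m)) : `|rsubmx x| <= `|x|.
Proof.
rewrite norm_rV_le//; apply/forallP => i; rewrite mxE; exact: coord_norm_le.
Qed.

Lemma norm_row_mx_lt n m (x : 'rV[R]_n) (y : 'rV[R]_m) e : 0 < e ->
  (`|row_mx x y| < e) = (`|x| < e) && (`|y| < e).
Proof.
move=> e0; rewrite !norm_rV_lt//; apply/forallP/andP.
  move=> h; split; apply/forallP => i.
    by have := h (lshift m i); rewrite row_mxEl.
  by have := h (rshift n i); rewrite row_mxEr.
move=> [/forallP h1 /forallP h2] i; case: (split_ordP i) => [j ->|j ->].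
  by rewrite row_mxEl.
by rewrite row_mxEr.
Qed.

Lemma norm_row_mx_le n m (x : 'rV[R]_n) (y : 'rV[R]_m) e : 0 <= e ->
  (`|row_mx x y| <= e) = (`|x| <= e) && (`|y| <= e).
Proof.
move=> e0; rewrite !norm_rV_le//; apply/forallP/andP.
  move=> h; split; apply/forallP => i.
    by have := h (lshift m i); rewrite row_mxEl.
  by have := h (rshift n i); rewrite row_mxEr.
move=> [/forallP h1 /forallP h2] i; case: (split_ordP i) => [j ->|j ->].
  by rewrite row_mxEl.
by rewrite row_mxEr.
Qed.

Lemma continuous_lsubmx n m : continuous (fun x : 'rV[R]_(n + m) => lsubmx x).
Proof.
by apply: nonexpansive_continuous => x y; rewrite -linearB norm_lsubmx_le.
Qed.

Lemma continuous_rsubmx n m : continuous (fun x : 'rV[R]_(n + m) => rsubmx x).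
Proof.
by apply: nonexpansive_continuous => x y; rewrite -linearB norm_rsubmx_le.
Qed.

Lemma continuous_row_mxr n m (x : 'rV[R]_n) :
  continuous (fun y : 'rV[R]_m => row_mx x y).
Proof.
apply: nonexpansive_continuous => y z.
by rewrite opp_row_mx add_row_mx subrr norm_row_mx_le// normr0 normr_ge0 lexx.
Qed.

Local Notation e_ i := (delta_mx ord0 i).

(** Smoothness is a condition on all the iterated partial derivatives; a class of continuous
functions that have partial derivatives in the class therefore consists of smooth functions. *)
Lemma smooth_coind n (S : set ('rV[R]_n -> R)) :
  (forall u, S u -> continuous u /\
     forall i, (forall x, derivable u x (e_ i)) /\ S (partial i u)) ->
  forall u, S u -> smooth u.
Proof.
move=> hS u Su s.
have Ss : S (foldr (@partial R n) u s).
  by elim: s => [//|i s IHs] /=; have [_ /(_ i)[_]] := hS _ IHs.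
by have [cs ds] := hS _ Ss; split => // i; have [] := ds i.
Qed.

Lemma smooth_continuous n (u : 'rV[R]_n -> R) : smooth u -> continuous u.
Proof. by move=> /(_ [::])[]. Qed.

Lemma smooth_derivable n (u : 'rV[R]_n -> R) i x : smooth u -> derivable u x (e_ i).
Proof. by move=> /(_ [::])[_]; exact. Qed.

Lemma smooth_partial n (u : 'rV[R]_n -> R) i : smooth u -> smooth (partial i u).
Proof. by move=> su s; have := su (rcons s i); rewrite foldr_rcons. Qed.

Lemma smooth_cst n (c : R) : smooth (fun _ : 'rV[R]_n => c).
Proof.
apply: (@smooth_coind n [set u | exists c, u = fun=> c]); last by exists c.
move=> _ [a ->]; split; first exact: cst_continuous.
move=> i; split; first by move=> x; exact: (derivable_cst a).
by exists 0; apply/funext => x; rewrite /partial; exact: (derive_cst a).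
Qed.

Lemma partialD n (u v : 'rV[R]_n -> R) i : smooth u -> smooth v ->
  partial i (fun x => u x + v x) = (fun x => partial i u x + partial i v x).
Proof.
by move=> su sv; apply/funext => x; rewrite /partial; apply: deriveD; exact: smooth_derivable.
Qed.

Lemma partialM n (u v : 'rV[R]_n -> R) i : smooth u -> smooth v ->
  partial i (fun x => u x * v x) =
  (fun x => u x * partial i v x + v x * partial i u x).
Proof.
by move=> su sv; apply/funext => x; rewrite /partial; apply: deriveM; exact: smooth_derivable.
Qed.

(** The algebra generated by smooth functions and by elementary functions of one coordinate. It is
stable under partial derivatives, which yields sums and products of smooth functions at once. *)
Inductive smooth_alg n : ('rV[R]_n -> R) -> Prop :=
| salg_base u : smooth u -> smooth_alg u
| salg_elem i b : elementary b -> smooth_alg (fun x => b (x ord0 i))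
| salg_add u v : smooth_alg u -> smooth_alg v -> smooth_alg (fun x => u x + v x)
| salg_mul u v : smooth_alg u -> smooth_alg v -> smooth_alg (fun x => u x * v x).

Lemma derivable_elementary n (b : R -> R) (i j : 'I_n) x : elementary b ->
  derivable (fun x : 'rV[R]_n => b (x ord0 i)) x (e_ j) /\
  'D_(e_ j) (fun x : 'rV[R]_n => b (x ord0 i)) x = if i == j then derive1 b (x ord0 i) else 0.
Proof.
move=> eb; have [db _] := elementary_derive eb.
case: eqP => [->|/eqP ij].
  by apply: derivable_congr1 => // h; rewrite !mxE !eqxx mulr1.
have := @derivable_congr n n (fun x : 'rV[R]_n => b (x ord0 i)) (fun=> b (x ord0 i)) x (e_ j) x (e_ j).
rewrite derive_cst; apply; last exact: derivable_cst.
by move=> h; rewrite !mxE eqxx (negbTE ij) mulr0 add0r.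
Qed.

Lemma smooth_alg_smooth n (u : 'rV[R]_n -> R) : smooth_alg u -> smooth u.
Proof.
apply: (@smooth_coind n (@smooth_alg n)).
move=> {}u; elim=> {u} [u su|i b eb|u v au [cu du] av [cv dv]|u v au [cu du] av [cv dv]].
- split=> [|i]; first exact: smooth_continuous.
  split=> [x|]; first exact: smooth_derivable.
  by apply: salg_base; exact: smooth_partial.
- split=> [|j].
    move=> x; apply: (continuous_comp (@coord_continuous _ _ _ ord0 i x)).
    exact: elementary_continuous.
  split=> [x|]; first by have [] := derivable_elementary i j x eb.
  rewrite (_ : partial _ _ = if i == j then (fun x : 'rV_n => derive1 b (x ord0 i)) else fun=> 0).
    case: eqP => _; last by apply: salg_base; exact: smooth_cst.
    by apply: salg_elem; have [] := elementary_derive eb.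
  apply/funext => x; rewrite /partial.
  by have [_ ->] := derivable_elementary i j x eb; case: eqP.
- split=> [x|i]; first exact: (continuousD (cu x) (cv x)).
  have [dui aui] := du i; have [dvi avi] := dv i.
  split=> [x|]; first exact: derivableD.
  rewrite (_ : partial _ _ = fun x => partial i u x + partial i v x).
    exact: salg_add.
  by apply/funext => x; apply: deriveD.
- split=> [x|i]; first exact: (continuousM (cu x) (cv x)).
  have [dui aui] := du i; have [dvi avi] := dv i.
  split=> [x|]; first exact: derivableM.
  rewrite (_ : partial _ _ = fun x => u x * partial i v x + v x * partial i u x).
    by apply: salg_add; exact: salg_mul.
  by apply/funext => x; apply: deriveM.
Qed.

Lemma smoothD n (u v : 'rV[R]_n -> R) : smooth u -> smooth v ->
  smooth (fun x => u x + v x).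
Proof. by move=> su sv; apply: smooth_alg_smooth; apply: salg_add; exact: salg_base. Qed.

Lemma smoothM n (u v : 'rV[R]_n -> R) : smooth u -> smooth v ->
  smooth (fun x => u x * v x).
Proof. by move=> su sv; apply: smooth_alg_smooth; apply: salg_mul; exact: salg_base. Qed.

Lemma smooth_elementary n (b : R -> R) (i : 'I_n) : elementary b ->
  smooth (fun x : 'rV[R]_n => b (x ord0 i)).
Proof. by move=> eb; apply: smooth_alg_smooth; exact: salg_elem. Qed.

Lemma smooth_prod n I (s : seq I) (F : I -> 'rV[R]_n -> R) :
  (forall i, smooth (F i)) -> smooth (fun x => \prod_(i <- s) F i x).
Proof.
move=> sF; elim: s => [|i s IHs].
  rewrite (_ : (fun _ => _) = fun=> 1); first exact: smooth_cst.
  by apply/funext => x; rewrite big_nil.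
rewrite (_ : (fun _ => _) = fun x => F i x * \prod_(j <- s) F j x).
  exact: (smoothM (sF i) IHs).
by apply/funext => x; rewrite big_cons.
Qed.

Lemma smoothB n (u v : 'rV[R]_n -> R) : smooth u -> smooth v ->
  smooth (fun x => u x - v x).
Proof.
move=> su sv; rewrite (_ : (fun x => _) = (fun x => u x + (-1) * v x)).
  exact: (smoothD su (smoothM (smooth_cst (-1)) sv)).
by apply/funext => x; rewrite mulN1r.
Qed.

Lemma partialB n (u v : 'rV[R]_n -> R) i : smooth u -> smooth v ->
  partial i (fun x => u x - v x) = (fun x => partial i u x - partial i v x).
Proof.
by move=> su sv; apply/funext => x; rewrite /partial; apply: deriveB; exact: smooth_derivable.
Qed.

Lemma derivable_slice n m (u : 'rV[R]_(n + m) -> R) (x : 'rV[R]_n) j y : smooth u ->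
  derivable (fun y : 'rV[R]_m => u (row_mx x y)) y (e_ j) /\
  'D_(e_ j) (fun y : 'rV[R]_m => u (row_mx x y)) y = partial (rshift n j) u (row_mx x y).
Proof.
move=> su; apply: derivable_congr => [h|]; last exact: smooth_derivable.
congr u; apply/rowP => i; case: (split_ordP i) => [k ->|k ->].
  by rewrite [RHS]mxE !row_mxEl !mxE eqxx (_ : (_ == _) = false) ?mulr0 ?add0r//; apply/negbTE; rewrite eq_sym -val_eqE/= neq_ltn ltn_addr// orbT.
by rewrite [RHS]mxE !row_mxEr !mxE eq_rshift.
Qed.

Lemma partial_slice n m (u : 'rV[R]_(n + m) -> R) (x : 'rV[R]_n) j : smooth u ->
  partial j (fun y : 'rV[R]_m => u (row_mx x y)) =
  fun y => partial (rshift n j) u (row_mx x y).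
Proof. by move=> su; apply/funext => y; have [] := derivable_slice x j y su. Qed.

Lemma smooth_slice n m (u : 'rV[R]_(n + m) -> R) (x : 'rV[R]_n) : smooth u ->
  smooth (fun y : 'rV[R]_m => u (row_mx x y)).
Proof.
move=> su.
apply: (@smooth_coind m [set v | exists2 u, smooth u & v = fun y => u (row_mx x y)]);
  last by exists u.
move=> _ [{su}u su ->]; split=> [y|i].
  apply: continuous_comp; first exact: continuous_row_mxr.
  exact: smooth_continuous.
split=> [y|]; first by have [] := derivable_slice x i y su.
by rewrite partial_slice//; exists (partial (rshift n i) u) => //; exact: smooth_partial.
Qed.

Lemma derivable_rsubmx n m (w : 'rV[R]_m -> R) i (x : 'rV[R]_(n + m)) : smooth w ->
  derivable (fun x : 'rV[R]_(n + m) => w (rsubmx x)) x (e_ i) /\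
  'D_(e_ i) (fun x : 'rV[R]_(n + m) => w (rsubmx x)) x =
   match fintype.split i with inl _ => 0 | inr j => partial j w (rsubmx x) end.
Proof.
move=> sw; case: splitP => j ij.
  have -> : i = lshift m j by exact/val_inj.
  have := @derivable_congr (n + m) m (fun x : 'rV[R]_(n + m) => w (rsubmx x)) (fun=> w (rsubmx x)) x (e_ (lshift m j)) 0 0.
  rewrite derive_cst; apply; last exact: derivable_cst.
  move=> h; congr w; apply/rowP => k; rewrite !mxE eqxx (_ : (_ == _) = false) ?mulr0 ?add0r//.
  by apply/negbTE; rewrite -val_eqE/= neq_ltn ltn_addr// orbT.
have -> : i = rshift n j by exact/val_inj.
apply: derivable_congr => [h|]; last exact: smooth_derivable.
by congr w; apply/rowP => k; rewrite !mxE eq_rshift.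
Qed.

Lemma partial_rsubmx_l n m (w : 'rV[R]_m -> R) (i : 'I_n) : smooth w ->
  partial (lshift m i) (fun x : 'rV[R]_(n + m) => w (rsubmx x)) = fun=> 0.
Proof.
move=> sw; apply/funext => x; have [_] := derivable_rsubmx (lshift m i) x sw.
by rewrite (unsplitK (inl _ i)).
Qed.

Lemma partial_rsubmx_r n m (w : 'rV[R]_m -> R) (i : 'I_m) : smooth w ->
  partial (rshift n i) (fun x : 'rV[R]_(n + m) => w (rsubmx x)) =
  fun x => partial i w (rsubmx x).
Proof.
move=> sw; apply/funext => x; have [_] := derivable_rsubmx (rshift n i) x sw.
by rewrite (unsplitK (inr _ i)).
Qed.

Lemma smooth_rsubmx n m (w : 'rV[R]_m -> R) : smooth w ->
  smooth (fun x : 'rV[R]_(n + m) => w (rsubmx x)).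
Proof.
move=> sw.
apply: (@smooth_coind (n + m) [set v | exists2 w, smooth w & v = fun x => w (rsubmx x)]);
  last by exists w.
move=> _ [{sw}w sw ->]; split=> [y|i].
  apply: continuous_comp; first exact: continuous_rsubmx.
  exact: smooth_continuous.
split=> [y|]; first by have [] := derivable_rsubmx i y sw.
case: (split_ordP i) => j ->.
  by rewrite partial_rsubmx_l//; exists (fun=> 0) => //; exact: smooth_cst.
by rewrite partial_rsubmx_r//; exists (partial j w) => //; exact: smooth_partial.
Qed.

End smooth_rV.

(** * Integrals of real-valued functions *)

Section real_integrals.
Context d (T : measurableType d) (R : realType) (mu : {measure set T -> \bar R}).
Implicit Types (D : set T) (f g b : T -> R).
Local Notation ig D f := (mu.-integrable D (EFin \o f)).

Lemma ig_add D f g : measurable D -> ig D f -> ig D g -> ig D (fun x => f x + g x).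
Proof. by move=> mD hf hg; exact: (integrableD mD hf hg). Qed.

Lemma ig_scale D f (c : R) : measurable D -> ig D f -> ig D (fun x => c * f x).
Proof. by move=> mD hf; exact: (integrableZl mD c hf). Qed.

Lemma ig_sub D f g : measurable D -> ig D f -> ig D g -> ig D (fun x => f x - g x).
Proof. by move=> mD hf hg; exact: (integrableB mD hf hg). Qed.


Lemma ig_measurable D f : ig D f -> measurable_fun D f.
Proof. by move=> /integrableP[/measurable_EFinP]. Qed.

Lemma ig_dom D f g : measurable D -> measurable_fun D f -> ig D g ->
  (forall x, D x -> `|f x| <= g x) -> ig D f.
Proof.
move=> mD mf hg fg; apply: (le_integrable mD _ _ hg); first exact/measurable_EFinP.
by move=> x Dx /=; rewrite lee_fin (le_trans (fg x Dx))// ler_norm.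
Qed.

Lemma ig_abs D f : measurable D -> ig D f -> ig D (fun x => `|f x|).
Proof.
move=> mD hf; apply: (ig_dom (g := fun x => `|f x|)) => //; last 2 first.
- exact: (integrable_abse hf).
- by move=> x _; rewrite normr_id.
by apply: measurableT_comp => //; exact: ig_measurable hf.
Qed.

Lemma ig_cst D (c : R) : measurable D -> (mu D < +oo)%E -> ig D (fun=> c).
Proof.
move=> mD Dfin; apply/integrableP; split; first exact: measurable_cst.
rewrite /= integral_cst// lte_mul_pinfty//.
Qed.

Lemma ig_bound D f (M : R) : measurable D -> (mu D < +oo)%E -> measurable_fun D f ->
  (forall x, D x -> `|f x| <= M) -> ig D f.
Proof. by move=> mD Dfin mf fM; apply: (ig_dom mD mf (ig_cst M mD Dfin)). Qed.

Lemma ig_mulb D f b (M : R) : measurable D -> ig D f -> measurable_fun D b ->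
  (forall x, D x -> `|b x| <= M) -> ig D (fun x => b x * f x).
Proof.
move=> mD hf mb bM; apply: (ig_dom (g := fun x => M * `|f x|)) => //.
- by apply: measurable_funM => //; exact: ig_measurable hf.
- by apply: ig_scale => //; exact: ig_abs.
by move=> x Dx; rewrite normrM ler_wpM2r// bM.
Qed.

Lemma ig_sub_set D E f : measurable D -> measurable E -> E `<=` D -> ig D f -> ig E f.
Proof. by move=> mD mE ED; exact: integrableS. Qed.

Lemma ig_patch D f : measurable D -> ig D f <-> mu.-integrable setT (EFin \o (f \_ D)).
Proof.
move=> mD; rewrite -restrict_EFin; split => h; last by apply/(integrable_mkcond _ mD).
by apply/(integrable_mkcond _ mD).
Qed.

Lemma ig_eq D f g : measurable D -> {in D, f =1 g} -> ig D f -> ig D g.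
Proof. by move=> mD fg; apply: eq_integrable => // x xD; rewrite /= fg. Qed.

Lemma Rintegral_sum D (I : Type) (s : seq I) (F : I -> T -> R) : measurable D ->
  (forall i, ig D (F i)) ->
  ig D (fun x => \sum_(i <- s) F i x) /\
  \int[mu]_(x in D) (\sum_(i <- s) F i x) = \sum_(i <- s) \int[mu]_(x in D) F i x.
Proof.
move=> mD hF; elim: s => [|i s [IH1 IH2]].
  split.
    rewrite (_ : (fun _ => _) = fun=> 0); last by apply/funext => x; rewrite big_nil.
    exact: integrable0.
  rewrite big_nil; under eq_Rintegral do rewrite big_nil.
  by rewrite Rintegral_cst// mul0r.
have E : (fun x => \sum_(j <- i :: s) F j x) = (fun x => F i x + \sum_(j <- s) F j x).
  by apply/funext => x; rewrite big_cons.
rewrite E big_cons; split; first exact: ig_add.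
by rewrite -IH2 -RintegralD.
Qed.

Lemma Rintegral_le0_eq0 D f : measurable D -> ig D f -> (forall x, D x -> 0 <= f x) ->
  \int[mu]_(x in D) f x <= 0 -> {ae mu, forall x, D x -> f x = 0}.
Proof.
move=> mD hf f0 h.
have h2 : (\int[mu]_(x in D) (f x)%:E = 0)%E.
  have fi := integrable_fin_num mD hf.
  rewrite -[LHS]fineK//; congr (_%:E); apply/eqP; rewrite eq_le h/=.
  exact: Rintegral_ge0.
have mf := ig_measurable hf.
have mf' : measurable_fun D (EFin \o f) by exact/measurable_EFinP.
have := (ae_eq_integral_abs mu mD mf').1.
rewrite (_ : (\int[mu]_(x in D) `|(EFin \o f) x|)%E = 0); last first.
  rewrite -h2; apply: eq_integral => x /[!inE] Dx /=.
  by rewrite ger0_norm// f0.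
move=> /(_ erefl); apply: filterS => x /= hx Dx.
by have := hx Dx; case.
Qed.

Lemma ae_Rintegral_eq D f g : measurable D -> measurable_fun D f -> measurable_fun D g ->
  {ae mu, forall x, D x -> f x = g x} ->
  \int[mu]_(x in D) f x = \int[mu]_(x in D) g x.
Proof.
move=> mD mf mg fg; rewrite /Rintegral; congr fine.
apply: ae_eq_integral => //; try exact/measurable_EFinP.
by apply: filterS fg => x h /h ->.
Qed.

Lemma ae_ig D f g : measurable D -> measurable_fun D g ->
  {ae mu, forall x, D x -> f x = g x} -> ig D f -> ig D g.
Proof.
move=> mD mg fg hf; have mf := ig_measurable hf.
apply/integrableP; split; first exact/measurable_EFinP.
have /integrableP[_] := hf; apply: le_lt_trans.
rewrite le_eqVlt; apply/orP; left; apply/eqP.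
apply: ae_eq_integral => //.
- by apply: measurableT_comp => //; exact/measurable_EFinP.
- by apply: measurableT_comp => //; exact/measurable_EFinP.
by apply: filterS fg => x h /h /= ->.
Qed.

End real_integrals.

(** * Test functions and weak gradients *)

Section test_functions.
Context {R : realType}.
Implicit Types n : nat.
Local Notation e_ i := (delta_mx ord0 i).

Definition support_in n (u : 'rV[R]_n -> R) K := forall x, ~ K x -> u x = 0.

Lemma test_smooth n (O : set 'rV[R]_n) u : test_function O u -> smooth u.
Proof. by case. Qed.

Lemma test_sub n (U O : set 'rV[R]_n) u : U `<=` O -> test_function U u -> test_function O u.
Proof. by move=> UO [su [K [cK KU uK]]]; split=> //; exists K; split=> // x /KU /UO. Qed.

Lemma partial_support n (u : 'rV[R]_n -> R) K i : closed K -> support_in u K ->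
  support_in (partial i u) K.
Proof.
move=> cK uK x Kx; rewrite /partial (@near_eq_derive _ _ _ _ (cst 0)) ?derive_cst//.
have : nbhs x (~` K) by apply: open_nbhs_nbhs; split=> //; exact: closed_openC.
by apply: filterS => y /uK.
Qed.

Lemma compact_closed_rV n (K : set 'rV[R]_n) : compact K -> closed K.
Proof. by move=> cK; apply: compact_closed. Qed.

Lemma test_partial n (O : set 'rV[R]_n) u i : test_function O u -> test_function O (partial i u).
Proof.
move=> [su [K [cK KO uK]]]; split; first exact: smooth_partial.
exists K; split=> //; apply: (partial_support (K := K)) => //.
exact: compact_closed_rV.
Qed.

Lemma test_mul n (O : set 'rV[R]_n) r u : smooth r -> test_function O u ->
  test_function O (fun x => r x * u x).
Proof.
move=> sr [su [K [cK KO uK]]]; split; first exact: smoothM.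
by exists K; split=> // x /uK ->; rewrite mulr0.
Qed.

Lemma testD n (O : set 'rV[R]_n) u v : test_function O u -> test_function O v ->
  test_function O (fun x => u x + v x).
Proof.
move=> [su [K [cK KO uK]]] [sv [K' [cK' KO' vK]]]; split; first exact: smoothD.
exists (K `|` K'); split=> [||x]; first exact: compactU.
  by move=> x [/KO|/KO'].
by move=> /not_orP[/uK -> /vK ->]; rewrite addr0.
Qed.

Lemma testZ n (O : set 'rV[R]_n) c u : test_function O u -> test_function O (fun x => c * u x).
Proof. by apply: test_mul; exact: smooth_cst. Qed.

Lemma testB n (O : set 'rV[R]_n) u v : test_function O u -> test_function O v ->
  test_function O (fun x => u x - v x).
Proof.
move=> tu tv; rewrite (_ : (fun x => _) = (fun x => u x + (-1) * v x)).
  by apply: testD => //; exact: testZ.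
by apply/funext => x; rewrite mulN1r.
Qed.

Lemma test0 n (O : set 'rV[R]_n) : test_function O (fun=> 0).
Proof.
split; first exact: smooth_cst.
by exists set0; split=> //; exact: compact0.
Qed.

Lemma test_slice n m (O : set 'rV[R]_(n + m)) (B : set 'rV[R]_m) u x :
  (forall y, O (row_mx x y) -> B y) -> test_function O u ->
  test_function B (fun y => u (row_mx x y)).
Proof.
move=> OB [su [K [cK KO uK]]]; split; first exact: smooth_slice.
exists ((fun y => row_mx x y) @^-1` K); split=> [|y /KO /OB//|y /uK//].
apply: bounded_closed_compact.
  have [M [Mr MK]] := compact_bounded cK; exists M; split => // N MN y /= Ky.
  have := MK _ MN _ Ky; apply: le_trans.
  by rewrite -{1}(row_mxKr x y); exact: norm_rsubmx_le.
rewrite -[X in closed (_ @^-1` X)]setCK preimage_setC; apply: open_closedC.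
apply: (@open_comp _ _ (fun y : 'rV[R]_m => row_mx x y) (~` K)).
  by move=> y _; exact: continuous_row_mxr.
by apply: closed_openC; exact: compact_closed_rV.
Qed.

Lemma continuous_support_bounded n (u : 'rV[R]_n -> R) K : compact K -> continuous u ->
  support_in u K -> exists2 M : R, 0 < M & forall x, `|u x| <= M.
Proof.
move=> cK cu uK.
have /compact_bounded [M [_ MA]] : compact (u @` K).
  by apply: continuous_compact => //; exact: continuous_subspaceT.
exists (`|M| + 1); first by rewrite ltr_wpDl.
move=> x; have [Kx|/uK ->] := pselect (K x); last by rewrite normr0 addr_ge0.
by apply: MA; [rewrite ltr_pwDr// ler_norm|exists x].
Qed.

Lemma test_bounded n (O : set 'rV[R]_n) u : test_function O u ->
  exists2 M : R, 0 < M & forall x, `|u x| <= M.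
Proof.
move=> [su [K [cK _ uK]]].
exact: (continuous_support_bounded cK (smooth_continuous su) uK).
Qed.

Lemma test_support_cube n (O : set 'rV[R]_n) u : test_function O u ->
  exists2 M : R, 1 <= M & forall x, M <= `|x| -> u x = 0.
Proof.
move=> [su [K [cK _ uK]]].
have [M M1 KM] := bounded_rV_sub_cube (compact_bounded cK).
exists M => // x Mx; apply: uK => /KM; rewrite /cube/= ltNge.
by rewrite Mx.
Qed.

Lemma smooth_measurable n (u : 'rV[R]_n -> R) D : smooth u -> measurable_fun D u.
Proof.
move=> su; apply: measurable_funTS; apply: continuous_rV_measurable.
exact: smooth_continuous.
Qed.

Lemma smooth_ig_compact n (u : 'rV[R]_n -> R) K : smooth u -> compact K ->
  leb.-integrable K (EFin \o u).
Proof.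
move=> su cK; have mK := compact_rV_measurable cK.
have /compact_bounded [M [_ MA]] : compact (u @` K).
  apply: continuous_compact => //; apply: continuous_subspaceT.
  exact: smooth_continuous.
apply: (@ig_bound _ _ _ _ _ _ (`|M| + 1)) => //.
- exact: leb_compact_fin.
- exact: smooth_measurable.
by move=> x Kx; apply: MA; [rewrite ltr_pwDr// ler_norm|exists x].
Qed.

Lemma smooth_L1loc n (O : set 'rV[R]_n) u : smooth u -> L1loc O u.
Proof. by move=> su K cK _; exact: smooth_ig_compact. Qed.

Lemma L1loc_ig n (O : set 'rV[R]_n) g phi D : measurable D -> L1loc O g ->
  test_function O phi -> leb.-integrable D (EFin \o (fun x => g x * phi x)).
Proof.
move=> mD lg tphi; have [M M0 bM] := test_bounded tphi.
have [sphi [K [cK KO uK]]] := tphi.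
have mK := compact_rV_measurable cK.
have h : leb.-integrable K (EFin \o (fun x => phi x * g x)).
  apply: (ig_mulb (M := M)) => //; first exact: lg.
  exact: smooth_measurable.
apply: (ig_sub_set measurableT) => //.
move/(ig_patch _ _ mK) : h; apply: ig_eq => // x _.
rewrite patchE; case: ifPn => [_|]; first by rewrite mulrC.
by rewrite notin_setE => /uK ->; rewrite mulr0.
Qed.

Lemma Rintegral_support n (O K D : set 'rV[R]_n) (f : 'rV[R]_n -> R) :
  K `<=` O -> K `<=` D -> support_in f K ->
  \int[leb]_(x in O) f x = \int[leb]_(x in D) f x.
Proof.
move=> KO KD fK; rewrite [LHS]Rintegral_mkcond [RHS]Rintegral_mkcond.
congr (Rintegral _ _ _); apply/funext => x; rewrite !patchE.
have [Kx|/fK ->] := pselect (K x); last by rewrite !if_same.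
by rewrite !mem_set//; [exact: KD|exact: KO].
Qed.

Lemma partial_diffquot n (u : 'rV[R]_n -> R) i x (s : nat -> R) : smooth u ->
  (forall k, s k != 0) -> s @ \oo --> 0 ->
  (fun k => (s k)^-1 * (u (s k *: e_ i + x) - u x)) @ \oo --> partial i u x.
Proof.
move=> su s0 sc.
have := @smooth_derivable R n u i x su; rewrite /derivable => dc.
have dc2 : (fun h => h^-1 *: ((u \o shift x) (h *: e_ i) - u x)) @ 0^' --> partial i u x.
  exact: dc.
have sc' : s @ \oo --> (0 : R)^'.
  move=> A /= hA; have h1 : \forall k \near \oo, s k != 0 -> A (s k) by exact: (sc _ hA).
  change (\forall k \near \oo, A (s k)); apply: filterS h1 => k; apply; exact: s0.
exact: (cvg_comp _ _ sc' dc2).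
Qed.

Lemma smooth_line_lipschitz n (u : 'rV[R]_n -> R) i x (t M : R) : smooth u ->
  (forall y, `|partial i u y| <= M) -> 0 <= t -> `|u (t *: e_ i + x) - u x| <= M * t.
Proof.
move=> su uM; rewrite le_eqVlt => /predU1P[<-|t0].
  by rewrite scale0r add0r subrr normr0 mulr0.
have dl (s : R) : is_derive s 1 (fun s : R => u (s *: e_ i + x)) (partial i u (s *: e_ i + x)).
  by apply: is_derive_line; exact: smooth_derivable.
have [|c _] := @MVT R (fun s : R => u (s *: e_ i + x)) (fun s => partial i u (s *: e_ i + x)) 0 t t0 (fun s _ => dl s).
  apply: continuous_subspaceT => s; apply: differentiable_continuous.
  by apply/derivable1_diffP; have [] := dl s.
rewrite scale0r add0r subr0 => ->.
by rewrite normrM (ger0_norm (ltW t0)) ler_wpM2r// ltW.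
Qed.

Lemma ig_shift n (f : 'rV[R]_n -> R) h : leb.-integrable setT (EFin \o f) ->
  leb.-integrable setT (EFin \o (fun x => f (x + h))).
Proof.
move=> /integrableP[mf fi]; have ms : measurable_fun setT (fun x : 'rV[R]_n => x + h).
  apply/measurable_fun_rVP => i.
  rewrite (_ : _ \o _ = (fun x => rV_coord i x + h ord0 i)); last first.
    by apply/funext => x; rewrite /= /rV_coord !mxE.
  by apply: measurable_funD => //; exact: measurable_rV_coord.
apply/integrableP; split; first exact: (measurableT_comp mf ms).
rewrite [ltLHS](_ : _ = \int[leb]_x `|(EFin \o f) x|)%E//.
apply: (@ge0_integral_rV_shift _ _ h (fun x => `|(EFin \o f) x|)%E) => //.
exact: measurableT_comp.
Qed.

Lemma Rintegral_shift n (f : 'rV[R]_n -> R) h : leb.-integrable setT (EFin \o f) ->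
  \int[leb]_x f (x + h) = \int[leb]_x f x.
Proof.
move=> /integrableP[mf fi]; rewrite /Rintegral; congr fine.
rewrite integralE [RHS]integralE; congr (_ - _)%E.
  have E : (\int[leb]_x (EFin \o f)^\+ (x + h)%R = \int[leb]_x (EFin \o f)^\+ x)%E.
    apply: (@ge0_integral_rV_shift R n h ((EFin \o f)^\+)%E); first exact: measurable_funepos.
    by move=> x; exact: funepos_ge0.
  by rewrite -E; apply: eq_integral => x _; rewrite !funeposE.
have E : (\int[leb]_x (EFin \o f)^\- (x + h)%R = \int[leb]_x (EFin \o f)^\- x)%E.
  apply: (@ge0_integral_rV_shift R n h ((EFin \o f)^\-)%E); first exact: measurable_funeneg.
  by move=> x; exact: funeneg_ge0.
by rewrite -E; apply: eq_integral => x _; rewrite !funenegE.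
Qed.

Lemma test_ig n (O : set 'rV[R]_n) u D : measurable D -> test_function O u ->
  leb.-integrable D (EFin \o u).
Proof.
move=> mD tu; have := L1loc_ig mD (smooth_L1loc (O := O) (@smooth_cst R n 1)) tu.
by apply: ig_eq => // x _; rewrite mul1r.
Qed.

(** The difference quotients integrate to zero by translation invariance, and
converge boundedly. *)
Lemma test_integral_partial n (O : set 'rV[R]_n) u i : test_function O u ->
  \int[leb]_x partial i u x = 0.
Proof.
move=> tu; have su := test_smooth tu.
have [M M0 uM] := test_bounded (test_partial i tu).
have [N N1 uN] := test_support_cube tu.
pose s k : R := k.+1%:R^-1.
have s0 k : 0 < s k by rewrite invr_gt0.
have s1 k : s k <= 1 by rewrite invf_le1// ler1n.
pose F k x := (s k)^-1 * (u (s k *: e_ i + x) - u x).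
have iu : leb.-integrable setT (EFin \o u) by exact: test_ig tu.
have iF k : leb.-integrable setT (EFin \o F k).
  apply: ig_scale => //; apply: ig_sub => //.
  have := ig_shift (s k *: e_ i) iu.
  by apply: ig_eq => // x _; rewrite addrC.
have F0 k : (\int[leb]_x (F k x)%:E = 0)%E.
  have iu2 : leb.-integrable setT (EFin \o (fun x => u (s k *: e_ i + x))).
    by have := ig_shift (s k *: e_ i) iu; apply: ig_eq => // x _; rewrite addrC.
  have E : \int[leb]_x F k x = 0.
    rewrite RintegralZl//; last exact: ig_sub.
    rewrite RintegralB// (_ : \int[leb]_x u (s k *: e_ i + x) = \int[leb]_x u x) ?subrr ?mulr0//.
    rewrite -(Rintegral_shift (s k *: e_ i) iu).
    by apply: eq_Rintegral => x _; rewrite addrC.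
  rewrite -(fineK (integrable_fin_num measurableT (iF k))); congr (_%:E).
  exact: E.
have mC := @cube_measurable R n (N + 1).
have fC : (leb (cube n (N + 1) : set 'rV[R]_n) < +oo)%E.
  by rewrite leb_cube ?ltry// ltr_wpDl// (le_trans ler01).
have [] := @dominated_convergence _ _ R leb setT measurableT (fun k => EFin \o F k)
   (EFin \o partial i u) (EFin \o ((fun=> M) \_ (cube n (N + 1)))).
- by move=> k; case/integrableP : (iF k).
- by apply/measurable_EFinP; apply: smooth_measurable; exact: smooth_partial.
- apply: aeW => x _; apply: cvg_EFin; first by apply: nearW.
  apply: partial_diffquot => //; first by move=> k; rewrite gt_eqF.
  exact: cvg_harmonic.
- apply/(ig_patch _ _ mC); exact: ig_cst.
- apply: aeW => x k _ /=; rewrite lee_fin patchE.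
  case: ifPn => [_|].
    rewrite normrM ger0_norm ?invr_ge0; last exact: ltW.
    by rewrite ler_pdivrMl// mulrC smooth_line_lipschitz// ltW.
  rewrite notin_setE/= => /negP; rewrite -leNgt => Nx.
  change (`|F k x| <= 0); rewrite /F (uN x) ?(uN (_ + _)) ?subrr ?mulr0 ?normr0//; last first.
    by rewrite (le_trans _ Nx)// lerDl.
  have h : `|s k *: e_ i : 'rV[R]_n| <= 1.
    rewrite norm_rV_le//; apply/forallP => j; rewrite !mxE eqxx/=.
    case: eqP => _; rewrite ?mulr1 ?mulr0 ?normr0// ger0_norm ?s1// ltW//.
  have := ler_normB (s k *: e_ i + x) (s k *: e_ i); rewrite addrC addKr => h2.
  by rewrite -(lerD2r 1) (le_trans Nx)// (le_trans h2)// lerD2l.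
move=> _ _ h; rewrite /Rintegral.
suff -> : (\int[leb]_x (partial i u x)%:E = 0)%E by [].
apply: (cvg_unique _ h) => //.
rewrite (_ : (fun n => _) = fun=> 0%E); first exact: cvg_cst.
by apply/funext => k; exact: F0.
Qed.

(** Integration by parts is the vanishing of the integral of the partial derivative of the
product of u with a test function. *)
Lemma smooth_weak_gradient n (O : set 'rV[R]_n) u : smooth u ->
  weak_gradient O u (fun x => \row_i partial i u x).
Proof.
move=> su; split; first exact: smooth_L1loc.
  move=> i; rewrite (_ : (fun x => _) = partial i u).
    by apply: smooth_L1loc; exact: smooth_partial.
  by apply/funext => x; rewrite mxE.
move=> phi i tphi; have [sphi [K [cK KO phiK]]] := tphi.
have tp := test_mul su tphi.
have := test_integral_partial i tp; rewrite partialM//.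
have i1 := L1loc_ig measurableT (smooth_L1loc (O := O) su) (test_partial i tphi).
have i2 := L1loc_ig measurableT (smooth_L1loc (O := O) (smooth_partial i su)) tphi.
have E : (fun x => phi x * partial i u x) = (fun x => partial i u x * phi x).
  by apply/funext => x; rewrite mulrC.
rewrite RintegralD//; last by rewrite E.
under [X in _ + X = _]eq_Rintegral do rewrite mulrC.
move=> /eqP; rewrite addr_eq0 => /eqP h.
rewrite (@Rintegral_support _ O K setT)//; last first.
  move=> x Kx; rewrite (@partial_support _ phi K i) ?mulr0//.
  exact: compact_closed_rV.
rewrite h; congr (- _); rewrite [RHS](@Rintegral_support _ O K setT)//.
  by apply: eq_Rintegral => x _; rewrite mxE.
by move=> x /phiK ->; rewrite mulr0.
Qed.

End test_functions.

(** * The fundamental lemma of the calculus of variations *)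

Section ae_tools.
Context d (T : measurableType d) (R : realType) (mu : {measure set T -> \bar R}).

Lemma ae_forall_count (I : countType) (P : I -> T -> Prop) :
  (forall i, {ae mu, forall x, P i x}) -> {ae mu, forall x, forall i, P i x}.
Proof.
move=> h.
have : {ae mu, forall x, forall k : nat, oapp (P ^~ x) True (unpickle k)}.
  apply/ae_foralln => k; case: (unpickle k) => [i|]; first exact: h.
  exact: aeW.
by apply: filterS => x hx i; have := hx (pickle i); rewrite pickleK.
Qed.

Lemma Rdominated_cvg (D : set T) (f_ : (T -> R)^nat) (f g : T -> R) :
  measurable D -> (forall k, measurable_fun D (f_ k)) -> measurable_fun D f ->
  (forall x, D x -> f_ ^~ x @ \oo --> f x) ->
  mu.-integrable D (EFin \o g) -> (forall k x, D x -> `|f_ k x| <= g x) ->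
  (fun k => \int[mu]_(x in D) f_ k x) @ \oo --> \int[mu]_(x in D) f x.
Proof.
move=> mD mf_ mf f_f ig f_g.
have ifk k : mu.-integrable D (EFin \o f_ k) by apply: (ig_dom mD _ ig) => // x /f_g.
have [|||||fi _ h] := @dominated_convergence _ _ R mu D mD (fun k => EFin \o f_ k) (EFin \o f) (EFin \o g).
- by move=> k; exact/measurable_EFinP.
- exact/measurable_EFinP.
- apply: aeW => x Dx; apply: cvg_EFin; first exact: nearW.
  exact: f_f.
- exact: ig.
- by apply: aeW => x k Dx /=; rewrite lee_fin f_g.
have fin := integrable_fin_num mD fi.
by apply: (fine_cvg (a := \int[mu]_(x in D) f x)); rewrite /Rintegral fineK.
Qed.

End ae_tools.

Section boxes.
Context {R : realType}.

Definition obox n (a b : 'rV[R]_n) : set 'rV[R]_n :=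
  [set x | forall i, a ord0 i < x ord0 i < b ord0 i].
Definition cbox n (a b : 'rV[R]_n) : set 'rV[R]_n :=
  [set x | forall i, a ord0 i <= x ord0 i <= b ord0 i].

Lemma obox_measurable n (a b : 'rV[R]_n) : measurable (obox a b).
Proof.
rewrite (_ : obox a b = [set x | forall i, `]a ord0 i, b ord0 i[%classic (x ord0 i)]).
  exact: (measurable_box (D := fun i => `]a ord0 i, b ord0 i[%classic)).
by apply/seteqP; split => x h i; have := h i; rewrite /= in_itv.
Qed.

Lemma cbox_compact n (a b : 'rV[R]_n) : compact (cbox a b).
Proof.
rewrite (_ : cbox a b = [set x | forall i, `[a ord0 i, b ord0 i]%classic (x ord0 i)]).
  apply: (@rV_compact R n (fun i => `[a ord0 i, b ord0 i]%classic)) => i.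
  exact: segment_compact.
by apply/seteqP; split => x h i; have := h i; rewrite /= in_itv.
Qed.

Lemma cbox_measurable n (a b : 'rV[R]_n) : measurable (cbox a b).
Proof. by apply: compact_rV_measurable; exact: cbox_compact. Qed.

Lemma obox_cbox n (a b : 'rV[R]_n) : obox a b `<=` cbox a b.
Proof. by move=> x h i; have /andP[? ?] := h i; rewrite !ltW. Qed.

Lemma oboxI n (a b c d : 'rV[R]_n) : obox a b `&` obox c d =
  obox (\row_i Num.max (a ord0 i) (c ord0 i)) (\row_i Num.min (b ord0 i) (d ord0 i)).
Proof.
apply/seteqP; split => x /=.
  move=> [h1 h2] i; have /andP[? ?] := h1 i; have /andP[? ?] := h2 i.
  by rewrite !mxE gt_max lt_min; do !(apply/andP; split).
move=> h; split=> i; have := h i; rewrite !mxE gt_max lt_min;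
  by move=> /andP[/andP[? ?] /andP[? ?]]; apply/andP; split.
Qed.

(** Open boxes are stable under intersection, so that Dynkin's lemma applies to them. *)
Lemma measurable_gen_obox n :
  @measurable _ 'rV[R]_n = <<s [set A | exists a b, A = @obox n a b] >>.
Proof.
set G := [set A | _].
apply/seteqP; split; last first.
  apply: smallest_sub; first exact: sigma_algebra_measurable.
  by move=> _ [a [b ->]]; exact: obox_measurable.
apply: smallest_sub; first exact: smallest_sigma_algebra.
have hc (i : 'I_n) (Y : set R) : measurable Y -> <<s G >> ((fun x : 'rV[R]_n => x ord0 i) @^-1` Y).
  move=> mY.
  suff : measurable_fun [set: g_sigma_algebraType G] (fun x : g_sigma_algebraType G => (x : 'rV[R]_n) ord0 i).
    by move=> /(_ measurableT _ mY); rewrite setTI.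
  apply: (measurability _ (RGenOpens.measurableE R)) => _ [_ [a [b ->] <-]].
  rewrite setTI.
  rewrite (_ : _ @^-1` _ = \bigcup_k obox (\row_j if j == i then a else - k%:R) (\row_j if j == i then b else k%:R)).
    by apply: bigcupT_measurable => k; apply: sub_sigma_algebra; do 2 eexists.
  apply/seteqP; split => [x|x [k _]]; last first.
    by move=> /(_ i); rewrite !mxE eqxx /= in_itv.
  rewrite /= in_itv/= => xab.
  have [k xk] : exists k : nat, `|x| < k%:R.
    exists (Num.truncn `|x|).+1; exact: truncnS_gt.
  exists k => // j; rewrite !mxE; case: eqP => [->//|_].
  by rewrite -ltr_norml (le_lt_trans (coord_norm_le _ _)).
move=> A; rewrite -bigcup_seq/= => -[i /= _ [Y mY <-]].
by rewrite setTI; exact: hc.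
Qed.

Lemma open_box_cover n (A : set 'rV[R]_n) x0 : open A -> A x0 ->
  exists c d : nat -> 'rV[R]_n,
    (forall k, cbox (c k) (d k) `<=` A) /\
    A = \bigcup_k obox (c k) (d k).
Proof.
move=> oA Ax0.
pose lo (c : 'rV[rat]_n * rat) : 'rV[R]_n := \row_i (ratr (c.1 ord0 i) - ratr c.2).
pose hi (c : 'rV[rat]_n * rat) : 'rV[R]_n := \row_i (ratr (c.1 ord0 i) + ratr c.2).
have hcover x : A x -> exists c, cbox (lo c) (hi c) `<=` A /\ obox (lo c) (hi c) x.
  move=> Ax; have [c [_ xc cA]] := rational_cube oA Ax; exists c; split.
    move=> y yc; apply: cA => i; have := yc i; rewrite !mxE => /andP[? ?].
    by rewrite ler_norml; apply/andP; split; lra.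
  move=> i; have := xc i; rewrite !mxE ltr_norml => /andP[? ?].
  by apply/andP; split; lra.
have [c0 [c0A _]] := hcover _ Ax0.
pose cc k := if unpickle k is Some c then (if `[< cbox (lo c) (hi c) `<=` A >] then c else c0) else c0.
have ccA k : cbox (lo (cc k)) (hi (cc k)) `<=` A.
  by rewrite /cc; case: (unpickle k) => // c; case: asboolP.
exists (lo \o cc), (hi \o cc); split => //.
apply/seteqP; split => [x /hcover[c [cA xc]]|x [k _ /= /obox_cbox]]; last exact: ccA.
by exists (pickle c) => //=; rewrite /cc pickleK; case: asboolP.
Qed.

Lemma L1loc_measurable n (O : set 'rV[R]_n) (f : 'rV[R]_n -> R) : open O -> L1loc O f ->
  measurable_fun O f.
Proof.
move=> oO lf; have [[x0 Ox0]|O0] := pselect (exists x, O x); last first.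
  rewrite (_ : O = set0); first exact: measurable_fun_set0.
  by apply/seteqP; split => x // Ox; apply: O0; exists x.
have [c [d [cdO OE]]] := open_box_cover oO Ox0.
rewrite OE; apply/measurable_fun_bigcup => k; first exact: obox_measurable.
apply: (measurable_funS (E := cbox (c k) (d k))); last 2 first.
- exact: obox_cbox.
- by apply: ig_measurable; apply: lf => //; exact: cbox_compact.
exact: cbox_measurable.
Qed.

(** Smooth approximations from below of the indicator of a box. *)
Definition bump n (a b : 'rV[R]_n) (k : nat) (x : 'rV[R]_n) : R :=
  \prod_i (step (k.+1%:R * x ord0 i + - (k.+1%:R * a ord0 i)) *
           step (- k.+1%:R * x ord0 i + k.+1%:R * b ord0 i)).

Lemma smooth_bump n (a b : 'rV[R]_n) k : smooth (bump a b k).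
Proof.
apply: smooth_prod => i; apply: smoothM.
  apply: (@smooth_elementary _ _ (fun t => step (k.+1%:R * t + - (k.+1%:R * a ord0 i)))).
  exact: elementary_step.
apply: (@smooth_elementary _ _ (fun t => step (- k.+1%:R * t + k.+1%:R * b ord0 i))).
exact: elementary_step.
Qed.

Lemma bump_ge0 n (a b : 'rV[R]_n) k x : 0 <= bump a b k x.
Proof. by apply: prodr_ge0 => i _; rewrite mulr_ge0 ?step_ge0. Qed.

Lemma bump_le1 n (a b : 'rV[R]_n) k x : bump a b k x <= 1.
Proof.
suff /andP[_] : 0 <= bump a b k x <= 1 by [].
rewrite /bump; apply: (big_ind (fun v : R => 0 <= v <= 1)); first by rewrite ler01 lexx.
  by move=> u v /andP[u0 u1] /andP[v0 v1]; rewrite mulr_ge0//= mulr_ile1.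
by move=> i _; rewrite mulr_ge0 ?step_ge0//= mulr_ile1 ?step_ge0 ?step_le1.
Qed.

Lemma bump_out n (a b : 'rV[R]_n) k x : ~ obox a b x -> bump a b k x = 0.
Proof.
move=> /existsNP[i /negP]; rewrite negb_and -!leNgt => h.
apply/eqP/prodf_eq0; exists i => //; rewrite mulf_eq0.
have k0 : 0 < k.+1%:R :> R by [].
case/orP : h => h; apply/orP; [left|right]; apply/eqP/step_le0.
  by rewrite subr_le0 ler_pM2l.
by rewrite mulNr addrC subr_le0 ler_pM2l.
Qed.

Lemma test_bump n (O : set 'rV[R]_n) (a b : 'rV[R]_n) k : cbox a b `<=` O ->
  test_function O (bump a b k).
Proof.
move=> abO; split; first exact: smooth_bump.
exists (cbox a b); split => //; first exact: cbox_compact.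
by move=> x h; apply: bump_out => /obox_cbox.
Qed.

Lemma bump_cvg n (a b x : 'rV[R]_n) : bump a b ^~ x @ \oo --> (\1_(obox a b) x : R).
Proof.
have [xab|xab] := pselect (obox a b x); last first.
  rewrite indicE memNset//= (_ : bump a b ^~ x = fun=> 0); first exact: cvg_cst.
  by apply/funext => k; exact: bump_out.
rewrite indicE mem_set//=.
have h : \forall k \near \oo, forall i, 1 <= k.+1%:R * (x ord0 i - a ord0 i) /\ 1 <= k.+1%:R * (b ord0 i - x ord0 i).
  apply: filter_forall => i; have /andP[h1 h2] := xab i.
  have d1 : 0 < x ord0 i - a ord0 i by rewrite subr_gt0.
  have d2 : 0 < b ord0 i - x ord0 i by rewrite subr_gt0.
  near=> k; split; rewrite -ler_pdivrMr// div1r.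
    near: k; exists (Num.truncn (x ord0 i - a ord0 i)^-1) => // k /= hk.
    by rewrite ltW// (lt_le_trans (truncnS_gt _))// ler_nat ltnS.
  near: k; exists (Num.truncn (b ord0 i - x ord0 i)^-1) => // k /= hk.
  by rewrite ltW// (lt_le_trans (truncnS_gt _))// ler_nat ltnS.
apply: cvg_near_cst; apply: filterS h => k hk.
apply: big1 => i _; have [h1 h2] := hk i.
rewrite (@step_ge1 _ (_ - _)); last by rewrite -mulrBr.
by rewrite mul1r step_ge1// mulNr addrC -mulrBr.
Unshelve. all: by end_near. Qed.

(** The fundamental lemma of the calculus of variations: the integrals over
boxes vanish by approximation, then over all Borel sets by Dynkin's lemma. *)
Lemma fundamental_lemma n (O : set 'rV[R]_n) (g : 'rV[R]_n -> R) : open O -> L1loc O g ->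
  (forall phi, test_function O phi -> \int[leb]_(x in O) (g x * phi x) = 0) ->
  {ae leb, forall x, O x -> g x = 0}.
Proof.
move=> oO lg hg; have [[x0 Ox0]|O0] := pselect (exists x, O x); last first.
  by apply: aeW => x Ox; exfalso; apply: O0; exists x.
have [c [d [cdO OE]]] := open_box_cover oO Ox0.
suff h k : {ae leb, forall x, obox (c k) (d k) x -> g x = 0}.
  have := ae_forall_count h; apply: filterS => x hx.
  by rewrite OE => -[k _]; exact: hx.
have gK : leb.-integrable (cbox (c k) (d k)) (EFin \o g).
  by apply: lg => //; exact: cbox_compact.
have mK := @cbox_measurable n (c k) (d k).
have mB := @obox_measurable n (c k) (d k).
have gB : leb.-integrable (obox (c k) (d k)) (EFin \o g).
  by apply: (ig_sub_set mK) => //; exact: obox_cbox.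
have box0 a b : obox a b `<=` obox (c k) (d k) -> (\int[leb]_(x in obox a b) (g x)%:E = 0)%E.
  move=> abcd; have [[x1 abx1]|ab0] := pselect (exists x, obox a b x); last first.
    rewrite (_ : obox a b = set0) ?integral_set0//.
    by apply/seteqP; split => x // abx; apply: ab0; exists x.
  have mab := @obox_measurable n a b.
  have gab : leb.-integrable (obox a b) (EFin \o g) by apply: (ig_sub_set mB).
  (* a nonempty open box inside another one has its closure inside the closure of the latter: a point that violated a
   bound would yield a point of the small box between the two bounds *)
  have cab : cbox a b `<=` cbox (c k) (d k).
    move=> y yab i; apply/andP; split; rewrite leNgt; apply/negP => hy.
      have /andP[h1 h2] := yab i; have /andP[h3 h4] := abx1 i.
      pose z : 'rV[R]_n := \row_j if j == i then (a ord0 i + Num.min (c k ord0 i) (b ord0 i)) / 2 else x1 ord0 j.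
      have /abcd/(_ i) : obox a b z.
        move=> j; rewrite mxE; case: eqP => [->|_]; last exact: abx1.
        have : a ord0 i < Num.min (c k ord0 i) (b ord0 i).
          by rewrite lt_min (le_lt_trans h1 hy) (lt_trans h3 h4).
        have : Num.min (c k ord0 i) (b ord0 i) <= b ord0 i by rewrite ge_min lexx orbT.
        by move=> ? ?; apply/andP; split; lra.
      rewrite mxE eqxx => /andP[].
      have : Num.min (c k ord0 i) (b ord0 i) <= c k ord0 i by rewrite ge_min lexx.
      lra.
    have /andP[h1 h2] := yab i; have /andP[h3 h4] := abx1 i.
    pose z : 'rV[R]_n := \row_j if j == i then (b ord0 i + Num.max (d k ord0 i) (a ord0 i)) / 2 else x1 ord0 j.
    have /abcd/(_ i) : obox a b z.
      move=> j; rewrite mxE; case: eqP => [->|_]; last exact: abx1.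
      have : Num.max (d k ord0 i) (a ord0 i) < b ord0 i.
        by rewrite gt_max (lt_le_trans hy h2) (lt_trans h3 h4).
      have : a ord0 i <= Num.max (d k ord0 i) (a ord0 i) by rewrite le_max lexx orbT.
      by move=> ? ?; apply/andP; split; lra.
    rewrite mxE eqxx => /andP[_].
    have : d k ord0 i <= Num.max (d k ord0 i) (a ord0 i) by rewrite le_max lexx.
    lra.
  have h0 j : \int[leb]_(x in cbox (c k) (d k)) (bump a b j x * g x) = 0.
    have tb : test_function O (bump a b j) by apply: test_bump => x /cab /cdO.
    rewrite -(hg _ tb) (@Rintegral_support _ _ _ (obox a b) O); last 3 first.
    - exact: subset_trans abcd (@obox_cbox _ _ _).
    - by move=> x /abcd /obox_cbox /cdO.
    - by move=> x /bump_out ->; rewrite mul0r.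
    by apply: eq_Rintegral => x _; rewrite mulrC.
  have mg : measurable_fun (cbox (c k) (d k)) g by exact: ig_measurable gK.
  have H : (fun j => \int[leb]_(x in cbox (c k) (d k)) (bump a b j x * g x)) @ \oo -->
      \int[leb]_(x in cbox (c k) (d k)) (\1_(obox a b) x * g x).
    apply: (Rdominated_cvg (g := fun x => `|g x|)) => //.
    - move=> j; apply: measurable_funM => //; apply: smooth_measurable; exact: smooth_bump.
    - by apply: measurable_funM => //; exact: measurable_indic.
    - by move=> x _; apply: cvgM; [exact: bump_cvg|exact: cvg_cst].
    - exact: ig_abs.
    - move=> j x _; rewrite normrM ler_piMl// ger0_norm ?bump_ge0//.
      exact: bump_le1.
  have {}H : \int[leb]_(x in cbox (c k) (d k)) (\1_(obox a b) x * g x) = 0.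
    move: H; rewrite (_ : (fun j => _) = fun=> 0); last exact/funext.
    by move=> /cvg_unique; apply => //; exact: cvg_cst.
  rewrite -[LHS]fineK; last exact: integrable_fin_num gab.
  congr (_%:E); rewrite -[RHS]H [RHS]Rintegral_mkcond -[LHS]/(Rintegral leb (obox a b) g).
  rewrite [LHS]Rintegral_mkcond; congr Rintegral; apply/funext => x; rewrite !patchE.
  have [abx|abx] := pselect (obox a b x).
    rewrite mem_set// mem_set ?indicE ?mem_set ?mul1r//.
    exact/obox_cbox/abcd.
  by rewrite (memNset abx) indicE (memNset abx) mul0r if_same.
have all0 : forall S, measurable S -> (\int[leb]_(x in S `&` obox (c k) (d k)) (g x)%:E = 0)%E.
  rewrite measurable_gen_obox.
  apply: (@dynkin_induction _ 'rV[R]_n _ _ (measurable_gen_obox n)).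
  - by move=> _ _ [a [b ->]] [a' [b' ->]]; rewrite oboxI; do 2 eexists.
  - by rewrite setTI; apply: box0.
  - by move=> _ [a [b ->]]; rewrite oboxI; apply: box0; rewrite -oboxI; exact: subIsetr.
  - move=> S mS S0.
    have := box0 _ _ (@subset_refl _ (obox (c k) (d k))).
    rewrite -{1}(setTI (obox (c k) (d k))) -(setUv S) setIUl.
    rewrite (integral_setU leb); last 4 first.
    + exact: measurableI.
    + by apply: measurableI => //; exact: measurableC.
    + apply/measurable_EFinP; apply: measurable_funS (ig_measurable gB) => //.
      by rewrite -setIUl; exact: subIsetr.
    + by apply/disj_setPS => x [[? _] [? _]].
    by rewrite S0 add0e.
  - move=> F mF tF F0.
    rewrite setI_bigcupl integral_bigcup//.
    + by apply: eseries0 => i _ _; exact: F0.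
    + by apply: trivIset_setIr.
    + by move=> i; exact: measurableI.
    + apply: (ig_sub_set mB) => //; last by rewrite -setI_bigcupl; exact: subIsetr.
      by apply: bigcupT_measurable => i; exact: measurableI.
have := @integral_ae_eq _ _ _ leb (obox (c k) (d k)) mB (cst 0%E) (EFin \o g) gB (measurable_cst _).
have h E : E `<=` obox (c k) (d k) -> measurable E ->
    (\int[leb]_(x in E) (EFin \o g) x = \int[leb]_(x in E) cst 0 x)%E.
  move=> EB mE; rewrite integral0 -[RHS](all0 E mE) (setIidl EB)//.
move=> /(_ h); apply: filterS => x hx Bx; have := hx Bx; by case.
Qed.

End boxes.

(** * Sobolev functions *)

Section sobolev.
Context {R : realType}.

Definition dgrad n (u : 'rV[R]_n -> R) (x : 'rV[R]_n) : 'rV[R]_n := \row_i partial i u x.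

Lemma dgradE n (u : 'rV[R]_n -> R) x i : dgrad u x ord0 i = partial i u x.
Proof. by rewrite mxE. Qed.

Lemma rV_eqP n (x y : 'rV[R]_n) : x = y <-> forall i, x ord0 i = y ord0 i.
Proof. by split=> [->//|h]; apply/rowP => i; exact: h. Qed.

Lemma L1locB n (O : set 'rV[R]_n) f g : L1loc O f -> L1loc O g -> L1loc O (fun x => f x - g x).
Proof.
move=> lf lg K cK KO; apply: ig_sub; [exact: compact_rV_measurable|exact: lf|exact: lg].
Qed.

Lemma L1locZ n (O : set 'rV[R]_n) f c : L1loc O f -> L1loc O (fun x => c * f x).
Proof.
move=> lf K cK KO; apply: ig_scale; [exact: compact_rV_measurable|exact: lf].
Qed.

Lemma L1locD n (O : set 'rV[R]_n) f g : L1loc O f -> L1loc O g -> L1loc O (fun x => f x + g x).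
Proof.
move=> lf lg K cK KO; apply: ig_add; [exact: compact_rV_measurable|exact: lf|exact: lg].
Qed.

Lemma weak_gradient_unique n (O : set 'rV[R]_n) u g h : open O ->
  weak_gradient O u g -> weak_gradient O u h -> {ae leb, forall x, O x -> g x = h x}.
Proof.
move=> oO [lu lg wg] [_ lh wh]; have mO := open_rV_measurable oO.
have H i : {ae leb, forall x, O x -> g x ord0 i - h x ord0 i = 0}.
  apply: (fundamental_lemma (g := fun x => g x ord0 i - h x ord0 i)) => //.
    exact: L1locB.
  move=> phi tphi; under eq_Rintegral do rewrite mulrBl.
  rewrite RintegralB//; try exact: (L1loc_ig (O := O)).
  apply/eqP; rewrite subr_eq0 -eqr_opp; apply/eqP.
  by rewrite -wg// -wh.
have := ae_forall_count H; apply: filterS => x hx Ox.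
by apply/rV_eqP => i; apply/eqP; rewrite -subr_eq0; apply/eqP; exact: hx.
Qed.

Lemma grad_weak n (O : set 'rV[R]_n) u g : weak_gradient O u g -> weak_gradient O u (grad O u).
Proof. by move=> wg; apply: (xgetPex (fun=> 0)); exists g. Qed.

Lemma grad_ae n (O : set 'rV[R]_n) u g : open O -> weak_gradient O u g ->
  {ae leb, forall x, O x -> grad O u x = g x}.
Proof. by move=> oO wg; apply: (weak_gradient_unique oO _ wg); exact: grad_weak wg. Qed.

Lemma weak_gradient_lin n (O : set 'rV[R]_n) u v g h (a : R) : measurable O ->
  weak_gradient O u g -> weak_gradient O v h ->
  weak_gradient O (fun x => a * u x + v x) (fun x => a *: g x + h x).
Proof.
move=> mO [lu lg wg] [lv lh wh]; split.
- by apply: L1locD => //; exact: L1locZ.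
- move=> i; rewrite (_ : (fun x => _) = (fun x => a * g x ord0 i + h x ord0 i)).
    by apply: L1locD; [apply: L1locZ|]; [exact: lg|exact: lh].
  by apply/funext => x; rewrite !mxE.
- move=> phi i tphi; have tp := test_partial i tphi.
  have := wg _ i tphi; have := wh _ i tphi.
  under [X in _ -> _ -> X = _]eq_Rintegral do rewrite mulrDl -mulrA.
  under [X in _ -> _ -> _ = - X]eq_Rintegral do rewrite !mxE mulrDl -mulrA.
  have i1 := L1loc_ig mO lu tp. have i2 := L1loc_ig mO lv tp.
  have i3 := L1loc_ig mO (lg i) tphi. have i4 := L1loc_ig mO (lh i) tphi.
  rewrite !RintegralD//; try exact: ig_scale.
  rewrite !RintegralZl// => -> ->; ring.
Qed.

Lemma weak_gradient_sub n (U O : set 'rV[R]_n) u g : U `<=` O ->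
  weak_gradient O u g -> weak_gradient U u g.
Proof.
move=> UO [lu lg wg]; split.
- by move=> K cK KU; apply: lu => // x /KU /UO.
- by move=> i K cK KU; apply: lg => // x /KU /UO.
move=> phi i tphi; have [sphi [K [cK KU phiK]]] := tphi.
have := wg _ i (test_sub UO tphi).
have KO := subset_trans KU UO.
rewrite -(@Rintegral_support _ _ U K O)//; last first.
  move=> x Kx; rewrite (@partial_support _ _ phi K i) ?mulr0//.
  exact: compact_closed_rV.
rewrite -(@Rintegral_support _ _ U K O)//.
by move=> x /phiK ->; rewrite mulr0.
Qed.

Lemma weak_gradient_eq n (O : set 'rV[R]_n) u v g : (forall x, O x -> u x = v x) ->
  weak_gradient O u g -> weak_gradient O v g.
Proof.
move=> uv [lu lg wg]; split => //.
  move=> K cK KO; apply: (ig_eq (f := u)); [exact: compact_rV_measurable| |exact: lu].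
  by move=> x /[!inE] Kx; apply: uv; exact: KO.
move=> phi i tphi; rewrite -wg//; apply: eq_Rintegral => x /[!inE] Ox.
by rewrite uv.
Qed.

Section powers.
Variable p : R.
Hypothesis p1 : 1 < p.
Let p0 : 0 < p. Proof. exact: lt_trans p1. Qed.

Lemma measurable_normpow n (O : set 'rV[R]_n) (u : 'rV[R]_n -> R) : measurable O -> measurable_fun O u ->
  measurable_fun O (fun x => `|u x| `^ p).
Proof.
move=> mO mu; apply: (measurableT_comp (measurable_powR p)).
exact: measurableT_comp.
Qed.

Lemma Lp_normE n (O : set 'rV[R]_n) u : measurable O ->
  Lp_norm p O u = ((\int[leb]_(x in O) (`|u x| `^ p)%:E) `^ p^-1)%E.
Proof.
move=> mO; rewrite /Lp_norm unlock; congr (_ `^ _)%E.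
rewrite [RHS]integral_mkcond; apply: eq_integral => x _.
rewrite /= !patchE; case: ifP => _ //=.
by rewrite normr0 powR0// gt_eqF.
Qed.

(** Finiteness of the extended norm, rephrased as integrability of the p-th power, the form that all the
estimates use. *)
Lemma LpP n (O : set 'rV[R]_n) u : measurable O ->
  Lp p O u <-> measurable_fun O u /\ leb.-integrable O (EFin \o (fun x => `|u x| `^ p)).
Proof.
move=> mO; rewrite /Lp.
have E : (Lp_norm p O u < +oo)%E <-> (\int[leb]_(x in O) (`|u x| `^ p)%:E < +oo)%E.
  rewrite Lp_normE//; split=> [|h]; last exact: poweR_lty.
  by apply: contraTT; rewrite -!leNgt !leye_eq => /eqP ->; rewrite poweRyr// invr_eq0 gt_eqF.
split=> [|[mu iu]].
  move=> /andP[h1 h2]; rewrite !inE/= in h1 h2.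
  have mu : measurable_fun O u.
    exact/(measurable_restrictT _ mO).
  split=> //; apply/integrableP; split.
    by apply/measurable_EFinP; exact: measurable_normpow.
  under eq_integral do rewrite /= ger0_norm ?powR_ge0//.
  exact/E.
apply/andP; split; rewrite inE /=.
  exact/(measurable_restrictT _ mO).
rewrite /finite_norm; apply/E; case/integrableP : iu => _.
by under eq_integral do rewrite /= ger0_norm ?powR_ge0//.
Qed.

End powers.
End sobolev.

(** * Approximation by test functions *)

Section approximation.
Context {R : realType}.
Local Notation ig D f := (leb.-integrable D (EFin \o f)).

Lemma norm_le_enorm n (x : 'rV[R]_n) : `|x| <= enorm x.
Proof.
rewrite norm_rV_le ?sqrtr_ge0//; apply/forallP => i.
rewrite -sqrtr_sqr ler_wsqrtr// (bigD1 i)//= lerDl.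
by apply: sumr_ge0 => j _; exact: sqr_ge0.
Qed.

Lemma enorm_le n (x : 'rV[R]_n) : enorm x <= n%:R * `|x|.
Proof.
rewrite -[leRHS]ger0_norm ?mulr_ge0// -sqrtr_sqr ler_wsqrtr//.
apply: (@le_trans _ _ (\sum_(i < n) `|x| ^+ 2)).
  apply: ler_sum => i _; rewrite -real_normK ?num_real// lerXn2r ?nnegrE//.
  exact: coord_norm_le.
rewrite sumr_const card_ord -[leLHS]mulr_natl exprMn; apply: ler_wpM2r; first exact: sqr_ge0.
by rewrite -natrX ler_nat; case: n {x} => // n; rewrite leq_pmulr.
Qed.

Lemma enorm_ge0 n (x : 'rV[R]_n) : 0 <= enorm x.
Proof. exact: sqrtr_ge0. Qed.

Lemma measurable_fun_rV n d (T : measurableType d) (D : set T) (f : T -> 'rV[R]_n) :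
  measurable D -> (forall i, measurable_fun D (fun x => f x ord0 i)) -> measurable_fun D f.
Proof.
move=> mD mf; pose f' x := if x \in D then f x else 0.
have mf' : measurable_fun setT f'.
  apply/measurable_fun_rVP => i.
  have := mf i; move/(measurable_restrictT _ mD); apply: eq_measurable_fun => x _.
  by rewrite patchE /= /f' /rV_coord; case: ifP => // _; rewrite mxE.
apply: (eq_measurable_fun f'); last exact: measurable_funTS.
by move=> x xD; rewrite /f' xD.
Qed.

Lemma measurable_fun_coord n d (T : measurableType d) (D : set T) (f : T -> 'rV[R]_n) i :
  measurable_fun D f -> measurable_fun D (fun x => f x ord0 i).
Proof. by move=> mf; apply: (measurableT_comp (@measurable_rV_coord R n i)). Qed.

Lemma measurable_norm_rV n : measurable_fun setT (fun x : 'rV[R]_n => `|x|).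
Proof. by apply: continuous_rV_measurable; exact: norm_continuous. Qed.

Lemma measurable_enorm n : measurable_fun setT (@enorm R n).
Proof.
have h := continuous_measurable_fun (@sqrt_continuous R).
rewrite /enorm; apply: (measurableT_comp h).
apply: measurable_sum => i; apply: measurable_funX.
exact: measurable_rV_coord.
Qed.

Lemma norm_rV_pow_le_sum n p (x : 'rV[R]_n) : 0 < p ->
  `|x| `^ p <= \sum_i `|x ord0 i| `^ p.
Proof.
move=> p0; have s0 : 0 <= \sum_i `|x ord0 i| `^ p by apply: sumr_ge0 => *; exact: powR_ge0.
have [->|x0] := eqVneq `|x| 0; first by rewrite powR0// gt_eqF.
have [[j i] /= xi] := @mx_norm_neq0 _ _ _ x x0; rewrite ord1 in xi.
have -> : `|x| = `|x ord0 i| by exact: xi.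
by rewrite (bigD1 i)//= lerDl; apply: sumr_ge0 => *; exact: powR_ge0.
Qed.

Lemma measurable_dgrad n (u : 'rV[R]_n -> R) D : measurable D -> smooth u ->
  measurable_fun D (dgrad u).
Proof.
move=> mD su; apply: measurable_fun_rV => // i.
under eq_fun do rewrite dgradE.
by apply: smooth_measurable; exact: smooth_partial.
Qed.

Lemma dgradB n (u v : 'rV[R]_n -> R) x : smooth u -> smooth v ->
  dgrad (fun x => u x - v x) x = dgrad u x - dgrad v x.
Proof. by move=> su sv; apply/rowP => i; rewrite !mxE partialB. Qed.

Section powers.
Variable p : R.
Hypothesis p1 : 1 < p.
Let p0 : 0 < p. Proof. exact: lt_trans p1. Qed.
Let p00 : 0 <= p. Proof. exact: ltW. Qed.

Lemma ig_pow_comp d (T : measurableType d) (mu : {measure set T -> \bar R}) D (f : T -> R) (g : T -> R) c :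
  measurable D -> measurable_fun D f -> mu.-integrable D (EFin \o g) ->
  (forall x, D x -> `|f x| `^ p <= c * g x) ->
  mu.-integrable D (EFin \o (fun x => `|f x| `^ p)).
Proof.
move=> mD mf ig fg; apply: (ig_dom (g := fun x => c * g x)) => //.
- apply: (measurableT_comp (measurable_powR p)); exact: measurableT_comp.
- exact: ig_scale.
by move=> x Dx; rewrite ger0_norm ?powR_ge0// fg.
Qed.

Lemma Lp_norm_le n (O : set 'rV[R]_n) u c : measurable O -> 0 <= c ->
  (\int[leb]_(x in O) (`|u x| `^ p)%:E <= (c `^ p)%:E)%E -> (Lp_norm p O u <= c%:E)%E.
Proof.
move=> mO c0 h; rewrite Lp_normE//.
apply: (@le_trans _ _ ((c `^ p)%:E `^ p^-1)%E).
  apply: gt0_ler_poweR => //; rewrite ?invr_ge0//.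
  + rewrite in_itv/= leey andbT; apply: integral_ge0 => x _; rewrite lee_fin powR_ge0//.
  + by rewrite in_itv/= leey andbT lee_fin powR_ge0.
by rewrite poweR_EFin -powRrM divff ?gt_eqF// powRr1.
Qed.

Lemma Lp_norm_ge n (O : set 'rV[R]_n) u c : measurable O -> 0 <= c ->
  (Lp_norm p O u <= c%:E)%E -> (\int[leb]_(x in O) (`|u x| `^ p)%:E <= (c `^ p)%:E)%E.
Proof.
move=> mO c0; rewrite Lp_normE//.
set I := (\int[leb]_(x in O) _)%E.
have I0 : (0 <= I)%E by apply: integral_ge0 => x _; rewrite lee_fin powR_ge0.
move=> h; have : ((I `^ p^-1) `^ p <= c%:E `^ p)%E.
  apply: gt0_ler_poweR => //; rewrite ?in_itv/= ?leey ?andbT ?poweR_ge0//.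
by rewrite -poweRrM mulVf ?gt_eqF// poweRe1// poweR_EFin.
Qed.

Lemma Rint_le d (T : measurableType d) (mu : {measure set T -> \bar R}) D (f : T -> R) c :
  measurable D -> mu.-integrable D (EFin \o f) ->
  (\int[mu]_(x in D) (f x)%:E <= c%:E)%E <-> \int[mu]_(x in D) f x <= c.
Proof.
move=> mD hf; have h := integrable_fin_num mD hf.
by rewrite -[X in (X <= _)%E]fineK// lee_fin.
Qed.

Lemma Lp_L1loc n (O : set 'rV[R]_n) u : open O -> Lp p O u -> L1loc O u.
Proof.
move=> oO /(LpP p1 _ (open_rV_measurable oO))[mu iu] K cK KO.
have mK := compact_rV_measurable cK; have mO := open_rV_measurable oO.
have mKu : measurable_fun K u by apply: measurable_funS mu.
apply: (ig_dom (g := fun x => 1 + `|u x| `^ p)) => //.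
  apply: ig_add => //; first by apply: ig_cst => //; exact: leb_compact_fin.
  exact: (ig_sub_set mO).
move=> x _; have := le_small_powR (ltW p1) (normr_ge0 (u x)) (@ltr01 R).
by rewrite powR1 mul1r.
Qed.

Lemma Lp_sub n (U O : set 'rV[R]_n) u : measurable U -> measurable O -> U `<=` O ->
  Lp p O u -> Lp p U u.
Proof.
move=> mU mO UO /(LpP p1 _ mO)[mu iu]; apply/(LpP p1 _ mU); split.
  exact: measurable_funS mu.
exact: (ig_sub_set mO).
Qed.

Lemma Lp_ae n (O : set 'rV[R]_n) u v : measurable O -> measurable_fun O v ->
  {ae leb, forall x, O x -> u x = v x} -> Lp p O u -> Lp p O v.
Proof.
move=> mO mv uv /(LpP p1 _ mO)[mu iu]; apply/(LpP p1 _ mO); split => //.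
apply: ae_ig iu => //; first exact: measurable_normpow.
by apply: filterS uv => x h /h ->.
Qed.

Lemma ig_norm_rV_pow n (O : set 'rV[R]_n) (g : 'rV[R]_n -> 'rV[R]_n) : measurable O ->
  (forall i, Lp p O (fun x => g x ord0 i)) <->
  measurable_fun O g /\ ig O (fun x => `|g x| `^ p).
Proof.
move=> mO; split=> [h|[mg ig] i].
  have mg : measurable_fun O g.
    by apply: measurable_fun_rV => // i; have /(LpP p1 _ mO)[] := h i.
  have mng : measurable_fun O (fun x => `|g x|) by exact: (measurableT_comp (@measurable_norm_rV n)).
  have H i : ig O (fun x => `|g x ord0 i| `^ p) by have /(LpP p1 _ mO)[] := h i.
  split=> //; apply: (ig_dom (g := fun x => \sum_(i < n) `|g x ord0 i| `^ p)) => //.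
  - exact: (measurableT_comp (measurable_powR p)).
  - by have [] := Rintegral_sum (index_enum _) mO H.
  - by move=> x _; rewrite ger0_norm ?powR_ge0// norm_rV_pow_le_sum.
apply/(LpP p1 _ mO); split; first exact: measurable_fun_coord.
apply: (ig_pow_comp (g := fun x => `|g x| `^ p) (c := 1)) => //.
  exact: measurable_fun_coord.
move=> x _; rewrite mul1r; apply: powR_mono => //; exact: coord_norm_le.
Qed.

Lemma W1p_sub n (U O : set 'rV[R]_n) u : open U -> open O -> U `<=` O ->
  W1p p O u -> W1p p U u /\ {ae leb, forall x, U x -> grad U u x = grad O u x}.
Proof.
move=> oU oO UO [Lu [g wg] Lg].
have mO := open_rV_measurable oO; have mU := open_rV_measurable oU.
have wO := grad_weak wg; have wU := weak_gradient_sub UO wO.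
have ae := grad_ae oU wU; split => //; split; first exact: Lp_sub Lu.
  by exists (grad O u).
move=> i; apply: (@Lp_ae _ _ (fun x => grad O u x ord0 i)) => //.
- by apply: L1loc_measurable => //; have [_ + _] := grad_weak wU; apply.
- by apply: filterS ae => x h /h ->.
exact: (Lp_sub mU mO UO (Lg i)).
Qed.

(** By uniqueness the chosen gradient agrees almost everywhere with any other weak gradient. *)
Lemma W1p_weak n (O : set 'rV[R]_n) u (g : 'rV[R]_n -> 'rV[R]_n) : open O -> Lp p O u -> weak_gradient O u g ->
  (forall i, Lp p O (fun x => g x ord0 i)) -> W1p p O u.
Proof.
move=> oO Lu wg Lg; split=> //; first by exists g.
have mO := open_rV_measurable oO.
move=> i; apply: (@Lp_ae _ _ (fun x => g x ord0 i)) => //.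
  by apply: L1loc_measurable => //; have [_ + _] := grad_weak wg; apply.
by apply: filterS (grad_ae oO wg) => x h /h ->.
Qed.

Lemma W1p_grad n (O : set 'rV[R]_n) u : open O -> W1p p O u ->
  [/\ measurable_fun O u, ig O (fun x => `|u x| `^ p),
      measurable_fun O (grad O u), ig O (fun x => `|grad O u x| `^ p)
    & weak_gradient O u (grad O u)].
Proof.
move=> oO [Lu [g wg] Lg]; have mO := open_rV_measurable oO.
have /(LpP p1 _ mO)[? ?] := Lu; have [? ?] := (ig_norm_rV_pow (grad O u) mO).1 Lg.
by split => //; exact: grad_weak wg.
Qed.

Lemma test_Lp n (O D : set 'rV[R]_n) u : measurable D -> test_function O u -> Lp p D u.
Proof.
move=> mD tu; apply/(LpP p1 _ mD); split; first by apply: smooth_measurable; exact: test_smooth tu.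
have [M M0 uM] := test_bounded tu; have iu := ig_abs mD (test_ig mD tu).
apply: (ig_pow_comp (g := fun x => `|u x|) (c := M `^ (p - 1))) => //.
  by apply: smooth_measurable; exact: test_smooth tu.
move=> x _; rewrite -mulr_powRB1// mulrC ler_wpM2r//.
by apply: powR_mono => //; rewrite subr_ge0 ltW.
Qed.

Lemma test_W1p n (O : set 'rV[R]_n) u : open O -> test_function O u ->
  W1p p O u /\ {ae leb, forall x, O x -> grad O u x = dgrad u x}.
Proof.
move=> oO tu; have mO := open_rV_measurable oO.
have wg := smooth_weak_gradient O (test_smooth tu).
split; last exact: grad_ae.
apply: (W1p_weak oO _ wg); first exact: test_Lp tu.
by move=> i; under eq_fun do rewrite mxE; apply: test_Lp (test_partial i tu).
Qed.

(** Closeness in W^{1,p}, with a prescribed candidate g in the place of the weak gradient of u: this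
form also makes sense before u is known to have a weak gradient. *)
Definition approx_test n (O : set 'rV[R]_n) (u : 'rV[R]_n -> R) (g : 'rV[R]_n -> 'rV[R]_n) (e : R) (phi : 'rV[R]_n -> R) :=
  [/\ test_function O phi, \int[leb]_(x in O) (`|phi x - u x| `^ p) <= e &
      \int[leb]_(x in O) (`|dgrad phi x - g x| `^ p) <= e].

Lemma ig_powB n (O : set 'rV[R]_n) u v : measurable O -> Lp p O u -> Lp p O v ->
  ig O (fun x => `|u x - v x| `^ p).
Proof.
move=> mO /(LpP p1 _ mO)[mu iu] /(LpP p1 _ mO)[mv iv].
apply: (ig_pow_comp (g := fun x => `|u x| `^ p + `|v x| `^ p) (c := 2 `^ p)) => //.
- exact: measurable_funB.
- exact: ig_add.
by move=> x _; apply: powR_le_add => //; exact: ler_normB.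
Qed.

Lemma ig_powB_rV n (O : set 'rV[R]_n) (g h : 'rV[R]_n -> 'rV[R]_n) : measurable O ->
  (forall i, Lp p O (fun x => g x ord0 i)) -> (forall i, Lp p O (fun x => h x ord0 i)) ->
  measurable_fun O (fun x => g x - h x) /\ ig O (fun x => `|g x - h x| `^ p).
Proof.
move=> mO Lg Lh; apply/(ig_norm_rV_pow (fun x => g x - h x) mO) => i.
have /(LpP p1 _ mO)[mg _] := Lg i; have /(LpP p1 _ mO)[mh _] := Lh i.
under eq_fun do rewrite !mxE.
apply/(LpP p1 _ mO); split; first exact: measurable_funB.
exact: ig_powB.
Qed.

Lemma W01p_approx n (O : set 'rV[R]_n) u (e : R) : open O -> W01p p O u -> 0 < e ->
  exists phi, approx_test O u (grad O u) e phi.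
Proof.
move=> oO [Wu [phi [tphi cphi]]] e0; have mO := open_rV_measurable oO.
have [Lu [g0 wg0] Lg] := Wu; have wg := grad_weak wg0.
pose c := e `^ p^-1; have c0 : 0 < c by rewrite powR_gt0.
have ce : c `^ p = e by rewrite /c -powRrM mulVf ?gt_eqF// powRr1// ltW.
have [j hj] : exists j, (W1p_norm p O (phi j \- u)%R <= c%:E)%E.
  have : \forall j \near \oo, (W1p_norm p O (phi j \- u)%R < c%:E)%E.
    apply: (cphi [set x | (x < c%:E)%E]); apply: open_nbhs_nbhs.
    by split; [exact: open_ereal_lt_ereal|rewrite /= lte_fin].
  by move=> [N _ h]; exists N; apply: ltW; apply: (h N) => /=.
have sphi := test_smooth (tphi j).
have Lphi := test_Lp mO (tphi j).
have Ldphi i : Lp p O (fun x => dgrad (phi j) x ord0 i).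
  by under eq_fun do rewrite mxE; apply: test_Lp (test_partial i (tphi j)).
exists (phi j); split => //.
  apply/(Rint_le _ mO); first exact: ig_powB.
  rewrite -ce; apply: Lp_norm_ge => //; first exact: ltW.
  by apply: le_trans hj; rewrite leeDl// Lnorm_ge0.
have [mgB igB] := ig_powB_rV mO Ldphi Lg.
apply/(Rint_le _ mO) => //.
have h2 : (Lp_norm p O (fun x => enorm (grad O (phi j \- u)%R x)) <= c%:E)%E.
  by apply: le_trans hj; rewrite leeDr// Lnorm_ge0.
have {}h2 := Lp_norm_ge mO (ltW c0) h2; rewrite ce in h2; apply: le_trans h2.
have wB : weak_gradient O (phi j \- u) (fun x => dgrad (phi j) x - grad O u x).
  have := weak_gradient_lin (-1) mO wg (smooth_weak_gradient O sphi).
  rewrite (_ : (fun x => -1 * u x + _) = phi j \- u); last first.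
    by apply/funext => x; rewrite mulN1r addrC.
  by under [in X in X -> _]eq_fun do rewrite scaleN1r addrC.
have aeB := grad_ae oO wB; have wB' := grad_weak wB.
have mgr : measurable_fun O (grad O (phi j \- u)).
  apply: measurable_fun_rV => // i; apply: L1loc_measurable => //.
  by have [_ + _] := wB'; apply.
apply: (@le_trans _ _ (\int[leb]_(x in O) (`|grad O (phi j \- u)%R x| `^ p)%:E)%E).
  rewrite le_eqVlt; apply/orP; left; apply/eqP.
  apply: ae_eq_integral => //.
  - by apply/measurable_EFinP; exact: ig_measurable igB.
  - apply/measurable_EFinP; apply: (measurableT_comp (measurable_powR p)).
    exact: (measurableT_comp (@measurable_norm_rV n)).
  - by apply: filterS aeB => x h /h ->.
apply: ge0_le_integral => //.
- apply/measurable_EFinP; apply: (measurableT_comp (measurable_powR p)).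
  exact: (measurableT_comp (@measurable_norm_rV n)).
- apply/measurable_EFinP; apply: (measurableT_comp (measurable_powR p)).
  by apply: measurableT_comp => //; exact: (measurableT_comp (@measurable_enorm n)).
- move=> x _; rewrite lee_fin; apply: powR_mono => //.
  by rewrite ger0_norm ?enorm_ge0// norm_le_enorm.
Qed.

(** The estimate that lets the two sides of the definition of a weak gradient pass to the limit. *)
Lemma Lp_test_pairing n (O K : set 'rV[R]_n) v psi (M d : R) : open O -> Lp p O v ->
  test_function O psi -> compact K -> support_in psi K -> (forall x, `|psi x| <= M) -> 0 < d ->
  \int[leb]_(x in O) (`|v x| `^ p) <= d `^ p ->
  `|\int[leb]_(x in O) (v x * psi x)| <= M * (fine (leb K) + 1) * d.
Proof.
move=> oO Lv tpsi cK psiK psiM d0 hd; have mO := open_rV_measurable oO.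
have mK := compact_rV_measurable cK; have /(LpP p1 _ mO)[mv iv] := Lv.
have M0 : 0 <= M by exact: le_trans (normr_ge0 _) (psiM 0).
have Kfin : leb K \is a fin_num by rewrite ge0_fin_numE// leb_compact_fin.
have i1 := L1loc_ig mO (Lp_L1loc oO Lv) tpsi.
have i2 : ig O (fun x => \1_K x : R).
  apply: (ig_sub_set measurableT) => //; apply/integrableP; split.
    by apply/measurable_EFinP; exact: measurable_indic.
  under eq_integral do rewrite /= ger0_norm//.
  by rewrite integral_indic// setIT -ge0_fin_numE.
apply: le_trans (le_normr_Rintegral mO i1) _.
have i3 : ig O (fun x => d * \1_K x + d `^ (1 - p) * `|v x| `^ p).
  by apply: ig_add => //; exact: ig_scale.
apply: (@le_trans _ _ (\int[leb]_(x in O) (M * (d * \1_K x + d `^ (1 - p) * `|v x| `^ p)))).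
  apply: le_Rintegral => //; [exact: ig_abs|exact: ig_scale|].
  move=> x Ox; rewrite normrM mulrC.
  have [Kx|Kx] := pselect (K x); last first.
    by rewrite (psiK _ Kx) normr0 mul0r mulr_ge0// addr_ge0// mulr_ge0 ?powR_ge0// ltW.
  rewrite indicE mem_set// mulr1; apply: ler_pM => //.
  exact: (le_small_powR (ltW p1)).
rewrite RintegralZl// -mulrA ler_wpM2l//.
rewrite RintegralD//; try exact: ig_scale.
rewrite !RintegralZl// mulrDl mul1r; apply: lerD.
  have -> : \int[leb]_(x in O) (\1_K x : R) = fine (leb (K `&` O)).
    by rewrite /Rintegral integral_indic.
  have hle : (leb (K `&` O) <= leb K)%E.
    by apply: le_measure; rewrite ?inE//; exact: measurableI.
  rewrite mulrC; apply: ler_wpM2r; first exact: ltW.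
  apply: fine_le => //; rewrite ge0_fin_numE//.
  by apply: le_lt_trans hle _; rewrite -ge0_fin_numE.
apply: (@le_trans _ _ (d `^ (1 - p) * d `^ p)); first by rewrite ler_wpM2l ?powR_ge0.
by rewrite -powR_split// subrK powRr1// ltW.
Qed.

Lemma approx_test_Lp n (O : set 'rV[R]_n) phi : open O -> test_function O phi ->
  Lp p O phi /\ forall i, Lp p O (fun x => dgrad phi x ord0 i).
Proof.
move=> oO tphi; have mO := open_rV_measurable oO; split; first exact: test_Lp tphi.
by move=> i; under eq_fun do rewrite mxE; apply: test_Lp (test_partial i tphi).
Qed.

Lemma LpB n (O : set 'rV[R]_n) u v : measurable O -> Lp p O u -> Lp p O v ->
  Lp p O (fun x => u x - v x).
Proof.
move=> mO Lu Lv; have /(LpP p1 _ mO)[mu _] := Lu; have /(LpP p1 _ mO)[mv _] := Lv.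
by apply/(LpP p1 _ mO); split; [exact: measurable_funB|exact: ig_powB].
Qed.

(** Both sides of the integration by parts formula are continuous for the L^p norms. *)
Lemma weak_gradient_limit n (O : set 'rV[R]_n) u (g : 'rV[R]_n -> 'rV[R]_n) : open O -> Lp p O u ->
  (forall i, Lp p O (fun x => g x ord0 i)) ->
  (forall e, 0 < e -> exists phi, approx_test O u g e phi) ->
  weak_gradient O u g.
Proof.
move=> oO Lu Lg happ; have mO := open_rV_measurable oO; split.
- exact: Lp_L1loc.
- by move=> i; exact: Lp_L1loc.
move=> psi i tpsi; have tdpsi := test_partial i tpsi.
have [spsi [K [cK KO psiK]]] := tpsi.
have dpsiK := @partial_support R n psi K i (compact_closed_rV cK) psiK.
have [M1 M10 psiM1] := test_bounded tpsi.
have [M2 M20 psiM2] := test_bounded tdpsi.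
apply/eqP; rewrite -subr_eq0 opprK -normr_le0; apply/ler_addgt0Pr => e e0; rewrite add0r.
pose C := (M1 + M2) * (fine (leb K) + 1).
have C0 : 0 < C by apply: mulr_gt0; [exact: addr_gt0|apply: ltr_wpDl => //; exact: fine_ge0].
pose d := e / C; have d0 : 0 < d by rewrite divr_gt0.
have [phi [tphi h1 h2]] := happ (d `^ p) (powR_gt0 _ d0).
have [Lphi Ldphi] := approx_test_Lp oO tphi.
have [_ _ /(_ psi i tpsi)] := smooth_weak_gradient O (test_smooth tphi).
have L1u := Lp_L1loc oO Lu; have L1phi := Lp_L1loc oO Lphi.
have L1g := Lp_L1loc oO (Lg i); have L1dphi := Lp_L1loc oO (Ldphi i).
move=> E.
have B1 : `|\int[leb]_(x in O) ((phi x - u x) * partial i psi x)| <= M2 * (fine (leb K) + 1) * d.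
  exact: (Lp_test_pairing oO (LpB mO Lphi Lu) tdpsi cK dpsiK psiM2 d0 h1).
have B2 : `|\int[leb]_(x in O) ((dgrad phi x ord0 i - g x ord0 i) * psi x)| <= M1 * (fine (leb K) + 1) * d.
  apply: (Lp_test_pairing oO (LpB mO (Ldphi i) (Lg i)) tpsi cK psiK psiM1 d0).
  apply: le_trans h2; apply: le_Rintegral => //.
  - exact: ig_powB.
  - by have [] := ig_powB_rV mO Ldphi Lg.
  move=> x _; apply: powR_mono => //.
  by have := coord_norm_le (dgrad phi x - g x) i; rewrite !mxE.
have S1 : \int[leb]_(x in O) ((phi x - u x) * partial i psi x) =
    \int[leb]_(x in O) (phi x * partial i psi x) - \int[leb]_(x in O) (u x * partial i psi x).
  under eq_Rintegral do rewrite mulrBl.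
  by rewrite RintegralB//; exact: (L1loc_ig (O := O)).
have S2 : \int[leb]_(x in O) ((dgrad phi x ord0 i - g x ord0 i) * psi x) =
    \int[leb]_(x in O) (dgrad phi x ord0 i * psi x) - \int[leb]_(x in O) (g x ord0 i * psi x).
  under eq_Rintegral do rewrite mulrBl.
  by rewrite RintegralB//; exact: (L1loc_ig (O := O)).
rewrite S1 in B1; rewrite S2 in B2.
set a := \int[leb]_(x in O) (u x * partial i psi x).
set b := \int[leb]_(x in O) (g x ord0 i * psi x).
have E' : \int[leb]_(x in O) (phi x * partial i psi x) = - \int[leb]_(x in O) (dgrad phi x ord0 i * psi x).
  exact: E.
rewrite E' -/a in B1; rewrite -/b in B2.
set c := \int[leb]_(x in O) (dgrad phi x ord0 i * psi x) in B1 B2.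
have -> : a + b = - ((- c - a) + (c - b)) by ring.
rewrite normrN (le_trans (ler_normD _ _))// (le_trans (lerD B1 B2))//.
rewrite -mulrDl -mulrDl [M2 + M1]addrC -/C /d mulrCA divff ?mulr1// gt_eqF//.
Qed.

Lemma W01p_of_approx n (O : set 'rV[R]_n) u (g : 'rV[R]_n -> 'rV[R]_n) : open O -> Lp p O u ->
  (forall i, Lp p O (fun x => g x ord0 i)) ->
  (forall e, 0 < e -> exists phi, approx_test O u g e phi) ->
  W01p p O u.
Proof.
move=> oO Lu Lg happ; have mO := open_rV_measurable oO.
have wg := weak_gradient_limit oO Lu Lg happ.
split; first exact: W1p_weak Lg.
have hk (k : nat) : 0 < (k.+1%:R^-1 : R) `^ p by rewrite powR_gt0// invr_gt0.
have /choice[phi hphi] : forall k : nat, exists phi, approx_test O u g ((k.+1%:R^-1) `^ p) phi.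
  by move=> k; exact: happ.
exists phi; split=> [j|]; first by have [] := hphi j.
have hle k : (W1p_norm p O (phi k \- u)%R <= ((1 + n%:R) * k.+1%:R^-1)%:E)%E.
  have [tphi h1 h2] := hphi k; have sphi := test_smooth tphi.
  have Lphi := test_Lp mO tphi.
  have Ldphi i : Lp p O (fun x => dgrad (phi k) x ord0 i).
    by under eq_fun do rewrite mxE; apply: test_Lp (test_partial i tphi).
  rewrite mulrDl mul1r EFinD /W1p_norm; apply: leeD.
    apply: Lp_norm_le => //; apply/(Rint_le _ mO) => //; exact: ig_powB.
  have wB : weak_gradient O (phi k \- u) (fun x => dgrad (phi k) x - g x).
    have := weak_gradient_lin (-1) mO wg (smooth_weak_gradient O sphi).
    rewrite (_ : (fun x => -1 * u x + _) = phi k \- u); last first.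
      by apply/funext => x; rewrite mulN1r addrC.
    by under [in X in X -> _]eq_fun do rewrite scaleN1r addrC.
  have aeB := grad_ae oO wB.
  have mgr : measurable_fun O (grad O (phi k \- u)).
    apply: measurable_fun_rV => // i; apply: L1loc_measurable => //.
    by have [_ + _] := grad_weak wB; apply.
  have [mgB igB] := ig_powB_rV mO Ldphi Lg.
  apply: Lp_norm_le => //.
  apply: (@le_trans _ _ (\int[leb]_(x in O) (n%:R `^ p * `|dgrad (phi k) x - g x| `^ p)%:E)%E).
    have e0' x : (0 <= (`|enorm (grad O (phi k \- u)%R x)| `^ p)%:E)%E by rewrite lee_fin powR_ge0.
    apply: ae_ge0_le_integral => //.
    - apply/measurable_EFinP; apply: (measurableT_comp (measurable_powR p)).
      by apply: measurableT_comp => //; exact: (measurableT_comp (@measurable_enorm n)).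
    - by apply/measurable_EFinP; apply: measurable_funM => //; exact: ig_measurable igB.
    - apply: filterS aeB => x h /h ->.
      rewrite lee_fin -powRM//; apply: powR_mono => //.
      by rewrite ger0_norm ?enorm_ge0// enorm_le.
  apply/(Rint_le _ mO); first exact: ig_scale.
  rewrite RintegralZl// powRM// ?invr_ge0//.
  by rewrite ler_wpM2l ?powR_ge0.
apply: (@squeeze_cvge _ _ _ _ (fun=> 0%E) _ (fun k => ((1 + n%:R) * k.+1%:R^-1)%:E)).
- by apply: nearW => k; rewrite hle andbT /W1p_norm adde_ge0// Lnorm_ge0.
- exact: cvg_cst.
apply: cvg_EFin; first exact: nearW.
rewrite -[X in _ --> X](mulr0 (1 + n%:R)).
by apply: cvgMr; exact: cvg_harmonic.
Qed.

End powers.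
End approximation.

(** * Increments of smooth functions *)

Section translations.
Context {R : realType}.
Local Notation ig D f := (leb.-integrable D (EFin \o f)).
Local Notation e_ i := (delta_mx ord0 i).
Local Notation lam := (@lebesgue_measure R).

Lemma continuous_line n (f : 'rV[R]_n -> R) (e x : 'rV[R]_n) : continuous f ->
  continuous (fun t : R => f (t *: e + x)).
Proof.
move=> cf t; apply: continuous_comp; last exact: cf.
by apply: cvgD; [apply: cvgZr_tmp; exact: cvg_id|exact: cvg_cst].
Qed.

Lemma continuous_normr_powR (p : R) : 0 < p -> continuous (fun t : R => `|t| `^ p).
Proof.
move=> p0 t; have [->|t0] := eqVneq t 0.
  apply/cvgrPdist_lt => e e0; near=> s.
  rewrite /= normr0 powR0 ?gt_eqF// sub0r normrN ger0_norm ?powR_ge0//.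
  have -> : e = (e `^ p^-1) `^ p by rewrite -powRrM mulVf ?gt_eqF// powRr1// ltW.
  apply: gt0_ltr_powR => //; rewrite ?nnegrE ?powR_ge0//.
  near: s; have h : 0 < e `^ p^-1 by rewrite powR_gt0.
  apply/nbhs_ballP; exists (e `^ p^-1) => //= y.
  by rewrite /ball_ /= sub0r normrN.
apply: (@continuous_comp _ _ _ (fun t : R => `|t|) (fun t => t `^ p)).
  exact: norm_continuous.
have nt0 : 0 < `|t| by rewrite normr_gt0.
have h : {for `|t|, continuous (fun s : R => expR (p * ln s))}.
  apply: continuous_comp; last exact: continuous_expR.
  by apply: cvgMr; exact: continuous_ln.
apply: cvg_trans; first apply: near_eq_cvg.
  near=> s; have s0 : 0 < s.
    near: s; exact: lt_nbhsr.
  by rewrite /powR gt_eqF.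
have -> : `|t| `^ p = expR (p * ln `|t|) by rewrite /powR gt_eqF.
exact: h.
Unshelve. all: by end_near.
Qed.

Lemma continuous_powR_norm n (f : 'rV[R]_n -> R) p : 0 < p -> continuous f ->
  continuous (fun x => `|f x| `^ p).
Proof.
move=> p0 cf x; apply: (@continuous_comp _ _ _ f (fun t : R => `|t| `^ p)); first exact: cf.
exact: continuous_normr_powR.
Qed.

Lemma segment_ig (f : R -> R) a b : continuous f ->
  lam.-integrable `[a, b] (EFin \o f).
Proof.
move=> cf; apply: continuous_compact_integrable; first exact: segment_compact.
exact: continuous_subspaceT.
Qed.

Lemma smooth_increment n (u : 'rV[R]_n -> R) i x (s : R) : smooth u -> 0 < s ->
  \int[lam]_(t in `[0, s]) partial i u (t *: e_ i + x) = u (s *: e_ i + x) - u x.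
Proof.
move=> su s0.
have cg : continuous (fun t : R => partial i u (t *: e_ i + x)).
  by apply: continuous_line; exact: smooth_continuous (smooth_partial i su).
have cF : continuous (fun t : R => u (t *: e_ i + x)).
  by apply: continuous_line; exact: smooth_continuous su.
have dF (t : R) : is_derive t (1 : R) (fun t : R => u (t *: e_ i + x)) (partial i u (t *: e_ i + x)).
  by apply: is_derive_line; exact: smooth_derivable.
rewrite /Rintegral (@continuous_FTC2 _ _ (fun t : R => u (t *: e_ i + x)))//=.
- by rewrite scale0r add0r.
- exact: continuous_subspaceT.
- split.
  + by move=> t _; apply: ex_derive.
  + by apply: cvg_at_right_filter; exact: cF.
  + by apply: cvg_at_left_filter; exact: cF.
- by move=> t _; rewrite derive1E; apply: derive_val.
Qed.

(** Jensen's inequality, obtained by integrating the tangent inequality for y^p taken at the mean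
value of the derivative. *)
Lemma increment_pow_le n (u : 'rV[R]_n -> R) i x (s p : R) : 1 < p -> smooth u -> 0 < s ->
  `|u (s *: e_ i + x) - u x| `^ p <=
  s `^ (p - 1) * \int[lam]_(t in `[0, s]) `|partial i u (t *: e_ i + x)| `^ p.
Proof.
move=> p1 su s0; have p0 : 0 < p by exact: lt_trans p1.
have cdu := smooth_continuous (smooth_partial i su).
have cg := @continuous_line _ _ (e_ i) x cdu.
have cgp := @continuous_line _ _ (e_ i) x (continuous_powR_norm p0 cdu).
have ms : measurable (`[0, s] : set (measurableTypeR R)) by exact: measurable_itv.
have ig1 := segment_ig 0 s cg; have ig2 := segment_ig 0 s cgp; have ig1' := ig_abs ms ig1.
set D := `|u _ - u _|; set I := \int[lam]_(t in _) _ `^ p.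
pose a := D / s; have a0 : 0 <= a by rewrite divr_ge0 ?normr_ge0// ltW.
have hD : D <= \int[lam]_(t in `[0, s]) `|partial i u (t *: e_ i + x)|.
  by rewrite /D -smooth_increment// le_normr_Rintegral.
have lams : fine (lam `[0, s]) = s by rewrite lebesgue_measure_itv/= lte_fin s0/= oppr0 addr0.
have igc : lam.-integrable `[0, s] (EFin \o (fun=> (p - 1) * a `^ p)).
  by apply: segment_ig; exact: cst_continuous.
have h : \int[lam]_(t in `[0, s]) (p * a `^ (p - 1) * `|partial i u (t *: e_ i + x)| - (p - 1) * a `^ p) <= I.
  apply: le_Rintegral => //.
    by apply: ig_sub => //; exact: ig_scale.
  by move=> t _; apply: powR_tangent.
rewrite RintegralB// in h; last exact: ig_scale.
rewrite RintegralZl// Rintegral_cst// lams in h.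
have h2 : p * a `^ (p - 1) * (a * s) <= p * a `^ (p - 1) * \int[lam]_(t in `[0, s]) `|partial i u (t *: e_ i + x)|.
  by rewrite ler_wpM2l ?mulr_ge0 ?powR_ge0 ?(ltW p0)// divfK ?gt_eqF.
have E : a `^ (p - 1) * a = a `^ p by rewrite mulrC mulr_powRB1.
have h3 : a `^ p * s <= I.
  have -> : a `^ p * s = p * a `^ (p - 1) * (a * s) - (p - 1) * a `^ p * s by rewrite -E; ring.
  by apply: le_trans h; rewrite lerD2r.
have -> : D `^ p = s `^ (p - 1) * (a `^ p * s).
  rewrite [RHS]mulrC -mulrA [s * _]mulrC -[X in _ * (_ * X)](powRr1 (ltW s0)) -powR_split// subrK.
  by rewrite -powRM// ?(ltW s0)// divfK// gt_eqF.
by rewrite ler_wpM2l ?powR_ge0.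
Qed.

(** The increments are integrated over A and the integrals are exchanged; each translate of A
along the segment lies in B. *)
Lemma translation_pow_le n (u : 'rV[R]_n -> R) i (A B : set 'rV[R]_n) (s p : R) : 1 < p -> smooth u -> 0 < s ->
  measurable A -> measurable B ->
  (forall x t, A x -> 0 <= t <= s -> B (t *: e_ i + x)) ->
  (\int[leb]_(x in A) (`|u (s *: e_ i + x) - u x| `^ p)%:E <=
   (s `^ p)%:E * \int[leb]_(x in B) (`|partial i u x| `^ p)%:E)%E.
Proof.
move=> p1 su s0 mA mB AB; have p0 : 0 < p by exact: lt_trans p1.
have s00 := ltW s0.
have cdu := smooth_continuous (smooth_partial i su).
have ms : measurable (`[0, s] : set (measurableTypeR R)) by exact: measurable_itv.
pose g x := `|partial i u x| `^ p.
have g0 x : 0 <= g x by exact: powR_ge0.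
have mg : measurable_fun setT g.
  by apply: continuous_rV_measurable; exact: continuous_powR_norm.
have sE : s `^ p = s `^ (p - 1) * s by rewrite mulrC mulr_powRB1.
pose f (z : 'rV[R]_n * measurableTypeR R) : \bar R :=
  ((\1_A z.1 * \1_(`[0, s] : set (measurableTypeR R)) z.2) * g ((z.2 : R) *: e_ i + z.1))%:E.
have f0 z : (0 <= f z)%E by rewrite lee_fin !mulr_ge0.
have msh : measurable_fun setT (fun z : 'rV[R]_n * measurableTypeR R => (z.2 : R) *: e_ i + z.1 : 'rV[R]_n).
  apply/measurable_fun_rVP => j.
  rewrite (_ : _ \o _ = (fun z => (z.2 : R) * (e_ i : 'rV[R]_n) ord0 j + rV_coord j z.1)); last first.
    by apply/funext => z; rewrite /= /rV_coord mxE [in X in X + _]mxE.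
  apply: measurable_funD; last by apply: measurableT_comp; [exact: measurable_rV_coord|exact: measurable_fst].
  by apply: measurable_funM => //; exact: measurable_snd.
have mf : measurable_fun setT f.
  apply/measurable_EFinP; apply: measurable_funM; last exact: measurableT_comp.
  apply: measurable_funM.
    by apply: measurableT_comp; [exact: measurable_indic|exact: measurable_fst].
  by apply: measurableT_comp; [exact: measurable_indic|exact: measurable_snd].
have mF := @measurable_fun_fubini_tonelli_F _ _ _ _ R lam f mf f0.
apply: (@le_trans _ _ ((s `^ (p - 1))%:E * \int[leb]_x \int[lam]_t f (x, t))%E).
  rewrite -ge0_integralZl//=; last 2 first.
  - by move=> x _; exact: integral_ge0.
  - by rewrite lee_fin powR_ge0.
  rewrite integral_mkcond; apply: ge0_le_integral => //.
  - by move=> x _; rewrite patchE; case: ifP => // _; rewrite lee_fin powR_ge0.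
  - apply/(measurable_restrictT _ mA); apply/measurable_EFinP; apply: measurable_funTS.
    apply: continuous_rV_measurable; apply: (continuous_powR_norm (f := fun x => u (s *: e_ i + x) - u x)) => //.
    have cs : continuous (fun x : 'rV[R]_n => s *: e_ i + x).
      by apply: nonexpansive_continuous => x y; rewrite opprD addrACA subrr add0r.
    have ct : continuous (fun x : 'rV[R]_n => u (s *: e_ i + x)).
      move=> x; apply: (@continuous_comp _ _ _ (fun x : 'rV[R]_n => s *: e_ i + x) u).
        exact: cs.
      exact: smooth_continuous.
    have cu := smooth_continuous su.
    move=> x; exact: (continuousB (ct x) (cu x)).
  - by apply: measurable_funeM; exact: mF.
  move=> x _; rewrite patchE; case: ifP => [|_]; last by rewrite mule_ge0 ?lee_fin ?powR_ge0// integral_ge0.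
  move=> xA; rewrite /f /=.
  have -> : (\int[lam]_t (\1_A x * \1_(`[0, s] : set (measurableTypeR R)) t * g ((t : R) *: e_ i + x))%:E =
     \int[lam]_(t in `[0%R, s]) (g ((t : R) *: e_ i + x))%:E)%E.
    rewrite [RHS]integral_mkcond; apply: eq_integral => t _.
    by rewrite patchE !indicE xA mul1r; case: ifP => _; rewrite ?mul1r ?mul0r.
  have igx := segment_ig 0 s (@continuous_line _ _ (e_ i) x (continuous_powR_norm p0 cdu)).
  have Fx := integrable_fin_num ms igx.
  rewrite -(fineK Fx) -EFinM lee_fin; exact: increment_pow_le.
rewrite sE EFinM -muleA; apply: lee_wpmul2l; first by rewrite lee_fin powR_ge0.
rewrite fubini_tonelli//.
have IB (t : measurableTypeR R) : t \in (`[0, s]%classic : set (measurableTypeR R)) -> (\int[leb]_x f (x, t) <= \int[leb]_(x in B) (g x)%:E)%E.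
  move=> /[dup] ts; rewrite inE/= in_itv/= => t0s.
  apply: (@le_trans _ _ (\int[leb]_x (((fun x => (g x)%:E) \_ B) (x + t *: e_ i)%R))%E).
    have mft : measurable_fun setT (fun x => f (x, t)).
      by apply: (measurableT_comp mf); exact: measurable_pair2.
    have mB' : measurable_fun setT (fun x : 'rV[R]_n => ((fun x => (g x)%:E) \_ B) (x + t *: e_ i)).
      apply: (measurableT_comp (f := (fun x => (g x)%:E) \_ B)).
        by apply/(measurable_restrictT _ mB); apply/measurable_EFinP; exact: measurable_funTS.
      have -> : (fun x : 'rV[R]_n => x + (t : R) *: e_ i) = (fun z : 'rV[R]_n * measurableTypeR R => (z.2 : R) *: e_ i + z.1 : 'rV[R]_n) \o (fun x => (x, t)).
        by apply/funext => x /=; rewrite addrC.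
      by apply: (measurableT_comp msh); exact: measurable_pair2.
    apply: ge0_le_integral.
    - exact: measurableT.
    - by move=> x _; exact: f0.
    - exact: mft.
    - exact: mB'.
    move=> x _; rewrite /f patchE.
    have -> : \1_(`[0, s]%classic : set (measurableTypeR R)) (x, t).2 = 1 :> R by rewrite indicE ts.
    rewrite mulr1 indicE.
    have [xA|xA] := boolP ((x, t).1 \in A); last by rewrite mul0r; case: ifP => _; rewrite lee_fin.
    rewrite mul1r mem_set; first by rewrite addrC.
    by rewrite addrC; apply: AB => //; rewrite inE in xA.
  rewrite ge0_integral_rV_shift//.
  - by rewrite -integral_mkcond.
  - by apply/(measurable_restrictT _ mB); apply/measurable_EFinP; exact: measurable_funTS.
  - by move=> x; rewrite patchE; case: ifP => // _; rewrite lee_fin.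
apply: (@le_trans _ _ (\int[lam]_(t in `[0%R, s]) \int[leb]_(x in B) (g x)%:E)%E).
  rewrite [leRHS]integral_mkcond; apply: ge0_le_integral => //.
  - by move=> t _; exact: integral_ge0.
  - exact: (@measurable_fun_fubini_tonelli_G _ _ _ _ R leb f mf f0).
  - by apply/(measurable_restrictT _ ms); exact: measurable_cst.
  - move=> t _; rewrite patchE; case: ifP => ts; first exact: IB.
    rewrite integral0_eq// => x _; by rewrite /f /= [in \1_(_ : set _) t]indicE ts mulr0 mul0r.
have -> : (\int[lam]_(_ in `[0%R, s]) \int[leb]_(x in B) (g x)%:E =
    \int[lam]_(_ in `[0%R, s]) (1 * \int[leb]_(x in B) (g x)%:E))%E.
  by apply: eq_integral => t _; rewrite mul1e.
rewrite ge0_integralZr//; last by apply: integral_ge0 => x _; rewrite lee_fin.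
have -> : (\int[lam]_(_ in `[0%R, s]) 1 = s%:E)%E.
  by rewrite integral_cst//= lebesgue_measure_itv/= lte_fin s0/= mul1e oppr0 adde0.
exact: lexx.
Qed.

(** A translation by 2M moves O outside the cube that contains it, where the function vanishes, so the
function is its own increment. *)
Lemma poincare n (O : set 'rV[R]_n) u (M p : R) : (0 < n)%N -> 1 < p -> 0 < M -> O `<=` cube n M ->
  test_function O u -> measurable O ->
  \int[leb]_(x in O) `|u x| `^ p <= (2 * M) `^ p * \int[leb]_(x in O) `|dgrad u x| `^ p.
Proof.
case: n O u => // n O u _ p1 M0 OM tu mO; have su := test_smooth tu.
have p0 : 0 < p by exact: lt_trans p1.
have [_ [K [cK KO uK]]] := tu.
have OK x : ~ O x -> u x = 0 by move=> Ox; apply: uK => /KO.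
have [Lu Ldu] : Lp p O u /\ forall i, Lp p O (fun x => dgrad u x ord0 i).
  split; first exact: test_Lp tu.
  by move=> i; under eq_fun do rewrite mxE; exact: test_Lp (test_partial i tu).
have /(LpP p1 _ mO)[mu iu] := Lu; have [_ idu] := (ig_norm_rV_pow p1 (dgrad u) mO).1 Ldu.
have /(LpP p1 _ mO)[_ ipu] := Ldu ord0.
have M20 : 0 < 2 * M by rewrite mulr_gt0.
have M200 := ltW M20.
apply: (@le_trans _ _ ((2 * M) `^ p * \int[leb]_(x in O) (`|dgrad u x ord0 ord0| `^ p))); last first.
  rewrite ler_wpM2l ?powR_ge0//; apply: le_Rintegral => // x _.
  by apply: powR_mono; [exact: ltW|exact: normr_ge0|exact: coord_norm_le].
apply/(Rint_le _ mO iu).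
have Fp := integrable_fin_num mO ipu.
rewrite EFinM fineK//.
have out x : O x -> u ((2 * M) *: delta_mx ord0 ord0 + x) = 0.
  move=> Ox; apply: OK => /OM; rewrite /cube /= => hx.
  have := le_lt_trans (coord_norm_le _ ord0) hx; rewrite !mxE !eqxx mulr1 => h1.
  have /OM hx2 := Ox; have h2 := le_lt_trans (coord_norm_le _ ord0) hx2.
  move: h1 h2; rewrite !ltr_norml => /andP[_ h1] /andP[h2 _]; lra.
apply: (@le_trans _ _ (\int[leb]_(x in O) (`|u ((2 * M) *: delta_mx ord0 ord0 + x) - u x| `^ p)%:E)%E).
  rewrite le_eqVlt; apply/orP; left; apply/eqP; apply: eq_integral => x; rewrite inE => Ox.
  by rewrite out// sub0r normrN.
apply: (le_trans (@translation_pow_le _ u ord0 O setT (2 * M) p p1 su M20 mO measurableT _)) => //.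
apply: lee_wpmul2l; first by rewrite lee_fin powR_ge0.
rewrite le_eqVlt; apply/orP; left; apply/eqP; rewrite [RHS]integral_mkcond.
apply: eq_integral => x _; rewrite patchE mxE; case: ifPn => // xO.
have -> : partial ord0 u x = 0.
  apply: (@partial_support R n.+1 u K ord0 (compact_closed_rV cK) uK).
  by move=> /KO; rewrite notin_setE in xO.
by rewrite normr0 powR0// gt_eqF.
Qed.

End translations.

(** * Convex integrands *)

Section convex.
Context {R : realType}.

Definition rdot n (s x : 'rV[R]_n) : R := \sum_i s ord0 i * x ord0 i.

Lemma rdotD n (s x y : 'rV[R]_n) : rdot s (x + y) = rdot s x + rdot s y.
Proof. by rewrite -big_split /=; apply: eq_bigr => i _; rewrite mxE mulrDr. Qed.

Lemma rdotN n (s x : 'rV[R]_n) : rdot s (- x) = - rdot s x.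
Proof. by rewrite -sumrN; apply: eq_bigr => i _; rewrite mxE mulrN. Qed.

Lemma rdotB n (s x y : 'rV[R]_n) : rdot s (x - y) = rdot s x - rdot s y.
Proof. by rewrite rdotD rdotN. Qed.

Lemma rdotZ n (s x : 'rV[R]_n) (a : R) : rdot s (a *: x) = a * rdot s x.
Proof. by rewrite mulr_sumr; apply: eq_bigr => i _; rewrite mxE mulrCA. Qed.

Lemma rdot0 n (x : 'rV[R]_n) : rdot 0 x = 0.
Proof. by rewrite /rdot big1// => i _; rewrite mxE mul0r. Qed.

Lemma rdot_le n (s x : 'rV[R]_n) : `|rdot s x| <= n%:R * `|s| * `|x|.
Proof.
apply: (le_trans (ler_norm_sum _ _ _)).
apply: (@le_trans _ _ (\sum_(i < n) `|s| * `|x|)).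
  by apply: ler_sum => i _; rewrite normrM ler_pM// coord_norm_le.
by rewrite sumr_const card_ord -mulrA mulr_natl.
Qed.

Lemma continuous_at_dist (V : normedModType R) (f : V -> R) (x : V) :
  (forall e : R, 0 < e -> exists2 d : R, 0 < d & forall y, `|x - y| < d -> `|f x - f y| < e) ->
  {for x, continuous f}.
Proof.
move=> h; apply/cvgrPdist_lt => e /h[d d0 hd].
apply/nbhs_ballP; exists d => //= y; rewrite -ball_normE /= => xy; exact: hd.
Qed.

Section one_function.
Variables (n : nat) (F : 'rV[R]_n -> R).
Hypothesis cF : convex_function [set: 'rV[R]_n] F.

Lemma convex_le (t : R) x y : 0 <= t <= 1 ->
  F (t *: x + (1 - t) *: y) <= t * F x + (1 - t) * F y.
Proof.
move=> /andP[t0 t1].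
have := cF (Itv01 t0 t1) (mem_set I : x \in [set: 'rV[R]_n]) (mem_set I : y \in [set: 'rV[R]_n]).
by [].
Qed.

Lemma convex_two (a b : R) x y : 0 < a -> 0 < b ->
  (a + b) * F ((a + b)^-1 *: (a *: x + b *: y)) <= a * F x + b * F y.
Proof.
move=> a0 b0; have ab : 0 < a + b by rewrite addr_gt0.
have ab0 : a + b != 0 by rewrite gt_eqF.
have t01 : 0 <= a / (a + b) <= 1.
  by rewrite divr_ge0 ?(ltW a0) ?(ltW ab)//= ler_pdivrMr// mul1r lerDl ltW.
have := convex_le x y t01.
have -> : 1 - a / (a + b) = b / (a + b) by field.
rewrite scalerDr !scalerA ![(a + b)^-1 * _]mulrC => h.
apply: (le_trans (ler_wpM2l (ltW ab) h)).
by rewrite le_eqVlt; apply/orP; left; apply/eqP; field.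
Qed.

(** Finite-dimensional Hahn-Banach: a supporting affine function is extended one
coordinate at a time, the new slope being squeezed between two families of
difference quotients by convexity. *)
Lemma subgradient_step x0 (k : nat) : (k <= n)%N ->
  exists s : 'rV[R]_n, forall y : 'rV[R]_n, (forall i : 'I_n, (k <= i)%N -> y ord0 i = 0) ->
    F x0 + rdot s y <= F (x0 + y).
Proof.
elim: k => [_|k IHk kn].
  exists 0 => y y0; have -> : y = 0 by apply/rowP => i; rewrite y0// mxE.
  by rewrite addr0 rdot0 addr0.
have [s hs] := IHk (ltnW kn); pose e : 'rV[R]_n := delta_mx ord0 (Ordinal kn).
pose V (y : 'rV[R]_n) := forall i : 'I_n, (k <= i)%N -> y ord0 i = 0.
pose A := [set c : R | exists t y, [/\ 0 < t, V y & c = (F x0 + rdot s y - F (x0 + (y - t *: e))) / t]].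
have AB t y t' y' : 0 < t -> V y -> 0 < t' -> V y' ->
    (F x0 + rdot s y - F (x0 + (y - t *: e))) / t <= (F (x0 + (y' + t' *: e)) - F x0 - rdot s y') / t'.
  move=> t0 Vy t'0 Vy'; rewrite ler_pdivrMr// mulrAC ler_pdivlMr//.
  have h := @convex_two t' t (x0 + (y - t *: e)) (x0 + (y' + t' *: e)) t'0 t0.
  have tt : t' + t != 0 by rewrite gt_eqF// addr_gt0.
  have E : (t' + t)^-1 *: (t' *: (x0 + (y - t *: e)) + t *: (x0 + (y' + t' *: e))) =
      x0 + (t' + t)^-1 *: (t' *: y + t *: y').
    apply/rowP => i; rewrite !mxE; field => //.
  have V2 : V ((t' + t)^-1 *: (t' *: y + t *: y')).
    by move=> i ki; rewrite !mxE Vy// Vy'// !mulr0 addr0 mulr0.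
  have h2 := hs _ V2; rewrite E in h.
  rewrite -(ler_pM2l (addr_gt0 t'0 t0)) mulrDr rdotZ mulrA divff// mul1r rdotD !rdotZ in h2.
  have := le_trans h2 h; lra.
have A0 : A !=set0.
  by exists ((F x0 + rdot s 0 - F (x0 + (0 - 1 *: e))) / 1), 1, 0; split=> // i _; rewrite mxE.
have ubA b : (exists t' y', [/\ 0 < t', V y' & b = (F (x0 + (y' + t' *: e)) - F x0 - rdot s y') / t']) ->
    ubound A b.
  by move=> [t' [y' [t'0 Vy' ->]]] c [t [y [t0 Vy ->]]]; exact: AB.
have hA : has_ubound A.
  exists ((F (x0 + (0 + 1 *: e)) - F x0 - rdot s 0) / 1); apply: ubA; exists 1, 0.
  by split=> // i _; rewrite mxE.
pose c := sup A.
pose s' : 'rV[R]_n := \row_i (if i == Ordinal kn then c else s ord0 i).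
exists s' => y Vy; pose t := y ord0 (Ordinal kn).
pose z : 'rV[R]_n := y - t *: e.
have Vz : V z.
  move=> i ki; rewrite !mxE eqxx /=; have [->|ik] := eqVneq i (Ordinal kn).
    by rewrite mulr1 subrr.
  rewrite mulr0 subr0 Vy// ltn_neqAle ki andbT; apply: contra ik => /eqP ki'.
  by apply/eqP/val_inj.
have sz : rdot s' z = rdot s z.
  apply: eq_bigr => i _; rewrite [s' _ _]mxE; case: eqP => // ->.
  by rewrite (Vz (Ordinal kn)) ?leqnn// !mulr0.
have se : rdot s' e = c.
  rewrite /rdot (bigD1 (Ordinal kn))//= big1 ?addr0 => [|i ik].
    by rewrite !mxE !eqxx mulr1.
  by rewrite !mxE (negbTE ik) andbF mulr0.
have yz : y = z + t *: e by rewrite subrK.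
have -> : rdot s' y = rdot s z + t * c by rewrite yz rdotD sz rdotZ se.
have [t0|t0|t0] := ltgtP t 0.
- have : (F x0 + rdot s z - F (x0 + (z - (- t) *: e))) / (- t) <= c.
    by apply: ub_le_sup => //; exists (- t), z; split => //; rewrite oppr_gt0.
  rewrite scaleNr opprK -yz ler_pdivrMr ?oppr_gt0//; lra.
- have : c <= (F (x0 + (z + t *: e)) - F x0 - rdot s z) / t.
    by apply: ge_sup => //; apply: ubA; exists t, z.
  rewrite -yz ler_pdivlMr//; lra.
- by rewrite yz t0 mul0r addr0 scale0r addr0; exact: hs.
Qed.

Lemma subgradient x0 : exists s : 'rV[R]_n, forall y, F x0 + rdot s (y - x0) <= F y.
Proof.
have [s hs] := @subgradient_step x0 n (leqnn n); exists s => y.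
by rewrite -[in leRHS](subrKC x0 y); apply: hs => i; rewrite leqNgt ltn_ord.
Qed.

Variables (p L : R).
Hypothesis p1 : 1 < p.
Hypothesis L0 : 0 <= L.
Hypothesis F0 : forall x, 0 <= F x.
Hypothesis FL : forall x, F x <= L * (1 + `|x| `^ p).
Let p0 : 0 <= p. Proof. by apply: ltW; exact: lt_trans p1. Qed.

(** Moving from a to b costs little: b is a convex combination of a, with weight
close to 1, and of a far point beyond b. *)
Lemma convex_perturb (e : R) a b : 0 < e -> e <= 1 ->
  F b <= F a + (L * 2 `^ p) * (e * (1 + `|a| `^ p)) + (L * 2 `^ p) * (e `^ (1 - p) * `|b - a| `^ p).
Proof.
move=> e0 e1; have e00 := ltW e0.
(* b = e z + (1 - e) a, and |z|^p costs e^(-p) |b - a|^p, of which the weight e keeps e^(1 - p) *)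
pose z := a + e^-1 *: (b - a).
have Eb : b = e *: z + (1 - e) *: a.
  rewrite /z scalerDr scalerA divff ?gt_eqF// scale1r.
  by apply/rowP => i; rewrite !mxE; ring.
have h := @convex_le e z a; rewrite -Eb e00 e1 in h; have {h} h := h isT.
have nz : `|z| `^ p <= 2 `^ p * (`|a| `^ p + e `^ (- p) * `|b - a| `^ p).
  apply: le_trans (powR_le_add p0 (normr_ge0 _) (normr_ge0 a) (normr_ge0 (e^-1 *: (b - a))) (ler_normD _ _)) _.
  rewrite normrZ powRM// ger0_norm ?invr_ge0//.
  by rewrite -[in X in X <= _](powR_inv1 e00) -powRrM mulN1r.
have p2 : 1 <= (2 : R) `^ p by rewrite -[X in X <= _](powRr0 2) ler_powR// ler1n.
have A0 := powR_ge0 `|a| p; have B0 := powR_ge0 `|b - a| p.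
have E1 : e * e `^ (- p) = e `^ (1 - p) by rewrite powR_split// powRr1.
have C0 : 0 <= e `^ (- p) * `|b - a| `^ p by rewrite mulr_ge0 ?powR_ge0.
apply: (le_trans h).
have h1 : e * F z <= e * (L * (1 + 2 `^ p * (`|a| `^ p + e `^ (- p) * `|b - a| `^ p))).
  apply: ler_wpM2l => //; apply: (le_trans (FL z)).
  by rewrite ler_wpM2l// lerD2l.
have h2 : e * (L * (1 + 2 `^ p * (`|a| `^ p + e `^ (- p) * `|b - a| `^ p))) <=
    e * (L * (2 `^ p * (1 + `|a| `^ p + e `^ (- p) * `|b - a| `^ p))).
  apply: ler_wpM2l => //; apply: ler_wpM2l => //.
  by rewrite -[X in _ <= _ * X]addrA [X in _ <= X]mulrDr mulr1 lerD2r.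
have h3 : (1 - e) * F a <= F a by rewrite ler_piMl// lerBlDr lerDl.
apply: (le_trans (lerD (le_trans h1 h2) h3)); rewrite -E1.
by rewrite le_eqVlt; apply/orP; left; apply/eqP; ring.
Qed.

Lemma convex_continuous : continuous F.
Proof.
move=> x; apply: continuous_at_dist => e e0.
pose C := L * 2 `^ p * (1 + (`|x| + 1) `^ p) + 1.
have C0 : 0 < C by rewrite ltr_wpDl// !mulr_ge0 ?powR_ge0// addr_ge0 ?powR_ge0.
pose d := Num.min 1 (e / (3 * C)).
have d0 : 0 < d by rewrite lt_min ltr01 divr_gt0// mulr_gt0.
have d1 : d <= 1 by rewrite ge_min lexx.
have dC : C * d <= e / 3.
  have : d <= e / (3 * C) by rewrite ge_min lexx orbT.
  rewrite ler_pdivlMr ?mulr_gt0// => h; rewrite ler_pdivlMr//; lra.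
pose D := L * 2 `^ p * d `^ (1 - p) + 1.
have D0 : 0 < D by rewrite ltr_wpDl// !mulr_ge0 ?powR_ge0.
pose h := (e / (3 * D)) `^ p^-1.
have h0 : 0 < h by rewrite powR_gt0// divr_gt0// mulr_gt0.
have hE : h `^ p = e / (3 * D).
  by rewrite /h -powRrM mulVf ?gt_eqF ?(lt_trans _ p1)// powRr1// divr_ge0 ?mulr_ge0// ltW.
have key a b : `|a| <= `|x| + 1 -> `|b - a| <= h -> F b - F a < e.
  move=> ha hab.
  have := @convex_perturb d a b d0 d1.
  have q1 : `|a| `^ p <= (`|x| + 1) `^ p by exact: powR_mono.
  have q2 : `|b - a| `^ p <= h `^ p by exact: powR_mono.
  have q3 : L * 2 `^ p * (d * (1 + `|a| `^ p)) <= C * d.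
    rewrite /C [d * _]mulrC mulrA; apply: ler_wpM2r; first exact: ltW.
    rewrite ler_wpDr// ler_wpM2l ?mulr_ge0 ?powR_ge0// lerD2l//.
  have q4 : L * 2 `^ p * (d `^ (1 - p) * `|b - a| `^ p) <= D * h `^ p.
    rewrite mulrA; apply: ler_pM => //; rewrite ?mulr_ge0 ?powR_ge0//.
    by rewrite /D lerDl.
  have q5 : D * h `^ p = e / 3 by rewrite hE; field; rewrite gt_eqF.
  lra.
exists (Num.min 1 h); first by rewrite lt_min ltr01 h0.
move=> y; rewrite lt_min distrC => /andP[y1 y2].
rewrite ltr_norml; apply/andP; split.
  rewrite ltrNl opprB; apply: key; first by rewrite lerDl.
  exact: ltW.
apply: key; last by rewrite distrC ltW.
rewrite -[X in `|X|](subrK x) addrC; apply: (le_trans (ler_normD _ _)).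
by rewrite lerD2l ltW.
Qed.

(** The supporting functions at rational points suffice. The supporting inequality at c, used at
the reflection 2c - x, bounds from below the value at x of the supporting function at c, so that continuity of F
alone gives the result, without a bound on the slopes. The zero function comes first so that the maximum of the
first functions is nonnegative. *)
Lemma affine_minorants : exists (a : nat -> R) (s : nat -> 'rV[R]_n),
  [/\ a 0%N = 0 /\ s 0%N = 0, forall j x, a j + rdot (s j) x <= F x &
      forall x e, 0 < e -> exists j, F x - e <= a j + rdot (s j) x].
Proof.
pose q2r (q : 'rV[rat]_n) : 'rV[R]_n := \row_i ratr (q ord0 i).
have /choice[s hs] : forall q : 'rV[rat]_n, exists s : 'rV[R]_n, forall y, F (q2r q) + rdot s (y - q2r q) <= F y.
  by move=> q; exact: subgradient.
pose q_ j : 'rV[rat]_n := if j is j'.+1 then odflt 0 (unpickle j') else 0.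
exists (fun j => if j is 0%N then 0 else F (q2r (q_ j)) - rdot (s (q_ j)) (q2r (q_ j))),
  (fun j => if j is 0%N then 0 else s (q_ j)); split => //.
  case=> [|j] x; first by rewrite rdot0 addr0.
  by have := hs (q_ j.+1) x; rewrite rdotB; lra.
move=> x e e0.
have e3 : 0 < e / 3 by rewrite divr_gt0.
have /cvgrPdist_lt /(_ _ e3) c1 : F z @[z --> x] --> F x by exact: convex_continuous.
have [d /= d0 hd] := (@nbhs_ballP _ _ _ _).1 c1.
pose A := ball x (d / 2).
have oA : open A by exact: ball_open.
have Ax : A x by apply: ballxx; rewrite divr_gt0.
have hA z : A z -> `|F x - F z| < e / 3 /\ `|F x - F (2 *: z - x)| < e / 3.
  rewrite /A -ball_normE /= => xz; split; apply: hd; rewrite -ball_normE /=.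
    by apply: (lt_le_trans xz); rewrite ler_pdivrMr// ler_peMr ?ler1n// ltW.
  have -> : x - (2 *: z - x) = 2 *: (x - z) by apply/rowP => i; rewrite !mxE; ring.
  by rewrite normrZ ger0_norm// mulrC -ltr_pdivlMr.
have [[c r] /= [r0 _ hc]] := rational_cube oA Ax.
have Ac : A (q2r c) by apply: hc => i; rewrite mxE subrr normr0 ltW.
have [h1 h2] := hA _ Ac.
exists (pickle c).+1; rewrite /q_ pickleK /=.
have h3 := hs c (2 *: q2r c - x).
have E : rdot (s c) (2 *: q2r c - x - q2r c) = - rdot (s c) (x - q2r c).
  by rewrite -rdotN; congr rdot; apply/rowP => i; rewrite !mxE; ring.
rewrite E rdotB in h3.
move: h1 h2; rewrite !ltr_norml => /andP[h11 h12] /andP[h21 h22]; lra.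
Qed.

End one_function.
End convex.

(** * Iterated integrals *)

Section fubini_rV.
Context {R : realType}.
Local Notation ig D f := (leb.-integrable D (EFin \o f)).

Definition rect n m (A : set 'rV[R]_n) (B : set 'rV[R]_m) : set 'rV[R]_(n + m) :=
  [set x | A (lsubmx x) /\ B (rsubmx x)].

Lemma rect_row n m (A : set 'rV[R]_n) (B : set 'rV[R]_m) x y :
  rect A B (row_mx x y) <-> A x /\ B y.
Proof. by rewrite /rect /= row_mxKl row_mxKr. Qed.

Lemma rect_measurable n m (A : set 'rV[R]_n) (B : set 'rV[R]_m) :
  measurable A -> measurable B -> measurable (rect A B).
Proof.
move=> mA mB; have -> : rect A B = (fun x => lsubmx x) @^-1` A `&` (fun x => rsubmx x) @^-1` B by [].
apply: measurableI.
  by rewrite -[X in measurable X]setTI; exact: measurable_lsubmx.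
by rewrite -[X in measurable X]setTI; exact: measurable_rsubmx.
Qed.

Lemma Rintegral_rect_setD n m (S Q : set 'rV[R]_n) (B : set 'rV[R]_m) (g : 'rV[R]_(n + m) -> R) :
  measurable S -> measurable Q -> measurable B -> Q `<=` S -> ig (rect S B) g ->
  \int[leb]_(x in rect S B) g x =
  \int[leb]_(x in rect Q B) g x + \int[leb]_(x in rect (S `\` Q) B) g x.
Proof.
move=> mS mQ mB QS ig; have mU : measurable (S `\` Q) by exact: measurableD.
have SE : rect S B = rect Q B `|` rect (S `\` Q) B.
  apply/seteqP; split => x /=.
    move=> [xS xo]; have [xQ|xQ] := pselect (Q (lsubmx x)); first by left.
    by right.
  by move=> [[xQ xo]|[[xS _] xo]]; split => //; exact: QS.
have dQU : [disjoint rect Q B & rect (S `\` Q) B].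
  by apply/disj_setPS => x [[xQ _] [[_ nQ] _]].
rewrite {1}SE Rintegral_setU//; try exact: rect_measurable.
by rewrite -SE.
Qed.

Lemma Rfubini n m (A : set 'rV[R]_n) (B : set 'rV[R]_m) (f : 'rV[R]_(n + m) -> R) :
  measurable A -> measurable B -> ig (rect A B) f ->
  [/\ {ae leb, forall x, A x -> ig B (fun y => f (row_mx x y))},
      ig A (fun x => \int[leb]_(y in B) f (row_mx x y)) &
      \int[leb]_(x in rect A B) f x = \int[leb]_(x in A) \int[leb]_(y in B) f (row_mx x y)].
Proof.
move=> mA mB fi; have mAB := rect_measurable mA mB.
pose g := (EFin \o f) \_ (rect A B).
have gi : leb.-integrable setT g by apply/(integrable_mkcond _ mAB).1.
have gi2 := integral_rV_split_prod gi.
have ae1 := @ae_integrable1 _ _ _ _ R leb leb _ gi2.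
have FI := @integrable_fubini_F _ _ _ _ R leb leb _ gi2.
pose Fe (x : 'rV[R]_n) := (\int[leb]_y g (row_mx x y))%E.
have FeI : leb.-integrable setT Fe by exact: FI.
have gA x : A x -> (fun y => g (row_mx x y)) = (EFin \o (fun y => f (row_mx x y))) \_ B.
  move=> Ax; apply/funext => y; rewrite /g !patchE.
  have -> : (row_mx x y \in rect A B) = (y \in B); last by [].
  by apply/idP/idP; rewrite !inE rect_row => // -[].
have gnA x : ~ A x -> Fe x = 0%E.
  move=> Ax; rewrite /Fe integral0_eq// => y _; rewrite /g patchE memNset//.
  by rewrite rect_row => -[].
have FeA x : A x -> Fe x = (\int[leb]_(y in B) (f (row_mx x y))%:E)%E.
  by move=> Ax; rewrite /Fe gA// -integral_mkcond.
have ae2 : {ae leb, forall x, Fe x \is a fin_num}.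
  by have := integrable_ae measurableT FeI; apply: filterS => x; apply.
have mfe : measurable_fun setT (fun x => fine (Fe x)).
  by apply: (measurableT_comp (@fine_measurable R setT measurableT)); exact: measurable_int FeI.
have ife : ig setT (fun x => fine (Fe x)).
  apply: (@le_integrable _ _ _ _ _ _ _ Fe) => //; first exact/measurable_EFinP.
  move=> x _ /=; case: (Fe x) => [r| |] //=; rewrite ?normr0 ?leey ?lexx//.
have IE x : x \in A -> fine (Fe x) = \int[leb]_(y in B) f (row_mx x y).
  by rewrite inE => Ax; rewrite FeA.
split.
- apply: filterS ae1 => x + Ax.
  rewrite /= gA//.
  by move/(integrable_mkcond _ mB).
- apply: (ig_eq mA IE); exact: (ig_sub_set measurableT).
rewrite -(eq_Rintegral _ IE) [LHS]/Rintegral integral_mkcond.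
rewrite -/g integral_rV_split// -/Fe.
have -> : (\int[leb]_x Fe x = \int[leb]_x (fine (Fe x))%:E)%E.
  apply: ae_eq_integral => //; [exact: measurable_int FeI|exact/measurable_EFinP|].
  by apply: filterS ae2 => x h _ /=; rewrite fineK.
rewrite [RHS]/Rintegral [in RHS]integral_mkcond; congr fine.
apply: eq_integral => x _; rewrite patchE; case: ifPn => // xA.
by rewrite gnA// => Ax; rewrite mem_set in xA.
Qed.

(** The bound is only required almost everywhere; it is how estimates on the slices return to the
cylinder. *)
Lemma slice_le n m (A : set 'rV[R]_n) (B : set 'rV[R]_m) (f : 'rV[R]_(n + m) -> R) (c : R) :
  measurable A -> measurable B -> (leb A < +oo)%E -> ig (rect A B) f ->
  {ae leb, forall x, A x -> c <= \int[leb]_(y in B) f (row_mx x y)} ->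
  c * fine (leb A) <= \int[leb]_(x in rect A B) f x.
Proof.
move=> mA mB Afin fi h; have [_ I ->] := Rfubini mA mB fi.
rewrite -Rintegral_cst// -subr_ge0 -RintegralB//; last exact: ig_cst.
have mI := ig_measurable I.
have mD : measurable_fun A (fun x => \int[leb]_(y in B) f (row_mx x y) - c) by exact: measurable_funB.
rewrite (@ae_Rintegral_eq _ _ _ leb A _ (fun x => `|\int[leb]_(y in B) f (row_mx x y) - c|))//.
- by apply: Rintegral_ge0 => x _; exact: normr_ge0.
- exact: measurableT_comp.
- by apply: filterS h => x h Ax; rewrite ger0_norm// subr_ge0 h.
Qed.

End fubini_rV.

(** * Integral functionals *)

Section energies.
Context {R : realType}.

Let lin_absorb (c I E D Y : R) : c * I <= E + (D + Y) -> Y <= c / 2 * I -> c / 2 * I <= E + D.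
Proof. lra. Qed.

Let lin_pointwise (Fh Fg f v u e C G E H Q V : R) :
  Fh <= Fg + C * (e * (1 + G)) + C * (E * H) -> - (f * (v - u)) <= e * Q + E * V ->
  Fh - f * v <= (Fg - f * u) + e * (C * (1 + G) + Q) + (C * E) * H + E * V.
Proof. lra. Qed.

Let lin_perturb (eK eX e A A' B B' T eta : R) :
  eK <= eta / 2 -> eK = eX + e -> 0 <= e -> A <= A' -> B <= B' -> A' + B' = eta / 2 ->
  T + eX + A + B <= T + eta.
Proof. lra. Qed.

Local Notation ig D f := (leb.-integrable D (EFin \o f)).
Variables (p q : R).
Hypothesis p1 : 1 < p.
Hypothesis pq : p^-1 + q^-1 = 1.
Let p0 : 0 < p. Proof. exact: lt_trans p1. Qed.

Lemma conj_gt1 : 1 < q.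
Proof.
have h : 0 < p^-1 < 1 by rewrite invr_gt0 p0 invf_lt1.
move: h => /andP[h1' h2'].
have E : q^-1 = 1 - p^-1 by rewrite -pq addrAC subrr add0r.
have h1 : 0 < q^-1 by rewrite E subr_gt0.
have h2 : q^-1 < 1 by rewrite E ltrBlDr ltrDl.
rewrite invr_gt0 in h1.
by rewrite -invf_lt1.
Qed.
Let q1 := conj_gt1.
Let q0 : 0 < q. Proof. exact: lt_trans q1. Qed.

(** Young's inequality in the form in which d makes the contribution of a datum a small. *)
Lemma pair_le (d a b : R) : 0 < d -> `|a * b| <= d * `|a| `^ q + d `^ (1 - p) * `|b| `^ p.
Proof.
move=> d0; rewrite normrM.
have c0 : 0 < d `^ q^-1 by rewrite powR_gt0.
have := young_weight p1 q0 pq c0 (normr_ge0 a) (normr_ge0 b).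
rewrite -!powRrM mulVf ?gt_eqF// powRr1 ?(ltW d0)//.
have -> : q^-1 * - p = 1 - p.
  have -> : q^-1 = 1 - p^-1 by rewrite -pq; ring.
  by rewrite mulrBl mul1r; field; rewrite gt_eqF.
by [].
Qed.

Lemma ig_pairing n (O : set 'rV[R]_n) f v : measurable O -> Lp q O f -> Lp p O v ->
  ig O (fun x => f x * v x).
Proof.
move=> mO /(LpP q1 _ mO)[mf fi] /(LpP p1 _ mO)[mv vi].
apply: (ig_dom (g := fun x => 1 * `|f x| `^ q + 1 `^ (1 - p) * `|v x| `^ p)) => //.
- exact: measurable_funM.
- by apply: ig_add => //; exact: ig_scale.
- by move=> x _; apply: pair_le.
Qed.

Section convex_energy.
Variables (n : nat) (F : 'rV[R]_n -> R) (L : R).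
Hypothesis cF : convex_function [set: 'rV[R]_n] F.
Hypothesis L0 : 0 <= L.
Hypothesis F0 : forall x, 0 <= F x.
Hypothesis FL : forall x, F x <= L * (1 + `|x| `^ p).
Variables (O : set 'rV[R]_n) (f : 'rV[R]_n -> R).
Hypothesis mO : measurable O.
Hypothesis Ofin : (leb O < +oo)%E.
Hypothesis Lf : Lp q O f.

Definition LpV (g : 'rV[R]_n -> 'rV[R]_n) := forall i, Lp p O (fun x => g x ord0 i).

Lemma convex_measurable : measurable_fun setT F.
Proof. by apply: continuous_rV_measurable; exact: (convex_continuous cF p1 L0 F0 FL). Qed.

Lemma ig_convex g : LpV g -> ig O (fun x => F (g x)).
Proof.
move=> /(ig_norm_rV_pow p1 g mO)[mg gi].
apply: (ig_dom (g := fun x => L * (1 + `|g x| `^ p))) => //.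
- exact: (measurableT_comp convex_measurable).
- by apply: ig_scale => //; apply: ig_add => //; exact: ig_cst.
- by move=> x _; rewrite ger0_norm.
Qed.

Lemma ig_energy g v : LpV g -> Lp p O v -> ig O (fun x => F (g x) - f x * v x).
Proof. by move=> Lg Lv; apply: ig_sub => //; [exact: ig_convex|exact: ig_pairing]. Qed.

(** The estimate of convex_perturb is integrated, and the linear term is treated by Young's
inequality. This is what allows minimizers to be replaced by test functions. *)
Lemma energy_perturb u g (eta : R) : Lp p O u -> LpV g -> 0 < eta ->
  exists2 delta : R, 0 < delta & forall v h, Lp p O v -> LpV h ->
    \int[leb]_(x in O) (`|v x - u x| `^ p) <= delta ->
    \int[leb]_(x in O) (`|h x - g x| `^ p) <= delta ->
    \int[leb]_(x in O) (F (h x) - f x * v x) <= \int[leb]_(x in O) (F (g x) - f x * u x) + eta.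
Proof.
move=> Lu Lg eta0.
have /(ig_norm_rV_pow p1 g mO)[mg gi] := Lg.
have /(LpP q1 _ mO)[mf fi] := Lf.
pose C := L * 2 `^ p; have C0 : 0 <= C by rewrite mulr_ge0 ?powR_ge0.
have i1 : ig O (fun x => 1 + `|g x| `^ p) by apply: ig_add => //; exact: ig_cst.
pose K := C * \int[leb]_(x in O) (1 + `|g x| `^ p) + \int[leb]_(x in O) (`|f x| `^ q) + 1.
have K0 : 0 < K.
  rewrite /K ltr_wpDl// addr_ge0// ?mulr_ge0//; apply: Rintegral_ge0 => x _; rewrite ?addr_ge0 ?powR_ge0//.
pose e := Num.min 1 (eta / (2 * K)).
have e0 : 0 < e by rewrite lt_min ltr01 divr_gt0// mulr_gt0.
have e1 : e <= 1 by rewrite ge_min lexx.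
have eK : e * K <= eta / 2.
  have : e <= eta / (2 * K) by rewrite ge_min lexx orbT.
  rewrite ler_pdivlMr ?mulr_gt0// => h; rewrite ler_pdivlMr//; lra.
pose D := (C + 1) * e `^ (1 - p).
have D0 : 0 < D by rewrite mulr_gt0 ?powR_gt0// ltr_wpDl.
exists (eta / (2 * D)); first by rewrite divr_gt0// mulr_gt0.
move=> v h Lv Lh dv dh.
have iv := ig_powB p1 mO Lv Lu; have [_ ih] := ig_powB_rV p1 mO Lh Lg.
have iE := ig_energy Lg Lu; have iE' := ig_energy Lh Lv.
pose B x := (F (g x) - f x * u x) + e * (C * (1 + `|g x| `^ p) + `|f x| `^ q) +
  (C * e `^ (1 - p)) * `|h x - g x| `^ p + e `^ (1 - p) * `|v x - u x| `^ p.
have j1 : ig O (fun x => C * (1 + `|g x| `^ p)) by exact: ig_scale.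
have j2 : ig O (fun x => C * (1 + `|g x| `^ p) + `|f x| `^ q) by exact: ig_add.
have j3 := ig_scale e mO j2.
have j4 := ig_scale (C * e `^ (1 - p)) mO ih.
have j5 := ig_scale (e `^ (1 - p)) mO iv.
have j6 := ig_add mO iE j3; have j7 := ig_add mO j6 j4; have j8 := ig_add mO j7 j5.
apply: (@le_trans _ _ (\int[leb]_(x in O) B x)).
  apply: le_Rintegral => // x _.
  have h1 := convex_perturb cF p1 L0 F0 FL (g x) (h x) e0 e1.
  have h2 := @pair_le e (f x) (v x - u x) e0.
  have h3 := ler_norm (- (f x * (v x - u x))); rewrite normrN in h3.
  rewrite /B -/C in h1 *.
  exact: (lin_pointwise h1 (le_trans h3 h2)).
have -> : \int[leb]_(x in O) B x = \int[leb]_(x in O) (F (g x) - f x * u x) +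
   e * (C * \int[leb]_(x in O) (1 + `|g x| `^ p) + \int[leb]_(x in O) (`|f x| `^ q)) +
   (C * e `^ (1 - p)) * \int[leb]_(x in O) (`|h x - g x| `^ p) +
   e `^ (1 - p) * \int[leb]_(x in O) (`|v x - u x| `^ p).
  by rewrite (RintegralD mO j7 j5) (RintegralD mO j6 j4) (RintegralD mO iE j3) !RintegralZl// (RintegralD mO j1 fi) RintegralZl.
have d1 : C * e `^ (1 - p) * \int[leb]_(x in O) (`|h x - g x| `^ p) <= C * e `^ (1 - p) * (eta / (2 * D)).
  by apply: ler_wpM2l => //; rewrite mulr_ge0 ?powR_ge0.
have d2 : e `^ (1 - p) * \int[leb]_(x in O) (`|v x - u x| `^ p) <= e `^ (1 - p) * (eta / (2 * D)).
  by apply: ler_wpM2l; [exact: powR_ge0|exact: dv].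
have DE : C * e `^ (1 - p) * (eta / (2 * D)) + e `^ (1 - p) * (eta / (2 * D)) = eta / 2.
  by rewrite -mulrDl -[X in _ + X]mul1r -mulrDl -/D; field; rewrite gt_eqF.
have : e * K = e * (C * \int[leb]_(x in O) (1 + `|g x| `^ p) + \int[leb]_(x in O) (`|f x| `^ q)) + e.
  by rewrite /K mulrDr mulr1.
move=> eKE; exact: (lin_perturb _ eK eKE (ltW e0) d1 d2 DE).
Qed.

(** The linear term is absorbed by means of Young's inequality and the Poincare inequality. *)
Lemma energy_coercive (c M : R) : (0 < n)%N -> 0 < c -> 0 < M -> O `<=` cube n M ->
  (forall x, c * `|x| `^ p <= F x) ->
  exists2 K : R, 0 <= K & forall psi, test_function O psi ->
    c / 2 * \int[leb]_(x in O) (`|dgrad psi x| `^ p) <=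
    \int[leb]_(x in O) (F (dgrad psi x) - f x * psi x) + K.
Proof.
move=> n0 c0 M0 OM Fc.
have /(LpP q1 _ mO)[mf fi] := Lf.
have P0 : 0 < (2 * M) `^ p by rewrite powR_gt0// mulr_gt0.
pose y := c / 2 / (2 * M) `^ p; have y0 : 0 < y by rewrite !divr_gt0.
pose d := y `^ (1 - p)^-1; have d0 : 0 < d by rewrite powR_gt0.
have dE : d `^ (1 - p) = y.
  by rewrite /d -powRrM mulVf ?powRr1 ?(ltW y0)// subr_eq0 eq_sym gt_eqF.
exists (d * \int[leb]_(x in O) (`|f x| `^ q)).
  by rewrite mulr_ge0 ?(ltW d0)//; apply: Rintegral_ge0 => x _; exact: powR_ge0.
move=> psi tpsi.
have [Lpsi Ldpsi] : Lp p O psi /\ LpV (dgrad psi).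
  split; first exact: test_Lp tpsi.
  by move=> i; under eq_fun do rewrite mxE; exact: test_Lp (test_partial i tpsi).
have /(LpP p1 _ mO)[_ ipsi] := Lpsi; have /(ig_norm_rV_pow p1 _ mO)[_ idpsi] := Ldpsi.
have iE := ig_energy Ldpsi Lpsi.
have P := poincare n0 p1 M0 OM tpsi mO.
have h : \int[leb]_(x in O) (c * `|dgrad psi x| `^ p) <=
   \int[leb]_(x in O) (F (dgrad psi x) - f x * psi x + (d * `|f x| `^ q + y * `|psi x| `^ p)).
  apply: le_Rintegral => //; first exact: ig_scale.
    apply: ig_add => //; apply: ig_add => //; exact: ig_scale.
  move=> x _; have h1 := Fc (dgrad psi x); have h2 := @pair_le d (f x) (psi x) d0.
  have h3 := ler_norm (f x * psi x); rewrite dE in h2.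
  have := lerD h1 (le_trans h3 h2).
  by rewrite -[X in X <= _]addrC -lerBrDl addrAC.
have i1 := ig_scale d mO fi; have i2 := ig_scale y mO ipsi.
rewrite RintegralZl// (RintegralD mO iE (ig_add mO i1 i2)) (RintegralD mO i1 i2) !RintegralZl// in h.
have h2 : y * \int[leb]_(x in O) (`|psi x| `^ p) <= c / 2 * \int[leb]_(x in O) (`|dgrad psi x| `^ p).
  apply: (le_trans (ler_wpM2l (ltW y0) P)).
  by rewrite mulrA /y divfK// gt_eqF.
exact: (lin_absorb h h2).
Qed.

End convex_energy.
End energies.

(** * Growth bounds and cutoffs *)

Section growth_bounds.
Context {R : realType}.

Let lin_growth (T Cp Ck k a pa b d w : R) :
  0 <= T -> 0 <= Cp -> 0 <= Ck -> 0 <= k -> 0 <= a -> 0 <= pa -> 0 <= b -> 0 <= d -> 0 <= w ->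
  T * (a + Cp * b) + k * (T * (pa + d + a + Ck * (2 * b + w + d))) <=
  T * (1 + Cp + k * (1 + 2 * Ck)) * (a + k * pa + (d + b + w)).
Proof.
move=> T0 Cp0 Ck0 k0 a0 pa0 b0 d0 w0; rewrite -subr_ge0.
have -> : T * (1 + Cp + k * (1 + 2 * Ck)) * (a + k * pa + (d + b + w)) -
    (T * (a + Cp * b) + k * (T * (pa + d + a + Ck * (2 * b + w + d)))) =
  T * ((Cp + 2 * (k * Ck)) * a + (Cp + k + 2 * (k * Ck)) * (k * pa) + (1 + Cp + k * Ck) * d +
       (1 + k) * b + (1 + Cp + k + k * Ck) * w) by ring.
have kC : 0 <= k * Ck by exact: mulr_ge0.
by rewrite mulr_ge0// !addr_ge0// ?mulr_ge0// ?addr_ge0// ?addr_ge0// ?addr_ge0// ?mulr_ge0.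
Qed.

Lemma powR_neg_le1 (h s : R) : 1 <= h -> 0 <= s -> h `^ (- s) <= 1.
Proof.
move=> h1 s0; rewrite powRN invf_le1 ?powR_gt0 ?(lt_le_trans ltr01 h1)//.
by rewrite -[X in X <= _](powRr0 h) ler_powR.
Qed.

Lemma powR_cutoff (p C h b : R) : 0 <= C -> 1 <= h -> 0 <= b ->
  (C / h * b) `^ p = C `^ p * (h `^ (- p) * b `^ p).
Proof.
move=> C0 h1 b0; have h0 : 0 <= h by exact: le_trans h1.
rewrite powRM ?divr_ge0// powRM ?invr_ge0// -mulrA; congr (_ * (_ * _)).
by rewrite -[in LHS](powR_inv1 h0) -powRrM mulN1r.
Qed.

(** The excess of an interpolated gradient when there is no mixed term: a is the size of the old horizontal
gradient, b the distance of the two functions, and C / h bounds the gradient of the cutoff. *)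
Lemma growth_zero (p C : R) : 1 < p -> 0 <= C -> exists2 K : R, 0 < K &
  forall a b h v : R, 0 <= a -> 0 <= b -> 1 <= h -> 0 <= v -> v <= a + C / h * b ->
  v `^ p <= K * (a `^ p + h `^ (- p) * b `^ p).
Proof.
move=> p1 C0; have p0 : 0 <= p by exact: le_trans (ltW p1).
exists (2 `^ p * (1 + C `^ p)); first by rewrite mulr_gt0 ?powR_gt0// ltr_pwDl// powR_ge0.
move=> a b h v a0 b0 h1 v0 vle.
have Ch : 0 <= C / h * b by rewrite !mulr_ge0 ?invr_ge0// (le_trans _ h1).
apply: (le_trans (powR_le_add p0 v0 a0 Ch vle)).
rewrite powR_cutoff// -[X in _ <= X]mulrA ler_wpM2l ?powR_ge0//.
have A := powR_ge0 a p; have C1 := powR_ge0 C p.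
have B : 0 <= h `^ (- p) * b `^ p by rewrite mulr_ge0 ?powR_ge0.
rewrite mulrDl mul1r; apply: lerD; first by rewrite lerDl.
by apply: ler_wpM2l => //; rewrite lerDr.
Qed.

(** The same with the mixed term. The vertical gradient v2 is compared with that of the given function
(s) where it multiplies a, and with that of the comparison function (w) where it multiplies b. Products with the
distance d of the gradients cost p-th powers of d, a and b; powR_mixed_opt splits the product of w with b / h into b^p
and a negative power of h times w^p. *)
Lemma growth_pos (p k C : R) : 1 < p -> 0 < k -> k < p -> 0 <= C -> exists2 K : R, 0 < K &
  forall a b d w s h v v2 : R, 0 <= a -> 0 <= b -> 0 <= d -> 0 <= w -> 0 <= s -> 1 <= h ->
  0 <= v -> 0 <= v2 -> v <= a + C / h * b -> v2 <= s + d -> v2 <= w + d ->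
  v `^ p + k * v2 `^ (p - k) * v `^ k <=
  K * (a `^ p + k * (s `^ (p - k) * a `^ k) +
       (d `^ p + b `^ p + h `^ (- (k * p / (p - k))) * w `^ p)).
Proof.
move=> p1 k0 kp C0; have p0 : 0 <= p by exact: le_trans (ltW p1).
have k00 := ltW k0; have pk0 : 0 <= p - k by rewrite subr_ge0 ltW.
exists (2 `^ p * (1 + C `^ p + k * (1 + 2 * C `^ k))).
  apply: mulr_gt0; first by rewrite powR_gt0.
  apply: ltr_pwDl; first by apply: ltr_pwDl => //; exact: powR_ge0.
  by rewrite mulr_ge0// addr_ge0// mulr_ge0// powR_ge0.
move=> a b d w s h v v2 a0 b0 d0 w0 s0 h1 v0 v20 hv hv1 hv2.
have h0 : 0 < h by exact: lt_le_trans h1.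
have Ch : 0 <= C / h * b by rewrite !mulr_ge0 ?invr_ge0// ltW.
have X1 := powR_le_add p0 v0 a0 Ch hv; rewrite powR_cutoff// in X1.
have X2 := powR_le_add k00 v0 a0 Ch hv; rewrite powR_cutoff// in X2.
have Y1 := powR_le_add pk0 v20 s0 d0 hv1.
have Y2 := powR_le_add pk0 v20 w0 d0 hv2.
have m1 := powR_mixed1 k00 (ltW kp) d0 a0.
have m2 := powR_mixed_opt k0 kp w0 b0 h0.
have m3 := powR_mixed1 k00 (ltW kp) d0 b0.
have hp := powR_neg_le1 h1 p0; have hk := powR_neg_le1 h1 k00.
have T2 : (2 : R) `^ k * 2 `^ (p - k) = 2 `^ p by rewrite -powR_split// addrC subrK.
have Pp (x y : R) : 0 <= x `^ y by exact: powR_ge0.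
have Z1 : v `^ p <= 2 `^ p * (a `^ p + C `^ p * b `^ p).
  apply: (le_trans X1); rewrite ler_wpM2l// lerD2l ler_wpM2l//.
  by rewrite ler_piMl.
have Z2 : v2 `^ (p - k) * v `^ k <= 2 `^ p * (s `^ (p - k) * a `^ k + d `^ p + a `^ p +
     C `^ k * (2 * b `^ p + h `^ (- (k * p / (p - k))) * w `^ p + d `^ p)).
  apply: (le_trans (ler_wpM2l (Pp _ _) X2)).
  have E : v2 `^ (p - k) * (2 `^ k * (a `^ k + C `^ k * (h `^ (- k) * b `^ k))) =
     2 `^ k * (v2 `^ (p - k) * a `^ k) + 2 `^ k * (C `^ k * (h `^ (- k) * (v2 `^ (p - k) * b `^ k))) by ring.
  have U1 : v2 `^ (p - k) * a `^ k <= 2 `^ (p - k) * (s `^ (p - k) * a `^ k + (d `^ p + a `^ p)).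
    apply: (le_trans (ler_wpM2r (Pp _ _) Y1)).
    by rewrite -mulrA ler_wpM2l// mulrDl lerD2l.
  have U2 : h `^ (- k) * (v2 `^ (p - k) * b `^ k) <=
      2 `^ (p - k) * ((b `^ p + h `^ (- (k * p / (p - k))) * w `^ p) + (d `^ p + b `^ p)).
    apply: (@le_trans _ _ (h `^ (- k) * (2 `^ (p - k) * (w `^ (p - k) + d `^ (p - k)) * b `^ k))).
      by rewrite ler_wpM2l// ler_wpM2r.
    have -> : h `^ (- k) * (2 `^ (p - k) * (w `^ (p - k) + d `^ (p - k)) * b `^ k) =
      2 `^ (p - k) * (h `^ (- k) * (w `^ (p - k) * b `^ k) + h `^ (- k) * (d `^ (p - k) * b `^ k)) by ring.
    rewrite ler_wpM2l// lerD//; apply: le_trans m3.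
    by rewrite ler_piMl// mulr_ge0.
  rewrite E -T2.
  have W1 := ler_wpM2l (Pp 2 k) U1.
  have W2 := ler_wpM2l (Pp 2 k) (ler_wpM2l (Pp C k) U2).
  apply: (le_trans (lerD W1 W2)).
  by rewrite le_eqVlt; apply/orP; left; apply/eqP; ring.
have Z3 := ler_wpM2l k00 Z2.
rewrite -mulrA; apply: (le_trans (lerD Z1 Z3)).
by apply: lin_growth => //; rewrite mulr_ge0.
Qed.

End growth_bounds.

Section cutoffs.
Context {R : realType} {r m : nat}.

Definition cutoff (t h : R) (x : 'rV[R]_(r + m)) : R :=
  \prod_(i < r) plateau t h (x ord0 (lshift m i)).

Lemma smooth_cutoff t h : smooth (cutoff t h).
Proof. by apply: smooth_prod => i; apply: smooth_elementary; exact: elementary_plateau. Qed.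

Lemma cutoff_ge0 t h x : 0 <= cutoff t h x.
Proof. by apply: prodr_ge0 => i _; exact: plateau_ge0. Qed.

Lemma cutoff_le1 t h x : cutoff t h x <= 1.
Proof. by apply: prodr_ile1 => i _; rewrite plateau_ge0 plateau_le1. Qed.

Lemma cutoff1 t h x : 0 < h -> `|lsubmx x| <= t -> cutoff t h x = 1.
Proof.
move=> h0 xt; rewrite /cutoff big1// => i _; apply: plateau1 => //.
by apply: le_trans xt; have := coord_norm_le (lsubmx x) i; rewrite mxE.
Qed.

Lemma cutoff0 t h x : 0 < h -> 0 <= t -> t + h <= `|lsubmx x| -> cutoff t h x = 0.
Proof.
move=> h0 t0; rewrite leNgt norm_rV_lt; last exact: ltr_wpDl.
move=> /forallPn[i]; rewrite -leNgt mxE => hi.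
by rewrite /cutoff (bigD1 i)//= plateau0// mul0r.
Qed.

Lemma prod_partial_le n I (s : seq I) (F : I -> 'rV[R]_n -> R) j x : (forall i, smooth (F i)) ->
  (forall i x, `|F i x| <= 1) ->
  `|partial j (fun x => \prod_(i <- s) F i x) x| <= \sum_(i <- s) `|partial j (F i) x|.
Proof.
move=> sF F1; elim: s => [|i s IHs].
  rewrite big_nil (_ : (fun x => _) = fun=> 1); last by apply/funext => y; rewrite big_nil.
  by rewrite /partial derive_cst normr0.
rewrite big_cons (_ : (fun x => _) = (fun y => F i y * \prod_(i <- s) F i y)); last first.
  by apply/funext => y; rewrite big_cons.
rewrite partialM//; last exact: smooth_prod.
rewrite addrC (le_trans (ler_normD _ _))// lerD//.
  rewrite normrM ler_piMl// normr_prod; apply: prodr_ile1 => k _.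
  by rewrite normr_ge0 F1.
by rewrite normrM; apply: le_trans IHs; rewrite ler_piMl.
Qed.

(** Each horizontal derivative acts on one factor of the product only. *)
Lemma partial_cutoff_l : exists2 C : R, 0 < C &
  forall t h x i, 0 <= t -> 1 <= h -> `|partial (lshift m i) (cutoff t h) x| <= C / h.
Proof.
have [C C0 hC] := @plateau_derive_le R; exists C => // t h x i t0 h1.
have Ch : 0 <= C / h by rewrite divr_ge0 ?(ltW C0)// (le_trans _ h1).
apply: (le_trans (prod_partial_le _ _ _ _ _)).
- by move=> j; apply: smooth_elementary; exact: elementary_plateau.
- by move=> j y; rewrite ger0_norm ?plateau_ge0 ?plateau_le1.
rewrite (bigD1 i)//= [X in _ + X]big1 ?addr0.
  have [_] := derivable_elementary (lshift m i) (lshift m i) x (elementary_plateau t h).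
  by rewrite eqxx /partial => ->; exact: hC.
move=> j ji; have [_] := derivable_elementary (lshift m j) (lshift m i) x (elementary_plateau t h).
by rewrite /partial (inj_eq (@lshift_inj _ _)) (negbTE ji) => ->; rewrite normr0.
Qed.

Lemma partial_cutoff_r t h x (i : 'I_m) : partial (rshift r i) (cutoff t h) x = 0.
Proof.
apply/eqP; rewrite -normr_le0; apply: (le_trans (prod_partial_le _ _ _ _ _)).
- by move=> j; apply: smooth_elementary; exact: elementary_plateau.
- by move=> j y; rewrite ger0_norm ?plateau_ge0 ?plateau_le1.
rewrite big1// => j _.
have [_] := derivable_elementary (lshift m j) (rshift r i) x (elementary_plateau t h).
by rewrite /partial eq_lrshift => ->; rewrite normr0.
Qed.

End cutoffs.

Section linear_arithmetic.
Context {R : realFieldType}.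

Lemma lin_gap (m a a' e bS : R) : m <= 2^-1 * a + 2^-1 * a' - bS ->
  a' <= m + e -> m <= a -> m <= a' -> bS <= a - a' + e + e.
Proof. lra. Qed.

Lemma lin_near (m a a' e : R) : m <= a -> a' <= m + e -> 0 <= a - a' + e.
Proof. lra. Qed.

Lemma lin_double (a a' mu K0 e : R) : a' <= mu + e -> e <= 1 ->
  a + K0 + (a' + K0) <= a - a' + e + 2 * (mu + 1 + K0).
Proof. lra. Qed.

Lemma lin_regroup (A a a' e : R) : 0 <= e -> A + (a - a' + e) <= A + a - a' + e + e.
Proof. lra. Qed.

Lemma lin_regroup2 (A a a' e : R) : A + (a - a' + e) + e = A + a - a' + e + e.
Proof. ring. Qed.

End linear_arithmetic.

(** * The energy of a slice *)

Section setting.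
Context {R : realType} {r m : nat}.
Local Notation ig D f := (leb.-integrable D (EFin \o f)).

Lemma norm_row0 (y : 'rV[R]_m) : `|row_mx (0 : 'rV[R]_r) y| = `|y|.
Proof.
apply/eqP; rewrite eq_le; apply/andP; split.
  by rewrite norm_row_mx_le// normr0 normr_ge0 lexx.
by have := norm_rsubmx_le (row_mx (0 : 'rV[R]_r) y); rewrite row_mxKr.
Qed.

Lemma F2_convex (F : 'rV[R]_(r + m) -> R) : convex_function [set: 'rV[R]_(r + m)] F ->
  convex_function [set: 'rV[R]_m] (F2 F).
Proof.
move=> cF t x y _ _.
have t01 : 0 <= t%:num <= 1 by apply/andP.
have := convex_le cF (row_mx 0 x) (row_mx 0 y) t01.
by rewrite !scale_row_mx add_row_mx !scaler0 addr0.
Qed.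

Lemma dgrad_slice (u : 'rV[R]_(r + m) -> R) (x : 'rV[R]_r) y : smooth u ->
  dgrad (fun y => u (row_mx x y)) y = rsubmx (dgrad u (row_mx x y)).
Proof. by move=> su; apply/rowP => i; rewrite !mxE partial_slice. Qed.

Definition excess_growth (p k : R) (x : 'rV[R]_(r + m)) : R :=
  `|lsubmx x| `^ p + k * `|rsubmx x| `^ (p - k) * `|lsubmx x| `^ k.

(** The hypotheses on the integrand and on the data, for the maximum norm: c and L are the constants of
the bounds from below and from above, and strict convexity is kept at midpoints only. *)
Record admissible (p q k c L M : R) (F : 'rV[R]_(r + m) -> R)
  (omega : set 'rV[R]_m) (f : 'rV[R]_m -> R) : Prop := Admissible {
  adm_p : 1 < p;
  adm_pq : p^-1 + q^-1 = 1;
  adm_k0 : 0 <= k;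
  adm_kp : k < p;
  adm_c : 0 < c;
  adm_L : 0 <= L;
  adm_convex : convex_function [set: 'rV[R]_(r + m)] F;
  adm_low : forall x, c * `|x| `^ p <= F x;
  adm_up : forall x, F x <= L * (1 + `|x| `^ p);
  adm_Glow : forall x, c * excess_growth p k x <= F x - F2 F (rsubmx x);
  adm_Gup : forall x, F x - F2 F (rsubmx x) <= L * excess_growth p k x;
  adm_strict : 0 < k -> exists2 b : R, 0 < b & forall x y,
    F2 F (2^-1 *: x + 2^-1 *: y) <= 2^-1 * F2 F x + 2^-1 * F2 F y - b * `|x - y| `^ p;
  adm_m : (0 < m)%N;
  adm_M : 0 < M;
  adm_open : open omega;
  adm_sub : omega `<=` cube m M;
  adm_f : Lp q omega f }.

Variables (p q k c L M : R) (F : 'rV[R]_(r + m) -> R).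
Variables (omega : set 'rV[R]_m) (f : 'rV[R]_m -> R).
Hypothesis H : admissible p q k c L M F omega f.

Let p1 : 1 < p := adm_p H.
Let p0 : 0 < p. Proof. exact: lt_trans p1. Qed.
Let p00 : 0 <= p. Proof. exact: ltW. Qed.
Let k0 := adm_k0 H.
Let c0 := adm_c H.
Let L0 := adm_L H.

Lemma adm_measurable : measurable omega.
Proof. exact: open_rV_measurable (adm_open H). Qed.
Let mO := adm_measurable.

Lemma adm_finite : (leb omega < +oo)%E.
Proof.
apply: (@le_lt_trans _ _ (leb (cube m M))).
  by apply: le_measure; rewrite ?inE//; [exact: cube_measurable|exact: adm_sub H].
by rewrite leb_cube ?ltry// (adm_M H).
Qed.
Let Ofin := adm_finite.

Lemma F_ge0 x : 0 <= F x.
Proof. by apply: le_trans (adm_low H x); rewrite mulr_ge0 ?powR_ge0// ltW. Qed.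

Lemma F2_ge0 y : 0 <= F2 F y.
Proof. exact: F_ge0. Qed.

Lemma F2_low y : c * `|y| `^ p <= F2 F y.
Proof. by apply: le_trans (adm_low H _); rewrite norm_row0. Qed.

Lemma F2_up y : F2 F y <= L * (1 + `|y| `^ p).
Proof. by apply: le_trans (adm_up H _) _; rewrite norm_row0. Qed.

Definition excess x := F x - F2 F (rsubmx x).

Lemma excess_growth_ge0 x : 0 <= excess_growth p k x.
Proof. by rewrite addr_ge0 ?powR_ge0// mulr_ge0 ?powR_ge0// mulr_ge0 ?powR_ge0. Qed.

Lemma excess_ge0 x : 0 <= excess x.
Proof. by apply: le_trans (adm_Glow H x); rewrite mulr_ge0 ?excess_growth_ge0// ltW. Qed.

Lemma ig_F2 g : LpV p omega g -> ig omega (fun y => F2 F (g y)).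
Proof.
move=> Lg; apply: (ig_convex p1 (F2_convex (adm_convex H)) L0 F2_ge0 F2_up mO Ofin Lg).
Qed.

Lemma test_LpV n (O D : set 'rV[R]_n) u : measurable D -> test_function O u ->
  Lp p D u /\ LpV p D (dgrad u).
Proof.
move=> mD tu; split; first exact: (test_Lp p1 mD tu).
by move=> i; under eq_fun do rewrite mxE; exact: (test_Lp p1 mD (test_partial i tu)).
Qed.

Definition J2 (psi : 'rV[R]_m -> R) := \int[leb]_(y in omega) (F2 F (dgrad psi y) - f y * psi y).

Lemma ig_J2 psi : test_function omega psi ->
  ig omega (fun y => F2 F (dgrad psi y) - f y * psi y).
Proof.
move=> tpsi; have [Lpsi Ldpsi] := test_LpV mO tpsi.
by apply: ig_sub => //; [exact: ig_F2|exact: (ig_pairing p1 (adm_pq H) mO (adm_f H) Lpsi)].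
Qed.

Lemma J2_coercive : exists2 K : R, 0 <= K & forall psi, test_function omega psi ->
  c / 2 * \int[leb]_(y in omega) (`|dgrad psi y| `^ p) <= J2 psi + K.
Proof.
exact: (energy_coercive p1 (adm_pq H) (F2_convex (adm_convex H)) L0 F2_ge0 F2_up mO Ofin
  (adm_f H) (adm_m H) c0 (adm_M H) (adm_sub H) F2_low).
Qed.

(** What a cutoff in the unbounded directions adds to the energy density: w is
the value of the comparison gradient and b stands for the distance of the two
functions. *)
Definition cutoff_cost (h : R) (y w : 'rV[R]_m) (b : R) : R :=
  if k == 0 then h `^ (- p) * b `^ p
  else `|y - w| `^ p + b `^ p + h `^ (- (k * p / (p - k))) * `|w| `^ p.

(** The exponent q such that a transition of width h costs h^(-q) per unit volume. The assumption that
relates r to p and k says that it exceeds r. *)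
Definition decay : R := if k == 0 then p else k * p / (p - k).

Let lin_cutoff (G g G' g' K X : R) :
  G <= L * g -> g <= K * (g' + X) -> c * g' <= G' -> 0 <= X -> 0 <= K -> 0 <= G' ->
  G <= (L * K * (c^-1 + 1)) * (G' + X).
Proof.
move=> h1 h2 h3 X0 K0 G'0.
have h4 : g' <= c^-1 * G' by rewrite ler_pdivlMl.
apply: (le_trans h1); rewrite -!mulrA; apply: ler_wpM2l => //.
apply: (le_trans h2); apply: ler_wpM2l => //.
rewrite mulrDl mul1r !mulrDr; apply: (le_trans (lerD h4 (lexx X))).
rewrite addrACA; apply: lerD; first by rewrite lerDl.
by rewrite lerDr mulr_ge0 ?invr_ge0// ltW.
Qed.

(** The growth bounds applied to the gradients x of the given function and z of its interpolation with a
function of gradient w. *)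
Lemma excess_cutoff (C : R) : 0 <= C -> exists2 K : R, 0 < K &
  forall (x z : 'rV[R]_(r + m)) (w : 'rV[R]_m) (b h : R), 0 <= b -> 1 <= h ->
  `|lsubmx z| <= `|lsubmx x| + C / h * b ->
  `|rsubmx z| <= `|rsubmx x| + `|rsubmx x - w| ->
  `|rsubmx z| <= `|w| + `|rsubmx x - w| ->
  excess z <= K * (excess x + cutoff_cost h (rsubmx x) w b).
Proof.
move=> C0; have [k_eq0|k_neq0] := eqVneq k 0.
  have [K K0 hK] := growth_zero p1 C0.
  exists (L * K * (c^-1 + 1) + 1).
    by apply: ltr_wpDl => //; rewrite !mulr_ge0 ?(ltW K0)// addr_ge0// invr_ge0 ltW.
  move=> x z w b h b0 h1 hl _ _.
  have X0 : 0 <= cutoff_cost h (rsubmx x) w b.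
    by rewrite /cutoff_cost k_eq0 eqxx mulr_ge0 ?powR_ge0.
  have E y : excess_growth p k y = `|lsubmx y| `^ p.
    by rewrite /excess_growth k_eq0 !mul0r addr0.
  have := hK _ _ _ _ (normr_ge0 _) b0 h1 (normr_ge0 _) hl.
  move=> h2; apply: (@le_trans _ _ (L * K * (c^-1 + 1) * (excess x + cutoff_cost h (rsubmx x) w b))).
    apply: (lin_cutoff (adm_Gup H z) _ (adm_Glow H x) X0 (ltW K0) (excess_ge0 x)).
    by rewrite !E /cutoff_cost k_eq0 eqxx.
  by apply: ler_wpM2r; [rewrite addr_ge0 ?excess_ge0|rewrite lerDl].
have kpos : 0 < k by rewrite lt_neqAle eq_sym k_neq0 k0.
have [K K0 hK] := growth_pos p1 kpos (adm_kp H) C0.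
exists (L * K * (c^-1 + 1) + 1).
  by apply: ltr_wpDl => //; rewrite !mulr_ge0 ?(ltW K0)// addr_ge0// invr_ge0 ltW.
move=> x z w b h b0 h1 hl hr1 hr2.
have X0 : 0 <= cutoff_cost h (rsubmx x) w b.
  by rewrite /cutoff_cost (negbTE k_neq0) !addr_ge0 ?mulr_ge0 ?powR_ge0.
have := hK _ _ _ _ _ _ _ _ (normr_ge0 (lsubmx x)) b0 (normr_ge0 (rsubmx x - w)) (normr_ge0 w)
  (normr_ge0 (rsubmx x)) h1 (normr_ge0 (lsubmx z)) (normr_ge0 (rsubmx z)) hl hr1 hr2.
move=> h2; apply: (@le_trans _ _ (L * K * (c^-1 + 1) * (excess x + cutoff_cost h (rsubmx x) w b))).
  apply: (lin_cutoff (adm_Gup H z) _ (adm_Glow H x) X0 (ltW K0) (excess_ge0 x)).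
  by rewrite /excess_growth /cutoff_cost (negbTE k_neq0) -[k * _ * _ in X in _ <= X]mulrA.
by apply: ler_wpM2r; [rewrite addr_ge0 ?excess_ge0|rewrite lerDl].
Qed.

Variable mu : R.
Hypothesis Jmu : forall psi, test_function omega psi -> mu <= J2 psi.

(** The energy of the midpoint of psi and w is at least mu, whereas strict convexity puts it below
the mean of the two energies by a multiple of the distance. *)
Lemma strict_convexity_gap : 0 < k -> exists2 K : R, 0 < K &
  forall psi w e, test_function omega psi -> test_function omega w -> J2 w <= mu + e ->
  \int[leb]_(y in omega) (`|dgrad psi y - dgrad w y| `^ p) <= K * (J2 psi - J2 w + e + e).
Proof.
move=> /(adm_strict H)[b b0 hb]; exists b^-1; first by rewrite invr_gt0.
move=> psi w e tpsi tw hw; rewrite ler_pdivlMl//.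
have tz : test_function omega (fun y => 2^-1 * psi y + 2^-1 * w y).
  by apply: testD; exact: testZ.
have dz y : dgrad (fun y => 2^-1 * psi y + 2^-1 * w y) y = 2^-1 *: dgrad psi y + 2^-1 *: dgrad w y.
  have sp := test_smooth tpsi; have sw := test_smooth tw.
  have s1 := test_smooth (testZ 2^-1 tpsi); have s2 := test_smooth (testZ 2^-1 tw).
  apply/rowP => i; rewrite !mxE (partialD _ s1 s2).
  rewrite (partialM _ (smooth_cst _) sp) (partialM _ (smooth_cst _) sw) /partial derive_cst.
  by rewrite !mulr0 !addr0.
have [Lpsi Ldpsi] := test_LpV mO tpsi; have [Lw Ldw] := test_LpV mO tw.
have [_ iB] := ig_powB_rV p1 mO Ldpsi Ldw.
have i1 := ig_J2 tpsi; have i2 := ig_J2 tw; have i3 := ig_J2 tz.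
have j1 := ig_scale 2^-1 mO i1; have j2 := ig_scale 2^-1 mO i2; have j3 := ig_scale b mO iB.
have j4 := ig_add mO j1 j2.
have h : J2 (fun y => 2^-1 * psi y + 2^-1 * w y) <= \int[leb]_(y in omega)
   (2^-1 * (F2 F (dgrad psi y) - f y * psi y) + 2^-1 * (F2 F (dgrad w y) - f y * w y) -
    b * `|dgrad psi y - dgrad w y| `^ p).
  apply: le_Rintegral => //; first exact: ig_sub.
  move=> y _; rewrite dz; have hy := hb (dgrad psi y) (dgrad w y).
  rewrite -subr_ge0 in hy; rewrite -subr_ge0; apply: (le_trans hy).
  by rewrite le_eqVlt; apply/orP; left; apply/eqP; ring.
rewrite RintegralB// RintegralD// !RintegralZl// -/(J2 psi) -/(J2 w) in h.
exact: (lin_gap (le_trans (Jmu tz) h) hw (Jmu tpsi) (Jmu tw)).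
Qed.

Let P2M : R := (2 * M) `^ p.
Let P2M0 : 0 <= P2M. Proof. exact: powR_ge0. Qed.

Lemma poincare_diff psi w : test_function omega psi -> test_function omega w ->
  \int[leb]_(y in omega) (`|w y - psi y| `^ p) <=
  P2M * \int[leb]_(y in omega) (`|dgrad psi y - dgrad w y| `^ p).
Proof.
move=> tpsi tw; have P := poincare (adm_m H) p1 (adm_M H) (adm_sub H) (testB tw tpsi) mO.
have E : \int[leb]_(y in omega) (`|dgrad psi y - dgrad w y| `^ p) =
    \int[leb]_(y in omega) (`|dgrad (fun y => w y - psi y) y| `^ p).
  apply: eq_Rintegral => y _.
  by rewrite (dgradB y (test_smooth tw) (test_smooth tpsi)) distrC.
rewrite E; exact: P.
Qed.

Let lin0 (h K1 K2 K3 a a' : R) : 0 <= h -> h <= 1 -> 0 <= K1 -> 0 <= K2 -> 0 <= a' -> 0 <= a ->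
  K1 * (a + h * (K2 * (a' + K3))) <= K1 * (1 + K2 + K2 * `|K3|) * (a + a' + h).
Proof.
move=> h0 h1 K10 K20 a'0 a0; rewrite -[X in _ <= X]mulrA ler_wpM2l//.
have e1 : h * (K2 * (a' + K3)) <= K2 * a' + h * (K2 * `|K3|).
  rewrite mulrDr mulrDr lerD//; first by rewrite ler_piMl// mulr_ge0.
  by rewrite ler_wpM2l// ler_wpM2l// ler_norm.
have n0 : 0 <= K2 * `|K3| by rewrite mulr_ge0.
apply: (le_trans (lerD (lexx a) e1)); rewrite -subr_ge0.
have -> : (1 + K2 + K2 * `|K3|) * (a + a' + h) - (a + (K2 * a' + h * (K2 * `|K3|))) =
  (K2 + K2 * `|K3|) * a + (1 + K2 * `|K3|) * a' + (1 + K2) * h by ring.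
by rewrite !addr_ge0// mulr_ge0// addr_ge0.
Qed.

Let lin1 (h K1 K2 K4 a a' e : R) : 0 <= h -> 0 <= K1 -> 0 <= K2 -> 0 <= K4 -> 0 <= a' -> 0 <= a -> 0 <= e ->
  K1 * (a + (K2 * (a' + e) + P2M * (K2 * (a' + e)) + h * K4)) <=
  K1 * (1 + K2 + P2M * K2 + K4) * (a + a' + e + h).
Proof.
move=> h0 K10 K20 K40 a'0 a0 e0; rewrite -[X in _ <= X]mulrA ler_wpM2l//.
have n0 : 0 <= P2M * K2 by rewrite mulr_ge0.
rewrite -subr_ge0.
have -> : (1 + K2 + P2M * K2 + K4) * (a + a' + e + h) - (a + (K2 * (a' + e) + P2M * (K2 * (a' + e)) + h * K4)) =
  (K2 + P2M * K2 + K4) * a + (1 + K4) * a' + (1 + K4) * e + (1 + K2 + P2M * K2) * h by ring.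
by rewrite !addr_ge0// mulr_ge0// !addr_ge0.
Qed.

(** x and z are the gradients on a slice of a function and of the competitor that interpolates between it
and a near minimizer w of the cross-sectional problem. For k = 0 the distance of the slice psi to w has the small
factor h^(-p), and coercivity is enough to bound it; for k > 0 it has none, and strict convexity bounds it by the
difference of the energies. *)
Lemma slice_bound (C : R) : 0 <= C -> exists2 K : R, 0 < K &
  forall psi w (e h : R) (x z : 'rV[R]_m -> 'rV[R]_(r + m)),
  test_function omega psi -> test_function omega w ->
  0 <= e -> e <= 1 -> J2 w <= mu + e -> 1 <= h ->
  ig omega (fun y => F (x y)) -> ig omega (fun y => F (z y)) ->
  LpV p omega (fun y => rsubmx (z y)) ->
  (forall y, rsubmx (x y) = dgrad psi y) ->
  (forall y, `|lsubmx (z y)| <= `|lsubmx (x y)| + C / h * `|w y - psi y|) ->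
  (forall y, `|rsubmx (z y)| <= `|dgrad psi y| + `|dgrad psi y - dgrad w y|) ->
  (forall y, `|rsubmx (z y)| <= `|dgrad w y| + `|dgrad psi y - dgrad w y|) ->
  \int[leb]_(y in omega) excess (z y) <=
  K * (\int[leb]_(y in omega) (F (x y) - f y * psi y) - J2 w + e + e + h `^ (- decay)).
Proof.
move=> C0.
have [K1 K10 hK1] := excess_cutoff C0.
have [K0 K00 hK0] := J2_coercive.
pose Kw := 2 / c * (mu + 1 + K0).
have wbound w e : test_function omega w -> e <= 1 -> J2 w <= mu + e ->
    \int[leb]_(y in omega) (`|dgrad w y| `^ p) <= Kw.
  move=> tw e1 hw; have h := hK0 _ tw.
  have h2 : c / 2 * \int[leb]_(y in omega) (`|dgrad w y| `^ p) <= mu + 1 + K0.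
    by apply: (le_trans h); rewrite lerD2r (le_trans hw)// lerD2l.
  have c2 : 0 < c / 2 by rewrite divr_gt0.
  by rewrite /Kw -[2 / c]invf_div ler_pdivlMl.
have common psi w (e h : R) (x z : 'rV[R]_m -> 'rV[R]_(r + m)) :
  test_function omega psi -> test_function omega w -> 0 <= e -> J2 w <= mu + e -> 1 <= h ->
  ig omega (fun y => F (x y)) -> ig omega (fun y => F (z y)) ->
  LpV p omega (fun y => rsubmx (z y)) ->
  (forall y, rsubmx (x y) = dgrad psi y) ->
  (forall y, `|lsubmx (z y)| <= `|lsubmx (x y)| + C / h * `|w y - psi y|) ->
  (forall y, `|rsubmx (z y)| <= `|dgrad psi y| + `|dgrad psi y - dgrad w y|) ->
  (forall y, `|rsubmx (z y)| <= `|dgrad w y| + `|dgrad psi y - dgrad w y|) ->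
  ig omega (fun y => cutoff_cost h (dgrad psi y) (dgrad w y) `|w y - psi y|) ->
  [/\ 0 <= \int[leb]_(y in omega) excess (x y), 0 <= J2 psi - J2 w + e,
    \int[leb]_(y in omega) (F (x y) - f y * psi y) = \int[leb]_(y in omega) excess (x y) + J2 psi &
    \int[leb]_(y in omega) excess (z y) <= K1 * (\int[leb]_(y in omega) excess (x y) +
      \int[leb]_(y in omega) cutoff_cost h (dgrad psi y) (dgrad w y) `|w y - psi y|)].
  move=> tpsi tw e0 hw h1 ix iz Lz xE hl hr1 hr2 ic.
  have [Lpsi Ldpsi] := test_LpV mO tpsi.
  have ixE : ig omega (fun y => excess (x y)).
    apply: ig_sub => //; apply: (ig_eq mO (f := fun y => F2 F (dgrad psi y))).
      by move=> y _; rewrite xE.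
    exact: ig_F2.
  have izE : ig omega (fun y => excess (z y)) by apply: ig_sub => //; exact: ig_F2.
  split.
  - by apply: Rintegral_ge0 => y _; exact: excess_ge0.
  - exact: (lin_near (Jmu tpsi) hw).
  - rewrite /J2 -RintegralD//; last exact: ig_J2.
    by apply: eq_Rintegral => y _; rewrite /excess xE; ring.
  rewrite -RintegralD// -RintegralZl//; last exact: ig_add.
  apply: le_Rintegral => //; first by apply: ig_scale => //; exact: ig_add.
  by move=> y _; have := hK1 (x y) (z y) (dgrad w y) `|w y - psi y| h; rewrite xE; apply.
have [k_eq0|k_neq0] := eqVneq k 0.
  pose K2 := P2M * (2 `^ p * (2 / c)).
  have K20 : 0 <= K2 by rewrite !mulr_ge0 ?powR_ge0// ?invr_ge0 ltW.
  exists (K1 * (1 + K2 + K2 * `|2 * (mu + 1 + K0)|)).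
    by rewrite mulr_gt0// -addrA ltr_wpDr// addr_ge0// mulr_ge0.
  move=> psi w e h x z tpsi tw e0 e1 hw h1 ix iz Lz xE hl hr1 hr2.
  have [Lpsi Ldpsi] := test_LpV mO tpsi; have [Lw Ldw] := test_LpV mO tw.
  have iwp := ig_powB p1 mO Lw Lpsi.
  have ccE y : cutoff_cost h (dgrad psi y) (dgrad w y) `|w y - psi y| = h `^ (- p) * `|w y - psi y| `^ p.
    by rewrite /cutoff_cost k_eq0 eqxx.
  have ic : ig omega (fun y => cutoff_cost h (dgrad psi y) (dgrad w y) `|w y - psi y|).
    by under eq_fun do rewrite ccE; exact: ig_scale.
  have [a0 b0 E] := common _ _ _ _ _ _ tpsi tw e0 hw h1 ix iz Lz xE hl hr1 hr2 ic.
  have ccI : \int[leb]_(y in omega) cutoff_cost h (dgrad psi y) (dgrad w y) `|w y - psi y| =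
      h `^ (- p) * \int[leb]_(y in omega) (`|w y - psi y| `^ p).
    rewrite -(RintegralZl _ mO iwp); apply: eq_Rintegral => y _; exact: ccE.
  rewrite ccI => hz; apply: (le_trans hz).
  have B : \int[leb]_(y in omega) (`|w y - psi y| `^ p) <= K2 * ((J2 psi - J2 w + e) + 2 * (mu + 1 + K0)).
    apply: (le_trans (poincare_diff tpsi tw)); rewrite /K2 -!mulrA ler_wpM2l//.
    have /(ig_norm_rV_pow p1 _ mO)[_ idpsi] := Ldpsi; have /(ig_norm_rV_pow p1 _ mO)[_ idw] := Ldw.
    have [_ iB] := ig_powB_rV p1 mO Ldpsi Ldw.
    apply: (@le_trans _ _ (\int[leb]_(y in omega) (2 `^ p * (`|dgrad psi y| `^ p + `|dgrad w y| `^ p)))).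
      have j1 := ig_add mO idpsi idw; have j2 := ig_scale (2 `^ p) mO j1.
      apply: (le_Rintegral mO iB j2) => y _.
      exact: (powR_le_add p00 (normr_ge0 _) (normr_ge0 _) (normr_ge0 _) (ler_normB _ _)).
    rewrite (RintegralZl _ mO (ig_add mO idpsi idw)) (RintegralD mO idpsi idw).
    apply: ler_wpM2l; first exact: powR_ge0.
    have h1' := hK0 _ tpsi; have h2' := hK0 _ tw.
    have c2 : 0 < c / 2 by rewrite divr_gt0.
    rewrite mulrA -[2 / c]invf_div ler_pdivlMl// mulrDr; apply: (le_trans (lerD h1' h2')).
    exact: lin_double.
  have hp0 : 0 <= h `^ (- p) by exact: powR_ge0.
  have hp1 := powR_neg_le1 h1 p00.
  have dE : decay = p by rewrite /decay k_eq0 eqxx.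
  have W := lin0 (2 * (mu + 1 + K0)) hp0 hp1 (ltW K10) K20 b0 a0.
  apply: (@le_trans _ _ (K1 * (\int[leb]_(y in omega) excess (x y) +
      h `^ (- p) * (K2 * ((J2 psi - J2 w + e) + 2 * (mu + 1 + K0)))))).
    by rewrite ler_wpM2l ?(ltW K10)// lerD2l ler_wpM2l.
  apply: (le_trans W); rewrite E dE; apply: ler_wpM2l.
    by rewrite mulr_ge0 ?(ltW K10)// !addr_ge0// mulr_ge0.
  by rewrite lerD2r; exact: lin_regroup.
have kpos : 0 < k by rewrite lt_neqAle eq_sym k_neq0 k0.
have [K2 K20 hK2] := strict_convexity_gap kpos.
exists (K1 * (1 + K2 + P2M * K2 + `|Kw|)).
  by rewrite mulr_gt0// -!addrA ltr_wpDr// addr_ge0 ?(ltW K20)// addr_ge0// mulr_ge0// ltW.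
move=> psi w e h x z tpsi tw e0 e1 hw h1 ix iz Lz xE hl hr1 hr2.
have [Lpsi Ldpsi] := test_LpV mO tpsi; have [Lw Ldw] := test_LpV mO tw.
have iwp := ig_powB p1 mO Lw Lpsi.
have [_ iB] := ig_powB_rV p1 mO Ldpsi Ldw.
have /(ig_norm_rV_pow p1 _ mO)[_ idw] := Ldw.
have dE : decay = k * p / (p - k) by rewrite /decay (negbTE k_neq0).
have ccE y : cutoff_cost h (dgrad psi y) (dgrad w y) `|w y - psi y| =
   `|dgrad psi y - dgrad w y| `^ p + `|w y - psi y| `^ p + h `^ (- decay) * `|dgrad w y| `^ p.
  by rewrite /cutoff_cost (negbTE k_neq0) dE.
have j1 := ig_add mO iB iwp; have j2 := ig_scale (h `^ (- decay)) mO idw.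
have ic : ig omega (fun y => cutoff_cost h (dgrad psi y) (dgrad w y) `|w y - psi y|).
  by under eq_fun do rewrite ccE; exact: ig_add.
have [a0 b0 E] := common _ _ _ _ _ _ tpsi tw e0 hw h1 ix iz Lz xE hl hr1 hr2 ic.
have ccI : \int[leb]_(y in omega) cutoff_cost h (dgrad psi y) (dgrad w y) `|w y - psi y| =
    \int[leb]_(y in omega) (`|dgrad psi y - dgrad w y| `^ p) + \int[leb]_(y in omega) (`|w y - psi y| `^ p) +
    h `^ (- decay) * \int[leb]_(y in omega) (`|dgrad w y| `^ p).
  rewrite -(RintegralZl _ mO idw) -(RintegralD mO iB iwp) -(RintegralD mO j1 j2).
  apply: eq_Rintegral => y _; exact: ccE.
rewrite ccI => hz; apply: (le_trans hz).
have S := hK2 _ _ _ tpsi tw hw.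
have B := le_trans (poincare_diff tpsi tw) (ler_wpM2l P2M0 S).
have Wb : \int[leb]_(y in omega) (`|dgrad w y| `^ p) <= `|Kw|.
  by apply: le_trans (ler_norm _); exact: wbound e1 hw.
have hp0 : 0 <= h `^ (- decay) by exact: powR_ge0.
have W := lin1 hp0 (ltW K10) (ltW K20) (normr_ge0 Kw) b0 a0 e0.
apply: (@le_trans _ _ (K1 * (\int[leb]_(y in omega) excess (x y) +
   (K2 * (J2 psi - J2 w + e + e) + P2M * (K2 * (J2 psi - J2 w + e + e)) + h `^ (- decay) * `|Kw|)))).
  rewrite ler_wpM2l ?(ltW K10)// lerD2l; apply: lerD; first exact: lerD.
  by rewrite ler_wpM2l.
apply: (le_trans W); rewrite E; apply: ler_wpM2l.
  by rewrite mulr_ge0 ?(ltW K10)// !addr_ge0 ?(ltW K20)// mulr_ge0// ltW.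
by rewrite lerD2r lin_regroup2.
Qed.

End setting.

Section linear_arithmetic.
Context {R : realFieldType}.

Lemma lin_slice (X Jw Jp e rho E0 E1 K h : R) : 0 <= rho -> rho <= 1 -> 0 <= E0 -> 0 <= e ->
  0 <= Jp - Jw + e -> E1 <= K * (X - Jw + e + e + h) ->
  - (2 * K * e + e + K * h) <= K * (X - Jw) - (E1 - E0 - rho * (Jp - Jw)).
Proof.
move=> r0 r1 E00 e0 hb h1.
have h2 : rho * (Jp - Jw) >= - e.
  have : 0 <= rho * (Jp - Jw + e) by exact: mulr_ge0.
  have : rho * e <= e by rewrite ler_piMl.
  rewrite mulrDr; lra.
have E : K * (X - Jw + e + e + h) = K * (X - Jw) + 2 * K * e + K * h by ring.
rewrite E in h1; lra.
Qed.

Lemma lin_convex (Fz F2z Fx a b rho f u w : R) : F2z <= (1 - rho) * a + rho * b ->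
  (Fz - f * (u + rho * (w - u))) - (Fx - f * u) <=
  (Fz - F2z) - (Fx - a) - rho * ((a - f * u) - (b - f * w)).
Proof.
rewrite -subr_ge0 => h; rewrite -subr_ge0; apply: (le_trans h).
by rewrite le_eqVlt; apply/orP; left; apply/eqP; ring.
Qed.

Lemma lin_final (IQ IR IS K D N N' d : R) : IS = IQ + IR -> 0 <= D + d -> D = - IQ + (K * IR - N) ->
  - N' <= N -> (1 + K) * IQ <= K * IS + d + N'.
Proof. by move=> -> h1 h2 h3; lra. Qed.

End linear_arithmetic.

(** * Comparison with an interpolated competitor *)

Section comparison.
Context {R : realType} {r m : nat}.
Local Notation ig D f := (leb.-integrable D (EFin \o f)).

Lemma ig_rsubmx (A : set 'rV[R]_r) (B : set 'rV[R]_m) g : measurable A -> (leb A < +oo)%E ->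
  measurable B -> ig B g -> ig (rect A B) (fun x => g (rsubmx x)).
Proof.
move=> mA Afin mB gi; have mAB := rect_measurable mA mB.
pose gB := (EFin \o g) \_ B.
have gBi : leb.-integrable setT gB by apply/(integrable_mkcond _ mB).1.
have mgB : measurable_fun setT gB by exact: measurable_int gBi.
pose G (x : 'rV[R]_(r + m)) : \bar R := ((\1_A (lsubmx x))%:E * gB (rsubmx x))%E.
have mG : measurable_fun setT G.
  apply: emeasurable_funM.
    apply/measurable_EFinP; apply: measurableT_comp; first exact: measurable_indic.
    exact: measurable_lsubmx.
  by apply: measurableT_comp => //; exact: measurable_rsubmx.
have GE : (EFin \o (fun x : 'rV[R]_(r + m) => g (rsubmx x))) \_ (rect A B) = G.
  apply/funext => x; rewrite /G /gB !patchE indicE.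
  have [xA|xA] := boolP (lsubmx x \in A); last first.
    rewrite mul0e ifN//; apply: contra xA; rewrite !inE; by case.
  rewrite mul1e; have -> : (x \in rect A B) = (rsubmx x \in B); last by [].
  apply/idP/idP; rewrite !inE; first by case.
  by move=> xB; split => //; rewrite inE in xA.
apply/(integrable_mkcond _ mAB).2; rewrite GE; apply/integrableP; split => //.
rewrite ge0_integral_rV_split//; last exact: measurableT_comp.
have I x : (\int[leb]_y `|G (row_mx x y)| = (\1_A x)%:E * \int[leb]_y `|gB y|)%E.
  rewrite -ge0_integralZl//; last exact: measurableT_comp.
  apply: eq_integral => y _; rewrite /G row_mxKl row_mxKr abseM; congr (_ * _)%E.
  by rewrite gee0_abs.
under eq_integral do rewrite I.
have [_ gBfin] := integrableP _ _ _ gBi.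
have Ifin : (\int[leb]_y `|gB y|)%E \is a fin_num.
  by rewrite ge0_fin_numE// integral_ge0.
rewrite ge0_integralZr//.
- rewrite integral_indic// setIT lte_mul_pinfty// ?ge0_fin_numE//.
- by apply/measurable_EFinP; exact: measurable_indic.
- exact: integral_ge0.
Qed.

Lemma Lp_rsubmx s (A : set 'rV[R]_r) (B : set 'rV[R]_m) g : 1 < s -> measurable A -> (leb A < +oo)%E ->
  measurable B -> Lp s B g -> Lp s (rect A B) (fun x => g (rsubmx x)).
Proof.
move=> s1 mA Afin mB /(LpP s1 _ mB)[mg gi]; have mAB := rect_measurable mA mB.
apply/(LpP s1 _ mAB); split; last exact: (ig_rsubmx mA Afin mB gi).
apply: (eq_measurable_fun (fun x => (g \_ B) (rsubmx x))).
  by move=> x; rewrite inE => -[_ xB]; rewrite patchE mem_set.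
apply: measurable_funTS; apply: measurableT_comp; last exact: measurable_rsubmx.
by apply/(measurable_restrictT _ mB).
Qed.

Lemma rect_finite (A : set 'rV[R]_r) (B : set 'rV[R]_m) : measurable A -> (leb A < +oo)%E ->
  measurable B -> (leb B < +oo)%E -> (leb (rect A B) < +oo)%E.
Proof.
move=> mA Afin mB Bfin; have mAB := rect_measurable mA mB.
have := ig_rsubmx mA Afin mB (ig_cst 1 mB Bfin) => /integrableP[_].
under eq_integral do rewrite /= normr1.
by rewrite integral_cst//= mul1e.
Qed.

Definition competitor (phi : 'rV[R]_(r + m) -> R) (w : 'rV[R]_m -> R) t h (x : 'rV[R]_(r + m)) : R :=
  phi x + cutoff t h x * (w (rsubmx x) - phi x).

Section competitor_facts.
Variables (phi : 'rV[R]_(r + m) -> R) (w : 'rV[R]_m -> R) (t h : R).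
Variables (A : set 'rV[R]_r) (B : set 'rV[R]_m).
Hypothesis t0 : 0 < t.
Hypothesis h1 : 1 <= h.
Hypothesis tphi : test_function (rect A B) phi.
Hypothesis tw : test_function B w.
Hypothesis slabA : [set x | `|x| <= t + h] `<=` A.

Let h0 : 0 < h. Proof. exact: lt_le_trans h1. Qed.
Let sphi := test_smooth tphi.
Let sw := test_smooth tw.
Let swr := @smooth_rsubmx _ r _ _ sw.
Let sc := @smooth_cutoff R r m t h.
Let sd := smoothB swr sphi.

Lemma cutoff_rsubmx_test : test_function (rect A B) (fun x => cutoff t h x * w (rsubmx x)).
Proof.
split; first exact: smoothM.
have [_ [K [cK KB wK]]] := tw.
exists ([set x : 'rV[R]_(r + m) | `|lsubmx x| <= t + h] `&` [set x | K (rsubmx x)]); split.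
- have cB : compact (cbox (- const_mx (t + h)) (const_mx (t + h)) : set 'rV[R]_r) by exact: cbox_compact.
  apply: (@bounded_closed_compact R).
    have : bounded_set K by exact: compact_bounded.
    move=> [M [Mr MK]]; exists (Num.max (t + h) (M + 1)); split; first exact: num_real.
    move=> N; rewrite gt_max => /andP[N1 N2] x [/= x1 x2].
    rewrite -[x]hsubmxK norm_row_mx_le; last first.
      by rewrite (le_trans _ (ltW N1))// addr_ge0// ltW.
    apply/andP; split; first by apply: (le_trans x1); exact: ltW.
    have MM : M < M + 1 by rewrite ltrDl.
    by apply: le_trans (ltW N2); exact: (MK _ MM).
  apply: closedI.
    apply: (@closed_comp _ _ (fun x : 'rV[R]_(r + m) => `|lsubmx x|) [set s : R | s <= t + h]); last exact: closed_le.
    move=> x _; apply: continuous_comp; [exact: continuous_lsubmx|exact: norm_continuous].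
  apply: (@closed_comp _ _ (fun x : 'rV[R]_(r + m) => rsubmx x) K); last exact: compact_closed_rV.
  by move=> x _; exact: continuous_rsubmx.
- by move=> x [/= x1 x2]; split; [exact: slabA|exact: KB].
move=> x /not_andP[/= /negP|x2]; last by rewrite wK// mulr0.
by rewrite -ltNge => x1; rewrite cutoff0 ?mul0r// ltW.
Qed.

Lemma competitor_test : test_function (rect A B) (competitor phi w t h).
Proof.
have -> : competitor phi w t h = (fun x => phi x + (cutoff t h x * w (rsubmx x) - cutoff t h x * phi x)).
  by apply/funext => x; rewrite /competitor mulrBr.
apply: (testD tphi); apply: testB; first exact: cutoff_rsubmx_test.
exact: (test_mul sc tphi).
Qed.

Lemma competitor_partial i x : partial i (competitor phi w t h) x =
  partial i phi x + (cutoff t h x * (partial i (fun x => w (rsubmx x)) x - partial i phi x) +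
    (w (rsubmx x) - phi x) * partial i (cutoff t h) x).
Proof.
rewrite /competitor (partialD i sphi (smoothM sc sd)) (partialM i sc sd).
by rewrite (partialB i swr sphi).
Qed.

Lemma competitor_rsubmx x : rsubmx (dgrad (competitor phi w t h) x) =
  (1 - cutoff t h x) *: rsubmx (dgrad phi x) + cutoff t h x *: dgrad w (rsubmx x).
Proof.
apply/rowP => i; rewrite !mxE competitor_partial partial_cutoff_r mulr0 addr0.
rewrite partial_rsubmx_r//; ring.
Qed.

Lemma competitor_lsubmx C x : 0 <= C ->
  (forall i, `|partial (lshift m i) (cutoff t h) x| <= C / h) ->
  `|lsubmx (dgrad (competitor phi w t h) x)| <=
  `|lsubmx (dgrad phi x)| + C / h * `|w (rsubmx x) - phi x|.
Proof.
move=> C0 hC; have Ch : 0 <= C / h by rewrite divr_ge0// ltW.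
have S0 : 0 <= `|lsubmx (dgrad phi x)| + C / h * `|w (rsubmx x) - phi x|.
  by rewrite addr_ge0// mulr_ge0.
rewrite (norm_rV_le _ S0); apply/forallP => i.
rewrite !mxE competitor_partial partial_rsubmx_l// sub0r mulrN addrA.
apply: (le_trans (ler_normD _ _)); apply: lerD.
  apply: (@le_trans _ _ `|partial (lshift m i) phi x|).
    have -> : partial (lshift m i) phi x - cutoff t h x * partial (lshift m i) phi x =
      (1 - cutoff t h x) * partial (lshift m i) phi x by ring.
    rewrite normrM ler_piMl// ger0_norm ?subr_ge0 ?cutoff_le1//.
    by rewrite lerBlDr lerDl cutoff_ge0.
  by have := coord_norm_le (lsubmx (dgrad phi x)) i; rewrite !mxE.
by rewrite normrM mulrC ler_wpM2r.
Qed.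

Lemma competitor_core x : `|lsubmx x| < t ->
  competitor phi w t h x = w (rsubmx x) /\
  dgrad (competitor phi w t h) x = row_mx 0 (dgrad w (rsubmx x)).
Proof.
move=> xt; have c1 : cutoff t h x = 1 by rewrite cutoff1// ltW.
split; first by rewrite /competitor c1 mul1r subrKC.
have dc i : partial i (cutoff t h) x = 0.
  have E : partial i (fun x => cutoff t h x - 1) x = 0.
    apply: (@partial_support R _ (fun x => cutoff t h x - 1) [set x | t <= `|lsubmx x|] i).
    - apply: (@closed_comp _ _ (fun x : 'rV[R]_(r + m) => `|lsubmx x|) [set s : R | t <= s]); last exact: closed_ge.
      by move=> y _; apply: continuous_comp; [exact: continuous_lsubmx|exact: norm_continuous].
    - by move=> y /negP; rewrite -ltNge => yt; rewrite cutoff1 ?subrr// ltW.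
    - by apply/negP; rewrite -ltNge.
  rewrite (partialB i sc (smooth_cst 1)) in E.
  by rewrite -[LHS]subr0 -[RHS]E; congr (_ - _); rewrite /partial derive_cst.
apply/rowP => i; case: (split_ordP i) => j ->.
  rewrite row_mxEl !mxE competitor_partial c1 dc mulr0 addr0 partial_rsubmx_l//.
  by rewrite mul1r sub0r subrr.
rewrite row_mxEr !mxE competitor_partial c1 dc mulr0 addr0 partial_rsubmx_r//.
by rewrite mul1r subrKC.
Qed.

(** The competitor differs from phi only on a compact subset of the cylinder over a slightly larger
cube, so the energies need only be compared there. *)
Lemma competitor_support : exists K : set 'rV[R]_(r + m),
  [/\ K `<=` rect A B, K `<=` rect (cube r (t + 2 * h)) B & forall x, ~ K x ->
    competitor phi w t h x = phi x /\ dgrad (competitor phi w t h) x = dgrad phi x].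
Proof.
have [sD [K [cK KO dK]]] := testB competitor_test tphi.
pose S := [set x : 'rV[R]_(r + m) | `|lsubmx x| <= t + h].
have cS : closed S.
  apply: (@closed_comp _ _ (fun x : 'rV[R]_(r + m) => `|lsubmx x|) [set s : R | s <= t + h]); last exact: closed_le.
  by move=> y _; apply: continuous_comp; [exact: continuous_lsubmx|exact: norm_continuous].
have sup : support_in (fun x => competitor phi w t h x - phi x) (K `&` S).
  move=> x /not_andP[/dK//|/negP]; rewrite -ltNge => xS.
  by rewrite /competitor cutoff0 ?mul0r ?addr0 ?subrr// ltW.
have cKS : closed (K `&` S) by apply: closedI => //; exact: compact_closed_rV.
exists (K `&` S); split.
- by move=> x [/KO].
- move=> x [/KO[xA xB] xS]; split => //=; apply: (le_lt_trans xS).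
  by rewrite ltrD2l mulr_natl mulr2n ltrDl.
move=> x nx; split; first by apply/eqP; rewrite -subr_eq0; apply/eqP; exact: sup.
apply/rowP => i; rewrite !dgradE; apply/eqP; rewrite -subr_eq0; apply/eqP.
have := @partial_support R _ _ _ i cKS sup x nx.
by rewrite (partialB i (test_smooth competitor_test) sphi).
Qed.

End competitor_facts.

Variables (p q k c L M : R) (F : 'rV[R]_(r + m) -> R).
Variables (omega : set 'rV[R]_m) (f : 'rV[R]_m -> R).
Hypothesis H : admissible p q k c L M F omega f.
Let p1 := adm_p H.
Let mO := adm_measurable H.
Let Ofin := adm_finite H.

Lemma dgrad_bounded n (O : set 'rV[R]_n) u : test_function O u ->
  exists2 B : R, 0 <= B & forall x, `|dgrad u x| <= B.
Proof.
move=> tu; have /choice[B hB] : forall i, exists B : R, forall x, `|partial i u x| <= B.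
  by move=> i; have [B _ hB] := test_bounded (test_partial i tu); exists B.
have B0 i : 0 <= B i by exact: le_trans (normr_ge0 _) (hB i 0).
exists (\sum_i B i); first by apply: sumr_ge0.
move=> x; rewrite norm_rV_le ?sumr_ge0//; apply/forallP => i; rewrite dgradE.
by apply: (le_trans (hB i x)); rewrite (bigD1 i)//= lerDl sumr_ge0.
Qed.

Lemma ig_slice_F (O : set 'rV[R]_(r + m)) u x : test_function O u ->
  ig omega (fun y => F (dgrad u (row_mx x y))).
Proof.
move=> tu; have [B B0 hB] := dgrad_bounded tu.
apply: (ig_bound (M := L * (1 + B `^ p))) => //.
  have mF := convex_measurable p1 (adm_convex H) (adm_L H) (F_ge0 H) (adm_up H).
  apply: measurable_funTS; apply: (measurableT_comp mF).
  apply: (measurableT_comp (measurable_dgrad measurableT (test_smooth tu))).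
  have -> : row_mx x = (fun z : 'rV[R]_r * 'rV[R]_m => row_mx z.1 z.2) \o (fun y => (x, y)) by [].
  by apply: (measurableT_comp (@measurable_row_mx R r m)); exact: measurable_pair1.
move=> y _; rewrite ger0_norm ?(F_ge0 H)//; apply: (le_trans (adm_up H _)).
apply: ler_wpM2l; first exact: adm_L H.
by rewrite lerD2l powR_mono// ltW// (lt_trans _ p1).
Qed.

Definition fbar (x : 'rV[R]_(r + m)) := f (rsubmx x).

Lemma ig_energy_rect (A : set 'rV[R]_r) (O : set 'rV[R]_(r + m)) u : measurable A -> (leb A < +oo)%E ->
  test_function O u -> ig (rect A omega) (fun x => F (dgrad u x) - fbar x * u x).
Proof.
move=> mA Afin tu; have mAB := rect_measurable mA mO.
have [Lu Ldu] := test_LpV H mAB tu.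
apply: (ig_energy p1 (adm_pq H) (adm_convex H) (adm_L H) (F_ge0 H) (adm_up H) mAB _ _ Ldu Lu).
- exact: rect_finite.
- exact: (Lp_rsubmx (conj_gt1 p1 (adm_pq H)) mA Afin mO (adm_f H)).
Qed.

(** Difference of the energy densities of phi and of the function w of x''. Subtracting w removes from the
energy of phi over a cube its leading term, the volume times mu. *)
Definition gap phi w (x : 'rV[R]_(r + m)) : R :=
  F (dgrad phi x) - fbar x * phi x - (F2 F (dgrad w (rsubmx x)) - fbar x * w (rsubmx x)).

Lemma ig_gap (A : set 'rV[R]_r) (O : set 'rV[R]_(r + m)) phi w : measurable A -> (leb A < +oo)%E ->
  test_function O phi -> test_function omega w -> ig (rect A omega) (gap phi w).
Proof.
move=> mA Afin tphi tw; apply: ig_sub; first exact: rect_measurable.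
  exact: ig_energy_rect tphi.
exact: (ig_rsubmx mA Afin mO (ig_J2 H tw)).
Qed.

Lemma fbar_row x y : fbar (row_mx x y) = f y.
Proof. by rewrite /fbar row_mxKr. Qed.

Lemma slice_energy O phi x : (forall x y, O (row_mx x y) -> omega y) -> test_function O phi ->
  [/\ test_function omega (fun y => phi (row_mx x y)),
     ig omega (fun y => F (dgrad phi (row_mx x y)) - f y * phi (row_mx x y)) &
    forall w, test_function omega w -> \int[leb]_(y in omega) gap phi w (row_mx x y) =
     \int[leb]_(y in omega) (F (dgrad phi (row_mx x y)) - f y * phi (row_mx x y)) - J2 F omega f w].
Proof.
move=> Oomega tphi.
have ts : test_function omega (fun y => phi (row_mx x y)) by apply: test_slice tphi => y; exact: Oomega.
have i1 : ig omega (fun y => F (dgrad phi (row_mx x y)) - f y * phi (row_mx x y)).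
  apply: ig_sub => //; first exact: ig_slice_F tphi.
  have [Ls _] := test_LpV H mO ts; exact: (ig_pairing p1 (adm_pq H) mO (adm_f H) Ls).
split => // w tw; rewrite /J2 -(RintegralB mO i1 (ig_J2 H tw)).
by apply: eq_Rintegral => y _; rewrite /gap fbar_row row_mxKr.
Qed.

Variable mu : R.
Hypothesis Jmu : forall psi, test_function omega psi -> mu <= J2 F omega f psi.

(** phi is nearly minimal, hence the integral of the change D of energy density is at least -d. On the inner
cylinder D is minus the gap. On the annulus slice_bound shows that D is slice by slice at most K times the gap plus
small terms: the hole filling trick of adding K times the gap over the inner cylinder gives the inequality. *)
Lemma comparison : exists2 K : R, 0 < K & forall (A : set 'rV[R]_r) phi w (e d t h : R),
  measurable A -> (leb A < +oo)%E -> [set x | `|x| <= t + h] `<=` A ->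
  test_function (rect A omega) phi ->
  (forall v, test_function (rect A omega) v ->
    \int[leb]_(x in rect A omega) (F (dgrad phi x) - fbar x * phi x) <=
    \int[leb]_(x in rect A omega) (F (dgrad v x) - fbar x * v x) + d) ->
  test_function omega w -> 0 <= e -> e <= 1 -> J2 F omega f w <= mu + e ->
  0 < t -> 1 <= h ->
  (1 + K) * \int[leb]_(x in rect (cube r t) omega) gap phi w x <=
  K * \int[leb]_(x in rect (cube r (t + 2 * h)) omega) gap phi w x + d +
  (2 * K * e + e + K * h `^ (- decay p k)) * (2 * (t + 2 * h)) ^+ r.
Proof.
have [C C0 hC] := @partial_cutoff_l R r m.
have [K K0 hK] := slice_bound H Jmu (ltW C0).
exists K => // A phi w e d t h mA Afin slabA tphi phimin tw e0 e1 hw t0 h1.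
have h0 : 0 < h by exact: lt_le_trans h1.
have s0 : 0 < t + 2 * h by rewrite addr_gt0// mulr_gt0.
pose v := competitor phi w t h; pose om := rect A omega.
have tv : test_function om v by exact: competitor_test.
pose D x := (F (dgrad v x) - fbar x * v x) - (F (dgrad phi x) - fbar x * phi x).
pose Q := cube r t; pose S := cube r (t + 2 * h); pose U := S `\` Q.
have mQ : measurable Q by exact: cube_measurable.
have mS : measurable S by exact: cube_measurable.
have mU : measurable U by exact: measurableD.
have QS : Q `<=` S.
  by move=> x /= xt; apply: (lt_trans xt); rewrite ltrDl mulr_gt0.
have Sfin : (leb S < +oo)%E by rewrite leb_cube// ltry.
have Qfin : (leb Q < +oo)%E by apply: le_lt_trans Sfin; apply: le_measure; rewrite ?inE.
have US : U `<=` S by move=> x [].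
have leUS : (leb U <= leb S)%E by apply: le_measure; rewrite ?inE.
have Ufin : (leb U < +oo)%E by exact: le_lt_trans Sfin.
have iD B : measurable B -> (leb B < +oo)%E -> ig (rect B omega) D.
  move=> mB Bfin; apply: ig_sub; first exact: rect_measurable.
    exact: ig_energy_rect tv.
  exact: ig_energy_rect tphi.
have ig_gap' B : measurable B -> (leb B < +oo)%E -> ig (rect B omega) (gap phi w).
  by move=> mB Bfin; exact: ig_gap tphi tw.
have mrQ := rect_measurable mQ mO; have mrU := rect_measurable mU mO.
have DO : \int[leb]_(x in om) D x = \int[leb]_(x in rect S omega) D x.
  have [K' [K'A K'S hK']] := competitor_support t0 h1 tphi tw slabA.
  apply: (@Rintegral_support R _ om K' (rect S omega) D K'A K'S).
  by move=> x /hK'[]; rewrite /D /v => -> ->; rewrite subrr.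
have D_ge0 : 0 <= \int[leb]_(x in rect S omega) D x + d.
  rewrite -DO /D (RintegralB (rect_measurable mA mO)).
  - by have := phimin _ tv; rewrite -subr_ge0 addrAC.
  - exact: ig_energy_rect tv.
  - exact: ig_energy_rect tphi.
have splitD := Rintegral_rect_setD mS mQ mO QS (iD S mS Sfin).
have splitG := Rintegral_rect_setD mS mQ mO QS (ig_gap' S mS Sfin).
rewrite -/U in splitD splitG.
have DQ : \int[leb]_(x in rect Q omega) D x = - \int[leb]_(x in rect Q omega) gap phi w x.
  rewrite -mulN1r -(RintegralZl _ mrQ (ig_gap' _ mQ Qfin)).
  apply: eq_Rintegral => x; rewrite inE => -[xQ _].
  have [vE dvE] := competitor_core h1 tphi tw xQ.
  by rewrite mulN1r /D /v vE dvE /gap [RHS]opprB.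
pose g x := K * gap phi w x - D x.
have iKg : ig (rect U omega) (fun x => K * gap phi w x).
  by apply: ig_scale => //; exact: ig_gap'.
have iU := iD _ mU Ufin.
have iGU := ig_gap' _ mU Ufin.
have ing : ig (rect U omega) g by exact: ig_sub.
have Oom (x : 'rV[R]_r) (y : 'rV[R]_m) : om (row_mx x y) -> omega y by move=> /rect_row[].
have hslice (x : 'rV[R]_r) : - (2 * K * e + e + K * h `^ (- decay p k)) <= \int[leb]_(y in omega) g (row_mx x y).
  have [tps i1 gE] := slice_energy x Oom tphi.
  have [tvs i2 _] := slice_energy x Oom tv.
  pose xi y := dgrad phi (row_mx x y); pose ze y := dgrad v (row_mx x y).
  pose psi y := phi (row_mx x y).
  have xiE y : rsubmx (xi y) = dgrad psi y by rewrite dgrad_slice//; exact: test_smooth tphi.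
  have zeE y : rsubmx (ze y) = (1 - cutoff t h (row_mx x y)) *: dgrad psi y + cutoff t h (row_mx x y) *: dgrad w y.
    by rewrite /ze (competitor_rsubmx t h tphi tw) row_mxKr -xiE.
  pose rho := cutoff t h (row_mx x (0 : 'rV[R]_m)).
  have rhoE y : cutoff t h (row_mx x y) = rho.
    by rewrite /rho /cutoff; apply: eq_bigr => i _; rewrite !row_mxEl.
  have rho0 : 0 <= rho by exact: cutoff_ge0.
  have rho1 : rho <= 1 by exact: cutoff_le1.
  have ize := ig_slice_F x tv; have ixi := ig_slice_F x tphi.
  have Lz : LpV p omega (fun y => rsubmx (ze y)).
    have [_] := test_LpV H mO tvs; congr LpV; apply/funext => y.
    by rewrite dgrad_slice//; exact: test_smooth tv.
  have hb := hK psi w e h xi ze tps tw e0 e1 hw h1 ixi ize Lz xiE.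
  have {}hb : \int[leb]_(y in omega) excess F (ze y) <=
      K * (\int[leb]_(y in omega) (F (xi y) - f y * psi y) - J2 F omega f w + e + e + h `^ (- decay p k)).
    apply: hb.
    - move=> y; have := @competitor_lsubmx phi w t h A omega h1 tphi tw C (row_mx x y) (ltW C0).
      by rewrite row_mxKr; apply => i; apply: hC => //; exact: ltW.
    - move=> y; rewrite zeE rhoE.
      have -> : (1 - rho) *: dgrad psi y + rho *: dgrad w y = dgrad psi y - rho *: (dgrad psi y - dgrad w y).
        by apply/rowP => i; rewrite !mxE; ring.
      rewrite (le_trans (ler_normB _ _))// lerD2l normrZ ger0_norm//.
      by rewrite ler_piMl.
    - move=> y; rewrite zeE rhoE.
      have -> : (1 - rho) *: dgrad psi y + rho *: dgrad w y = dgrad w y + (1 - rho) *: (dgrad psi y - dgrad w y).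
        by apply/rowP => i; rewrite !mxE; ring.
      rewrite (le_trans (ler_normD _ _))// lerD2l normrZ ger0_norm ?subr_ge0//.
      by rewrite ler_piMl// lerBlDr lerDl.
  have [_ Ldps] := test_LpV H mO tps.
  have iexz : ig omega (fun y => excess F (ze y)) by apply: (ig_sub mO ize); exact: (ig_F2 H Lz).
  have iexx : ig omega (fun y => excess F (xi y)).
    by apply: (ig_sub mO ixi); under eq_fun do rewrite xiE; exact: (ig_F2 H Ldps).
  have iJp := ig_J2 H tps; have iJw := ig_J2 H tw.
  (* the convexity of F'' along the interpolation bounds D by the change of the excess minus rho times the gap of the
     cross-sectional energies *)
  pose Dub y := excess F (ze y) - excess F (xi y) -
    rho * ((F2 F (dgrad psi y) - f y * psi y) - (F2 F (dgrad w y) - f y * w y)).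
  have k1 := ig_sub mO iexz iexx; have k2 := ig_sub mO iJp iJw; have k3 := ig_scale rho mO k2.
  have iDub : ig omega Dub by exact: ig_sub.
  have gapE y : gap phi w (row_mx x y) = (F (xi y) - f y * psi y) - (F2 F (dgrad w y) - f y * w y).
    by rewrite /gap fbar_row row_mxKr.
  have igap : ig omega (fun y => gap phi w (row_mx x y)).
    by under eq_fun do rewrite gapE; exact: ig_sub.
  have DE y : D (row_mx x y) = (F (ze y) - f y * v (row_mx x y)) - (F (xi y) - f y * psi y).
    by rewrite /D fbar_row.
  have iDs : ig omega (fun y => D (row_mx x y)).
    by under eq_fun do rewrite DE; exact: ig_sub.
  have ig1 := ig_scale K mO igap.
  apply: (@le_trans _ _ (\int[leb]_(y in omega) (K * gap phi w (row_mx x y) - Dub y))); last first.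
    apply: le_Rintegral => //; first exact: ig_sub.
      exact: ig_sub.
    move=> y _; rewrite /g lerD2l lerN2 DE /Dub.
    have cvx := convex_le (F2_convex (adm_convex H)) (dgrad psi y) (dgrad w y) (t := 1 - rho).
    have -> : v (row_mx x y) = psi y + rho * (w y - psi y).
      by rewrite /v /competitor rhoE row_mxKr.
    have : F2 F (rsubmx (ze y)) <= (1 - rho) * F2 F (dgrad psi y) + rho * F2 F (dgrad w y).
      have := cvx; rewrite subr_ge0 rho1 lerBlDr lerDl rho0 => /(_ isT).
      by rewrite zeE rhoE (_ : 1 - (1 - rho) = rho)//; ring.
    by rewrite /excess xiE => cv; exact: lin_convex.
  rewrite (RintegralB mO ig1 iDub) (RintegralZl _ mO igap) gE//.
  rewrite /Dub (RintegralB mO k1 k3) (RintegralB mO iexz iexx) (RintegralZl _ mO k2) (RintegralB mO iJp iJw).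
  apply: (lin_slice rho0 rho1 _ e0 _ hb).
    by apply: Rintegral_ge0 => y _; exact: (excess_ge0 H).
  exact: (lin_near (Jmu tps) hw).
have key := slice_le mU mO Ufin ing (aeW _ (fun x _ => hslice x)).
rewrite (RintegralB mrU iKg iU) (RintegralZl _ mrU iGU) in key.
set kap := 2 * K * e + e + K * h `^ (- decay p k) in key *.
have kap0 : 0 <= kap by rewrite !addr_ge0// ?mulr_ge0 ?powR_ge0// ltW.
have NN : - (kap * (2 * (t + 2 * h)) ^+ r) <= - kap * fine (leb U).
  rewrite mulNr lerN2 ler_wpM2l//.
  have -> : (2 * (t + 2 * h)) ^+ r = fine (leb S) by rewrite leb_cube.
  by apply: fine_le => //; rewrite ge0_fin_numE.
have NN2 := le_trans NN key.
rewrite splitD DQ in D_ge0.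
apply: (lin_final splitG D_ge0 _ NN2).
by rewrite subKr.
Qed.

End comparison.

(** * Iteration over dilated cubes *)

Section iteration.
Context {R : realType}.

(** The error grows like s^j at step j but is reached with the factor th^j; as th s < 1 the total is
a convergent geometric sum. *)
Lemma geometric_iteration (th s A : R) (E : nat -> R) J : 0 <= th -> th * s < 1 ->
  (forall j, (j < J)%N -> E j <= th * E j.+1 + A * s ^+ j) ->
  E 0%N <= th ^+ J * E J + A * ((1 - (th * s) ^+ J) / (1 - th * s)).
Proof.
move=> th0 k1; elim: J => [_|J IHJ hE]; first by rewrite !expr0 mul1r subrr mul0r mulr0 addr0.
have k0 : 1 - th * s != 0 by rewrite subr_eq0 eq_sym lt_eqF.
have h := hE J (ltnSn J).
have {}IHJ := IHJ (fun j jJ => hE j (ltnW jJ)).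
apply: (le_trans IHJ).
have h2 := ler_wpM2l (exprn_ge0 J th0) h.
apply: (@le_trans _ _ (th ^+ J * (th * E J.+1 + A * s ^+ J) + A * ((1 - (th * s) ^+ J) / (1 - th * s)))).
  by rewrite lerD2r.
rewrite le_eqVlt; apply/orP; left; apply/eqP.
by rewrite exprS [(th * s) ^+ J.+1]exprS exprMn; field.
Qed.

(** Ratio of the radii: large enough to reach infinity, small enough for the
volumes not to compensate the contraction factor K / (1 + K). *)
Lemma dilation_ratio (K : R) r : (0 < r)%N -> 0 < K ->
  exists2 s : R, 1 < s & K / (1 + K) * s ^+ r < 1 /\ (1 + K) * (1 - K / (1 + K) * s ^+ r) = 2^-1.
Proof.
move=> r0 K0; have K1 : 0 < 1 + K by rewrite addr_gt0.
(* s^r = 1 + 1 / (2K) gives K / (1 + K) s^r = (K + 1/2) / (K + 1) *)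
pose y := 1 + (2 * K)^-1.
have y1 : 1 < y by rewrite ltrDl invr_gt0 mulr_gt0.
have y0 : 0 <= y by rewrite ltW// (lt_trans _ y1).
have rn0 : r%:R != 0 :> R by rewrite pnatr_eq0 -lt0n.
exists (y `^ r%:R^-1).
  have h1 : (1 : R) `^ r%:R^-1 = 1 by rewrite powR1.
  rewrite -[X in X < _]h1; apply: gt0_ltr_powR => //; rewrite ?nnegrE//.
  by rewrite invr_gt0 ltr0n.
have -> : (y `^ r%:R^-1) ^+ r = y.
  by rewrite -powR_mulrn ?powR_ge0// -powRrM mulVf// powRr1.
have K0' : K != 0 by rewrite gt_eqF.
have K1' : 1 + K != 0 by rewrite gt_eqF.
have E : (1 + K) * (1 - K / (1 + K) * y) = 2^-1.
  by rewrite /y; field; rewrite K0' K1'.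
split=> //; rewrite -subr_gt0 -(pmulr_rgt0 _ K1) E.
by rewrite invr_gt0.
Qed.

(** Large T makes T^(r - q) small because r < q. *)
Lemma small_power (c q r : R) (eta t0 : R) : 0 < c -> r < q -> 0 < eta ->
  exists2 T : R, t0 <= T /\ 0 < T & c * T `^ (r - q) <= eta.
Proof.
move=> c0 rq eta0; pose X := (c / eta) `^ (q - r)^-1.
have ce : 0 < c / eta by rewrite divr_gt0.
have X0 : 0 < X by rewrite powR_gt0.
exists (Num.max t0 X); first by rewrite le_max lexx lt_max X0 orbT.
set T := Num.max t0 X; have XT : X <= T by rewrite le_max lexx orbT.
have qr : 0 < q - r by rewrite subr_gt0.
have T0 : 0 < T by exact: lt_le_trans XT.
rewrite -(opprB q r) powRN -ler_pdivlMr ?invr_gt0 ?powR_gt0// invrK mulrC -ler_pdivrMr//.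
have -> : c / eta = X `^ (q - r) by rewrite -powRrM mulVf ?gt_eqF// powRr1// ltW.
by rewrite ge0_ler_powR ?nnegrE ?(ltW qr) ?(ltW X0) ?(ltW T0).
Qed.

Lemma small_geometric (k C eta : R) : 0 <= k -> k < 1 -> 0 <= C -> 0 < eta ->
  exists N : nat, forall J, (N <= J)%N -> C * k ^+ J <= eta.
Proof.
move=> k0 k1 C0 eta0.
have h : (fun J => C * k ^+ J) @ \oo --> (0 : R).
  rewrite -[X in _ --> X](mulr0 C); apply: cvgMr; apply: cvg_expr.
  by rewrite ger0_norm.
have [N _ hN] : \forall J \near \oo, `|0 - C * k ^+ J| < eta by move/cvgrPdist_lt : h; apply.
exists N => J NJ; apply: ltW; apply: le_lt_trans (hN J NJ).
by rewrite sub0r normrN ler_norm.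
Qed.

Lemma dilation_index (T s : R) (N : nat) x : 0 < T -> 1 < s -> T * s ^+ N <= x ->
  exists J, [/\ (N <= J)%N, T * s ^+ J <= x & x <= T * s ^+ J.+1].
Proof.
move=> T0 s1 hx.
have s0 : 0 < s by exact: lt_trans s1.
have [J0 hJ0] : exists J, x < T * s ^+ J.
  have si : 0 <= s^-1 by rewrite invr_ge0 ltW.
  have si1 : s^-1 < 1 by rewrite invf_lt1.
  have x0 : 0 <= x by apply: le_trans hx; rewrite mulr_ge0 ?exprn_ge0 ?ltW.
  have T2 : 0 < T / 2 by rewrite divr_gt0.
  have [J hJ] := small_geometric si si1 x0 T2; exists J.
  have := hJ J (leqnn J); rewrite exprVn ler_pdivrMr ?exprn_gt0// => h.
  by apply: (le_lt_trans h); rewrite ltr_pM2r ?exprn_gt0// ltr_pdivrMr// ltr_pMr// ltr1n.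
have [J [JN h1 h2]] : exists J, [/\ (N <= J)%N, T * s ^+ J <= x & ~ T * s ^+ J.+1 <= x].
  pose P J := (N <= J)%N && (T * s ^+ J <= x).
  have exP : exists J, P J by exists N; rewrite /P leqnn.
  have ubP J : P J -> (J <= J0)%N.
    move=> /andP[_ h]; rewrite leqNgt; apply/negP => JJ.
    have := le_lt_trans h hJ0; apply/negP; rewrite -leNgt ler_pM2l//.
    by rewrite ler_eXn2l// ltnW.
  have [J /andP[NJ hJ] maxJ] := ex_maxnP exP ubP.
  exists J; split => // h.
  by have := maxJ J.+1; rewrite /P (leqW NJ) h ltnn => /(_ isT).
by exists J; split => //; rewrite ltW// ltNge; apply/negP.
Qed.

End iteration.

Section local_energy.
Context {R : realType} {r m : nat}.
Local Notation ig D f := (leb.-integrable D (EFin \o f)).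
Variables (p q k c L M : R) (F : 'rV[R]_(r + m) -> R).
Variables (omega : set 'rV[R]_m) (f : 'rV[R]_m -> R).
Hypothesis H : admissible p q k c L M F omega f.
Hypothesis r0 : (0 < r)%N.
Let p1 := adm_p H.
Let mO := adm_measurable H.
Let Ofin := adm_finite H.
Variable mu : R.
Hypothesis Jmu : forall psi, test_function omega psi -> mu <= J2 F omega f psi.

Local Notation E phi D := (\int[leb]_(x in D) (F (dgrad phi x) - fbar f x * phi x)).
Local Notation I phi w t := (\int[leb]_(x in rect (cube r t) omega) gap F f phi w x).

(** The slice is a test function of omega, and F exceeds F'' by a nonnegative quantity. *)
Lemma slice_lower_bound (A : set 'rV[R]_r) phi x : test_function (rect A omega) phi ->
  mu <= \int[leb]_(y in omega) (F (dgrad phi (row_mx x y)) - f y * phi (row_mx x y)).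
Proof.
move=> tphi; have Aom (z : 'rV[R]_r) (y : 'rV[R]_m) : rect A omega (row_mx z y) -> omega y by move=> /rect_row[].
have [ts i1 _] := slice_energy H x Aom tphi.
apply: (le_trans (Jmu ts)); apply: (le_Rintegral mO (ig_J2 H ts) i1) => y _.
rewrite lerD2r dgrad_slice; last exact: test_smooth tphi.
by rewrite -subr_ge0; exact: (excess_ge0 H).
Qed.

Lemma gap_slice_lower_bound (A : set 'rV[R]_r) phi w e x : test_function (rect A omega) phi ->
  test_function omega w -> J2 F omega f w <= mu + e ->
  - e <= \int[leb]_(y in omega) gap F f phi w (row_mx x y).
Proof.
move=> tphi tw hw; have Aom (z : 'rV[R]_r) (y : 'rV[R]_m) : rect A omega (row_mx z y) -> omega y by move=> /rect_row[].
have [_ _ ->//] := slice_energy H x Aom tphi.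
have := slice_lower_bound x tphi; move: hw; set a := J2 _ _ _ _; set b := \int[leb]_(y in omega) _.
by rewrite -lerBlDr => h1 h2; rewrite lerBrDr addrC (le_trans h1).
Qed.

Lemma cube_finite t : 0 < t -> (leb (cube r t : set 'rV[R]_r) < +oo)%E.
Proof. by move=> t0; rewrite leb_cube// ltry. Qed.

Lemma cube_sub t T : t <= T -> cube r t `<=` (cube r T : set 'rV[R]_r).
Proof. by move=> tT x /= h; exact: lt_le_trans tT. Qed.

(** The gap need not be nonnegative, but its integrals over slices are at least -e. *)
Lemma gap_mono (A : set 'rV[R]_r) phi w e t T : 0 < t -> t <= T ->
  test_function (rect A omega) phi -> test_function omega w -> 0 <= e -> J2 F omega f w <= mu + e ->
  I phi w t <= I phi w T + e * (2 * T) ^+ r.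
Proof.
move=> t0 tT tphi tw e0 hw; have T0 : 0 < T by exact: lt_le_trans tT.
have mS := @cube_measurable R r T; have mQ := @cube_measurable R r t.
have QS := cube_sub tT; have Sfin := cube_finite T0.
have igS := ig_gap H mS Sfin tphi tw.
rewrite (Rintegral_rect_setD mS mQ mO QS igS) -addrA lerDl.
have mU : measurable (cube r T `\` cube r t : set 'rV[R]_r) by exact: measurableD.
have leU : (leb (cube r T `\` cube r t : set 'rV[R]_r) <= leb (cube r T : set 'rV[R]_r))%E.
  by apply: le_measure; rewrite ?inE//; exact: subIsetl.
have Ufin : (leb (cube r T `\` cube r t : set 'rV[R]_r) < +oo)%E by exact: le_lt_trans Sfin.
have := slice_le mU mO Ufin (ig_gap H mU Ufin tphi tw)
  (aeW _ (fun x _ => gap_slice_lower_bound x tphi tw hw)).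
move=> h; rewrite -[X in X <= _](addNr (e * (2 * T) ^+ r)) lerD2r.
apply: le_trans h; rewrite mulNr lerN2 ler_wpM2l//.
have -> : (2 * T) ^+ r = fine (leb (cube r T : set 'rV[R]_r)) by rewrite leb_cube.
by apply: fine_le => //; rewrite ge0_fin_numE.
Qed.

Lemma gap_integral (A : set 'rV[R]_r) phi w t : 0 < t ->
  test_function (rect A omega) phi -> test_function omega w ->
  E phi (rect (cube r t) omega) = I phi w t + (2 * t) ^+ r * J2 F omega f w.
Proof.
move=> t0 tphi tw; have mQ := @cube_measurable R r t; have Qfin := cube_finite t0.
have i1 := ig_rsubmx mQ Qfin mO (ig_J2 H tw).
have i2 := ig_energy_rect H mQ Qfin tphi.
have [_ _ E2] := Rfubini mQ mO i1.
rewrite [I phi w t](_ : _ = E phi (rect (cube r t) omega) - (2 * t) ^+ r * J2 F omega f w) ?subrK//.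
rewrite (RintegralB (rect_measurable mQ mO) i2 i1) E2; congr (_ - _).
under eq_Rintegral do under eq_Rintegral do rewrite row_mxKr.
have lQ : fine (leb (cube r t : set 'rV[R]_r)) = (2 * t) ^+ r by rewrite leb_cube.
by rewrite -/(J2 F omega f w) Rintegral_cst// lQ mulrC.
Qed.

Let hs (A : set 'rV[R]_r) phi : test_function (rect A omega) phi -> forall x, mu <=
  \int[leb]_(y in omega) (F (dgrad phi (row_mx x y)) - fbar f (row_mx x y) * phi (row_mx x y)).
Proof.
move=> tphi x; under eq_Rintegral do rewrite fbar_row; exact: slice_lower_bound tphi.
Qed.

Let lin_initial (EA EQ EU Iq X d lN mu' lU q' Jw N amu : R) : EA = EQ + EU -> mu' * lU <= EU ->
  EQ = Iq + q' * Jw -> EA <= X + d -> X <= lN * N -> - (amu * N) <= mu' * lU ->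
  - (amu * N) <= q' * Jw -> Iq <= (lN + 2 * amu) * N + d.
Proof. lra. Qed.

(** The start of the iteration: comparison with the zero function bounds the energy on the whole cylinder
by its volume, and the slices outside the cube have energy at least mu. *)
Lemma initial_bound (A : set 'rV[R]_r) phi w (d t N : R) : measurable A -> (leb A < +oo)%E ->
  fine (leb A) <= N -> 0 < t -> cube r t `<=` A -> test_function (rect A omega) phi ->
  E phi (rect A omega) <= E (fun=> 0) (rect A omega) + d ->
  test_function omega w ->
  I phi w t <= (L * fine (leb omega) + 2 * `|mu|) * N + d.
Proof.
move=> mA Afin AN t0 tA tphi hE tw.
have mQ := @cube_measurable R r t; have Qfin := cube_finite t0.
have iE := ig_energy_rect H mA Afin tphi.
have mU : measurable (A `\` cube r t) by exact: measurableD.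
have leU : (leb (A `\` cube r t) <= leb A)%E by apply: le_measure; rewrite ?inE//; exact: subIsetl.
have Ufin : (leb (A `\` cube r t) < +oo)%E by exact: le_lt_trans Afin.
have leQ : (leb (cube r t : set 'rV[R]_r) <= leb A)%E by apply: le_measure; rewrite ?inE.
have N0 : 0 <= N by apply: le_trans AN; exact: fine_ge0.
have NU : fine (leb (A `\` cube r t)) <= N.
  by apply: le_trans AN; apply: fine_le => //; rewrite ge0_fin_numE.
have NQ : (2 * t) ^+ r <= N.
  have -> : (2 * t) ^+ r = fine (leb (cube r t : set 'rV[R]_r)) by rewrite leb_cube.
  by apply: le_trans AN; apply: fine_le => //; rewrite ge0_fin_numE.
have h1 := slice_le mU mO Ufin (ig_energy_rect H mU Ufin tphi) (aeW _ (fun x _ => hs tphi x)).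
have h2 := Rintegral_rect_setD mA mQ mO tA iE.
have h3 := gap_integral t0 tphi tw.
have h4 : E (fun=> 0) (rect A omega) <= L * fine (leb omega) * N.
  have mAO := rect_measurable mA mO.
  have AOfin : (leb (rect A omega) < +oo)%E by exact: rect_finite.
  have ic : ig (rect A omega) (fun=> L) by exact: ig_cst.
  apply: (@le_trans _ _ (\int[leb]_(x in rect A omega) L)).
    apply: (le_Rintegral mAO (ig_energy_rect H mA Afin (test0 (rect A omega))) ic).
    move=> x _; rewrite mulr0 subr0; apply: (le_trans (adm_up H _)).
    have -> : dgrad (fun=> 0 : R) x = 0 :> 'rV[R]_(r + m).
      by apply/rowP => i; rewrite !mxE /partial derive_cst.
    by rewrite normr0 powR0 ?addr0 ?mulr1// gt_eqF// (lt_trans _ p1).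
  have [_ _ ->] := Rfubini mA mO ic.
  rewrite Rintegral_cst// Rintegral_cst//; apply: ler_wpM2l => //.
  by rewrite mulr_ge0 ?(adm_L H)// fine_ge0.
have n1 : - (`|mu| * N) <= mu * fine (leb (A `\` cube r t)).
  have l1 : - `|mu| <= mu by rewrite lerNl -normrN ler_norm.
  have f0 : 0 <= fine (leb (A `\` cube r t)) by exact: fine_ge0.
  by rewrite -mulNr (le_trans _ (ler_wpM2r f0 l1))// !mulNr lerN2 ler_wpM2l.
have n2 : - (`|mu| * N) <= (2 * t) ^+ r * J2 F omega f w.
  have l1 : - `|mu| <= J2 F omega f w by apply: le_trans (Jmu tw); rewrite lerNl -normrN ler_norm.
  have f0 : 0 <= (2 * t) ^+ r by rewrite exprn_ge0// mulr_ge0// ltW.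
  apply: le_trans (ler_wpM2l f0 l1).
  by rewrite mulrN lerN2 [X in X <= _]mulrC ler_wpM2l.
exact: (lin_initial h2 h1 h3 hE h4 n1 n2).
Qed.

Local Notation Q := (decay p k).

Let lin_step (K IT Is d X : R) : 0 < K -> (1 + K) * IT <= K * Is + d + X ->
  IT <= K / (1 + K) * Is + (d + X) / (1 + K).
Proof.
move=> K0 h; have K1 : 0 < 1 + K by rewrite addr_gt0.
have -> : K / (1 + K) * Is + (d + X) / (1 + K) = (K * Is + d + X) / (1 + K) by field; rewrite gt_eqF.
by rewrite ler_pdivlMr// mulrC.
Qed.

(** The radii are T s^j and the widths h_j = (s - 1) T s^j / 2, so that t_j + 2 h_j = t_(j + 1). The
widths increase, hence the cost per unit volume at step j is at most its value at step 0, while the volumes grow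
like s^(r j); the choice of s makes the sum of the errors comparable to the first of them. *)
Lemma iterated_comparison : 0 <= Q -> exists K s : R, [/\ 0 < K, 1 < s, K / (1 + K) * s ^+ r < 1 &
  forall (A : set 'rV[R]_r) phi w (e d T : R) J,
  measurable A -> (leb A < +oo)%E -> [set x | `|x| <= T * s ^+ J] `<=` A ->
  test_function (rect A omega) phi ->
  (forall v, test_function (rect A omega) v -> E phi (rect A omega) <= E v (rect A omega) + d) ->
  test_function omega w -> 0 <= e -> e <= 1 -> 0 <= d -> J2 F omega f w <= mu + e ->
  1 <= (s - 1) / 2 * T -> 0 < T ->
  I phi w T <= (K / (1 + K)) ^+ J * I phi w (T * s ^+ J) +
    2 * (d + (2 * K * e + e + K * ((s - 1) / 2 * T) `^ (- Q)) * (2 * (T * s)) ^+ r)].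
Proof.
move=> Q0; have [K K0 hK] := comparison H Jmu.
have [s s1 [k1 E12]] := dilation_ratio r0 K0.
exists K, s; split => // A phi w e d T J mA Afin TA tphi phimin tw e0 e1 d0 hw hT T0.
have K1 : 0 < 1 + K by rewrite addr_gt0.
have s0 : 0 < s by exact: lt_trans s1.
set th := K / (1 + K) in k1 E12 *.
have th0 : 0 <= th by rewrite divr_ge0 ?ltW.
set kap := 2 * K * e + e + K * ((s - 1) / 2 * T) `^ (- Q).
have kap0 : 0 <= kap by rewrite !addr_ge0// ?mulr_ge0 ?powR_ge0// ltW.
pose A0 := (d + kap * (2 * (T * s)) ^+ r) / (1 + K).
have TS0 : 0 <= (2 * (T * s)) ^+ r by rewrite exprn_ge0// !mulr_ge0 ?ltW.
have A00 : 0 <= A0 by rewrite divr_ge0 ?(ltW K1)// addr_ge0// mulr_ge0.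
have step j : (j < J)%N -> I phi w (T * s ^+ j) <= th * I phi w (T * s ^+ j.+1) + A0 * (s ^+ r) ^+ j.
  move=> jJ; have sj1 : 1 <= s ^+ j by rewrite exprn_ege1// ltW.
  have sj0 : 0 < s ^+ j by rewrite exprn_gt0.
  have tj0 : 0 < T * s ^+ j by rewrite mulr_gt0.
  pose h := (s - 1) / 2 * (T * s ^+ j).
  have sm : 0 < (s - 1) / 2 by rewrite divr_gt0// subr_gt0.
  have hT' : (s - 1) / 2 * T <= h by rewrite /h mulrA ler_peMr// ltW// (lt_le_trans _ hT).
  have h1 : 1 <= h by exact: le_trans hT'.
  have tE : T * s ^+ j + 2 * h = T * s ^+ j.+1 by rewrite /h exprS; field.
  have slab : [set x : 'rV[R]_r | `|x| <= T * s ^+ j + h] `<=` A.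
    move=> x /= hx; apply: TA => /=; apply: (le_trans hx).
    apply: (@le_trans _ _ (T * s ^+ j.+1)).
      by rewrite -tE lerD2l mulr_natl mulr2n lerDl (le_trans _ h1).
    by rewrite ler_pM2l// ler_eXn2l.
  have := hK A phi w e d (T * s ^+ j) h mA Afin slab tphi phimin tw e0 e1 hw tj0 h1.
  rewrite tE => /(lin_step K0) hh; apply: (le_trans hh); rewrite lerD2l.
  have -> : A0 * s ^+ r ^+ j = (d + kap * (2 * (T * s)) ^+ r) * s ^+ r ^+ j / (1 + K) by rewrite /A0 mulrAC.
  apply: ler_wpM2r; first by rewrite invr_ge0 ltW.
  rewrite [X in _ <= X]mulrDl; apply: lerD; first by rewrite ler_peMr// exprn_ege1// exprn_ege1// ltW.
  have -> : (2 * (T * s ^+ j.+1)) ^+ r = (2 * (T * s)) ^+ r * (s ^+ r) ^+ j.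
    by rewrite exprAC -exprMn exprS; congr (_ ^+ r); ring.
  rewrite mulrA; apply: ler_wpM2r; first by rewrite exprn_ge0// exprn_ge0// ltW.
  apply: ler_wpM2r => //; rewrite lerD2l; apply: ler_wpM2l; first exact: ltW.
  rewrite !powRN lef_pV2 ?posrE ?powR_gt0 ?(lt_le_trans ltr01 hT) ?(lt_le_trans ltr01 h1)//.
  rewrite ge0_ler_powR ?nnegrE ?(le_trans ler01 hT) ?(le_trans ler01 h1)//.
have := @geometric_iteration _ th (s ^+ r) A0 (fun j => I phi w (T * s ^+ j)) J th0 k1 step.
rewrite expr0 mulr1 => hg; apply: (le_trans hg); rewrite lerD2l.
have k10 : 0 < 1 - th * s ^+ r by rewrite subr_gt0.
have E2 : A0 / (1 - th * s ^+ r) = 2 * (d + kap * (2 * (T * s)) ^+ r).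
  rewrite /A0 -mulrA -invfM E12 invrK mulrC//.
rewrite -E2; apply: ler_wpM2l => //.
rewrite ler_pdivrMr// mulVf ?gt_eqF// lerBlDr lerDl exprn_ge0// mulr_ge0// exprn_ge0// ltW//.
Qed.

End local_energy.

(** * Local energy of the minimizers *)

Section near_minimizers.
Context {R : realType}.
Local Notation ig D f := (leb.-integrable D (EFin \o f)).
Variable p : R.
Hypothesis p1 : 1 < p.
Let p0 : 0 < p. Proof. exact: lt_trans p1. Qed.

Lemma test_W01p n (O : set 'rV[R]_n) v : open O -> test_function O v -> W01p p O v.
Proof.
move=> oO tv; have mO := open_rV_measurable oO.
apply: (@W01p_of_approx R p p1 n O v (dgrad v) oO).
- exact: (test_Lp p1 mO tv).
- by move=> i; under eq_fun do rewrite mxE; exact: (test_Lp p1 mO (test_partial i tv)).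
move=> e e0; exists v; split=> //.
- under eq_Rintegral do rewrite subrr normr0 powR0 ?gt_eqF//.
  by rewrite Rintegral_cst// mul0r ltW.
under eq_Rintegral do rewrite subrr normr0 powR0 ?gt_eqF//.
by rewrite Rintegral_cst// mul0r ltW.
Qed.

Lemma energy_ae n (Phi f : 'rV[R]_n -> R) (O : set 'rV[R]_n) v g : open O -> measurable_fun setT Phi ->
  W1p p O v -> measurable_fun O g -> measurable_fun O f ->
  {ae leb, forall x, O x -> grad O v x = g x} ->
  energy Phi f O v = \int[leb]_(x in O) (Phi (g x) - f x * v x).
Proof.
move=> oO mPhi Wv mg mf ae; have mO := open_rV_measurable oO.
have [mv _ mgv _ _] := W1p_grad p1 oO Wv.
apply: ae_Rintegral_eq => //.
- by apply: measurable_funB; [exact: (measurableT_comp mPhi)|exact: measurable_funM].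
- by apply: measurable_funB; [exact: (measurableT_comp mPhi)|exact: measurable_funM].
- by apply: filterS ae => x h Ox; rewrite h.
Qed.

Lemma energy_test n (Phi f : 'rV[R]_n -> R) (O : set 'rV[R]_n) v : open O -> measurable_fun setT Phi ->
  measurable_fun O f -> test_function O v ->
  energy Phi f O v = \int[leb]_(x in O) (Phi (dgrad v x) - f x * v x).
Proof.
move=> oO mPhi mf tv; have mO := open_rV_measurable oO.
have [Wv ae] := test_W1p p1 oO tv.
apply: energy_ae => //; apply: measurable_dgrad => //; exact: test_smooth tv.
Qed.

End near_minimizers.

Section dilations.
Context {R : realType} {r : nat}.
Variable omega' : set 'rV[R]_r.

Definition dilated (l : R) : set 'rV[R]_r := [set l *: y | y in omega'].

Lemma dilated_open l : 0 < l -> open omega' -> open (dilated l).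
Proof.
move=> l0 oA; rewrite openE => x [y Ay <-].
have /nbhs_ballP[e /= e0 eA] : nbhs y omega' by exact: open_nbhs_nbhs.
apply/nbhs_ballP; exists (l * e) => /=; first exact: mulr_gt0.
move=> z; rewrite -ball_normE /= => hz; exists (l^-1 *: z); last first.
  by rewrite scalerA divff ?gt_eqF// scale1r.
apply: eA; rewrite -ball_normE /=.
have -> : y - l^-1 *: z = l^-1 *: (l *: y - z).
  by rewrite scalerBr scalerA mulVf ?gt_eqF// scale1r.
by rewrite normrZ ger0_norm ?invr_ge0 ?(ltW l0)// mulrC ltr_pdivrMr// mulrC.
Qed.

Lemma dilated_cube : open omega' -> omega' 0 -> exists2 a : R, 0 < a &
  forall l, 0 < l -> [set x | `|x| <= a * l] `<=` dilated l.
Proof.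
move=> oA A0; have /nbhs_ballP[e /= e0 eA] : nbhs (0 : 'rV[R]_r) omega' by exact: open_nbhs_nbhs.
exists (e / 2); first by rewrite divr_gt0.
move=> l l0 x /= hx; exists (l^-1 *: x); last by rewrite scalerA divff ?gt_eqF// scale1r.
apply: eA; rewrite -ball_normE /= sub0r normrN normrZ ger0_norm ?invr_ge0 ?(ltW l0)//.
rewrite mulrC ltr_pdivrMr//; apply: (le_lt_trans hx).
by rewrite ltr_pM2r// ltr_pdivrMr// ltr_pMr// ltr1n.
Qed.

Lemma dilated_sub N l : 0 < l -> omega' `<=` cube r N -> dilated l `<=` cube r (N * l).
Proof.
move=> l0 AN _ [y Ay <-]; rewrite /cube /= normrZ ger0_norm ?(ltW l0)// mulrC.
by rewrite ltr_pM2r//; exact: AN.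
Qed.

Lemma dilated_measure N l : 0 < l -> 1 <= N -> open omega' -> omega' `<=` cube r N ->
  (leb (dilated l) < +oo)%E /\ fine (leb (dilated l)) <= (2 * (N * l)) ^+ r.
Proof.
move=> l0 N1 oA AN; have mA := open_rV_measurable (dilated_open l0 oA).
have Nl : 0 < N * l by rewrite mulr_gt0// (lt_le_trans _ N1).
have le : (leb (dilated l) <= leb (cube r (N * l) : set 'rV[R]_r))%E.
  by apply: le_measure; rewrite ?inE//; [exact: cube_measurable|exact: dilated_sub].
have fin : (leb (cube r (N * l) : set 'rV[R]_r) < +oo)%E by exact: cube_finite.
split; first exact: le_lt_trans fin.
have -> : (2 * (N * l)) ^+ r = fine (leb (cube r (N * l) : set 'rV[R]_r)) by rewrite leb_cube.
by apply: fine_le => //; rewrite ge0_fin_numE// (le_lt_trans le).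
Qed.

Lemma rect_open m (A : set 'rV[R]_r) (B : set 'rV[R]_m) : open A -> open B -> open (rect A B).
Proof.
move=> oA oB; apply: openI.
  apply: (@open_comp _ _ (fun x : 'rV[R]_(r + m) => lsubmx x) A) => // x _; exact: continuous_lsubmx.
apply: (@open_comp _ _ (fun x : 'rV[R]_(r + m) => rsubmx x) B) => // x _; exact: continuous_rsubmx.
Qed.

End dilations.

Section linear_arithmetic.
Context {R : realFieldType}.

Lemma lin_total (En I0 IT X V0 VT VS Jw mu e d K P eta : R) :
  En = I0 + V0 * Jw -> I0 <= IT + e * VT -> IT <= X + 2 * (d + (2 * K * e + e + K * P) * VS) ->
  X <= eta / 4 -> 2 * (K * P * VS) <= eta / 4 -> d <= eta / 8 ->
  e * (2 * (2 * K + 1) * VS + VT + V0) <= eta / 4 -> V0 * Jw <= V0 * (mu + e) ->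
  En <= V0 * mu + eta.
Proof. by move=> -> h1 h2 h3 h4 h5 h6 h7; lra. Qed.

End linear_arithmetic.

Section local_energy.
Context {R : realType} {r m : nat}.
Local Notation ig D f := (leb.-integrable D (EFin \o f)).
Variables (p q k c L M : R) (F : 'rV[R]_(r + m) -> R).
Variables (omega : set 'rV[R]_m) (f : 'rV[R]_m -> R).
Hypothesis H : admissible p q k c L M F omega f.
Hypothesis r0 : (0 < r)%N.
Let p1 := adm_p H.
Let mO := adm_measurable H.
Let Ofin := adm_finite H.
Variable mu : R.
Hypothesis Jmu : forall psi, test_function omega psi -> mu <= J2 F omega f psi.
Hypothesis Jinf : forall e, 0 < e -> exists2 w, test_function omega w & J2 F omega f w <= mu + e.
Variable omega' : set 'rV[R]_r.
Hypothesis oA : open omega'.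
Hypothesis A0 : omega' 0.
Hypothesis bA : bounded_set omega'.
Hypothesis rate : r%:R < decay p k.

Local Notation cyl l := (rect (dilated omega' l) omega).
Local Notation E phi D := (\int[leb]_(x in D) (F (dgrad phi x) - fbar f x * phi x)).
Local Notation Q := (decay p k).

(** A test function is an admissible competitor for the minimizer, whose energy is close to that of any
good approximation. *)
Lemma near_minimizer (A : set 'rV[R]_r) u (d : R) : open A -> (leb A < +oo)%E ->
  is_minimizer p F (fbar f) (rect A omega) u -> 0 < d ->
  exists2 delta : R, 0 < delta & forall phi, approx_test p (rect A omega) u (grad (rect A omega) u) delta phi ->
    forall v, test_function (rect A omega) v -> E phi (rect A omega) <= E v (rect A omega) + d.
Proof.
move=> opA Afin [[Wu _] umin] d0.
have oC := rect_open opA (adm_open H); have mC := open_rV_measurable oC.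
have mA := open_rV_measurable opA.
have Cfin : (leb (rect A omega) < +oo)%E by exact: rect_finite.
have Lf := Lp_rsubmx (conj_gt1 p1 (adm_pq H)) mA Afin mO (adm_f H).
have mF := convex_measurable p1 (adm_convex H) (adm_L H) (F_ge0 H) (adm_up H).
have /(LpP (conj_gt1 p1 (adm_pq H)) _ mC)[mf _] := Lf.
have [Lu _ Lgu] := Wu.
have [delta delta0 hd] := energy_perturb p1 (adm_pq H) (adm_convex H) (adm_L H) (F_ge0 H) (adm_up H) mC Cfin Lf Lu Lgu d0.
exists delta => // phi [tphi h1 h2] v tv.
have [Lphi Ldphi] := test_LpV H mC tphi.
apply: (le_trans (hd _ _ Lphi Ldphi h1 h2)); rewrite lerD2r.
have := umin v (test_W01p p1 oC tv).
by rewrite (energy_test p1 oC mF mf tv).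
Qed.

Lemma decay_gt0 : 0 < Q.
Proof. by apply: lt_trans rate; rewrite ltr0n. Qed.

(** Parameters are chosen in the order T, then e (hence w) and d, then the number of steps: T makes the cost
of the transitions small, e and d the errors of near minimality on the cube of half-side T s, and the number of steps,
which tends to infinity with l, makes the initial gap, of the order of the volume l^r, negligible after contraction. *)
Lemma local_energy (u : R -> 'rV[R]_(r + m) -> R) (t0 eta : R) :
  (forall l, 0 < l -> is_minimizer p F (fbar f) (cyl l) (u l)) -> 0 < t0 -> 0 < eta ->
  exists2 l1 : R, 0 < l1 & forall l, l1 <= l -> forall delta, 0 < delta ->
    exists2 phi, approx_test p (cyl l) (u l) (grad (cyl l) (u l)) delta phi &
      E phi (rect (cube r t0) omega) <= (2 * t0) ^+ r * mu + eta.
Proof.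
move=> umin t00 eta0.
have [K [s [K0 s1 k1 hit]]] := iterated_comparison H r0 Jmu (ltW decay_gt0).
have [a a0 ha] := dilated_cube oA A0.
have [N N1 hN] := bounded_rV_sub_cube bA.
have s0 : 0 < s by exact: lt_trans s1.
have K10 : 0 < 1 + K by rewrite addr_gt0.
pose sm := (s - 1) / 2; have sm0 : 0 < sm by rewrite divr_gt0// subr_gt0.
have eta4 : 0 < eta / 4 by rewrite divr_gt0.
(* twice the error K h^(-Q) times the volume (2 T s)^r, with h = sm T, is cT T^(r - Q) *)
pose cT := 2 * K * sm `^ (- Q) * (2 * s) ^+ r.
have cT0 : 0 < cT.
  apply: mulr_gt0; last by rewrite exprn_gt0// mulr_gt0.
  by rewrite mulr_gt0 ?powR_gt0// mulr_gt0.
have [T [tT T0] hT] := small_power (Num.max t0 sm^-1) cT0 rate eta4.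
have t0T : t0 <= T by apply: le_trans tT; rewrite le_max lexx.
have smT : 1 <= sm * T.
  by rewrite mulrC -ler_pdivrMr// mul1r; apply: le_trans tT; rewrite le_max lexx orbT.
have hP : 2 * (K * (sm * T) `^ (- Q) * (2 * (T * s)) ^+ r) <= eta / 4.
  apply: le_trans hT; rewrite le_eqVlt; apply/orP; left; apply/eqP.
  rewrite powR_split// powR_mulrn ?(ltW T0)// powRM ?(ltW sm0) ?(ltW T0)//.
  by rewrite /cT !exprMn; ring.
(* De collects the volumes that the near minimality e of w is multiplied by in lin_total *)
pose De := 2 * (2 * K + 1) * (2 * (T * s)) ^+ r + (2 * T) ^+ r + (2 * t0) ^+ r.
have De0 : 0 < De.
  have V1 : 0 < 2 * (2 * K + 1) * (2 * (T * s)) ^+ r.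
    apply: mulr_gt0; last by rewrite exprn_gt0// mulr_gt0// mulr_gt0.
    by rewrite mulr_gt0// addr_gt0// mulr_gt0.
  by apply: addr_gt0; [apply: addr_gt0 => //|]; rewrite exprn_gt0// mulr_gt0.
pose e := Num.min 1 (eta / 4 / De).
have e0 : 0 < e by rewrite lt_min ltr01 divr_gt0.
have e1 : e <= 1 by rewrite ge_min lexx.
have heDe : e * De <= eta / 4 by rewrite -ler_pdivlMr// ge_min lexx orbT.
have [w tw hw] := Jinf e0.
pose d := Num.min 1 (eta / 8).
have d0 : 0 < d by rewrite lt_min ltr01 divr_gt0.
have d1 : d <= 1 by rewrite ge_min lexx.
have hd : d <= eta / 8 by rewrite ge_min lexx orbT.
pose th := K / (1 + K); have th0 : 0 <= th by rewrite divr_ge0 ?ltW.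
have ka0 : 0 <= th * s ^+ r by rewrite mulr_ge0// exprn_ge0// ltW.
pose C1 := (L * fine (leb omega) + 2 * `|mu|) * (2 * N) ^+ r + 1.
have LO : 0 <= L * fine (leb omega) + 2 * `|mu|.
  by rewrite addr_ge0// mulr_ge0 ?(adm_L H)// fine_ge0.
have N0 : 0 < N by exact: lt_le_trans N1.
have C10 : 0 <= C1 by rewrite addr_ge0// mulr_ge0// exprn_ge0// mulr_ge0// ltW.
have C20 : 0 <= C1 * (T * s / a) ^+ r.
  by rewrite mulr_ge0// exprn_ge0// divr_ge0 ?(ltW a0)// mulr_ge0 ?ltW.
have [J0 hJ0] := small_geometric ka0 k1 C20 eta4.
pose l1 := Num.max 1 (T * s ^+ J0 / a).
exists l1; first by rewrite lt_max ltr01.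
move=> l; rewrite ge_max => /andP[l_ge1 hl] delta delta0.
have l0 : 0 < l by exact: lt_le_trans l_ge1.
have hal : T * s ^+ J0 <= a * l by rewrite [a * l]mulrC -ler_pdivrMr.
have [J [JJ0 hJ1 hJ2]] := dilation_index T0 s1 hal.
have oAl := dilated_open l0 oA; have mAl := open_rV_measurable oAl.
have [Alfin Alle] := dilated_measure l0 N1 oA hN.
have [d' d'0 hd'] := near_minimizer oAl Alfin (umin _ l0) d0.
have oC := rect_open oAl (adm_open H).
have [Wu _] := umin _ l0.
have md : 0 < Num.min delta d' by rewrite lt_min delta0.
have [phi [tphi h1 h2]] := W01p_approx p1 oC Wu md.
have phimin : forall v, test_function (cyl l) v -> E phi (cyl l) <= E v (cyl l) + d.
  apply: hd'; split => //; [apply: le_trans h1 _|apply: le_trans h2 _]; by rewrite ge_min lexx orbT.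
exists phi.
  split => //; [apply: le_trans h1 _|apply: le_trans h2 _]; by rewrite ge_min lexx.
have TJ0 : 0 < T * s ^+ J by rewrite mulr_gt0 ?exprn_gt0.
have slab : [set x : 'rV[R]_r | `|x| <= T * s ^+ J] `<=` dilated omega' l.
  by move=> x /= hx; apply: ha => //=; exact: le_trans hJ1.
have g1 := hit _ _ _ _ _ _ _ mAl Alfin slab tphi phimin tw (ltW e0) e1 (ltW d0) hw smT T0.
have cubeA : cube r (T * s ^+ J) `<=` dilated omega' l.
  by move=> x /= hx; apply: slab => /=; exact: ltW.
have g2 := initial_bound H Jmu mAl Alfin Alle TJ0 cubeA tphi (phimin _ (test0 (cyl l))) tw.
have g3 := gap_mono H Jmu t00 t0T tphi tw (ltW e0) hw.
have g4 := gap_integral H t00 tphi tw.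
have g5 : th ^+ J * \int[leb]_(x in rect (cube r (T * s ^+ J)) omega) gap F f phi w x <= eta / 4.
  apply: le_trans (hJ0 J JJ0).
  apply: (le_trans (ler_wpM2l (exprn_ge0 J th0) g2)).
  have B : (L * fine (leb omega) + 2 * `|mu|) * (2 * (N * l)) ^+ r + d <= C1 * l ^+ r.
    rewrite /C1 [X in _ <= X]mulrDl mul1r; apply: lerD; last by apply: (le_trans d1); rewrite exprn_ege1.
    by rewrite -[X in _ <= X]mulrA -exprMn -[2 * N * l]mulrA.
  apply: (le_trans (ler_wpM2l (exprn_ge0 J th0) B)).
  have hl2 : l <= T * s / a * s ^+ J.
    by rewrite mulrAC ler_pdivlMr// [l * a]mulrC (le_trans hJ2)// exprS mulrA.
  have hl3 : l ^+ r <= (T * s / a * s ^+ J) ^+ r.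
    by apply: lerXn2r; rewrite ?nnegrE ?(ltW l0)// (le_trans (ltW l0) hl2).
  have hl4 : th ^+ J * (C1 * l ^+ r) <= th ^+ J * (C1 * (T * s / a * s ^+ J) ^+ r).
    by rewrite ler_wpM2l ?exprn_ge0// ler_wpM2l.
  apply: (le_trans hl4); rewrite le_eqVlt; apply/orP; left; apply/eqP.
  rewrite [(th * s ^+ r) ^+ J]exprMn [(s ^+ r) ^+ J]exprAC.
  rewrite [(T * s / a * s ^+ J) ^+ r]exprMn; move: (th ^+ J) ((T * s / a) ^+ r) ((s ^+ J) ^+ r) => x y z.
  by rewrite mulrCA [x * _]mulrCA !mulrA.
have V0 : 0 <= (2 * t0) ^+ r by rewrite exprn_ge0// mulr_ge0// ltW.
exact: (lin_total g4 g3 g1 g5 hP hd heDe (ler_wpM2l V0 hw)).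
Qed.

End local_energy.

(** * Lower semicontinuity under weak convergence *)

Section functional.
Context {R : realType} {n : nat}.
Local Notation ig D f := (leb.-integrable D (EFin \o f)).
Variables (p q : R).
Hypothesis p1 : 1 < p.
Hypothesis pq : p^-1 + q^-1 = 1.
Let p0 : 0 < p. Proof. exact: lt_trans p1. Qed.
Let q1 := conj_gt1 p1 pq.
Variables (D : set 'rV[R]_n) (f : 'rV[R]_n -> R).
Hypothesis mD : measurable D.
Hypothesis Dfin : (leb D < +oo)%E.
Hypothesis Lf : Lp q D f.
Variables (s : 'rV[R]_n -> 'rV[R]_n) (S : R).
Hypothesis ms : measurable_fun D s.
Hypothesis sS : forall x, D x -> `|s x| <= S.
Hypothesis S0 : 0 <= S.

Lemma measurable_rdot (g : 'rV[R]_n -> 'rV[R]_n) : measurable_fun D g -> measurable_fun D (fun x => rdot (s x) (g x)).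
Proof.
move=> mg; apply: measurable_sum => i; apply: measurable_funM; exact: measurable_fun_coord.
Qed.

Lemma rdot_dom (g : 'rV[R]_n -> 'rV[R]_n) d x : 0 < d -> D x ->
  `|rdot (s x) (g x)| <= n%:R * S * (d + d `^ (1 - p) * `|g x| `^ p).
Proof.
move=> d0 Dx; apply: (le_trans (rdot_le _ _)).
have h := le_small_powR (ltW p1) (normr_ge0 (g x)) d0.
apply: (@le_trans _ _ (n%:R * S * `|g x|)).
  by rewrite ler_wpM2r// ler_wpM2l// sS.
by rewrite ler_wpM2l// mulr_ge0.
Qed.

Lemma ig_rdot g : LpV p D g -> ig D (fun x => rdot (s x) (g x)).
Proof.
move=> /(ig_norm_rV_pow p1 g mD)[mg gi].
apply: (ig_dom (g := fun x => n%:R * S * (1 + 1 `^ (1 - p) * `|g x| `^ p))) => //.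
- exact: measurable_rdot.
- by apply: ig_scale => //; apply: ig_add => //; [exact: ig_cst|exact: ig_scale].
- by move=> x Dx; exact: rdot_dom.
Qed.

(** The energy with F replaced by a field of affine functions, up to their constant terms. *)
Definition functional v (g : 'rV[R]_n -> 'rV[R]_n) : R := \int[leb]_(x in D) (rdot (s x) (g x) - f x * v x).

Lemma ig_functional v g : Lp p D v -> LpV p D g -> ig D (fun x => rdot (s x) (g x) - f x * v x).
Proof. by move=> Lv Lg; apply: (ig_sub mD (ig_rdot Lg)); exact: (ig_pairing p1 pq mD Lf Lv). Qed.

(** A bound for the norm of the linear form; the summands 1 make it positive. *)
Definition functional_cst : R := n%:R * S * (fine (leb D) + 1) + (\int[leb]_(x in D) (`|f x| `^ q) + 1).

Lemma functional_cst_gt0 : 0 < functional_cst.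
Proof.
rewrite /functional_cst ltr_wpDl ?mulr_ge0 ?addr_ge0 ?fine_ge0//.
by rewrite ltr_wpDl// Rintegral_ge0// => x _; exact: powR_ge0.
Qed.

Lemma functional_bound v g d : 0 < d -> Lp p D v -> LpV p D g ->
  \int[leb]_(x in D) (`|v x| `^ p) <= d `^ p -> \int[leb]_(x in D) (`|g x| `^ p) <= d `^ p ->
  `|functional v g| <= functional_cst * d.
Proof.
move=> d0 Lv Lg hv hg.
have /(LpP p1 _ mD)[_ iv] := Lv; have /(ig_norm_rV_pow p1 g mD)[_ gi] := Lg.
have /(LpP q1 _ mD)[_ fi] := Lf.
have iF := ig_functional Lv Lg.
have j0 : ig D (fun=> d) by exact: ig_cst.
have j1 := ig_scale (d `^ (1 - p)) mD gi; have j2 := ig_add mD j0 j1.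
have j3 := ig_scale (n%:R * S) mD j2.
have j4 := ig_scale d mD fi; have j5 := ig_scale (d `^ (1 - p)) mD iv.
have j6 := ig_add mD j4 j5; have j7 := ig_add mD j3 j6.
apply: (le_trans (le_normr_Rintegral mD iF)).
apply: (le_trans (le_Rintegral mD (ig_abs mD iF) j7 _)).
  move=> x Dx; apply: (le_trans (ler_normB _ _)); apply: lerD; first exact: rdot_dom.
  exact: (pair_le p1 pq).
rewrite (RintegralD mD j3 j6) (RintegralZl _ mD j2) (RintegralD mD j0 j1) (RintegralD mD j4 j5).
rewrite !RintegralZl// Rintegral_cst//.
have dd : d `^ (1 - p) * d `^ p = d by rewrite -powR_split// subrK powRr1// ltW.
have b1 : d `^ (1 - p) * \int[leb]_(x in D) (`|v x| `^ p) <= d.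
  by rewrite -[X in _ <= X]dd ler_wpM2l ?powR_ge0.
have b2 : d `^ (1 - p) * \int[leb]_(x in D) (`|g x| `^ p) <= d.
  by rewrite -[X in _ <= X]dd ler_wpM2l ?powR_ge0.
rewrite /functional_cst mulrDl; apply: lerD.
  rewrite -[X in _ <= X]mulrA ler_wpM2l ?mulr_ge0//.
  by rewrite mulrDl mul1r [fine _ * d]mulrC lerD2l.
by rewrite mulrDl mul1r [_ * d]mulrC lerD2l.
Qed.

(** Boundedness follows from functional_bound with d slightly larger than the norm of u, which allows
the norm of u to be zero. These are the linear forms against which weak convergence is tested. *)
Lemma functional_dual (O : set 'rV[R]_n) : open O -> D `<=` O ->
  W1p_dual p O (fun v => functional v (grad O v)).
Proof.
move=> oO DO; have mO := open_rV_measurable oO.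
have W v : W1p p O v -> Lp p D v /\ LpV p D (grad O v).
  by move=> [Lv _ Lg]; split=> [|i]; [exact: (Lp_sub p1 mD mO DO Lv)|exact: (Lp_sub p1 mD mO DO (Lg i))].
split.
  move=> a u v Wu Wv; have [Lu Lgu] := W _ Wu; have [Lv Lgv] := W _ Wv.
  have [_ [gu wu] _] := Wu; have [_ [gv wv] _] := Wv.
  have wl := weak_gradient_lin a mO (grad_weak wu) (grad_weak wv).
  have ae := grad_ae oO wl.
  have iu := ig_functional Lu Lgu; have iv := ig_functional Lv Lgv.
  have iau := ig_scale a mD iu.
  rewrite -(RintegralZl _ mD iu) -(RintegralD mD iau iv).
  have mgl : measurable_fun D (grad O (fun x => a * u x + v x)).
    apply: (measurable_funS mO DO); apply: measurable_fun_rV => // i.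
    by apply: L1loc_measurable => //; have [_ + _] := grad_weak wl; apply.
  have /(LpP p1 _ mD)[mu _] := Lu; have /(LpP p1 _ mD)[mv _] := Lv.
  have /(LpP q1 _ mD)[mf _] := Lf.
  apply: ae_Rintegral_eq => //.
  - apply: measurable_funB; first exact: measurable_rdot.
    by apply: measurable_funM => //; apply: measurable_funD => //; exact: measurable_funM.
  - exact: ig_measurable (ig_add mD iau iv).
  apply: filterS ae => x h Dx; rewrite h; last exact: DO.
  by rewrite rdotD rdotZ; ring.
exists functional_cst => u Wu; have [Lu Lgu] := W _ Wu.
have C0 := functional_cst_gt0.
set N := W1p_norm p O u.
have N0 : (0 <= N)%E by rewrite /N /W1p_norm adde_ge0// Lnorm_ge0.
have [|Nfin] := eqVneq N +oo%E; first by move=> ->; rewrite gt0_muley ?leey// lte_fin.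
have NE : N = (fine N)%:E by rewrite fineK// ge0_fin_numE// lt_neqAle Nfin leey.
rewrite NE -EFinM lee_fin; apply/ler_addgt0Pr => e e0.
pose d := fine N + e / functional_cst.
have ec : 0 < e / functional_cst by rewrite divr_gt0.
have d0 : 0 < d by rewrite ltr_wpDl ?fine_ge0.
have -> : functional_cst * fine N + e = functional_cst * d.
  by rewrite mulrDr mulrCA divff ?mulr1// gt_eqF.
have Nd : (N <= d%:E)%E by rewrite NE lee_fin lerDl ltW.
have [_ iu _ igu _] := W1p_grad p1 oO Wu.
have /(LpP p1 _ mD)[_ iuD] := Lu; have /(ig_norm_rV_pow p1 _ mD)[_ igD] := Lgu.
have sub (h : 'rV[R]_n -> R) : (forall x, 0 <= h x) -> ig O h -> ig D h ->
    \int[leb]_(x in D) h x <= \int[leb]_(x in O) h x.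
  move=> h0 iO iD; rewrite /Rintegral; apply: fine_le; [exact: integrable_fin_num iD|exact: integrable_fin_num iO|].
  apply: ge0_subset_integral => //; first exact: (measurable_int leb iO).
  by move=> x _; rewrite lee_fin.
apply: functional_bound => //.
- apply: (le_trans (sub _ (fun x => powR_ge0 _ _) iu iuD)).
  apply/(Rint_le _ mO iu); apply: (Lp_norm_ge p1 mO (ltW d0)).
  by apply: le_trans Nd; rewrite /N /W1p_norm leeDl// Lnorm_ge0.
- apply: (le_trans (sub _ (fun x => powR_ge0 _ _) igu igD)).
  apply/(Rint_le _ mO igu).
  have := Lp_norm_ge p1 mO (ltW d0) (u := fun x => enorm (grad O u x)).
  move=> h; apply: le_trans (h _); last first.
    by apply: le_trans Nd; rewrite /N /W1p_norm leeDr// Lnorm_ge0.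
  have [_ _ mgu _ _] := W1p_grad p1 oO Wu.
  apply: ge0_le_integral => //.
  + by apply/measurable_EFinP; exact: ig_measurable igu.
  + apply/measurable_EFinP; apply: (measurableT_comp (measurable_powR p)).
    by apply: measurableT_comp => //; exact: (measurableT_comp (@measurable_enorm R n)).
  + move=> x _; rewrite lee_fin; apply: powR_mono => //; first exact: ltW.
    by rewrite ger0_norm ?enorm_ge0// norm_le_enorm.
Qed.

End functional.

Lemma subset_Rintegral {R : realType} n (D O : set 'rV[R]_n) (h : 'rV[R]_n -> R) :
  measurable D -> measurable O -> D `<=` O -> (forall x, 0 <= h x) ->
  leb.-integrable O (EFin \o h) -> \int[leb]_(x in D) h x <= \int[leb]_(x in O) h x.
Proof.
move=> mD mO DO h0 iO; have iD := ig_sub_set mO mD DO iO.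
rewrite /Rintegral; apply: fine_le; [exact: integrable_fin_num iD|exact: integrable_fin_num iO|].
apply: ge0_subset_integral => //; first exact: (measurable_int leb iO).
by move=> x _; rewrite lee_fin.
Qed.

Lemma lin_minorant {R : realFieldType} (A Lp Lu Ls V eta : R) : A + Lp <= V + eta / 3 ->
  `|Lp - Lu| <= eta / 3 -> `|Ls - Lu| <= eta / 3 -> A + Ls <= V + eta.
Proof. rewrite !ler_norml => h1 /andP[h2 h3] /andP[h4 h5]; lra. Qed.

Section selection.
Context {R : realType} {n : nat}.
Variables (a : nat -> R) (s : nat -> 'rV[R]_n) (g : 'rV[R]_n -> 'rV[R]_n) (D : set 'rV[R]_n).
Hypothesis mD : measurable D.
Hypothesis mg : measurable_fun D g.

(** A measurable choice of an affine function that realizes at g x the maximum of the first ones, so that this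
maximum becomes an affine integrand with bounded measurable coefficients. *)
Fixpoint best (N : nat) (x : 'rV[R]_n) : R * 'rV[R]_n :=
  if N is N'.+1 then
    if (best N' x).1 + rdot (best N' x).2 (g x) < a N + rdot (s N) (g x)
    then (a N, s N) else best N' x
  else (a 0%N, s 0%N).

Lemma best_in N x : exists j, best N x = (a j, s j).
Proof. by elim: N => [|N [j E]] /=; [exists 0%N|case: ifP => _; [exists N.+1|exists j]]. Qed.

Lemma best_max N x j : (j <= N)%N ->
  a j + rdot (s j) (g x) <= (best N x).1 + rdot (best N x).2 (g x).
Proof.
elim: N => [|N IHN] /=; first by rewrite leqn0 => /eqP ->.
rewrite leq_eqVlt => /predU1P[->|jN]; case: ifP => //=.
- by move=> /negbT; rewrite -leNgt.
- by move=> /ltW; apply: le_trans; exact: IHN.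
- by move=> _; exact: IHN.
Qed.

Lemma best_bounded N : exists2 S : R, 0 <= S & forall x, `|(best N x).2| <= S /\ `|(best N x).1| <= S.
Proof.
elim: N => [|N [S S0 hS]] /=.
  by exists (Num.max `|s 0%N| `|a 0%N|); [rewrite le_max normr_ge0|move=> x; rewrite !le_max !lexx orbT].
exists (Num.max S (Num.max `|s N.+1| `|a N.+1|)); first by rewrite le_max S0.
move=> x; have [h1 h2] := hS x; case: ifP => _ /=; rewrite !le_max ?lexx ?orbT// h1 h2//.
Qed.

Lemma measurable_best N : measurable_fun D (fun x => (best N x).1) /\ measurable_fun D (fun x => (best N x).2).
Proof.
elim: N => [|N [m1 m2]] /=; first by split; exact: measurable_cst.
have mr (h : 'rV[R]_n -> 'rV[R]_n) : measurable_fun D h -> measurable_fun D (fun x => rdot (h x) (g x)).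
  by move=> mh; apply: measurable_sum => i; apply: measurable_funM; exact: measurable_fun_coord.
have mb : measurable_fun D (fun x => (best N x).1 + rdot (best N x).2 (g x) < a N.+1 + rdot (s N.+1) (g x)).
  apply: measurable_fun_ltr; apply: measurable_funD => //; first exact: mr.
  by apply: mr; exact: measurable_cst.
split.
  rewrite (_ : (fun x => _) = (fun x => if (best N x).1 + rdot (best N x).2 (g x) < a N.+1 + rdot (s N.+1) (g x) then a N.+1 else (best N x).1)).
    apply: (measurable_fun_if mD mb); first exact: measurable_cst.
    by apply: measurable_funS m1 => // x [].
  by apply/funext => x; case: ifP.
rewrite (_ : (fun x => _) = (fun x => if (best N x).1 + rdot (best N x).2 (g x) < a N.+1 + rdot (s N.+1) (g x) then s N.+1 else (best N x).2)).
  apply: (measurable_fun_if mD mb); first exact: measurable_cst.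
  by apply: measurable_funS m2 => // x [].
by apply/funext => x; case: ifP.
Qed.

End selection.

Section tubes.
Context {R : realType} {r m : nat}.

Definition tube (omega : set 'rV[R]_m) (t : R) : set 'rV[R]_(r + m) := rect (cube r t) omega.

Lemma cube_open t : open (cube r t : set 'rV[R]_r).
Proof.
rewrite (_ : cube r t = ball (0 : 'rV[R]_r) t); first exact: ball_open.
by apply/seteqP; split => x; rewrite /cube -ball_normE /= sub0r normrN.
Qed.

Lemma tube_open omega t : open omega -> open (tube omega t).
Proof. by move=> oo; apply: rect_open => //; exact: cube_open. Qed.

Lemma tube_finite omega t : 0 < t -> measurable omega -> (leb omega < +oo)%E -> (leb (tube omega t) < +oo)%E.
Proof. by move=> t0 mo ofin; apply: rect_finite => //; [exact: cube_measurable|exact: cube_finite]. Qed.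

End tubes.
Arguments tube_open {R r m omega} t _.

Section lower_semicontinuity.
Context {R : realType} {r m : nat}.
Local Notation ig D f := (leb.-integrable D (EFin \o f)).
Variables (p q k c L M : R) (F : 'rV[R]_(r + m) -> R).
Variables (omega : set 'rV[R]_m) (f : 'rV[R]_m -> R).
Hypothesis H : admissible p q k c L M F omega f.
Hypothesis r0 : (0 < r)%N.
Let p1 := adm_p H.
Let p0 : 0 < p. Proof. exact: lt_trans p1. Qed.
Let mO := adm_measurable H.
Let Ofin := adm_finite H.
Variable mu : R.
Hypothesis Jmu : forall psi, test_function omega psi -> mu <= J2 F omega f psi.
Hypothesis Jinf : forall e, 0 < e -> exists2 w, test_function omega w & J2 F omega f w <= mu + e.
Variable omega' : set 'rV[R]_r.
Hypothesis oA : open omega'.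
Hypothesis A0 : omega' 0.
Hypothesis bA : bounded_set omega'.
Hypothesis rate : r%:R < decay p k.
Variables (u : R -> 'rV[R]_(r + m) -> R) (l : nat -> R) (ustar : 'rV[R]_(r + m) -> R).

Local Notation cyl l := (rect (dilated omega' l) omega).
Local Notation E phi D := (\int[leb]_(x in D) (F (dgrad phi x) - fbar f x * phi x)).

Hypothesis umin : forall l, 0 < l -> is_minimizer p F (fbar f) (cyl l) (u l).
Hypothesis loo : l j @[j --> \oo] --> +oo.
Hypothesis wcvg : forall l0, 0 < l0 -> W1p_weak_cvg p (cyl l0) (fun j => u (l j)) ustar.

Lemma tube_cylinder t : exists2 l0 : R, 0 < l0 & forall l, l0 <= l -> tube omega t `<=` cyl l.
Proof.
have [a a0 ha] := dilated_cube oA A0.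
exists (Num.max 1 (t / a)); first by rewrite lt_max ltr01.
move=> l'; rewrite ge_max => /andP[l1 l2] x [xc xo]; split => //.
apply: ha; first exact: lt_le_trans l1.
by rewrite /= (le_trans (ltW xc))// mulrC -ler_pdivrMr.
Qed.

Lemma ustar_W1p t : W1p p (tube omega t) ustar.
Proof.
have [l0 l00 hl] := tube_cylinder t.
have [W _ _] := wcvg l00.
have oC := rect_open (dilated_open l00 oA) (adm_open H).
by have [] := W1p_sub p1 (tube_open t (adm_open H)) oC (hl _ (lexx _)) W.
Qed.

(** The affine integrand is below F, hence its value at the test functions close to the minimizers is
bounded by local_energy; being weakly continuous, it can be evaluated at the limit. *)
Lemma minorant_bound t (A : 'rV[R]_(r + m) -> R) (s : 'rV[R]_(r + m) -> 'rV[R]_(r + m)) (S : R) : 0 < t ->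
  measurable_fun (tube omega t) s -> measurable_fun (tube omega t) A -> 0 <= S ->
  (forall x, tube omega t x -> `|s x| <= S /\ `|A x| <= S) ->
  (forall x y, tube omega t x -> A x + rdot (s x) y <= F y) ->
  \int[leb]_(x in tube omega t) A x + functional (tube omega t) (fbar f) s ustar (grad (tube omega t) ustar) <= (2 * t) ^+ r * mu.
Proof.
move=> t0 ms mA S0 sS AF.
have oD := @tube_open R r m omega t (adm_open H); have mD := open_rV_measurable oD.
have Dfin := @tube_finite R r m omega t t0 mO Ofin.
have mc := @cube_measurable R r t; have cfin := @cube_finite R r t t0.
have Lf : Lp q (tube omega t) (fbar f) := Lp_rsubmx (conj_gt1 p1 (adm_pq H)) mc cfin mO (adm_f H).
have pq := adm_pq H.
have sS' x : tube omega t x -> `|s x| <= S by move=> /sS[].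
have iA : ig (tube omega t) A by apply: (ig_bound (M := S)) => // x /sS[].
apply/ler_addgt0Pr => eta eta0.
have eta3 : 0 < eta / 3 by rewrite divr_gt0.
have [l1 l10 hloc] := local_energy H r0 Jmu Jinf oA A0 bA rate umin t0 eta3.
have [l0 l00 hl0] := tube_cylinder t.
have oC := rect_open (dilated_open l00 oA) (adm_open H).
have DC := hl0 _ (lexx l0).
have [Wstar hW hL] := wcvg l00.
have dual := functional_dual p1 pq mD Dfin Lf ms sS' S0 oC DC.
have /cvgrPdist_lt /(_ _ eta3) cL := hL _ dual.
have hl1 : \forall j \near \oo, Num.max l1 l0 <= l j by move/cvgryPge : loo; apply.
have [j [[h1 h2] h3]] := filter_ex (filterI (filterI hl1 hW) cL).
move: h1; rewrite ge_max => /andP[jl1 jl0].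
have lj0 : 0 < l j by exact: lt_le_trans jl0.
have oCj := rect_open (dilated_open lj0 oA) (adm_open H).
have DCj := hl0 _ jl0.
pose Cst := @functional_cst R (r + m) q (tube omega t) (fbar f) S.
have C0 : 0 < Cst by exact: functional_cst_gt0.
pose d := eta / 3 / Cst; have d0 : 0 < d by rewrite divr_gt0.
have [phi [tphi g1 g2] hphi] := hloc (l j) jl1 (d `^ p) (powR_gt0 _ d0).
set uj := u (l j) in h2 h3 g1 g2.
have [[Wuj _] _] := umin lj0; rewrite -/uj in Wuj.
have [WD aeO] := W1p_sub p1 oD oC DC h2.
have [_ aeCj] := W1p_sub p1 oD oCj DCj Wuj.
have [_ aeS] := W1p_sub p1 oD oC DC Wstar.
have WsD := ustar_W1p t.
have phiD : Lp p (tube omega t) phi /\ LpV p (tube omega t) (dgrad phi) := test_LpV H mD tphi.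
have [Lphi Ldphi] := phiD.
have [Luj _ Lguj] := WD.
have [Lus _ Lgus] := WsD.
have mCj := open_rV_measurable oCj.
have mC := open_rV_measurable oC.
have [Lphi' Ldphi'] := test_LpV H mCj tphi.
have [Lujc _ Lgujc] := Wuj.
pose Fn v g := functional (tube omega t) (fbar f) s v g.
have B1 : `|Fn (fun x => phi x - uj x) (fun x => dgrad phi x - grad (cyl (l j)) uj x)| <= Cst * d.
  have [mB iBg] := ig_powB_rV p1 mCj Ldphi' Lgujc.
  have iB := ig_powB p1 mCj Lphi' Lujc.
  have LgD : LpV p (tube omega t) (fun x => dgrad phi x - grad (cyl (l j)) uj x).
    apply/(ig_norm_rV_pow p1 _ mD); split; first exact: (measurable_funS mCj DCj).
    exact: (ig_sub_set mCj mD DCj).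
  have LD : Lp p (tube omega t) (fun x => phi x - uj x) by exact: (LpB p1 mD).
  apply: (functional_bound p1 pq mD Dfin Lf ms sS' S0 d0 LD LgD).
    exact: (le_trans (subset_Rintegral mD mCj DCj (fun x => powR_ge0 _ _) iB) g1).
  exact: (le_trans (subset_Rintegral mD mCj DCj (fun x => powR_ge0 _ _) iBg) g2).
have iphi := ig_functional p1 pq mD Dfin Lf ms sS' S0 Lphi Ldphi.
have LgujD : LpV p (tube omega t) (grad (cyl (l j)) uj).
  by move=> i; exact: (Lp_sub p1 mD mCj DCj (Lgujc i)).
have iuj := ig_functional p1 pq mD Dfin Lf ms sS' S0 Luj LgujD.
have E1 : Fn (fun x => phi x - uj x) (fun x => dgrad phi x - grad (cyl (l j)) uj x) =
    Fn phi (dgrad phi) - Fn uj (grad (cyl (l j)) uj).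
  rewrite /Fn /functional -(RintegralB mD iphi iuj).
  by apply: eq_Rintegral => x _; rewrite rdotB; ring.
have [mf _] := (LpP (conj_gt1 p1 pq) (fbar f) mD).1 Lf.
have aeFn v g h : Lp p (tube omega t) v -> measurable_fun (tube omega t) g -> measurable_fun (tube omega t) h ->
    {ae leb, forall x, tube omega t x -> g x = h x} -> Fn v g = Fn v h.
  move=> /(LpP p1 _ mD)[mv _] mg mh ae; apply: ae_Rintegral_eq => //.
  - by apply: measurable_funB; [exact: measurable_rdot|exact: measurable_funM].
  - by apply: measurable_funB; [exact: measurable_rdot|exact: measurable_funM].
  - by apply: filterS ae => x hx Dx; rewrite hx.
have mgO v O' : open O' -> tube omega t `<=` O' -> W1p p O' v -> measurable_fun (tube omega t) (grad O' v).
  by move=> oO' sub /(W1p_grad p1 oO')[_ _ mg _ _]; exact: (measurable_funS (open_rV_measurable oO') sub mg).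
have E2 : Fn uj (grad (cyl (l j)) uj) = Fn uj (grad (cyl l0) uj).
  apply: aeFn => //; [exact: mgO|exact: mgO|].
  by apply: filterS2 aeCj aeO => x e1 e2 Dx; rewrite -e1// e2.
have E3 : Fn ustar (grad (cyl l0) ustar) = Fn ustar (grad (tube omega t) ustar).
  apply: aeFn => //; [exact: mgO|exact: mgO|].
  by apply: filterS aeS => x e1 Dx; rewrite e1.
have iE : ig (tube omega t) (fun x => F (dgrad phi x) - fbar f x * phi x) := ig_energy_rect H mc cfin tphi.
have B2 : \int[leb]_(x in tube omega t) A x + Fn phi (dgrad phi) <= E phi (tube omega t).
  rewrite /Fn /functional -(RintegralD mD iA iphi); apply: le_Rintegral => //.
    exact: ig_add.
  by move=> x Dx; rewrite addrA lerD2r; exact: AF.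
rewrite -/(Fn _ _) -E3; rewrite -/(Fn _ _) -/(Fn _ _) -E2 E3 in h3.
rewrite E1 in B1.
have Cd : Cst * d = eta / 3 by rewrite /d mulrC divfK// gt_eqF.
rewrite Cd in B1; rewrite E3.
exact: (lin_minorant (le_trans B2 hphi) B1 (ltW h3)).
Qed.

(** F is the monotone limit of the maxima of its first affine minorants, each of which satisfies
minorant_bound with its optimal selection at the gradient of the limit. *)
Lemma limit_energy t : 0 < t ->
  \int[leb]_(x in tube omega t) (F (grad (tube omega t) ustar x) - fbar f x * ustar x) <= (2 * t) ^+ r * mu.
Proof.
move=> t0.
have oD := @tube_open R r m omega t (adm_open H); have mD := open_rV_measurable oD.
have Dfin := @tube_finite R r m omega t t0 mO Ofin.
have mc := @cube_measurable R r t; have cfin := @cube_finite R r t t0.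
have Lf : Lp q (tube omega t) (fbar f) := Lp_rsubmx (conj_gt1 p1 (adm_pq H)) mc cfin mO (adm_f H).
have pq := adm_pq H.
have WsD := ustar_W1p t; have [Lus _ Lgus] := WsD.
have [_ _ mg _ _] := W1p_grad p1 oD WsD.
set g := grad (tube omega t) ustar in mg Lgus *.
have F0 := F_ge0 H.
have [a [s [[a00 s00] hmin hsup]]] := affine_minorants (adm_convex H) p1 (adm_L H) F0 (adm_up H).
pose B := best a s g; have mB := measurable_best a s mD mg.
pose h N x := (B N x).1 + rdot (B N x).2 (g x).
have mF := convex_measurable p1 (adm_convex H) (adm_L H) F0 (adm_up H).
have iF : ig (tube omega t) (fun x => F (g x)) := ig_convex p1 (adm_convex H) (adm_L H) F0 (adm_up H) mD Dfin Lgus.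
have ifu : ig (tube omega t) (fun x => fbar f x * ustar x) := ig_pairing p1 pq mD Lf Lus.
have hF N x : h N x <= F (g x).
  by rewrite /h /B; have [j ->] := best_in a s g N x; exact: hmin.
have h0 N x : 0 <= h N x.
  by apply: le_trans (best_max a s g x (leq0n N)); rewrite a00 s00 rdot0 addr0.
have mh N : measurable_fun (tube omega t) (h N).
  have [m1 m2] := mB N; apply: measurable_funD => //.
  by apply: measurable_rdot.
have bound N : \int[leb]_(x in tube omega t) h N x <=
    (2 * t) ^+ r * mu + \int[leb]_(x in tube omega t) (fbar f x * ustar x).
  have [S S0 hS] := best_bounded a s g N; have [m1 m2] := mB N.
  have BS x : tube omega t x -> `|(B N x).2| <= S /\ `|(B N x).1| <= S by move=> _; exact: hS.
  have := @minorant_bound t (fun x => (B N x).1) (fun x => (B N x).2) S t0 m2 m1 S0 BS.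
  have AF x y : tube omega t x -> (B N x).1 + rdot (B N x).2 y <= F y.
    by move=> _; rewrite /B; have [j ->] := best_in a s g N x; exact: hmin.
  move=> /(_ AF); rewrite -lerBlDr; apply: le_trans.
  have iA : ig (tube omega t) (fun x => (B N x).1) by apply: (ig_bound (M := S)) => // x /BS[].
  have iL := ig_functional p1 pq mD Dfin Lf m2 (fun x Dx => (BS x Dx).1) S0 Lus Lgus.
  have ih : ig (tube omega t) (h N).
    apply: (ig_dom mD (mh N) iF) => x _; rewrite ger0_norm//; exact: hF.
  rewrite -(RintegralB mD ih ifu) /functional -(RintegralD mD iA iL).
  apply: le_Rintegral => //; [exact: ig_sub|exact: ig_add|].
  by move=> x _; rewrite /h addrA.
have cvg : (fun N => \int[leb]_(x in tube omega t) h N x) @ \oo --> \int[leb]_(x in tube omega t) F (g x).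
  apply: (Rdominated_cvg (g := fun x => F (g x))) => //.
  - exact: (measurableT_comp mF).
  - move=> x _; apply/cvgrPdist_le => e e0.
    have [j hj] := hsup (g x) e e0; exists j => // N /= jN.
    rewrite ger0_norm ?subr_ge0//; rewrite lerBlDr addrC -lerBlDr.
    by apply: (le_trans hj); exact: best_max.
  - by move=> N x _; rewrite ger0_norm.
rewrite (RintegralB mD iF ifu) lerBlDr.
by apply: (cvgr_to_le cvg); apply: nearW => N; exact: bound.
Qed.

End lower_semicontinuity.

(** * Slices of the limit *)

Section tools.
Context {R : realType}.
Local Notation ig D f := (leb.-integrable D (EFin \o f)).

Lemma flat_cutoff n N : 0 < N -> exists2 rho : 'rV[R]_n -> R, test_function setT rho &
  forall x, cube n N x -> rho x = 1.
Proof.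
move=> N0; exists (fun x => \prod_(i < n) plateau N 1 (x ord0 i)); last first.
  move=> x xN; rewrite big1// => i _; apply: plateau1 => //.
  by apply: le_trans (coord_norm_le x i) _; exact: ltW.
split; first by apply: smooth_prod => i; apply: smooth_elementary; exact: elementary_plateau.
exists (cbox (- const_mx (N + 1)) (const_mx (N + 1))); split => //; first exact: cbox_compact.
move=> x hx; have [i hi] : exists i : 'I_n, N + 1 <= `|x ord0 i|.
  apply/not_existsP => hn; apply: hx => i; rewrite !mxE -ler_norml ltW// ltNge.
  by apply/negP; exact: hn.
by rewrite (bigD1 i)//= plateau0// mul0r.
Qed.

Lemma measurable_slice r m (A : set 'rV[R]_r) (B : set 'rV[R]_m) (h : 'rV[R]_(r + m) -> R) x :
  measurable A -> measurable B -> measurable_fun (rect A B) h -> A x ->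
  measurable_fun B (fun y => h (row_mx x y)).
Proof.
move=> mA mB mh Ax; have mAB := rect_measurable mA mB.
apply: (eq_measurable_fun (fun y => (h \_ (rect A B)) (row_mx x y))).
  by move=> y; rewrite inE => By; rewrite patchE mem_set//; apply/rect_row.
apply: measurable_funTS.
have -> : (fun y => (h \_ (rect A B)) (row_mx x y)) =
   (h \_ (rect A B)) \o (fun z : 'rV[R]_r * 'rV[R]_m => row_mx z.1 z.2) \o (fun y => (x, y)) by [].
apply: measurableT_comp; last exact: measurable_pair1.
apply: measurableT_comp; last exact: measurable_row_mx.
by apply/(measurable_restrictT _ mAB).
Qed.

(** Where all the h j exceed a fixed e, Markov's inequality bounds the measure by c / (e (j + 1)) for every
j. This avoids the extraction of a subsequence that converges almost everywhere. *)
Lemma ae_small n (A : set 'rV[R]_n) (h : nat -> 'rV[R]_n -> R) (c : R) : measurable A -> (leb A < +oo)%E ->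
  (forall j, ig A (h j)) -> (forall j x, 0 <= h j x) ->
  (forall j, \int[leb]_(x in A) h j x <= c / j.+1%:R) ->
  {ae leb, forall x, A x -> forall e : R, 0 < e -> exists j, h j x <= e}.
Proof.
move=> mA Afin ih h0 hc.
have key (k : nat) : {ae leb, forall x, A x -> exists j, h j x <= k.+1%:R^-1}.
  pose e : R := k.+1%:R^-1; have e0 : 0 < e by rewrite invr_gt0.
  pose B := A `&` \bigcap_j [set x | A x /\ e < h j x].
  have mB : measurable B.
    apply: measurableI => //; apply: bigcapT_measurable => j.
    have -> : [set x | A x /\ e < h j x] = A `&` (h j) @^-1` `]e, +oo[%classic.
      by apply/seteqP; split => x /=; rewrite in_itv/= andbT.
    by apply: (ig_measurable (ih j)) => //; exact: measurable_itv.
  have BA : B `<=` A by move=> x [].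
  have leB : (leb B <= leb A)%E by apply: le_measure; rewrite ?inE.
  have Bfin : (leb B < +oo)%E by exact: le_lt_trans Afin.
  have B0 : leb B = 0%E.
    apply/eqP; rewrite eq_le measure_ge0 andbT.
    have Bf : leb B \is a fin_num by rewrite ge0_fin_numE.
    rewrite -(fineK Bf) lee_fin; apply/ler_addgt0Pr => d d0; rewrite add0r.
    have [j hj] : exists j : nat, c / (e * d) <= j.+1%:R.
      exists (Num.bound (c / (e * d))); apply: (le_trans (ler_norm _)); apply: ltW.
      apply: (lt_le_trans (archi_boundP (normr_ge0 _))).
      have -> : Num.bound `|c / (e * d)| = Num.bound (c / (e * d)).
        by rewrite /Num.bound normr_id.
      by rewrite ler_nat.
    have h1 : e * fine (leb B) <= \int[leb]_(x in A) h j x.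
      have -> : e * fine (leb B) = \int[leb]_(x in B) e by rewrite Rintegral_cst.
      have iB : ig B (h j) by exact: (ig_sub_set mA mB BA (ih j)).
      apply: (@le_trans _ _ (\int[leb]_(x in B) h j x)).
        apply: (le_Rintegral mB _ iB); first exact: ig_cst.
        by move=> x [_ /(_ j I)[_ /ltW]].
      exact: (subset_Rintegral mB mA BA (h0 j) (ih j)).
    have h2 := le_trans h1 (hc j).
    rewrite -(ler_pM2l e0); apply: (le_trans h2).
    by rewrite ler_pdivrMr ?ltr0n// -ler_pdivrMl ?mulr_gt0// mulrC.
  exists B; split => // x /= nx.
  have nx' : A x /\ ~ (exists j, h j x <= e).
    by move: nx => /not_implyP.
  case: nx' => Ax nx'; split => // j _; split => //; rewrite ltNge; apply/negP => hj; apply: nx'.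
  by exists j.
have := ae_forall_count key; apply: filterS => x hx Ax e e0.
have [k hk] : exists k : nat, k.+1%:R^-1 <= e :> R.
  exists (Num.bound e^-1); rewrite invf_ple ?posrE//.
  have := archi_boundP (ltW (_ : 0 < e^-1)); rewrite invr_gt0 => /(_ e0) eb.
  by apply: (le_trans (ltW eb)); rewrite ler_nat.
by have [j hj] := hx k Ax; exists j; exact: le_trans hk.
Qed.

Lemma ae_pick n (A : set 'rV[R]_n) (P : 'rV[R]_n -> Prop) : measurable A -> (0 < leb A)%E ->
  {ae leb, forall x, A x -> P x} -> exists2 x, A x & P x.
Proof.
move=> mA A0 [N [mN N0 hN]]; apply: contrapT => nex.
have AN : A `<=` N.
  by move=> x Ax; apply: hN => /= hP; apply: nex; exists x => //; exact: hP.
have : (leb A <= leb N)%E by apply: le_measure; rewrite ?inE.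
by rewrite N0 leNgt A0.
Qed.

End tools.

Section slices.
Context {R : realType} {r m : nat}.
Local Notation ig D f := (leb.-integrable D (EFin \o f)).
Variables (p q k c L M : R) (F : 'rV[R]_(r + m) -> R).
Variables (omega : set 'rV[R]_m) (f : 'rV[R]_m -> R).
Hypothesis H : admissible p q k c L M F omega f.
Let p1 := adm_p H.
Let p0 : 0 < p. Proof. exact: lt_trans p1. Qed.
Let mO := adm_measurable H.
Let Ofin := adm_finite H.
Variable mu : R.
Hypothesis Jmu : forall psi, test_function omega psi -> mu <= J2 F omega f psi.

(** The energies of approximating test functions exceed that of their limit by arbitrarily little
(energy_perturb). *)
Lemma closure_lower_bound v (g : 'rV[R]_m -> 'rV[R]_m) : Lp p omega v -> LpV p omega g ->
  (forall e, 0 < e -> exists phi, approx_test p omega v g e phi) ->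
  mu <= \int[leb]_(y in omega) (F2 F (g y) - f y * v y).
Proof.
move=> Lv Lg happ; apply/ler_addgt0Pr => eta eta0.
have [d d0 hd] := energy_perturb p1 (adm_pq H) (F2_convex (adm_convex H)) (adm_L H) (F2_ge0 H) (F2_up H)
  mO Ofin (adm_f H) Lv Lg eta0.
have [phi [tphi h1 h2]] := happ d d0.
have [Lphi Ldphi] := test_LpV H mO tphi.
exact: (le_trans (Jmu tphi) (hd _ _ Lphi Ldphi h1 h2)).
Qed.

Variable ustar : 'rV[R]_(r + m) -> R.
Hypothesis trace0 : zero_trace p (infinite_cylinder omega) ustar.
Hypothesis uW : forall t, W1p p (@tube R r m omega t) ustar.

Local Notation D t := (@tube R r m omega t).
Local Notation g t := (grad (D t) ustar).
Let oD t : open (D t) := @tube_open R r m omega t (adm_open H).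
Let mD t : measurable (D t) := open_rV_measurable (@oD t).

Lemma infinite_cylinder_open : open (@infinite_cylinder R r m omega).
Proof.
apply: (@open_comp _ _ (fun x : 'rV[R]_(r + m) => rsubmx x) omega); last exact: adm_open H.
by move=> x _; exact: continuous_rsubmx.
Qed.

Lemma tube_infinite t : D t `<=` infinite_cylinder omega.
Proof. by move=> x []. Qed.

Lemma tube_bounded t : 0 < t -> exists2 N : R, 0 < N & D t `<=` cube (r + m) N.
Proof.
move=> t0; exists (Num.max t M); first by rewrite lt_max t0.
move=> x [xt xo]; have /= xM := adm_sub H xo; rewrite /cube /= -[x]hsubmxK norm_row_mx_lt; last by rewrite lt_max t0.
by rewrite !lt_max xt xM orbT.
Qed.

(** The hypothesis on the trace is applied to a cutoff that equals 1 on the tube. *)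
Lemma tube_approx t e : 0 < t -> 0 < e -> exists psi, [/\ test_function (infinite_cylinder omega) psi,
  ig (D t) (fun x => `|psi x - ustar x| `^ p), ig (D t) (fun x => `|dgrad psi x - g t x| `^ p),
  \int[leb]_(x in D t) (`|psi x - ustar x| `^ p) <= e &
  \int[leb]_(x in D t) (`|dgrad psi x - g t x| `^ p) <= e].
Proof.
move=> t0 e0; have [N N0 DN] := tube_bounded t0.
have [rho trho rho1] := flat_cutoff (r + m) N0.
have oI := infinite_cylinder_open; have mI := open_rV_measurable oI.
have W0 := trace0 trho.
have [psi [tpsi h1 h2]] := W01p_approx p1 oI W0 e0.
have [[Lru [g0 wg0] Lgru] _] := W0.
have mDt := @mD t.
have [Lpsi Ldpsi] := test_LpV H mI tpsi; have [LpsiD LdpsiD] := test_LpV H mDt tpsi.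
have i1 := ig_powB p1 mI Lpsi Lru; have [mi2 i2] := ig_powB_rV p1 mI Ldpsi Lgru.
have [Lu _ Lg] := uW t.
have j1 := ig_powB p1 mDt LpsiD Lu; have [mj2 j2] := ig_powB_rV p1 mDt LdpsiD Lg.
have DI := @tube_infinite t.
have wru := weak_gradient_sub DI (grad_weak wg0).
have wu : weak_gradient (D t) ustar (grad (infinite_cylinder omega) (rho \* ustar)).
  by apply: weak_gradient_eq wru => x Dx; rewrite /= rho1 ?mul1r//; exact: DN.
have ae := grad_ae (@oD t) wu.
have k1 : \int[leb]_(x in D t) (`|psi x - ustar x| `^ p) <= e.
  apply: le_trans h1; apply: le_trans (subset_Rintegral mDt mI DI (fun x => powR_ge0 _ _) i1).
  rewrite le_eqVlt; apply/orP; left; apply/eqP; apply: eq_Rintegral => x; rewrite inE => Dx.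
  by rewrite /= rho1 ?mul1r//; exact: DN.
have k2 : \int[leb]_(x in D t) (`|dgrad psi x - g t x| `^ p) <= e.
  apply: le_trans h2; apply: le_trans (subset_Rintegral mDt mI DI (fun x => powR_ge0 _ _) i2).
  rewrite le_eqVlt; apply/orP; left; apply/eqP.
  have a1 := ig_measurable j2.
  have a2 := measurable_funS mI DI (ig_measurable i2).
  apply: (ae_Rintegral_eq mDt a1 a2).
  by apply: filterS ae => x hx Dx; rewrite hx.
by exists psi; split; [exact: tpsi|exact: j1|exact: j2|exact: k1|exact: k2].
Qed.

Definition slice (h : 'rV[R]_(r + m) -> R) (x : 'rV[R]_r) (y : 'rV[R]_m) : R := h (row_mx x y).
Definition slice_grad t (x : 'rV[R]_r) (y : 'rV[R]_m) : 'rV[R]_m := rsubmx (g t (row_mx x y)).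

(** The L^p distances of tube_approx are integrals over x' of the distances of the slices. *)
Lemma ae_slices t : 0 < t -> {ae leb, forall x : 'rV[R]_r, cube r t x ->
  [/\ Lp p omega (slice ustar x), LpV p omega (slice_grad t x) &
    forall e, 0 < e -> exists phi, approx_test p omega (slice ustar x) (slice_grad t x) e phi]}.
Proof.
move=> t0; have mc := @cube_measurable R r t; have cfin := @cube_finite R r t t0.
have [mu' iu mg igd _] := W1p_grad p1 (@oD t) (uW t).
have [a1 _ _] := Rfubini mc mO iu; have [a2 _ _] := Rfubini mc mO igd.
have hk (j : nat) : 0 < (j.+1%:R^-1 : R) by rewrite invr_gt0.
have /choice[psi hpsi] : forall j : nat, exists psi, [/\ test_function (infinite_cylinder omega) psi,
    ig (D t) (fun x => `|psi x - ustar x| `^ p), ig (D t) (fun x => `|dgrad psi x - g t x| `^ p),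
    \int[leb]_(x in D t) (`|psi x - ustar x| `^ p) <= j.+1%:R^-1 &
    \int[leb]_(x in D t) (`|dgrad psi x - g t x| `^ p) <= j.+1%:R^-1].
  by move=> j; exact: tube_approx.
pose h j x := `|psi j x - ustar x| `^ p + `|dgrad (psi j) x - g t x| `^ p.
have h0 j x : 0 <= h j x by rewrite addr_ge0 ?powR_ge0.
have ih j : ig (D t) (h j) by have [_ i1 i2 _ _] := hpsi j; exact: (ig_add (@mD t) i1 i2).
have hh j : \int[leb]_(x in D t) h j x <= 2 / j.+1%:R.
  have [_ i1 i2 h1 h2] := hpsi j; rewrite (RintegralD (@mD t) i1 i2).
  by rewrite mulrDl mul1r; exact: lerD.
pose Hj j (x : 'rV[R]_r) := \int[leb]_(y in omega) h j (row_mx x y).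
have a3 : {ae leb, forall x : 'rV[R]_r, cube r t x -> forall e : R, 0 < e -> exists j, Hj j x <= e}.
  apply: (ae_small (c := 2)) => //.
  - by move=> j; have [] := Rfubini mc mO (ih j).
  - by move=> j x; apply: Rintegral_ge0 => y _; exact: h0.
  - by move=> j; have [_ _ <-] := Rfubini mc mO (ih j); exact: hh.
have a4 : {ae leb, forall x : 'rV[R]_r, forall j : nat, cube r t x -> ig omega (fun y => h j (row_mx x y))}.
  by apply: ae_forall_count => j; have [] := Rfubini mc mO (ih j).
apply: filterS2 (filterI a1 a2) (filterI a3 a4) => x [b1 b2] [b3 b4] xt.
have mus : measurable_fun omega (slice ustar x) by exact: (measurable_slice mc mO mu' xt).
have mgs i : measurable_fun omega (fun y => g t (row_mx x y) ord0 i).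
  exact: (measurable_slice mc mO (measurable_fun_coord i mg) xt).
have mgs' : measurable_fun omega (slice_grad t x).
  by apply: measurable_fun_rV => // i; under eq_fun do rewrite mxE; exact: mgs.
have Lus : Lp p omega (slice ustar x) by apply/(LpP p1 _ mO); split => //; exact: b1.
have Lgs : LpV p omega (slice_grad t x).
  apply/(ig_norm_rV_pow p1 _ mO); split => //; apply: (ig_dom mO _ (b2 xt)).
    apply: (measurableT_comp (measurable_powR p)).
    exact: (measurableT_comp (@measurable_norm_rV R m)).
  move=> y _; rewrite ger0_norm ?powR_ge0//; apply: powR_mono => //; first exact: ltW.
  exact: norm_rsubmx_le.
split => // e e0; have [j hj] := b3 xt e e0; have [tpsi _ _ _ _] := hpsi j.
exists (slice (psi j) x).
have ts : test_function omega (slice (psi j) x).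
  by apply: test_slice tpsi => y; rewrite /infinite_cylinder /= row_mxKr.
have [Ls Lds] := test_LpV H mO ts.
split => //.
- apply: le_trans hj; apply: (le_Rintegral mO (ig_powB p1 mO Ls Lus) (b4 j xt)) => y _.
  by rewrite /h /slice lerDl powR_ge0.
- apply: le_trans hj; have [_ i2] := ig_powB_rV p1 mO Lds Lgs.
  apply: (le_Rintegral mO i2 (b4 j xt)) => y _.
  rewrite /h /slice_grad (dgrad_slice _ _ (test_smooth tpsi)).
  rewrite -[X in X <= _]add0r; apply: lerD; first exact: powR_ge0.
  apply: powR_mono; [exact: ltW|exact: normr_ge0|].
  have -> : rsubmx (dgrad (psi j) (row_mx x y)) - rsubmx (g t (row_mx x y)) =
    rsubmx (dgrad (psi j) (row_mx x y) - g t (row_mx x y)) by apply/rowP => i; rewrite !mxE.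
  exact: norm_rsubmx_le.
Qed.

Hypothesis upper : forall t, 0 < t ->
  \int[leb]_(x in D t) (F (g t x) - fbar f x * ustar x) <= (2 * t) ^+ r * mu.

(** The energy of u* on a tube is the sum of its excess and of the energies of its slices. The latter are
at least mu and the total is at most the volume times mu, so the excess vanishes and almost every slice is optimal. *)
Lemma optimal_slices t : 0 < t ->
  {ae leb, forall x, D t x -> lsubmx (g t x) = 0} /\
  {ae leb, forall x : 'rV[R]_r, cube r t x ->
     \int[leb]_(y in omega) (F2 F (slice_grad t x y) - f y * slice ustar x y) = mu}.
Proof.
move=> t0; have mc := @cube_measurable R r t; have cfin := @cube_finite R r t t0.
have Dfin := @tube_finite R r m omega t t0 mO Ofin.
have Lf : Lp q (D t) (fbar f) := Lp_rsubmx (conj_gt1 p1 (adm_pq H)) mc cfin mO (adm_f H).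
have [Lu _ Lg] := uW t; have mDt := @mD t.
have [mg igd] := (ig_norm_rV_pow p1 _ mDt).1 Lg.
have iF := ig_convex p1 (adm_convex H) (adm_L H) (F_ge0 H) (adm_up H) mDt Dfin Lg.
have ifu := ig_pairing p1 (adm_pq H) mDt Lf Lu.
have Lg2 : LpV p (D t) (fun x => row_mx 0 (rsubmx (g t x))).
  apply/(ig_norm_rV_pow p1 _ mDt); have mr : measurable_fun (D t) (fun x => row_mx (0 : 'rV[R]_r) (rsubmx (g t x))).
    apply: measurable_fun_rV => // i; case: (split_ordP i) => j ->.
      by under eq_fun do rewrite row_mxEl mxE; exact: measurable_cst.
    by under eq_fun do rewrite row_mxEr mxE; exact: measurable_fun_coord.
  split => //; apply: (ig_dom mDt _ igd).
    apply: (measurableT_comp (measurable_powR p)).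
    exact: (measurableT_comp (@measurable_norm_rV R (r + m))).
  move=> x _; rewrite ger0_norm ?powR_ge0// norm_row0; apply: powR_mono => //; first exact: ltW.
  exact: norm_rsubmx_le.
have iF2 : ig (D t) (fun x => F2 F (rsubmx (g t x))).
  exact: (ig_convex p1 (adm_convex H) (adm_L H) (F_ge0 H) (adm_up H) mDt Dfin Lg2).
have iex : ig (D t) (fun x => excess F (g t x)) by exact: ig_sub.
have iE2 : ig (D t) (fun x => F2 F (rsubmx (g t x)) - fbar f x * ustar x) by exact: ig_sub.
have [a1 iI EI] := Rfubini mc mO iE2.
have sE (x : 'rV[R]_r) : \int[leb]_(y in omega) (F2 F (rsubmx (g t (row_mx x y))) - fbar f (row_mx x y) * ustar (row_mx x y)) =
    \int[leb]_(y in omega) (F2 F (slice_grad t x y) - f y * slice ustar x y).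
  by apply: eq_Rintegral => y _; rewrite fbar_row.
have lower : {ae leb, forall x : 'rV[R]_r, cube r t x ->
    mu <= \int[leb]_(y in omega) (F2 F (rsubmx (g t (row_mx x y))) - fbar f (row_mx x y) * ustar (row_mx x y))}.
  apply: filterS (ae_slices t0) => x hx xt; have [Ls Lgs happ] := hx xt.
  by rewrite sE; exact: closure_lower_bound.
have lQ : fine (leb (cube r t : set 'rV[R]_r)) = (2 * t) ^+ r by rewrite leb_cube.
have h1 := slice_le mc mO cfin iE2 lower; rewrite lQ in h1.
have h2 : \int[leb]_(x in D t) (F (g t x) - fbar f x * ustar x) =
   \int[leb]_(x in D t) excess F (g t x) + \int[leb]_(x in D t) (F2 F (rsubmx (g t x)) - fbar f x * ustar x).
  rewrite -(RintegralD mDt iex iE2); apply: eq_Rintegral => x _; rewrite /excess; ring.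
have h3 := upper t0; rewrite h2 in h3.
have h4 : 0 <= \int[leb]_(x in D t) excess F (g t x).
  by apply: Rintegral_ge0 => x _; exact: (excess_ge0 H).
have [ex0 E20] : \int[leb]_(x in D t) excess F (g t x) <= 0 /\
    \int[leb]_(x in D t) (F2 F (rsubmx (g t x)) - fbar f x * ustar x) <= (2 * t) ^+ r * mu.
  rewrite mulrC in h1; split.
    by rewrite -(lerD2r (\int[leb]_(x in D t) (F2 F (rsubmx (g t x)) - fbar f x * ustar x))) add0r (le_trans h3).
  by apply: le_trans h3; rewrite lerDr.
split.
  have := Rintegral_le0_eq0 mDt iex (fun x _ => excess_ge0 H _) ex0; apply: filterS => x hx Dx.
  have := adm_Glow H (g t x); rewrite -/(excess F (g t x)) hx// => hle.
  have ge0 := excess_growth_ge0 H (g t x).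
  have : excess_growth p k (g t x) <= 0 by rewrite -(ler_pM2l (adm_c H)) mulr0.
  rewrite /excess_growth => le0.
  have : `|lsubmx (g t x)| `^ p <= 0.
    apply: le_trans le0; rewrite lerDl mulr_ge0 ?powR_ge0// mulr_ge0 ?powR_ge0//.
    exact: adm_k0 H.
  move=> n0; apply/eqP; rewrite -normr_eq0; apply/eqP.
  have : `|lsubmx (g t x)| `^ p = 0 by apply/eqP; rewrite eq_le n0 powR_ge0.
  by move/powR_eq0_eq0.
have iIm : ig (cube r t) (fun x : 'rV[R]_r => \int[leb]_(y in omega) (F2 F (rsubmx (g t (row_mx x y))) - fbar f (row_mx x y) * ustar (row_mx x y)) - mu).
  by apply: ig_sub => //; exact: ig_cst.
have aeabs : {ae leb, forall x : 'rV[R]_r, cube r t x ->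
   \int[leb]_(y in omega) (F2 F (rsubmx (g t (row_mx x y))) - fbar f (row_mx x y) * ustar (row_mx x y)) - mu =
   `|\int[leb]_(y in omega) (F2 F (rsubmx (g t (row_mx x y))) - fbar f (row_mx x y) * ustar (row_mx x y)) - mu|}.
  by apply: filterS lower => x hx xt; rewrite ger0_norm// subr_ge0 hx.
have ia := ig_abs mc iIm.
have abs0 : \int[leb]_(x in cube r t) `|\int[leb]_(y in omega) (F2 F (rsubmx (g t (row_mx x y))) - fbar f (row_mx x y) * ustar (row_mx x y)) - mu| <= 0.
  rewrite -(ae_Rintegral_eq mc (ig_measurable iIm) (ig_measurable ia) aeabs).
  have ic : ig (cube r t) (fun=> mu : R) by exact: ig_cst.
  by rewrite (RintegralB mc iI ic) -EI Rintegral_cst// lQ subr_le0 mulrC.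
have := Rintegral_le0_eq0 mc ia (fun x _ => normr_ge0 _) abs0; apply: filterS => x hx xt.
have /eqP := hx xt; rewrite normr_eq0 subr_eq0 => /eqP <-.
by rewrite sE.
Qed.

End slices.

Section translations.
Context {R : realType}.
Local Notation ig D f := (leb.-integrable D (EFin \o f)).
Local Notation e_ i := (delta_mx ord0 i).

Lemma measurable_shift n (h : 'rV[R]_n) : measurable_fun setT (fun x : 'rV[R]_n => x + h).
Proof.
apply/measurable_fun_rVP => i.
rewrite (_ : _ \o _ = (fun x => rV_coord i x + h ord0 i)); last first.
  by apply/funext => x; rewrite /= /rV_coord !mxE.
by apply: measurable_funD; [exact: measurable_rV_coord|exact: measurable_cst].
Qed.

Lemma ae_shift n (h : 'rV[R]_n) (P : 'rV[R]_n -> Prop) :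
  {ae leb, forall x, P x} -> {ae leb, forall x, P (x + h)}.
Proof.
move=> [N [mN N0 hN]].
pose Nh := [set x : 'rV[R]_n | N (x + h)].
have mNh : measurable Nh by rewrite -[X in measurable X]setTI; exact: (measurable_shift h measurableT mN).
exists Nh; split => //; last by move=> x /= hx; apply: hN.
have mf : measurable_fun setT (fun x : 'rV[R]_n => (\1_N x : R)%:E).
  by apply/measurable_EFinP; exact: measurable_indic.
have e1 : (\int[leb]_(x in [set: 'rV[R]_n]) (\1_Nh x : R)%:E = leb Nh)%E by rewrite integral_indic// setIT.
have e2 : (\int[leb]_(x in [set: 'rV[R]_n]) (\1_N x : R)%:E = leb N)%E by rewrite integral_indic// setIT.
rewrite -e1 -N0 -e2 -(ge0_integral_rV_shift h mf) => [|x]; last by rewrite lee_fin.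
by apply: eq_integral.
Qed.

(** Both hypothesis and conclusion say that B is a null set, by Tonelli's theorem. *)
Lemma ae_swap n m (B : set 'rV[R]_(n + m)) : measurable B ->
  {ae leb, forall x : 'rV[R]_n, {ae leb, forall y : 'rV[R]_m, ~ B (row_mx x y)}} ->
  {ae leb, forall y : 'rV[R]_m, {ae leb, forall x : 'rV[R]_n, ~ B (row_mx x y)}}.
Proof.
move=> mB h; pose f z : \bar R := (\1_B z)%:E.
have mf : measurable_fun setT f by apply/measurable_EFinP; exact: measurable_indic.
have f0 z : (0 <= f z)%E by rewrite lee_fin.
have sw := ge0_integral_rV_split_sym mf f0.
have mf2 : measurable_fun setT (fun z : 'rV[R]_n * 'rV[R]_m => f (row_mx z.1 z.2)).
  by apply: (measurableT_comp mf); exact: measurable_row_mx.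
have mx (x : 'rV[R]_n) : measurable_fun setT (fun y : 'rV[R]_m => f (row_mx x y)).
  exact: (measurableT_comp mf2 (measurable_pair1 _)).
have my (y : 'rV[R]_m) : measurable_fun setT (fun x : 'rV[R]_n => f (row_mx x y)).
  exact: (measurableT_comp mf2 (measurable_pair2 _)).
have mFx : measurable_fun setT (fun x : 'rV[R]_n => \int[leb]_y f (row_mx x y))%E.
  exact: (@measurable_fun_fubini_tonelli_F _ _ _ _ R leb _ mf2 (fun z => f0 _)).
have mFy : measurable_fun setT (fun y : 'rV[R]_m => \int[leb]_x f (row_mx x y))%E.
  exact: (@measurable_fun_fubini_tonelli_G _ _ _ _ R leb _ mf2 (fun z => f0 _)).
have z1 : (\int[leb]_x \int[leb]_y f (row_mx x y) = 0)%E.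
  transitivity (\int[leb]_(x in [set: 'rV[R]_n]) (cst 0%E x))%E; last by rewrite integral0.
  apply: ae_eq_integral => //; apply: filterS h => x hx _.
  transitivity (\int[leb]_(y in [set: 'rV[R]_m]) (cst 0%E y))%E; last by rewrite integral0.
  apply: ae_eq_integral => //; apply: filterS hx => y hy _.
  by rewrite /f indicE memNset.
have zero k (G : 'rV[R]_k -> \bar R) : measurable_fun setT G -> (forall x, 0 <= G x)%E ->
    (\int[leb]_x G x = 0)%E -> {ae leb, forall x, G x = 0%E}.
  move=> mG G0 IG; have := (ae_eq_integral_abs leb measurableT mG).1.
  rewrite (_ : (\int[leb]_(x in setT) `|G x|)%E = 0%E); last first.
    by rewrite -IG; apply: eq_integral => x _; rewrite gee0_abs.
  by move=> /(_ erefl); apply: filterS => x; apply.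
have := zero _ _ mFy (fun y => integral_ge0 _ (fun x _ => f0 _)).
rewrite -sw z1 => /(_ erefl); apply: filterS => y hy.
have := zero _ _ (my y) (fun x => f0 _) hy; apply: filterS => x.
move=> hx Bx; move: hx; rewrite /f indicE mem_set//= => -[/eqP]; by rewrite oner_eq0.
Qed.

Lemma increment_split (p U U' P P' : R) : 0 < p ->
  `|U' - U| `^ p <= 2 `^ p * (2 `^ p * (`|P' - U'| `^ p + `|P - U| `^ p) + `|P' - P| `^ p).
Proof.
move=> p0; have p00 := ltW p0.
have E : `|U' - U| <= (`|P' - U'| + `|P - U|) + `|P' - P|.
  have -> : U' - U = (P - U) - (P' - U') + (P' - P) by ring.
  by apply: (le_trans (ler_normD _ _)); rewrite lerD2r; apply: (le_trans (ler_normB _ _)); rewrite addrC.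
apply: (le_trans (powR_le_add p00 (normr_ge0 _) (addr_ge0 (normr_ge0 _) (normr_ge0 _)) (normr_ge0 _) E)).
by rewrite ler_wpM2l ?powR_ge0// lerD2r powR_add_le.
Qed.

(** The increments of the approximating smooth functions are controlled by their i-th derivatives, which tend
to zero in L^p; the increments themselves pass to the limit in L^p. *)
Lemma flat_translation n (p s : R) i (A D : set 'rV[R]_n) u g : 1 < p -> 0 < s ->
  measurable A -> measurable D -> A `<=` D ->
  (forall x t, A x -> 0 <= t <= s -> D (t *: e_ i + x)) -> Lp p D u -> LpV p D g ->
  {ae leb, forall x, D x -> g x ord0 i = 0} ->
  (forall e, 0 < e -> exists psi, [/\ smooth psi,
    ig D (fun x => `|psi x - u x| `^ p), ig D (fun x => `|dgrad psi x - g x| `^ p),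
    \int[leb]_(x in D) (`|psi x - u x| `^ p) <= e & \int[leb]_(x in D) (`|dgrad psi x - g x| `^ p) <= e]) ->
  {ae leb, forall x, A x -> u (s *: e_ i + x) = u x}.
Proof.
move=> p1 s0 mA mD AD ADs Lu Lg g0 happ; have p0 : 0 < p := lt_trans ltr01 p1.
have ADe x : A x -> D (s *: e_ i + x) by move=> Ax; apply: ADs => //; rewrite lexx (ltW s0).
have [mu _] := (LpP p1 _ mD).1 Lu; have [mg _] := (ig_norm_rV_pow p1 g mD).1 Lg.
pose U := u \_ D; have mU : measurable_fun setT U by apply/(measurable_restrictT _ mD).
pose sh (x : 'rV[R]_n) := s *: e_ i + x.
have msh : measurable_fun setT sh.
  by rewrite (_ : sh = fun x => x + s *: e_ i); [exact: measurable_shift|apply/funext => x; rewrite /sh addrC].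
have mUs : measurable_fun setT (U \o sh) by exact: measurableT_comp.
pose W := (fun x => `|U (sh x) - U x| `^ p) \_ A.
have mW : measurable_fun setT W.
  apply/(measurable_restrictT _ mA); apply: measurable_funTS.
  apply: (measurableT_comp (measurable_powR p)); apply: measurableT_comp => //.
  exact: measurable_funB.
have W0 x : 0 <= W x by rewrite /W patchE; case: ifP => // _; exact: powR_ge0.
pose C := 2 `^ p * (2 `^ p * (1 + 1) + s `^ p).
have C0 : 0 < C by rewrite mulr_gt0 ?powR_gt0// ltr_wpDr ?powR_ge0// mulr_gt0 ?powR_gt0.
have bound e : 0 < e -> (\int[leb]_x (W x)%:E <= (C * e)%:E)%E.
  move=> e0; have [psi [spsi i1 i2 h1 h2]] := happ e e0.
  pose a := (fun x => `|psi x - u x| `^ p) \_ D.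
  pose b := (fun x => `|psi (sh x) - psi x| `^ p) \_ A.
  have a0 x : 0 <= a x by rewrite /a patchE; case: ifP => // _; exact: powR_ge0.
  have b0 x : 0 <= b x by rewrite /b patchE; case: ifP => // _; exact: powR_ge0.
  have ma : measurable_fun setT a by apply/(measurable_restrictT _ mD); exact: ig_measurable i1.
  have mas : measurable_fun setT (a \o sh) by exact: measurableT_comp.
  have mpsi : measurable_fun setT psi by exact: smooth_measurable.
  have mb : measurable_fun setT b.
    apply/(measurable_restrictT _ mA); apply: measurable_funTS.
    apply: (measurableT_comp (measurable_powR p)); apply: measurableT_comp => //.
    by apply: measurable_funB => //; exact: measurableT_comp.
  have Ia : (\int[leb]_x (a x)%:E <= e%:E)%E.
    have -> : (\int[leb]_x (a x)%:E = \int[leb]_(x in D) (`|psi x - u x| `^ p)%:E)%E.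
      rewrite [RHS]integral_mkcond; apply: eq_integral => x _; rewrite /a !patchE.
      by case: ifP.
    exact/(Rint_le _ mD i1).
  have Ias : (\int[leb]_x (a (sh x))%:E <= e%:E)%E.
    have mae : measurable_fun setT (EFin \o a) by exact/measurable_EFinP.
    have sE := ge0_integral_rV_shift (s *: e_ i) mae (fun x => a0 x : (0 <= (a x)%:E)%E).
    have -> : (\int[leb]_x (a (sh x))%:E = \int[leb]_x (a x)%:E)%E; last exact: Ia.
    by rewrite -[RHS]sE; apply: eq_integral => x _; rewrite /sh /= addrC.
  have Ib : (\int[leb]_x (b x)%:E <= (s `^ p * e)%:E)%E.
    have -> : (\int[leb]_x (b x)%:E = \int[leb]_(x in A) (`|psi (sh x) - psi x| `^ p)%:E)%E.
      rewrite [RHS]integral_mkcond; apply: eq_integral => x _; rewrite /b !patchE.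
      by case: ifP.
    apply: (le_trans (translation_pow_le p1 spsi s0 mA mD ADs)).
    rewrite EFinM; apply: lee_wpmul2l; first by rewrite lee_fin powR_ge0.
    have mdp : measurable_fun D (fun x => partial i psi x - g x ord0 i).
      apply: measurable_funB; last exact: measurable_fun_coord.
      by apply: measurable_funTS; apply: smooth_measurable; exact: smooth_partial.
    have mdq : measurable_fun D (partial i psi).
      by apply: measurable_funTS; apply: smooth_measurable; exact: smooth_partial.
    have mpw (w : 'rV[R]_n -> R) : measurable_fun D w -> measurable_fun D (fun x => (`|w x| `^ p)%:E).
      move=> mw; apply/measurable_EFinP; apply: (measurableT_comp (measurable_powR p)).
      exact: measurableT_comp.
    have -> : (\int[leb]_(x in D) (`|partial i psi x| `^ p)%:E =
        \int[leb]_(x in D) (`|partial i psi x - g x ord0 i| `^ p)%:E)%E.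
      apply: ae_eq_integral; [exact: mD|exact: (mpw _ mdq)|exact: (mpw _ mdp)|].
      by apply: filterS g0 => x hx Dx; rewrite hx// subr0.
    have h2' : (\int[leb]_(x in D) (`|dgrad psi x - g x| `^ p)%:E <= e%:E)%E by exact/(Rint_le _ mD i2).
    apply: le_trans h2'; apply: ge0_le_integral => //.
    + exact: mpw.
    + by apply/measurable_EFinP; exact: ig_measurable i2.
    + move=> x _; rewrite lee_fin; apply: powR_mono; [exact: ltW|exact: normr_ge0|].
      by have := coord_norm_le (dgrad psi x - g x) i; rewrite !mxE.
  have pw x : ((W x)%:E <= (2 `^ p)%:E * ((2 `^ p)%:E * ((a (sh x))%:E + (a x)%:E) + (b x)%:E))%E.
    change ((W x)%:E <= (2 `^ p * (2 `^ p * (a (sh x) + a x) + b x))%:E)%E; rewrite lee_fin /W patchE; case: ifPn => [|_]; last first.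
      by rewrite mulr_ge0 ?powR_ge0// addr_ge0// mulr_ge0 ?powR_ge0// addr_ge0.
    rewrite inE => Ax; rewrite /a /b /U !patchE !mem_set//; try exact: AD; try exact: ADe.
    exact: increment_split.
  have e2 : (0 <= (2 `^ p)%:E :> \bar R)%E by rewrite lee_fin powR_ge0.
  have mE (w : 'rV[R]_n -> R) : measurable_fun setT w -> measurable_fun setT (fun x => (w x)%:E).
    by move=> ?; exact/measurable_EFinP.
  have m1 : measurable_fun setT (fun x => (a (sh x))%:E + (a x)%:E)%E.
    by apply: emeasurable_funD; exact: mE.
  have m2 : measurable_fun setT (fun x => (2 `^ p)%:E * ((a (sh x))%:E + (a x)%:E))%E by exact: measurable_funeM.
  have m3 : measurable_fun setT (fun x => (2 `^ p)%:E * ((a (sh x))%:E + (a x)%:E) + (b x)%:E)%E.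
    by apply: emeasurable_funD => //; exact: mE.
  have a0e x : (0 <= (a x)%:E)%E by rewrite lee_fin.
  have b0e x : (0 <= (b x)%:E)%E by rewrite lee_fin.
  have n1 x : (0 <= (a (sh x))%:E + (a x)%:E)%E by exact: (adde_ge0 (a0e _) (a0e _)).
  have n2 x : (0 <= (2 `^ p)%:E * ((a (sh x))%:E + (a x)%:E))%E by exact: (mule_ge0 e2 (n1 x)).
  have n3 x : (0 <= (2 `^ p)%:E * ((a (sh x))%:E + (a x)%:E) + (b x)%:E)%E by exact: (adde_ge0 (n2 x) (b0e x)).
  apply: (@le_trans _ _ (\int[leb]_x ((2 `^ p)%:E * ((2 `^ p)%:E * ((a (sh x))%:E + (a x)%:E) + (b x)%:E)))%E).
    apply: ge0_le_integral; [exact: measurableT|by move=> x _; rewrite lee_fin|exact: mE|exact: measurable_funeM|by move=> x _; exact: pw].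
  rewrite (ge0_integralZl leb measurableT m3 (fun x _ => n3 x) e2).
  rewrite (ge0_integralD leb measurableT (fun x _ => n2 x) m2 (fun x _ => b0e x) (mE _ mb)).
  rewrite (ge0_integralZl leb measurableT m1 (fun x _ => n1 x) e2).
  rewrite (ge0_integralD leb measurableT (fun x _ => a0e (sh x)) (mE _ mas) (fun x _ => a0e x) (mE _ ma)).
  rewrite /C -mulrA mulrDl -[2 `^ p * (1 + 1) * e]mulrA mulrDl mul1r !EFinM !EFinD !EFinM EFinD.
  apply: lee_wpmul2l => //; apply: leeD; last exact: Ib.
  by apply: (lee_wpmul2l e2); exact: (leeD Ias Ia).
have I0 : (\int[leb]_x (W x)%:E = 0)%E.
  apply/eqP; rewrite eq_le; apply/andP; split; last by apply: integral_ge0 => x _; rewrite lee_fin.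
  apply/lee_addgt0Pr => e e0; rewrite add0e.
  have := bound (e / C) (divr_gt0 e0 C0); rewrite mulrC divfK// gt_eqF//.
have mWe : measurable_fun setT (EFin \o W) by exact/measurable_EFinP.
have := (ae_eq_integral_abs leb measurableT mWe).1.
rewrite (_ : (\int[leb]_(x in setT) `|(EFin \o W) x|)%E = 0%E); last first.
  by rewrite -I0; apply: eq_integral => x _ /=; rewrite ger0_norm.
move=> /(_ erefl); apply: filterS => x /(_ I) /= [] hx Ax; move: hx.
rewrite /W patchE mem_set// => /powR_eq0_eq0 /eqP; rewrite normr_eq0 subr_eq0 => /eqP.
by rewrite /U !patchE !mem_set//; [exact: AD|exact: ADe].
Qed.

End translations.

(** * Invariance under horizontal translations *)

Section invariance.
Context {R : realType} {r m : nat}.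
Local Notation ig D f := (leb.-integrable D (EFin \o f)).
Local Notation e_ i := (delta_mx ord0 i).
Variables (p q k c L M : R) (F : 'rV[R]_(r + m) -> R).
Variables (omega : set 'rV[R]_m) (f : 'rV[R]_m -> R).
Hypothesis H : admissible p q k c L M F omega f.
Let p1 := adm_p H.
Variable ustar : 'rV[R]_(r + m) -> R.
Hypothesis trace0 : zero_trace p (infinite_cylinder omega) ustar.
Hypothesis uW : forall t, W1p p (@tube R r m omega t) ustar.
Hypothesis flat : forall t, 0 < t ->
  {ae leb, forall x, @tube R r m omega t x -> lsubmx (grad (@tube R r m omega t) ustar x) = 0}.

Local Notation D t := (@tube R r m omega t).
Local Notation zero_extension := (ustar \_ (infinite_cylinder omega)).

Lemma measurable_zero_extension : measurable_fun setT zero_extension.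
Proof.
have oI := @infinite_cylinder_open R r m p q k c L M F omega f H; have mI := open_rV_measurable oI.
apply/(measurable_restrictT _ mI).
have E : infinite_cylinder omega = \bigcup_(j : nat) D j.+1%:R.
  apply/seteqP; split => [x xo|x [j _ [_ xo]]]; last exact: xo.
  exists (Num.bound `|lsubmx x|) => //; split => //=; rewrite /cube /=.
  apply: (lt_le_trans (archi_boundP (normr_ge0 _))); by rewrite ler_nat.
rewrite E; apply/measurable_fun_bigcup => j.
  exact: open_rV_measurable (@tube_open R r m omega _ (adm_open H)).
have [Lu _ _] := uW j.+1%:R.
by have [] := (LpP p1 _ (open_rV_measurable (@tube_open R r m omega _ (adm_open H)))).1 Lu.
Qed.

(** Invariance is stated for the extension by zero because horizontal translations preserve the infinite
cylinder; the set of invariant directions is then a group. *)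
Definition shift_invariant (h : 'rV[R]_r) :=
  {ae leb, forall x : 'rV[R]_(r + m), zero_extension (x + row_mx h 0) = zero_extension x}.

Lemma shift_invariantD h h' : shift_invariant h -> shift_invariant h' -> shift_invariant (h + h').
Proof.
move=> ih ih'; have ih2 := ae_shift (row_mx h' 0) ih.
apply: filterS2 ih' ih2 => x e1 e2; rewrite -e1 -e2; congr (zero_extension _).
by rewrite -addrA add_row_mx addr0 [h' + h]addrC.
Qed.

Lemma shift_invariantN h : shift_invariant h -> shift_invariant (- h).
Proof.
move=> ih; have := ae_shift (row_mx (- h) 0) ih; apply: filterS => x <-; congr (zero_extension _).
by rewrite -addrA add_row_mx addr0 addNr row_mx0 addr0.
Qed.

Lemma shift_invariant0 : shift_invariant 0.
Proof. by apply: aeW => x; rewrite row_mx0 addr0. Qed.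

(** The translation of a tube by s stays within the tube whose half-side is larger by s; the infinite
cylinder is a countable union of tubes. *)
Lemma shift_invariant_coord i s : 0 < s -> shift_invariant (s *: e_ i).
Proof.
move=> s0.
have key (j : nat) : {ae leb, forall x, D j.+1%:R x -> ustar (s *: e_ (lshift m i) + x) = ustar x}.
  set t : R := j.+1%:R; have t0 : 0 < t by rewrite ltr0n.
  have ts0 : 0 < t + s by exact: addr_gt0.
  have oD t' := @tube_open R r m omega t' (adm_open H).
  have [Lu _ Lg] := uW (t + s).
  have sub : D t `<=` D (t + s).
    by move=> x [xt xo]; split => //; apply: (lt_le_trans xt); rewrite lerDl ltW.
  apply: (@flat_translation R _ p s (lshift m i) (D t) (D (t + s)) ustar (grad (D (t + s)) ustar) p1 s0
    (open_rV_measurable (oD t)) (open_rV_measurable (oD (t + s))) sub) => //.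
  - move=> x a [xt xo] /andP[a0 as_]; split; rewrite /cube /=.
      have -> : lsubmx (a *: e_ (lshift m i) + x) = a *: e_ i + lsubmx x.
        apply/rowP => j'; rewrite !mxE; congr (a * _ + _).
      apply: (le_lt_trans (ler_normD _ _)); rewrite addrC; apply: ltr_leD => //.
      rewrite normrZ (ger0_norm a0); apply: le_trans as_; rewrite ler_piMr//.
      rewrite norm_rV_le//; apply/forallP => j'; rewrite !mxE.
      by rewrite normr_nat lern1 leq_b1.
    have -> : rsubmx (a *: e_ (lshift m i) + x) = rsubmx x; last by [].
    apply/rowP => j'; rewrite !mxE.
    by rewrite eqxx/= eq_sym eq_lrshift mulr0 add0r.
  - have := flat ts0; apply: filterS => x hx Dx; have := hx Dx => /rowP /(_ i).
    by rewrite !mxE.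
  - move=> e e0; have [psi [tpsi i1 i2 h1 h2]] := @tube_approx R r m p q k c L M F omega f H ustar trace0 uW (t + s) e ts0 e0.
    by exists psi; split; [exact: test_smooth tpsi|exact: i1|exact: i2|exact: h1|exact: h2].
have := ae_forall_count key; apply: filterS => x hx.
have rE : rsubmx (x + row_mx (s *: e_ i) 0) = rsubmx x.
  by apply/rowP => j; rewrite !mxE; case: split_ordP => j' /eqP; rewrite ?eq_rshift ?eq_rlshift// => _; rewrite mxE addr0.
rewrite !patchE; case: ifPn => [|]; last first.
  rewrite notin_setE => nx; rewrite memNset// => xo; apply: nx.
  by rewrite /infinite_cylinder /= rE.
rewrite inE /infinite_cylinder /= rE => xo; rewrite mem_set//.
have xD : D (Num.bound `|lsubmx x|).+1%:R x.
  split => //=; rewrite /cube /=; apply: (lt_le_trans (archi_boundP (normr_ge0 _))).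
  by rewrite ler_nat.
rewrite -(hx _ xD); congr (ustar _); rewrite addrC; congr (_ + _).
apply/rowP => j; rewrite !mxE; case: split_ordP => j' ->.
  by rewrite !mxE !eqxx/= (inj_eq (@lshift_inj _ _)).
by rewrite !mxE eqxx/= eq_rlshift mulr0.
Qed.

Lemma shift_invariant_all h : shift_invariant h.
Proof.
rewrite (row_sum_delta h); elim/big_ind: _ => [||i _].
- exact: shift_invariant0.
- exact: shift_invariantD.
have [h0|h0|->] := ltgtP (h ord0 i) 0; last by rewrite scale0r; exact: shift_invariant0.
- have -> : h ord0 i *: e_ i = - ((- h ord0 i) *: e_ i) :> 'rV[R]_r by rewrite scaleNr opprK.
  by apply: shift_invariantN; apply: shift_invariant_coord; rewrite oppr_gt0.
- exact: shift_invariant_coord.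
Qed.

(** For every h, u* is invariant by h off a null set depending on h. Tonelli's theorem exchanges the quantifiers:
for almost every x the value u*(x) is taken at almost all points of the horizontal space through x, hence almost
every y in R^r yields the value of u* at almost every x. *)
Lemma invariant_slice : {ae leb, forall y : 'rV[R]_r, {ae leb, forall x : 'rV[R]_(r + m),
  infinite_cylinder omega x -> ustar x = ustar (row_mx y (rsubmx x))}}.
Proof.
have mU := measurable_zero_extension.
pose U := zero_extension.
pose sh (z : 'rV[R]_(r + (r + m))) := rsubmx z + row_mx (lsubmx z) 0.
(* the first r coordinates of the point are replaced by the additional ones *)
pose re (z : 'rV[R]_((r + m) + r)) := row_mx (rsubmx z) (rsubmx (lsubmx z)).
have msh : measurable_fun setT sh.
  apply: measurable_fun_rV => // i; rewrite /sh; under eq_fun do rewrite mxE.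
  apply: measurable_funD; first by apply: measurable_fun_coord; exact: measurable_rsubmx.
  apply: measurable_fun_coord.
  rewrite (_ : (fun x => _) = (fun z : 'rV[R]_r * 'rV[R]_m => row_mx z.1 z.2) \o (fun z : 'rV[R]_(r + (r + m)) => (lsubmx z, 0)))//.
  apply: (measurableT_comp (@measurable_row_mx R r m)).
  by apply: measurable_fun_pair; [exact: measurable_lsubmx|exact: measurable_cst].
have mre : measurable_fun setT re.
  rewrite (_ : re = (fun z : 'rV[R]_r * 'rV[R]_m => row_mx z.1 z.2) \o (fun z : 'rV[R]_((r + m) + r) => (rsubmx z, rsubmx (lsubmx z))))//.
  apply: (measurableT_comp (@measurable_row_mx R r m)).
  apply: measurable_fun_pair; first exact: measurable_rsubmx.
  by apply: (measurableT_comp (@measurable_rsubmx R _ _)); exact: measurable_lsubmx.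
have neq N (v w : 'rV[R]_N -> R) : measurable_fun setT v -> measurable_fun setT w ->
    measurable [set z | v z <> w z].
  move=> mv mw; rewrite (_ : [set z | _] = ~` [set z | v z - w z = 0]).
    apply: measurableC.
    by have := measurable_funB mv mw measurableT (measurable_set1 (0 : R)); rewrite setTI.
  apply/seteqP; split => z /= h h'; apply: h; first by apply/eqP; rewrite -subr_eq0 h'.
  by rewrite h' subrr.
have a1 : {ae leb, forall x : 'rV[R]_(r + m), {ae leb, forall h : 'rV[R]_r, U (x + row_mx h 0) = U x}}.
  have mB : measurable [set z | U (sh z) <> U (rsubmx z)].
    apply: neq; apply: (measurableT_comp mU) => //; exact: measurable_rsubmx.
  have := ae_swap mB.
  have h : {ae leb, forall h : 'rV[R]_r, {ae leb, forall x : 'rV[R]_(r + m), ~ [set z | U (sh z) <> U (rsubmx z)] (row_mx h x)}}.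
    apply: aeW => h; have := shift_invariant_all h; apply: filterS => x hx /=.
    by rewrite /sh row_mxKr row_mxKl; apply; exact: hx.
  move=> /(_ h); apply: filterS => x; apply: filterS => h' /=.
  by rewrite /sh row_mxKr row_mxKl => /contrapT.
have mB : measurable [set z | U (re z) <> U (lsubmx z)].
  apply: neq; apply: (measurableT_comp mU) => //; exact: measurable_lsubmx.
have := ae_swap mB.
have h : {ae leb, forall x : 'rV[R]_(r + m), {ae leb, forall y : 'rV[R]_r, ~ [set z | U (re z) <> U (lsubmx z)] (row_mx x y)}}.
  apply: filterS a1 => x hx; have := ae_shift (- lsubmx x) hx; apply: filterS => y hy /=.
  rewrite /re row_mxKr row_mxKl => /(_ _); apply; rewrite -hy; congr U.
  have -> : x + row_mx (y - lsubmx x) 0 = row_mx y (rsubmx x) by rewrite -{1}[x]hsubmxK add_row_mx addr0 addrC subrK.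
  by [].
move=> /(_ h); apply: filterS => y; apply: filterS => x /= hx xo; move: hx.
rewrite /re row_mxKr row_mxKl => /contrapT; rewrite /U !patchE !mem_set//.
by rewrite /infinite_cylinder /= row_mxKr.
Qed.

End invariance.

(** * Minimality of the limit *)

Section minimal_slice.
Context {R : realType} {r m : nat}.
Variables (p q k c L M : R) (F : 'rV[R]_(r + m) -> R).
Variables (omega : set 'rV[R]_m) (f : 'rV[R]_m -> R).
Hypothesis H : admissible p q k c L M F omega f.
Let p1 := adm_p H.
Let oO := adm_open H.
Variable mu : R.
Hypothesis Jmu : forall psi, test_function omega psi -> mu <= J2 F omega f psi.

Lemma W01p_lower_bound w : W01p p omega w -> mu <= energy (F2 F) f omega w.
Proof.
move=> W; have [[Lw _ Lg] _] := W.
by apply: (closure_lower_bound H Jmu Lw Lg) => e e0; exact: W01p_approx.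
Qed.

Variable ustar : 'rV[R]_(r + m) -> R.
Hypothesis trace0 : zero_trace p (infinite_cylinder omega) ustar.
Hypothesis uW : forall t, W1p p (@tube R r m omega t) ustar.
Hypothesis upper : forall t, 0 < t ->
  \int[leb]_(x in @tube R r m omega t) (F (grad (@tube R r m omega t) ustar x) - fbar f x * ustar x) <= (2 * t) ^+ r * mu.

(** Being optimal, being a limit of test functions and representing u* are properties of almost every slice, so one
slice has them all. *)
Lemma minimal_slice : exists v, {ae leb, forall x, infinite_cylinder omega x -> ustar x = v (rsubmx x)} /\
  is_minimizer p (F2 F) f omega v.
Proof.
have flat t (t0 : 0 < t) := (optimal_slices H Jmu trace0 uW upper t0).1.
have [_ opt] := optimal_slices H Jmu trace0 uW upper ltr01.
have sl := ae_slices H trace0 uW ltr01.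
have inv := invariant_slice H trace0 uW flat.
have pos : (0 < leb (cube r (1 : R)))%E by rewrite leb_cube// lte_fin exprn_gt0// mulr_gt0.
have [y _ [Ey [Lv Lg happ] Iy]] : exists2 y : 'rV[R]_r, cube r 1 y &
  [/\ \int[leb]_(z in omega) (F2 F (slice_grad omega ustar 1 y z) - f z * slice ustar y z) = mu,
   [/\ Lp p omega (slice ustar y), LpV p omega (slice_grad omega ustar 1 y) &
    forall e, 0 < e -> exists phi, approx_test p omega (slice ustar y) (slice_grad omega ustar 1 y) e phi] &
   {ae leb, forall x, infinite_cylinder omega x -> ustar x = ustar (row_mx y (rsubmx x))}].
  apply: (ae_pick (@cube_measurable R r 1) pos).
  by apply: filterS3 opt sl inv => y h1 h2 h3 y1; split; [exact: h1|exact: h2|exact: h3].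
exists (slice ustar y); split; first exact: Iy.
have W := W01p_of_approx p1 oO Lv Lg happ.
split; first exact: W.
have wg := weak_gradient_limit p1 oO Lv Lg happ.
have mO := adm_measurable H.
have [mg _] := (ig_norm_rV_pow p1 _ mO).1 Lg.
have [mf _] := (LpP (conj_gt1 p1 (adm_pq H)) f mO).1 (adm_f H).
have mPhi : measurable_fun setT (F2 F).
  exact: (convex_measurable p1 (F2_convex (adm_convex H)) (adm_L H) (F2_ge0 H) (F2_up H)).
have [W1 _] := W.
rewrite (energy_ae p1 oO mPhi W1 mg mf (grad_ae oO wg)) Ey.
exact: W01p_lower_bound.
Qed.

End minimal_slice.

Section interface.
Context {R : realType} {r m : nat}.
Local Notation N := ((r + m)%:R : R).

Lemma enorm_pow_ge n (x : 'rV[R]_n) p : 0 <= p -> `|x| `^ p <= enorm x `^ p.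
Proof. by move=> p0; apply: powR_mono => //; exact: norm_le_enorm. Qed.

Lemma enorm_pow_le n N (x : 'rV[R]_n) p : (n <= N)%N -> 0 <= p -> enorm x `^ p <= N%:R `^ p * `|x| `^ p.
Proof.
move=> nN p0; rewrite -powRM//; apply: powR_mono => //; first exact: enorm_ge0.
by apply: (le_trans (enorm_le x)); rewrite ler_wpM2r// ler_nat.
Qed.

Lemma growth_ge p k (x : 'rV[R]_(r + m)) : 0 <= k -> k <= p -> excess_growth p k x <= growth p k x.
Proof.
move=> k0 kp; have p0 := le_trans k0 kp; apply: lerD; first exact: enorm_pow_ge.
by apply: ler_pM; rewrite ?mulr_ge0 ?powR_ge0 ?enorm_pow_ge// ler_wpM2l// enorm_pow_ge// subr_ge0.
Qed.

Lemma growth_le p k (x : 'rV[R]_(r + m)) : 0 <= k -> k < p -> growth p k x <= N `^ p * excess_growth p k x.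
Proof.
move=> k0 kp; have p0 := le_trans k0 (ltW kp); rewrite /excess_growth mulrDr.
apply: lerD; first by apply: enorm_pow_le => //; exact: leq_addr.
have pk : 0 <= p - k by rewrite subr_ge0 ltW.
have -> : N `^ p * (k * `|rsubmx x| `^ (p - k) * `|lsubmx x| `^ k) =
  k * (N `^ (p - k) * `|rsubmx x| `^ (p - k)) * (N `^ k * `|lsubmx x| `^ k).
  have -> : N `^ p = N `^ (p - k) * N `^ k.
    by rewrite -powRD subrK// gt_eqF// (le_lt_trans k0).
  ring.
apply: ler_pM; rewrite ?mulr_ge0 ?powR_ge0//.
  by rewrite ler_wpM2l// enorm_pow_le// leq_addl.
by apply: enorm_pow_le => //; exact: leq_addr.
Qed.

(** The two norms are comparable, and each term of the growth function is homogeneous of degree p, so that the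
upper bounds lose a factor N^p. *)
Lemma admissible_enorm (p p' k lambda Lambda : R) (omega : set 'rV[R]_m) (F : 'rV[R]_(r + m) -> R) f :
  (0 < m)%N -> 1 < p -> p^-1 + p'^-1 = 1 -> 0 <= k < p ->
  bounded_set omega -> open omega -> convex_function [set: 'rV[R]_(r + m)] F ->
  0 < lambda -> lambda <= Lambda ->
  (forall xi, lambda * enorm xi `^ p <= F xi <= Lambda * (enorm xi `^ p + 1)) ->
  (forall xi, lambda * growth p k xi <= F xi - F2 F (rsubmx xi) <= Lambda * growth p k xi) ->
  (0 < k -> exists2 beta, 0 < beta & uniformly_strictly_convex p k beta (F2 F)) ->
  Lp p' omega f ->
  exists M, admissible p p' k lambda (Lambda * N `^ p) M F omega f.
Proof.
move=> m0 p1 pq /andP[k0 kp] bo oo cF l0 lL hF hG hS Lf.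
have [M M1 oM] := bounded_rV_sub_cube bo; exists M.
have p0 : 0 <= p by exact: le_trans (ltW p1).
have L0 : 0 <= Lambda by exact: le_trans (ltW l0) lL.
have N1 : 1 <= N by rewrite ler1n addn_gt0 m0 orbT.
have Np1 : 1 <= N `^ p by have := powR_mono p0 ler01 N1; rewrite powR1.
split => //.
- by rewrite mulr_ge0 ?powR_ge0.
- move=> x; have /andP[h _] := hF x; apply: le_trans h.
  by rewrite ler_wpM2l ?enorm_pow_ge// ltW.
- move=> x; have /andP[_ h] := hF x; apply: (le_trans h).
  rewrite -mulrA ler_wpM2l// mulrDr mulr1 addrC; apply: lerD => //.
  exact: enorm_pow_le.
- move=> x; have /andP[h _] := hG x; apply: le_trans h.
  by rewrite ler_wpM2l ?growth_ge// ltW.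
- move=> x; have /andP[_ h] := hG x; apply: (le_trans h).
  by rewrite -mulrA ler_wpM2l// growth_le.
- move=> k1; have [beta b0 hb] := hS k1.
  pose b := k * beta * 2^-1 * 2^-1 * (2^-1 `^ (p - 1) + 2^-1 `^ (p - 1)).
  have h2 : 0 < 2^-1 :> R by rewrite invr_gt0.
  have b1 : 0 < b by rewrite !mulr_gt0// addr_gt0 ?powR_gt0.
  exists b => // x y.
  have half : 0 <= (2^-1 : R) <= 1 by rewrite ltW//= invf_le1// ler1n.
  have half1 : 2^-1 + 2^-1 = 1 :> R by rewrite -div1r -splitr.
  apply: (le_trans (hb x y _ _ half half half1)).
  rewrite lerD2l lerN2 -/b ler_wpM2l ?enorm_pow_ge//; exact: ltW.
- exact: lt_le_trans M1.
Qed.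

End interface.

(** Coercivity bounds the energies from below, so that a finite infimum exists. *)
Lemma infimum_test (R : realType) (r m : nat) (p q k c L M : R) (F : 'rV[R]_(r + m) -> R) omega f :
  admissible p q k c L M F omega f -> exists mu,
  (forall psi, test_function omega psi -> mu <= J2 F omega f psi) /\
  (forall e, 0 < e -> exists2 w, test_function omega w & J2 F omega f w <= mu + e).
Proof.
move=> H; have [K K0 hK] := J2_coercive H.
pose S := [set J2 F omega f psi | psi in [set psi | test_function omega psi]].
have lb : lbound S (- K).
  move=> _ [psi tpsi <-]; have := hK psi tpsi.
  rewrite -subr_ge0 => /= h; rewrite -subr_ge0 opprK; apply: le_trans h _.
  rewrite lerBlDr lerDl mulr_ge0 ?divr_ge0 ?(ltW (adm_c H))//.
  by apply: Rintegral_ge0 => y _; exact: powR_ge0.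
have ne : S !=set0 by exists (J2 F omega f (fun=> 0)); exists (fun=> 0) => //; exact: test0.
have hinf : has_inf S by split => //; exists (- K).
exists (inf S); split.
  by move=> psi tpsi; apply: ge_inf; [exists (- K)|exists psi].
move=> e e0; have [_ [w tw <-] hw] := inf_adherent e0 hinf.
by exists w => //; exact: ltW.
Qed.

Theorem theorem4p3 (R : realType) (r m : nat) (p p' k lambda Lambda : R)
  (omega' : set 'rV[R]_r) (omega'' : set 'rV[R]_m)
  (F : 'rV[R]_(r + m) -> R) (f'' : 'rV[R]_m -> R)
  (u : R -> 'rV[R]_(r + m) -> R) (l : nat -> R) (ustar : 'rV[R]_(r + m) -> R) :
  (0 < r)%N -> (0 < m)%N ->
  1 < p -> p^-1 + p'^-1 = 1 -> 0 <= k < p ->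
  bounded_set omega' -> open omega' -> omega' 0 -> starshaped0 omega' ->
  lipschitz (gauge omega') ->
  bounded_set omega'' -> open omega'' ->
  convex_function [set: 'rV[R]_(r + m)] F ->
  0 < lambda -> lambda <= Lambda ->
  (forall xi, lambda * enorm xi `^ p <= F xi <= Lambda * (enorm xi `^ p + 1)) ->
  (forall xi, lambda * growth p k xi <= F xi - F2 F (rsubmx xi)
                <= Lambda * growth p k xi) ->
  (0 < k -> exists2 beta, 0 < beta &
              uniformly_strictly_convex p k beta (F2 F)) ->
  Lp p' omega'' f'' ->
  (k = 0 -> r%:R < p) -> (0 < k -> r%:R < k * p / (p - k)) ->
  (forall t, 0 < t -> is_minimizer p F (fun x => f'' (rsubmx x))
                        (cylinder omega' omega'' t) (u t)) ->
  (forall j, 0 < l j) -> l j @[j --> \oo] --> +oo ->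
  W1p_loc p (infinite_cylinder omega'') ustar ->
  zero_trace p (infinite_cylinder omega'') ustar ->
  (forall l0, 0 < l0 ->
     W1p_weak_cvg p (cylinder omega' omega'' l0) (fun j => u (l j)) ustar) ->
  exists v : 'rV[R]_m -> R,
    {ae leb, forall x, infinite_cylinder omega'' x -> ustar x = v (rsubmx x)} /\
    is_minimizer p (F2 F) f'' omega'' v.
Proof.
move=> r0 m0 p1 pq kp bA oA A0 _ _ bo oo cF l0 lL hF hG hS Lf rate0 ratek umin _ loo _ trace0 wcvg.
have [M H] := admissible_enorm m0 p1 pq kp bo oo cF l0 lL hF hG hS Lf.
have [mu [Jmu Jinf]] := infimum_test H.
have rate : r%:R < decay p k.
  rewrite /decay; case: eqP => [k0|/eqP k0]; first exact: rate0.
  by apply: ratek; rewrite lt_neqAle eq_sym k0; case/andP: kp.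
apply: (@minimal_slice R r m p p' k lambda _ M F omega'' f'' H mu Jmu ustar trace0).
  by move=> t; exact: (ustar_W1p H oA A0 wcvg t).
by move=> t t0; exact: (limit_energy H r0 Jmu Jinf oA A0 bA rate umin loo wcvg t0).
Qed.
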